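(* Let $\mathbb{D}=\{z\in\mathbb{C}: |z|<1\}$, let $f:\mathbb{D}\to\mathbb{C}$ be a conformal mapping of $\mathbb{D}$, and let $1\le p<\infty$. For $0<r<1$ write $r\mathbb{D}=\{z: |z|<r\}$. Then the function $$ r\mapsto \frac{\mathcal{C}_p\big(f(r\mathbb{D})\big)}{\mathcal{C}_p(r\mathbb{D})}=\frac{r^{4/p}}{\mathcal{C}_p(\mathbb{D})}\,\mathcal{C}_p\big(f(r\mathbb{D})\big),\qquad 0<r<1, $$ is strictly decreasing unless $f$ is linear, in which case this function is constant. Moreover, if $p\le 2$, the reciprocal of this function is a convex function of $\log r$.
   Context: For a bounded domain $D\subset\mathbb{C}\cong\mathbb{R}^2$, equipped with Lebesgue area measure $dA$, and $1\le p<\infty$, define $$ \mathcal{C}_p(D)=\inf\left\{\frac{\int_D|\nabla u|^2\,dA}{\left(\int_D u^p\,dA\right)^{2/p}} : u\in W^{1,2}_0(D),\ u\ge 0,\ u\not\equiv 0\right\}. $$ A conformal mapping of $\mathbb{D}$ means an injective holomorphic function on $\mathbb{D}$ (it maps $\mathbb{D}$ conformally onto its image). ''Linear'' means of the form $f(z)=az+b$ with constants $a,b\in\mathbb{C}$, $a\neq0$. ''Convex function of $\log r$'' means that, as a function of $s=\log r\in(-\infty,0)$, it is convex. *)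

(* Defs.v *)
From HB Require Import structures.
From mathcomp Require Import all_boot all_order all_algebra.
From mathcomp Require Import all_classical all_reals all_analysis.
From mathcomp.real_closed Require Import complex.

Set Implicit Arguments.
Unset Strict Implicit.
Unset Printing Implicit Defensive.

Import Order.TTheory GRing.Theory Num.Theory.
Import numFieldNormedType.Exports.

Local Open Scope classical_set_scope.
Local Open Scope ring_scope.
Local Open Scope complex_scope.

Section Sobolev.
Variable R : realType.
Implicit Types (D : set (R * R)) (u phi : R * R -> R) (g : R * R -> R * R).

Definition area : {measure set (measurableTypeR R * measurableTypeR R) -> \bar R} :=
  (@lebesgue_measure R \x @lebesgue_measure R)%E.

(* [false] stands for the first coordinate, [true] for the second. *)
Definition coord_dir (i : bool) : R * R := if i then (0, 1) else (1, 0).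

Definition partial (i : bool) phi : R * R -> R := 'D_(coord_dir i) phi.

Definition iter_partial (s : seq bool) phi : R * R -> R := foldr partial phi s.

Definition smooth phi : Prop := forall s : seq bool,
  continuous (iter_partial s phi) /\
  forall i x, derivable (iter_partial s phi) x (coord_dir i).

(* $C_c^\infty(D)$, its elements being extended by $0$ to the plane. *)
Definition test_function D phi : Prop :=
  [/\ smooth phi,
      compact (closure [set x | phi x != 0]) &
      closure [set x | phi x != 0] `<=` D].

(* $u|_D\in L^2(D)$; only the values of [u] on [D] matter. *)
Definition L2 D u : Prop := (u \_ D) \in Lfun area 2%:E.

Definition weak_gradient D u g : Prop := forall phi, test_function D phi ->
  (\int[area]_(x in D) (u x * partial false phi x)
    = - \int[area]_(x in D) ((g x).1 * phi x)) /\
  (\int[area]_(x in D) (u x * partial true phi x)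
    = - \int[area]_(x in D) ((g x).2 * phi x)).

(* [u] belongs to $W^{1,2}(D)$ and [g] is its weak gradient, which is unique
   up to a null set when [D] is open. *)
Definition W12 D u g : Prop :=
  [/\ L2 D u, L2 D (fun x => (g x).1), L2 D (fun x => (g x).2) &
      weak_gradient D u g].

Definition W12_dist2 D u g phi : \bar R :=
  \int[area]_(x in D) ((phi x - u x) ^+ 2
    + (partial false phi x - (g x).1) ^+ 2
    + (partial true phi x - (g x).2) ^+ 2)%:E.

(* $W^{1,2}_0(D)$ is the closure of $C_c^\infty(D)$ in $W^{1,2}(D)$. *)
Definition W12_0 D u g : Prop :=
  W12 D u g /\
  forall e : R, 0 < e -> exists2 phi, test_function D phi &
    (W12_dist2 D u g phi < (e ^+ 2)%:E)%E.

Definition admissible D u g : Prop :=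
  [/\ W12_0 D u g,
      {ae area, forall x, D x -> 0 <= u x} &
      ~ {ae area, forall x, D x -> u x = 0}].

Definition rayleigh (p : R) D u g : \bar R :=
  ((\int[area]_(x in D) ((g x).1 ^+ 2 + (g x).2 ^+ 2)%:E)
   / (\int[area]_(x in D) ((u x `^ p)%:E)) `^ (2 / p))%E.

End Sobolev.

Section Conformal.
Variable R : realType.
Implicit Types (D : set R[i]) (f : R[i] -> R[i]) (p r : R).

(* The identification of the plane [R * R], which carries the area measure,
   with the complex numbers. *)
Definition to_complex (x : R * R) : R[i] := x.1 +i* x.2.

(* [u] ranges over $W^{1,2}_0$ and [g] over representatives of its gradient.
   For a nonempty bounded open [D] the infimum is finite, so that [fine] only
   moves it from [\bar R] to [R]. *)
Definition Cp p D : R :=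
  let Omega := to_complex @^-1` D in
  fine (ereal_inf [set q | exists u g,
    admissible Omega u g /\ q = rayleigh p Omega u g]).

Definition disc r : set R[i] := [set z | `|z| < r%:C].

(* Since the scalar field is [R[i]], [derivable f z 1] is complex
   differentiability. *)
Definition conformal_on D f : Prop :=
  (forall z, D z -> derivable (f : R[i]^o -> R[i]^o) z 1) /\ set_inj D f.

Definition linear_on D f : Prop :=
  exists a b : R[i], a != 0 /\ forall z, D z -> f z = a * z + b.

Definition Cp_ratio p f r : R := Cp p (f @` disc r) / Cp p (disc r).

End Conformal.

(* Main.v *)
(* By homogeneity C_p(D)^(-p/2) is the supremum of the integral of |phi|^p over
   the test functions phi on D with Dirichlet integral at most 1. The Dirichlet
   integral is conformally invariant, so pulling test functions back along
   z |-> f(rz) gives C_p(f(rD)) = (r^2 M(log r))^(-2/p), where M(s) is the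
   supremum of the integral of |phi(z)|^p |f'(e^s z)|^2 over the test functions
   on the unit disc with Dirichlet integral at most 1; for f = id, M is a
   constant K, and the ratio of the theorem is (K/M)^(2/p).
   For fixed z the function w |-> f'(e^w z) is holomorphic; averaging its
   squared modulus over the points s + h, h in {rho, -rho, i rho, -i rho}, adds
   rho^2 times the squared modulus of its derivative, up to O(rho^3). An
   imaginary h amounts to a rotation of phi, which preserves the Dirichlet
   integral. Hence 2 M(s) <= M(s + rho) + M(s - rho) + O(rho^3), so that M is
   convex, and nondecreasing because it is bounded near -oo. If M takes the same
   value twice, it is constant near -oo; for almost optimal phi the integral of
   |phi|^p |z f''(e^s z)|^2 is then arbitrarily small, which forces f'' = 0
   since a Sobolev inequality prevents |phi|^p from concentrating at 0. *)
Require Import Defs.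
From HB Require Import structures.
From mathcomp Require Import all_boot all_order all_algebra.
From mathcomp Require Import all_classical all_reals all_analysis measurable_realfun.
From mathcomp.real_closed Require Import complex.
From mathcomp Require Import ring lra.

Set Implicit Arguments.
Unset Strict Implicit.
Unset Printing Implicit Defensive.

Import Order.TTheory GRing.Theory Num.Theory.
Import numFieldNormedType.Exports.

Local Open Scope classical_set_scope.
Local Open Scope ring_scope.
Local Open Scope complex_scope.

Local Notation Re := (@complex.Re _).
Local Notation Im := (@complex.Im _).

(** * Complex differentiation *)

Section Modulus.
Variable R : realType.
Implicit Types (z w : R[i]) (x y : R).

(** The suprema are only approached by test functions, so every estimate has to be uniform in [phi].
    The expansion of [h |-> f' (e^(s + h) z)] therefore has constants that do not depend on [z], and
    the Sobolev inequality turns a pointwise error [O(rho^3)] into a mass error of the same order.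
    The constants still depend on [s]; convexity is thus obtained from a maximum argument on an
    interval. Strictness compares [rho^2] times the extra term with the errors of order [rho^3], the
    defect of the almost optimal [phi] being chosen as [rho^3] too. The equality between [C_p] and
    the supremum over test functions has two sides. For a Sobolev competitor, approximating test
    functions converge almost everywhere and Fatou's lemma passes to the limit; conversely a test
    function must be made nonnegative, by smoothing its absolute value. Convexity of the reciprocal
    for [p <= 2] holds because it is [(M / K)^(2/p)], a power at least [1] of a positive convex
    function. Local-to-global steps (Goursat, boundedness on compact sets, the conformal change of
    variables) all go through one bisection principle, [rectangle_ind]. *)

Definition cabs z : R := Num.sqrt (Re z ^+ 2 + Im z ^+ 2).

Lemma cabsE z : `|z| = (cabs z)%:C.
Proof. exact: normc_def. Qed.

Lemma cabs_ge0 z : 0 <= cabs z. Proof. exact: sqrtr_ge0. Qed.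

Lemma cabsM z w : cabs (z * w) = cabs z * cabs w.
Proof. by apply: complexI; rewrite rmorphM/= -!cabsE normrM. Qed.

Lemma cabsX z n : cabs (z ^+ n) = cabs z ^+ n.
Proof. by apply: complexI; rewrite rmorphXn/= -!cabsE normrX. Qed.

Lemma cabsD z w : cabs (z + w) <= cabs z + cabs w.
Proof. by rewrite -lecR rmorphD/= -!cabsE ler_normD. Qed.

Lemma cabsN z : cabs (- z) = cabs z.
Proof. by apply: complexI; rewrite -!cabsE normrN. Qed.

Lemma cabsB z w : cabs (z - w) = cabs (w - z).
Proof. by rewrite -cabsN opprB. Qed.

Lemma cabs0 : cabs 0 = 0 :> R.
Proof. by apply: complexI; rewrite -!cabsE normr0. Qed.

Lemma cabs1 : cabs 1 = 1 :> R.
Proof. by apply: complexI; rewrite -!cabsE normr1. Qed.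

Lemma cabs0_eq0 z : (cabs z == 0) = (z == 0).
Proof. by rewrite -(inj_eq (@complexI R)) -cabsE normr_eq0. Qed.

Lemma cabs_gt0 z : (0 < cabs z) = (z != 0).
Proof. by rewrite lt_neqAle cabs_ge0 andbT eq_sym cabs0_eq0. Qed.

Lemma cabsV z : cabs z^-1 = (cabs z)^-1.
Proof. by apply: complexI; rewrite fmorphV/= -!cabsE normfV. Qed.

Lemma cabs_real x : cabs x%:C = `|x|.
Proof. by rewrite /cabs /= expr0n/= addr0 sqrtr_sqr. Qed.

Lemma cabs_i : cabs 'i = 1 :> R.
Proof. by rewrite /cabs/= expr0n/= add0r expr1n sqrtr1. Qed.

Lemma sqr_cabs z : cabs z ^+ 2 = Re z ^+ 2 + Im z ^+ 2.
Proof. by rewrite sqr_sqrtr// addr_ge0// sqr_ge0. Qed.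

Lemma Re_le_cabs z : `|Re z| <= cabs z.
Proof. by rewrite -sqrtr_sqr ler_wsqrtr// lerDl sqr_ge0. Qed.

Lemma Im_le_cabs z : `|Im z| <= cabs z.
Proof. by rewrite -sqrtr_sqr ler_wsqrtr// lerDr sqr_ge0. Qed.

Lemma cabs_leD z : cabs z <= `|Re z| + `|Im z|.
Proof.
rewrite -[leRHS]ger0_norm ?addr_ge0// -sqrtr_sqr ler_wsqrtr//.
by rewrite sqrrD !real_normK ?num_real// lerD2r lerDl mulrn_wge0 ?mulr_ge0.
Qed.

Lemma cabs_distD z w (v : R[i]) : cabs (z - w) <= cabs (z - v) + cabs (v - w).
Proof. by rewrite (_ : z - w = (z - v) + (v - w)) ?cabsD//; ring. Qed.

Lemma cabs_leB z w : cabs z - cabs w <= cabs (z - w).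
Proof.
by rewrite lerBlDr -{1}(subrK w z) cabsD.
Qed.

Lemma Re_add z w : Re (z + w) = Re z + Re w. Proof. by case: z w => [? ?] []. Qed.
Lemma Im_add z w : Im (z + w) = Im z + Im w. Proof. by case: z w => [? ?] []. Qed.
Lemma Re_opp z : Re (- z) = - Re z. Proof. by case: z. Qed.
Lemma Im_opp z : Im (- z) = - Im z. Proof. by case: z. Qed.
Lemma Re_mul z w : Re (z * w) = Re z * Re w - Im z * Im w.
Proof. by case: z w => [? ?] []. Qed.
Lemma Im_mul z w : Im (z * w) = Re z * Im w + Im z * Re w.
Proof. by case: z w => [? ?] []. Qed.
Definition ReImE := (Re_add, Im_add, Re_opp, Im_opp, Re_mul, Im_mul).

Lemma complex_eqP z w : Re z = Re w -> Im z = Im w -> z = w.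
Proof. by case: z w => [? ?] [? ?] /= -> ->. Qed.

End Modulus.

Section ComplexDerivative.
Variable R : realType.
Implicit Types (z w a b : R[i]) (f g : R[i] -> R[i]) (U : set R[i]).

(** Complex differentiability in terms of the real-valued modulus. The bound is non-strict, so that
    [h = 0] is included. *)
Definition cderiv f z a : Prop := forall e : R, 0 < e ->
  exists2 d : R, 0 < d & forall h, cabs h < d ->
    cabs (f (z + h) - f z - a * h) <= e * cabs h.

Definition ccont f z : Prop := forall e : R, 0 < e ->
  exists2 d : R, 0 < d & forall w, cabs (w - z) < d -> cabs (f w - f z) < e.

Definition copen U : Prop := forall z, U z ->
  exists2 d : R, 0 < d & forall w, cabs (w - z) < d -> U w.

Definition cball z (r : R) : set R[i] := [set w | cabs (w - z) < r].

Lemma cball_open z r : copen (cball z r).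
Proof.
move=> w /= zw; exists (r - cabs (w - z)); first by rewrite subr_gt0.
move=> v vw; rewrite /cball /=; apply: le_lt_trans (cabs_distD _ _ w) _; lra.
Qed.

Lemma cderiv_cont f z a : cderiv f z a -> ccont f z.
Proof.
move=> fz e e0; have [d d0 H] := fz 1 ltr01.
exists (Num.min d (e / (2 + cabs a))).
  by rewrite lt_min d0 divr_gt0// ltr_wpDr ?cabs_ge0.
move=> w; rewrite lt_min => /andP[wd we].
have := H _ wd; rewrite (addrC z) subrK mul1r => {}H.
have a0 := cabs_ge0 a.
have w0 := cabs_ge0 (w - z).
rewrite ltr_pdivlMr in we; last by lra.
have -> : f w - f z = (f w - f z - a * (w - z)) + a * (w - z) by ring.
apply: le_lt_trans (cabsD _ _) _; rewrite cabsM.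
nra.
Qed.

Lemma cderiv_eq f g z a : (exists2 d : R, 0 < d & forall w, cabs (w - z) < d -> f w = g w) ->
  cderiv f z a -> cderiv g z a.
Proof.
move=> [d d0 fg] fz e e0; have [d' d'0 H] := fz e e0.
exists (Num.min d d'); first by rewrite lt_min d0.
move=> h; rewrite lt_min => /andP[? ?].
by rewrite -!fg ?H// ?subrr ?cabs0// [z + h]addrC addrK.
Qed.

Lemma cderiv_cst c z : cderiv (fun=> c) z 0.
Proof.
move=> e e0; exists 1 => // h _.
by rewrite subrr mul0r subr0 cabs0 mulr_ge0 ?cabs_ge0// ltW.
Qed.

Lemma cderiv_id z : cderiv id z 1.
Proof.
move=> e e0; exists 1 => // h _.
by rewrite mul1r [z + h]addrC addrK subrr cabs0 mulr_ge0 ?cabs_ge0// ltW.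
Qed.

Lemma cderivD f g z a b : cderiv f z a -> cderiv g z b ->
  cderiv (fun w => f w + g w) z (a + b).
Proof.
move=> fz gz e e0; have e2 : 0 < e / 2 by lra.
have [d d0 H] := fz _ e2; have [d' d'0 H'] := gz _ e2.
exists (Num.min d d'); first by rewrite lt_min d0.
move=> h; rewrite lt_min => /andP[/H ? /H' ?].
have -> : f (z + h) + g (z + h) - (f z + g z) - (a + b) * h =
  (f (z + h) - f z - a * h) + (g (z + h) - g z - b * h) by ring.
by apply: le_trans (cabsD _ _) _; lra.
Qed.

Lemma cderivM f g z a b : cderiv f z a -> cderiv g z b ->
  cderiv (fun w => f w * g w) z (a * g z + f z * b).
Proof.
move=> fz gz e e0.
set c := 1 + cabs (f z) + cabs (g z) + cabs a + cabs b.
have [c1 c2 c3 c4] : [/\ 0 <= cabs (f z), 0 <= cabs (g z), 0 <= cabs a & 0 <= cabs b].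
  by rewrite !cabs_ge0.
have c0 : 1 <= c by rewrite /c; lra.
have e'0 : 0 < Num.min 1 (e / (4 * c)).
  by rewrite lt_min ltr01 divr_gt0//; lra.
have [d d0 H] := fz _ e'0.
have [d' d'0 H'] := gz _ e'0.
exists (Num.min (Num.min d d') (e / (4 * c ^+2))).
  by rewrite !lt_min d0 d'0/= divr_gt0// mulr_gt0// exprn_gt0//; lra.
move=> h; rewrite !lt_min => /andP[/andP[/H uh0 /H' vh0] hd]; move: uh0 vh0.
set u := f (z + h) - f z - a * h.
set v := g (z + h) - g z - b * h.
move=> uh vh.
have -> : f (z + h) * g (z + h) - f z * g z - (a * g z + f z * b) * h =
   u * g z + (f z + a * h + u) * v + (a * h + u) * (b * h).
  rewrite /u /v; ring.
have h0 := cabs_ge0 h.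
have e1 : Num.min 1 (e / (4 * c)) <= 1 by rewrite ge_min lexx.
have e2 : Num.min 1 (e / (4 * c)) * (4 * c) <= e.
  by rewrite -ler_pdivlMr ?ge_min ?lexx ?orbT//; lra.
move: hd; rewrite ltr_pdivlMr; last by rewrite mulr_gt0// exprn_gt0//; lra.
move: e'0 uh vh e1 e2; set k := Num.min _ _ => k0 uh vh k1 k2 hd.
apply: le_trans (cabsD _ _) _; apply: le_trans (lerD (cabsD _ _) (lexx _)) _.
rewrite !cabsM.
have A1 : cabs (a * h + u) <= (cabs a + 1) * cabs h.
  by apply: le_trans (cabsD _ _) _; rewrite cabsM mulrDl lerD2l; nra.
have h4 : c * cabs h <= c ^+2 * cabs h by rewrite ler_wpM2r// expr2; nra.
have h1 : c * cabs h <= e / 4 by lra.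
have h5 : cabs h <= 1 \/ 1 < cabs h by case: (leP (cabs h) 1); auto.
have A2 : cabs (f z + a * h + u) * cabs v <= k * (c * (1 + cabs h)) * cabs h.
  rewrite (_ : k * (c * (1 + cabs h)) * cabs h = (c * (1 + cabs h)) * (k * cabs h)); last ring.
  rewrite ler_pM ?cabs_ge0// -addrA; apply: le_trans (cabsD _ _) _.
  by rewrite /c; nra.
have A3 : cabs (a * h + u) * (cabs b * cabs h) <= (c * c * cabs h) * cabs h.
  rewrite (_ : c * c * cabs h * cabs h = (c * cabs h) * (c * cabs h)); last ring.
  rewrite ler_pM ?cabs_ge0// ?mulr_ge0//.
    by apply: le_trans A1 _; rewrite /c; nra.
  by rewrite /c; nra.
have A4 : cabs u * cabs (g z) <= k * c * cabs h.
  rewrite (_ : k * c * cabs h = k * cabs h * c); last ring.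
  by rewrite ler_pM ?cabs_ge0// /c; lra.
have A5 : k * c * cabs h <= e/4 * cabs h by rewrite ler_wpM2r//; lra.
have A6 : c * c * cabs h * cabs h <= e/4 * cabs h.
  by rewrite ler_wpM2r//; lra.
have A7 : k * (c * (1 + cabs h)) * cabs h <= (e/4 + e/4) * cabs h.
  rewrite ler_wpM2r// (_ : k * (c * (1 + cabs h)) = k * c + k * (c * cabs h)); last ring.
  apply: lerD; first lra.
  apply: le_trans (_ : 1 * (c * cabs h) <= _); last by rewrite mul1r.
  by rewrite ler_wpM2r// mulr_ge0//; lra.
lra.
Qed.

Lemma cderivZ c f z a : cderiv f z a -> cderiv (fun w => c * f w) z (c * a).
Proof.
by move=> fz; have := cderivM (cderiv_cst c z) fz; rewrite mul0r add0r.
Qed.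

Lemma cderiv_comp f g z a b : cderiv f z a -> cderiv g (f z) b ->
  cderiv (fun w => g (f w)) z (b * a).
Proof.
move=> fz gz e e0.
have a0 := cabs_ge0 a.
have b0 := cabs_ge0 b.
have k0 : 0 < Num.min 1 (e / (2 * (1 + cabs b))).
  by rewrite lt_min ltr01 divr_gt0// mulr_gt0//; lra.
have l0 : 0 < e / (2 * (1 + cabs a)) by rewrite divr_gt0// mulr_gt0//; lra.
have [d d0 H] := fz _ k0.
have [d' d'0 H'] := gz _ l0.
have k1 : Num.min 1 (e / (2 * (1 + cabs b))) <= 1 by rewrite ge_min lexx.
have k2 : Num.min 1 (e / (2 * (1 + cabs b))) * (2 * (1 + cabs b)) <= e.
  by rewrite -ler_pdivlMr ?ge_min ?lexx ?orbT//; lra.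
have l1 : e / (2 * (1 + cabs a)) * (2 * (1 + cabs a)) = e.
  by rewrite divfK// gt_eqF//; lra.
move: k1 k2 H l1 H' k0 l0; set k := Num.min _ _; set l := e / _.
move=> k1 k2 H l1 H' k0 l0.
exists (Num.min d (d' / (1 + cabs a))).
  by rewrite lt_min d0 divr_gt0//; lra.
move=> h; rewrite lt_min ltr_pdivlMr; last lra.
move=> /andP[/H uh hd].
have h0 := cabs_ge0 h.
set h' := f (z + h) - f z.
have eh : h' = (f (z + h) - f z - a * h) + a * h by rewrite /h'; ring.
have h'le : cabs h' <= (1 + cabs a) * cabs h.
  by rewrite eh; apply: le_trans (cabsD _ _) _; rewrite cabsM; nra.
have := H' h'; rewrite {1 2}/h' (addrC (f z)) subrK => /(_ _)/wrap[].
  by apply: le_lt_trans h'le _; lra.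
set v := _ - _ - b * h'.
move=> vh.
have -> : g (f (z + h)) - g (f z) - b * a * h =
   v + b * (f (z + h) - f z - a * h).
  by rewrite /v /h'; ring.
apply: le_trans (cabsD _ _) _; rewrite cabsM.
have A1 : cabs b * cabs (f (z + h) - f z - a * h) <= e / 2 * cabs h.
  apply: le_trans (ler_wpM2l b0 uh) _.
  by rewrite mulrA ler_wpM2r//; nra.
have A2 : l * cabs h' <= e/2 * cabs h.
  apply: le_trans (ler_wpM2l (ltW l0) h'le) _.
  by rewrite mulrA ler_wpM2r//; nra.
lra.
Qed.

Lemma cderiv_inv z : z != 0 -> cderiv (fun w => w^-1) z (- z ^- 2).
Proof.
move=> z0 e e0.
have c0 : 0 < cabs z by rewrite cabs_gt0.
exists (Num.min (cabs z / 2) (e * cabs z ^+ 3 / 2)).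
  by rewrite lt_min !divr_gt0// mulr_gt0// exprn_gt0.
move=> h; rewrite lt_min => /andP[h1 h2].
have zh : cabs z / 2 <= cabs (z + h).
  have := cabs_leB z (- h); rewrite cabsN opprK; lra.
have zh0 : z + h != 0 by rewrite -cabs_gt0; lra.
have -> : (z + h)^-1 - z^-1 - - z ^- 2 * h = h ^+ 2 * (z ^- 2 * (z + h)^-1).
  by field; apply/andP.
rewrite !cabsM !cabsV !cabsX expr2 -mulrA mulrC ler_wpM2r ?cabs_ge0//.
have [c2 c3] : 0 < cabs z ^+ 2 /\ 0 < cabs (z + h).
  by rewrite exprn_gt0//; split => //; lra.
rewrite -invfM ler_pdivrMr; last by rewrite mulr_gt0.
apply: le_trans (ltW h2) _.
rewrite exprS (mulrC (cabs z)) mulrA -!mulrA ler_wpM2l ?(ltW e0)//.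
by do 2 rewrite ler_wpM2l ?(ltW c0)//.
Qed.

Lemma cderiv_uniq f z a b : cderiv f z a -> cderiv f z b -> a = b.
Proof.
move=> fa fb; apply/eqP; rewrite -subr_eq0 -cabs0_eq0; apply/eqP.
apply/eqP; rewrite eq_le cabs_ge0 andbT; apply/ler_addgt0Pl => e e0; rewrite addr0.
have e2 : 0 < e / 2 by lra.
have [d d0 H] := fa _ e2; have [d' d'0 H'] := fb _ e2.
pose h : R[i] := (Num.min d d' / 2)%:C.
have m0 : 0 < Num.min d d' by rewrite lt_min d0.
have hE : cabs h = Num.min d d' / 2 by rewrite cabs_real gtr0_norm// divr_gt0.
have hd : cabs h < Num.min d d' by rewrite hE; lra.
move: (hd); rewrite lt_min => /andP[/H {}H /H' {}H'].
have h0 : 0 < cabs h by rewrite hE; lra.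
rewrite -(ler_pM2r h0) -cabsM.
have -> : (a - b) * h = (f (z + h) - f z - b * h) - (f (z + h) - f z - a * h) by ring.
by apply: le_trans (cabsD _ _) _; rewrite cabsN; lra.
Qed.

(** The derivative is carried as a function, so that it can be differentiated in turn; see
    [holo_deriv]. *)
Definition holo U f f' : Prop := forall z, U z -> cderiv f z (f' z).

End ComplexDerivative.

(** * Cauchy's theorem and Taylor expansion *)

Section RectangleInduction.
Variable R : realType.

Lemma exists_half_lt (t d : R) : 0 < d -> exists n, t / 2 ^+ n < d.
Proof.
move=> d0; have [t0|t0] := ltP t 0; first by exists 0; rewrite divr1; lra.
exists (Num.bound (t / d)).
rewrite ltr_pdivrMr ?exprn_gt0// mulrC -ltr_pdivrMr//.
apply: lt_trans (archi_boundP _) _; first by rewrite divr_ge0// ltW.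
by rewrite -natrX ltr_nat ltn_expl.
Qed.

(* Bisection; [P x y t] is a property of the rectangle with lower left corner
   [(x, y)] and sides [t * a] and [t * b]. *)
Lemma rectangle_ind (P : R -> R -> R -> Prop) (a b x0 y0 t0 : R) :
  0 <= a -> 0 <= b -> 0 < t0 ->
  (forall x y t, 0 < t -> P x y (t / 2) -> P (x + t / 2 * a) y (t / 2) ->
     P x (y + t / 2 * b) (t / 2) -> P (x + t / 2 * a) (y + t / 2 * b) (t / 2) ->
     P x y t) ->
  (forall p q, x0 <= p <= x0 + t0 * a -> y0 <= q <= y0 + t0 * b ->
     exists2 d, 0 < d & forall x y t, 0 < t < d ->
       x0 <= x -> x + t * a <= x0 + t0 * a ->
       y0 <= y -> y + t * b <= y0 + t0 * b ->
       x <= p <= x + t * a -> y <= q <= y + t * b -> P x y t) ->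
  P x0 y0 t0.
Proof.
move=> a0 b0 t00 Psplit Ploc; apply: contrapT => nP.
(* A rectangle failing [P] has a quarter failing [P]. Since [choice] wants a total relation, the
   conclusion is vacuous when the scale is not positive or when [P] holds. *)
have step (s : R * R * R) : exists s' : R * R * R,
    0 < s.2 -> ~ P s.1.1 s.1.2 s.2 ->
    [/\ ~ P s'.1.1 s'.1.2 s'.2, s'.2 = s.2 / 2,
      s.1.1 <= s'.1.1, s'.1.1 + s'.2 * a <= s.1.1 + s.2 * a &
      s.1.2 <= s'.1.2 /\ s'.1.2 + s'.2 * b <= s.1.2 + s.2 * b].
  move: s => [[x y] t] /=.
  have [t_gt0|] := pselect (0 < t); last by exists (x, y, t) => t1.
  have [Pxy|nPxy] := pselect (P x y t); first by exists (x, y, t) => ? /(_ Pxy).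
  have ta : 0 <= t / 2 * a by rewrite mulr_ge0// divr_ge0// ltW.
  have tb : 0 <= t / 2 * b by rewrite mulr_ge0// divr_ge0// ltW.
  have [P1|?] := pselect (P x y (t / 2)); last first.
    by exists (x, y, t / 2) => _ _; split => //=; try split; lra.
  have [P2|?] := pselect (P (x + t / 2 * a) y (t / 2)); last first.
    by exists (x + t / 2 * a, y, t / 2) => _ _; split => //=; try split; lra.
  have [P3|?] := pselect (P x (y + t / 2 * b) (t / 2)); last first.
    by exists (x, y + t / 2 * b, t / 2) => _ _; split => //=; try split; lra.
  have [P4|?] := pselect (P (x + t / 2 * a) (y + t / 2 * b) (t / 2)); last first.
    by exists (x + t / 2 * a, y + t / 2 * b, t / 2) => _ _; split => //=; try split; lra.
  by exfalso; apply: nPxy; exact: Psplit.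
have [f fP] := choice step.
pose s n := iter n f (x0, y0, t0).
have sP n : ~ P (s n).1.1 (s n).1.2 (s n).2 /\ (s n).2 = t0 / 2 ^+ n.
  elim: n => [|n [IH1 IH2]]; first by rewrite divr1.
  have [|//|? sn _ _ _] := fP (s n); first by rewrite IH2 divr_gt0// exprn_gt0.
  by split => //; rewrite /s iterS sn -/(s n) IH2 exprSr invfM mulrA.
have sN n : [/\ (s n).1.1 <= (s n.+1).1.1,
      (s n.+1).1.1 + (s n.+1).2 * a <= (s n).1.1 + (s n).2 * a,
      (s n).1.2 <= (s n.+1).1.2 &
      (s n.+1).1.2 + (s n.+1).2 * b <= (s n).1.2 + (s n).2 * b].
  have [nPn sn] := sP n.
  by have [|//|? _ ? ? []] := fP (s n); first by rewrite sn divr_gt0// exprn_gt0.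
have tn_gt0 n : 0 < (s n).2 by rewrite (sP n).2 divr_gt0// exprn_gt0.
have sD n k : [/\ (s n).1.1 <= (s (n + k)%N).1.1,
      (s (n + k)%N).1.1 + (s (n + k)%N).2 * a <= (s n).1.1 + (s n).2 * a,
      (s n).1.2 <= (s (n + k)%N).1.2 &
      (s (n + k)%N).1.2 + (s (n + k)%N).2 * b <= (s n).1.2 + (s n).2 * b].
  elim: k => [|k [A B C D]]; first by rewrite addn0.
  rewrite addnS; have [A' B' C' D'] := sN (n + k)%N.
  by split; [exact: le_trans A A'|exact: le_trans B' B|exact: le_trans C C'|
             exact: le_trans D' D].
have sx m n : (s m).1.1 <= (s n).1.1 + (s n).2 * a.
  have [mn|/ltnW nm] := leqP m n.
    have [A _ _ _] := sD m (n - m)%N; rewrite subnKC// in A.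
    by apply: le_trans A _; rewrite lerDl mulr_ge0// ltW.
  have [_ A _ _] := sD n (m - n)%N; rewrite subnKC// in A.
  by apply: le_trans _ A; rewrite lerDl mulr_ge0// ltW.
have sy m n : (s m).1.2 <= (s n).1.2 + (s n).2 * b.
  have [mn|/ltnW nm] := leqP m n.
    have [_ _ A _] := sD m (n - m)%N; rewrite subnKC// in A.
    by apply: le_trans A _; rewrite lerDl mulr_ge0// ltW.
  have [_ _ _ A] := sD n (m - n)%N; rewrite subnKC// in A.
  by apply: le_trans _ A; rewrite lerDl mulr_ge0// ltW.
(* By [sx] and [sy] every lower left corner is dominated by every upper right corner, so the suprema
   of the lower left corners give a point common to all rectangles of the chain. The local
   hypothesis at this point contradicts the failure of [P] on a small member. *)
pose p := sup (range (fun n => (s n).1.1)).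
pose q := sup (range (fun n => (s n).1.2)).
have pP n : (s n).1.1 <= p <= (s n).1.1 + (s n).2 * a.
  apply/andP; split.
    by apply: ub_le_sup; [exists (x0 + t0 * a) => _ [m _ <-]; exact: (sx m 0)|exists n].
  by apply: ge_sup; [exists x0, 0|move=> _ [m _ <-]].
have qP n : (s n).1.2 <= q <= (s n).1.2 + (s n).2 * b.
  apply/andP; split.
    by apply: ub_le_sup; [exists (y0 + t0 * b) => _ [m _ <-]; exact: (sy m 0)|exists n].
  by apply: ge_sup; [exists y0, 0|move=> _ [m _ <-]].
have [d d0 H] := Ploc p q (pP 0) (qP 0).
have [n nd] := exists_half_lt t0 d0.
have [A B C D] := sD 0 n; rewrite add0n in A B C D.
have [nPn sn] := sP n.
apply: nPn; apply: H => //.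
by rewrite tn_gt0 sn.
Qed.

Lemma itv_dist (x p u t : R) : x <= p -> p <= x + t -> x <= u -> u <= x + t -> `|u - p| <= t.
Proof. by move=> *; rewrite ler_norml; apply/andP; split; lra. Qed.

End RectangleInduction.

(** * Integrals of complex-valued functions over an interval *)

Section ComplexIntegral.
Variable R : realType.
Implicit Types (a b c : R) (f g : R -> R[i]).

Definition rint a b (h : R -> R) : R := \int[lebesgue_measure]_(x in `[a, b]) h x.

Definition cint a b f : R[i] := rint a b (Re \o f) +i* rint a b (Im \o f).

Definition rcont f (t : R) : Prop := forall e : R, 0 < e ->
  exists2 d : R, 0 < d & forall u, `|u - t| < d -> cabs (f u - f t) < e.

Definition path_cont a b f : Prop := forall t, a <= t <= b -> rcont f t.

Lemma rcont_eps (h : R -> R) t :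
  (forall e : R, 0 < e -> exists2 d : R, 0 < d & forall u, `|u - t| < d -> `|h u - h t| < e) ->
  {for t, continuous h}.
Proof.
move=> H; apply/cvgrPdist_lt => e e0; have [d d0 hd] := H e e0.
apply/nbhs_ballP; exists d => //= u /=; rewrite /ball/= distrC => /hd.
by rewrite distrC.
Qed.

Lemma integrable_cont a b (h : R -> R) :
  (forall t, a <= t <= b -> {for t, continuous h}) ->
  (@lebesgue_measure R).-integrable `[a, b] (EFin \o h).
Proof.
move=> H; apply: continuous_compact_integrable; first exact: segment_compact.
by apply: continuous_in_subspaceT => x; rewrite inE/= in_itv/= => /H.
Qed.

Lemma rcont_Re f t : rcont f t -> {for t, continuous (Re \o f)}.
Proof.
move=> H; apply: rcont_eps => e /H[d d0 {}H]; exists d => // u /H; apply: le_lt_trans.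
by rewrite /= -Re_opp -Re_add Re_le_cabs.
Qed.

Lemma rcont_Im f t : rcont f t -> {for t, continuous (Im \o f)}.
Proof.
move=> H; apply: rcont_eps => e /H[d d0 {}H]; exists d => // u /H; apply: le_lt_trans.
by rewrite /= -Im_opp -Im_add Im_le_cabs.
Qed.

Lemma rcont_cst (k : R[i]) t : rcont (fun=> k) t.
Proof. by move=> e e0; exists 1 => // u _; rewrite subrr cabs0. Qed.

Lemma rcontD f g t : rcont f t -> rcont g t -> rcont (fun u => f u + g u) t.
Proof.
move=> ft gt e e0; have e2 : 0 < e / 2 by lra.
have [d d0 H] := ft _ e2; have [d' d'0 H'] := gt _ e2.
exists (Num.min d d'); first by rewrite lt_min d0.
move=> u; rewrite lt_min => /andP[/H ? /H' ?].
rewrite (_ : f u + g u - (f t + g t) = (f u - f t) + (g u - g t)); last ring.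
by apply: le_lt_trans (cabsD _ _) _; lra.
Qed.

Lemma rcontZ (k : R[i]) f t : rcont f t -> rcont (fun u => k * f u) t.
Proof.
move=> ft e e0.
have k0 : 0 < 1 + cabs k by rewrite ltr_pwDl ?cabs_ge0.
have [d d0 H] := ft _ (divr_gt0 e0 k0); exists d => // u /H.
rewrite -mulrBr cabsM ltr_pdivlMr// => ?.
by have := cabs_ge0 k; have := cabs_ge0 (f u - f t); nra.
Qed.

Lemma ccont_rcont (F : R[i] -> R[i]) f t : rcont f t -> ccont F (f t) -> rcont (F \o f) t.
Proof.
move=> ft Ft e /Ft[d d0 H]; have [d' d'0 H'] := ft _ d0.
by exists d' => // u /H' /H.
Qed.

Lemma rint_cst a b (k : R) : a <= b -> rint a b (fun=> k) = k * (b - a).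
Proof.
move=> ab; rewrite /rint (@Rintegral_cst _ _ _ lebesgue_measure)//=.
rewrite lebesgue_measure_itv/= lte_fin; case: ltP => //= ba.
by rewrite (le_anti (introT andP (conj ab ba))) subrr mulr0.
Qed.

Lemma rintD a b (h k : R -> R) :
  (forall t, a <= t <= b -> {for t, continuous h}) ->
  (forall t, a <= t <= b -> {for t, continuous k}) ->
  rint a b (fun t => h t + k t) = rint a b h + rint a b k.
Proof. by move=> hc kc; apply: RintegralD => //; exact: integrable_cont. Qed.

Lemma rintZ a b (c : R) (h : R -> R) :
  (forall t, a <= t <= b -> {for t, continuous h}) ->
  rint a b (fun t => c * h t) = c * rint a b h.
Proof. by move=> hc; apply: RintegralZl => //; exact: integrable_cont. Qed.

Lemma cint_cst a b (k : R[i]) : a <= b -> cint a b (fun=> k) = k * (b - a)%:C.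
Proof.
move=> ab; apply: complex_eqP; rewrite !ReImE/= mulr0.
  by rewrite subr0 -rint_cst.
by rewrite add0r -rint_cst.
Qed.

Lemma eq_cint a b f g : (forall t, a <= t <= b -> f t = g t) -> cint a b f = cint a b g.
Proof.
by move=> fg; rewrite /cint /rint; congr (_ +i* _); apply: eq_Rintegral => t;
  rewrite inE/= in_itv/= => /fg ->.
Qed.

Lemma cintD a b f g : path_cont a b f -> path_cont a b g ->
  cint a b (fun t => f t + g t) = cint a b f + cint a b g.
Proof.
move=> fc gc; apply: complex_eqP; rewrite !ReImE /=.
  rewrite -rintD; [|by move=> t /fc/rcont_Re|by move=> t /gc/rcont_Re].
  by apply: eq_Rintegral => t _ /=; rewrite Re_add.
rewrite -rintD; [|by move=> t /fc/rcont_Im|by move=> t /gc/rcont_Im].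
by apply: eq_Rintegral => t _ /=; rewrite Im_add.
Qed.

Lemma cintZ a b (k : R[i]) f : path_cont a b f ->
  cint a b (fun t => k * f t) = k * cint a b f.
Proof.
move=> fc.
have fR t : a <= t <= b -> {for t, continuous (Re \o f)} by move=> /fc/rcont_Re.
have fI t : a <= t <= b -> {for t, continuous (Im \o f)} by move=> /fc/rcont_Im.
have cM (c : R) (h : R -> R) t : {for t, continuous h} -> {for t, continuous (fun u => c * h u : R)}.
  by move=> hc; apply: continuousM hc; exact: cst_continuous.
apply: complex_eqP; rewrite !ReImE /=.
  rewrite -mulNr -!rintZ// -rintD; [|by move=> t /fR/cM|by move=> t /fI/cM].
  by apply: eq_Rintegral => t _ /=; rewrite Re_mul mulNr.
rewrite -!rintZ// -rintD; [|by move=> t /fI/cM|by move=> t /fR/cM].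
by apply: eq_Rintegral => t _ /=; rewrite Im_mul.
Qed.

Lemma rint_split a b c (h : R -> R) : a <= c <= b ->
  (forall t, a <= t <= b -> {for t, continuous h}) ->
  rint a b h = rint a c h + rint c b h.
Proof.
move=> /andP[ac cb] hc.
have := @Rintegral_itvB R h (BLeft a) (BRight b) c (integrable_cont hc).
rewrite !bnd_simp => /(_ ac cb); rewrite Rintegral_itv_obnd_cbnd.
  by rewrite {3}/rint => <-; rewrite /rint addrC subrK.
apply: integrableS (integrable_cont hc) => //.
by apply: subset_itv => //; rewrite bnd_simp.
Qed.

Lemma cint_split a b c f : a <= c <= b -> path_cont a b f ->
  cint a b f = cint a c f + cint c b f.
Proof.
move=> acb fc; apply: complex_eqP.
  by rewrite Re_add; exact: (rint_split acb (fun t tt => rcont_Re (fc t tt))).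
by rewrite Im_add; exact: (rint_split acb (fun t tt => rcont_Im (fc t tt))).
Qed.

Lemma Re_cint_le a b f (M : R) : a <= b -> path_cont a b f ->
  (forall t, a <= t <= b -> cabs (f t) <= M) -> Re (cint a b f) <= M * (b - a).
Proof.
move=> ab fc fM /=.
rewrite -rint_cst//.
apply: le_Rintegral => //.
- by apply: integrable_cont => t /fc/rcont_Re.
- by apply: integrable_cont => t _; exact: cst_continuous.
move=> t /=; rewrite in_itv/= => /fM; apply: le_trans.
exact: le_trans (ler_norm _) (Re_le_cabs _).
Qed.

(** Multiplying the integrand by the unimodular constant [u = |I| / I] makes the integral equal to
    [|I|], so that the bound on real parts, [Re_cint_le], applies. *)
Lemma cint_le a b f (M : R) : a <= b -> path_cont a b f ->
  (forall t, a <= t <= b -> cabs (f t) <= M) -> cabs (cint a b f) <= M * (b - a).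
Proof.
move=> ab fc fM.
set I := cint a b f.
have [->|I0] := eqVneq I 0.
  rewrite cabs0 mulr_ge0 ?subr_ge0//.
  by apply: le_trans (cabs_ge0 (f a)) (fM _ _); rewrite lexx.
pose u := (cabs I)%:C / I.
have u1 : cabs u = 1.
  by rewrite cabsM cabsV cabs_real ger0_norm ?cabs_ge0// divff// cabs0_eq0.
have -> : cabs I = Re (cint a b (fun t => u * f t)).
  by rewrite cintZ// -/I /u divfK//.
apply: Re_cint_le => //.
  by move=> t /fc; exact: rcontZ.
by move=> t /fM; rewrite cabsM u1 mul1r.
Qed.

End ComplexIntegral.

(** * Goursat's theorem for rectangles *)

Section Goursat.
Variable R : realType.
Implicit Types (G H : R[i] -> R[i]) (x y : R).

Lemma rcont_horizontal y x : rcont (fun t : R => t +i* y) x.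
Proof.
move=> e e0; exists e => // u; apply: le_lt_trans.
by rewrite (_ : _ - _ = (u - x)%:C) ?cabs_real//; apply: complex_eqP; rewrite !ReImE/=; ring.
Qed.

Lemma rcont_vertical x y : rcont (fun t : R => x +i* t) y.
Proof.
move=> e e0; exists e => // u; apply: le_lt_trans.
rewrite (_ : _ - _ = 'i * (u - y)%:C) ?cabsM ?cabs_i ?mul1r ?cabs_real//.
by apply: complex_eqP; rewrite !ReImE/=; ring.
Qed.

(** The counterclockwise boundary integral: [dz] is [dt] on the horizontal sides and [i dt] on the
    vertical ones. *)
Definition rect_int G (x0 x1 y0 y1 : R) : R[i] :=
  cint x0 x1 (fun t => G (t +i* y0)) - cint x0 x1 (fun t => G (t +i* y1))
  + 'i * (cint y0 y1 (fun t => G (x1 +i* t)) - cint y0 y1 (fun t => G (x0 +i* t))).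

Definition rect (x0 x1 y0 y1 : R) : set R[i] :=
  [set z | x0 <= Re z <= x1 /\ y0 <= Im z <= y1].

Definition rect_cont G x0 x1 y0 y1 : Prop := forall z, rect x0 x1 y0 y1 z -> ccont G z.

Lemma rect_path_h G x0 x1 y0 y1 a b y : rect_cont G x0 x1 y0 y1 ->
  x0 <= a -> b <= x1 -> y0 <= y <= y1 -> path_cont a b (fun t => G (t +i* y)).
Proof.
move=> Gc xa bx yy t /andP[at_ tb]; apply: (@ccont_rcont _ G (fun t => t +i* y)).
  exact: rcont_horizontal.
by apply: Gc; split => //=; rewrite (le_trans xa at_) (le_trans tb bx).
Qed.

Lemma rect_path_v G x0 x1 y0 y1 a b x : rect_cont G x0 x1 y0 y1 ->
  y0 <= a -> b <= y1 -> x0 <= x <= x1 -> path_cont a b (fun t => G (x +i* t)).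
Proof.
move=> Gc xa bx yy t /andP[at_ tb]; apply: (@ccont_rcont _ G (fun t => x +i* t)).
  exact: rcont_vertical.
by apply: Gc; split => //=; rewrite (le_trans xa at_) (le_trans tb bx).
Qed.

Lemma rect_intD G H x0 x1 y0 y1 : x0 <= x1 -> y0 <= y1 ->
  rect_cont G x0 x1 y0 y1 -> rect_cont H x0 x1 y0 y1 ->
  rect_int (fun z => G z + H z) x0 x1 y0 y1 =
  rect_int G x0 x1 y0 y1 + rect_int H x0 x1 y0 y1.
Proof.
move=> x01 y01 Gc Hc; rewrite /rect_int !cintD; first by ring.
- by apply: rect_path_v Gc _ _ _; rewrite ?lexx ?x01.
- by apply: rect_path_v Hc _ _ _; rewrite ?lexx ?x01.
- by apply: rect_path_v Gc _ _ _; rewrite ?lexx ?x01.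
- by apply: rect_path_v Hc _ _ _; rewrite ?lexx ?x01.
- by apply: rect_path_h Gc _ _ _; rewrite ?lexx ?y01.
- by apply: rect_path_h Hc _ _ _; rewrite ?lexx ?y01.
- by apply: rect_path_h Gc _ _ _; rewrite ?lexx ?y01.
- by apply: rect_path_h Hc _ _ _; rewrite ?lexx ?y01.
Qed.

(** On opposite sides the integrand differs by a constant. The two constants, integrated along their
    sides, cancel because [i * i = - 1] on one pair and the orientation is reversed on the other. *)
Lemma rect_int_affine (A c : R[i]) x0 x1 y0 y1 : x0 <= x1 -> y0 <= y1 ->
  rect_int (fun z => A + c * z) x0 x1 y0 y1 = 0.
Proof.
move=> x01 y01; rewrite /rect_int.
have pc (f : R -> R[i]) a b : (forall t, rcont f t) -> path_cont a b f by move=> H t _.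
have hh y t : rcont (fun t => A + c * (t +i* y)) t.
  by apply: rcontD; [exact: rcont_cst|apply: rcontZ; exact: rcont_horizontal].
have hv x t : rcont (fun t => A + c * (x +i* t)) t.
  by apply: rcontD; [exact: rcont_cst|apply: rcontZ; exact: rcont_vertical].
have -> : cint x0 x1 (fun t => A + c * (t +i* y0)) =
    cint x0 x1 (fun t => A + c * (t +i* y1)) + c * 'i * (y0 - y1)%:C * (x1 - x0)%:C.
  rewrite -cint_cst// -cintD; [|exact: pc|by apply: pc => t; exact: rcont_cst].
  by apply: eq_cint => t _; apply: complex_eqP; rewrite !ReImE/=; ring.
have -> : cint y0 y1 (fun t => A + c * (x1 +i* t)) =
    cint y0 y1 (fun t => A + c * (x0 +i* t)) + c * (x1 - x0)%:C * (y1 - y0)%:C.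
  rewrite -cint_cst// -cintD; [|exact: pc|by apply: pc => t; exact: rcont_cst].
  by apply: eq_cint => t _; apply: complex_eqP; rewrite !ReImE/=; ring.
by rewrite !rmorphB /=; ring.
Qed.

Lemma rect_int_split G x0 x x1 y0 y y1 : x0 <= x <= x1 -> y0 <= y <= y1 ->
  rect_cont G x0 x1 y0 y1 ->
  rect_int G x0 x1 y0 y1 = rect_int G x0 x y0 y + rect_int G x x1 y0 y
    + rect_int G x0 x y y1 + rect_int G x x1 y y1.
Proof.
move=> xx yy Gc; rewrite /rect_int; move: (xx) (yy) => /andP[x0x xx1] /andP[y0y yy1].
have x01 := le_trans x0x xx1; have y01 := le_trans y0y yy1.
rewrite (@cint_split _ x0 x1 x (fun t => G (t +i* y0)))//; last first.
  by apply: (rect_path_h Gc) => //; rewrite lexx.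
rewrite (@cint_split _ x0 x1 x (fun t => G (t +i* y1)))//; last first.
  by apply: (rect_path_h Gc) => //; rewrite lexx andbT.
rewrite (@cint_split _ y0 y1 y (fun t => G (x1 +i* t)))//; last first.
  by apply: (rect_path_v Gc) => //; rewrite lexx andbT.
rewrite (@cint_split _ y0 y1 y (fun t => G (x0 +i* t)))//; last first.
  by apply: (rect_path_v Gc) => //; rewrite lexx.
by ring.
Qed.

Lemma rect_int_le G x0 x1 y0 y1 (M : R) : x0 <= x1 -> y0 <= y1 ->
  rect_cont G x0 x1 y0 y1 -> (forall z, rect x0 x1 y0 y1 z -> cabs (G z) <= M) ->
  cabs (rect_int G x0 x1 y0 y1) <= M * (2 * ((x1 - x0) + (y1 - y0))).
Proof.
move=> x01 y01 Gc GM; rewrite /rect_int.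
have h y : y0 <= y <= y1 -> cabs (cint x0 x1 (fun t => G (t +i* y))) <= M * (x1 - x0).
  by move=> yy; apply: cint_le => // [|t tt]; [exact: rect_path_h Gc _ _ _|apply: GM].
have v x : x0 <= x <= x1 -> cabs (cint y0 y1 (fun t => G (x +i* t))) <= M * (y1 - y0).
  by move=> yy; apply: cint_le => // [|t tt]; [exact: rect_path_v Gc _ _ _|apply: GM].
apply: le_trans (cabsD _ _) _; rewrite cabsM cabs_i mul1r.
apply: le_trans (lerD (cabsD _ _) (cabsD _ _)) _; rewrite !cabsN.
have := h y0; have := h y1; have := v x0; have := v x1.
rewrite !lexx x01 y01 => /(_ isT) ? /(_ isT) ? /(_ isT) ? /(_ isT) ?; lra.
Qed.

(** The bound [e * t ^+ 2] is additive under quartering, so by bisection it suffices near each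
    point. There the affine part of [G] integrates to [0], and the remainder is [o(t)] on a boundary
    of length proportional to [t]. *)
Theorem goursat G x0 x1 y0 y1 : x0 <= x1 -> y0 <= y1 ->
  (forall z, rect x0 x1 y0 y1 z -> exists a, cderiv G z a) ->
  rect_int G x0 x1 y0 y1 = 0.
Proof.
move=> x01 y01 Gd; apply/eqP; rewrite -cabs0_eq0 eq_le cabs_ge0 andbT.
apply/ler_addgt0Pl => e e0; rewrite addr0.
have Gc : rect_cont G x0 x1 y0 y1 by move=> z /Gd[a]; exact: cderiv_cont.
set a := x1 - x0; set b := y1 - y0.
have a0 : 0 <= a by rewrite subr_ge0.
have b0 : 0 <= b by rewrite subr_ge0.
pose P x y t := x0 <= x -> x + t * a <= x1 -> y0 <= y -> y + t * b <= y1 ->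
  cabs (rect_int G x (x + t * a) y (y + t * b)) <= e * t ^+ 2.
have subc x y t : 0 < t -> x0 <= x -> x + t * a <= x1 -> y0 <= y -> y + t * b <= y1 ->
    rect_cont G x (x + t * a) y (y + t * b).
  move=> t0 h1 h2 h3 h4 z [/andP[k1 k2] /andP[k3 k4]]; apply: Gc.
  by split; apply/andP; split; lra.
suff : P x0 y0 1.
  by rewrite /P !mul1r !(addrC _ a, addrC _ b) !subrK !lexx expr1n mulr1; apply.
apply: (@rectangle_ind R P a b) => //.
  move=> x y t t0 P1 P2 P3 P4 h1 h2 h3 h4.
  have ta : 0 <= t / 2 * a by rewrite mulr_ge0// divr_ge0// ltW.
  have tb : 0 <= t / 2 * b by rewrite mulr_ge0// divr_ge0// ltW.
  rewrite (@rect_int_split G x (x + t / 2 * a) _ y (y + t / 2 * b)); [| |lra|exact: subc]; last first.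
    by apply/andP; split; lra.
  have -> : x + t * a = x + t / 2 * a + t / 2 * a by field.
  have -> : y + t * b = y + t / 2 * b + t / 2 * b by field.
  apply: le_trans (cabsD _ _) _; apply: le_trans (lerD (cabsD _ _) (lexx _)) _.
  apply: le_trans (lerD (lerD (cabsD _ _) (lexx _)) (lexx _)) _.
  have -> : e * t ^+ 2 = e * (t / 2) ^+ 2 + e * (t / 2) ^+ 2 + e * (t / 2) ^+ 2 + e * (t / 2) ^+ 2.
    by field.
  apply: lerD; [apply: lerD; [apply: lerD|]|].
  - by apply: P1 => //; lra.
  - by apply: P2 => //; lra.
  - by apply: P3 => //; lra.
  - by apply: P4 => //; lra.
rewrite !mul1r => p q; rewrite /a /b !(addrC _ (_ - _)) !subrK => pp qq.
have [c Gp] := Gd (p +i* q) (conj pp qq).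
(* On a rectangle of scale [t] the distance to the point is at most [t (a + b)] and the perimeter is
   [2 t (a + b)]. Their product explains the denominator; the summand [1] keeps it positive. *)
have k0 : 0 < e / (1 + 2 * (a + b) ^+ 2).
  by rewrite divr_gt0// ltr_pwDl// mulr_ge0// sqr_ge0.
have [d d0 H] := Gp _ k0.
exists (d / (1 + (a + b))); first by rewrite divr_gt0// ltr_pwDl// addr_ge0.
move=> x y t /andP[t0 td] h1 h2 h3 h4 /andP[p1 p2] /andP[q1 q2] h5 h6 h7 h8.
set k := e / _ in k0 H.
rewrite -/a in h2 h6 p2; rewrite -/b in h4 h8 q2.
have kE : k * (1 + 2 * (a + b) ^+ 2) = e.
  by rewrite divfK// gt_eqF// ltr_pwDl// mulr_ge0// sqr_ge0.
rewrite ltr_pdivlMr in td; last by rewrite ltr_pwDl// addr_ge0.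
have ta : 0 <= t * a by rewrite mulr_ge0// ltW.
have tb : 0 <= t * b by rewrite mulr_ge0// ltW.
have xx : x <= x + t * a by lra.
have yy : y <= y + t * b by lra.
pose A := G (p +i* q) - c * (p +i* q).
pose E z := G z + ((- A) + (- c) * z).
have cA (B C : R[i]) u v r s : rect_cont (fun z => B + C * z) u v r s.
  move=> z _; apply: (@cderiv_cont _ _ _ (0 + C * 1)).
  by apply: cderivD; [exact: cderiv_cst|apply: cderivZ; exact: cderiv_id].
have GE : G = (fun z => E z + (A + c * z)).
  by apply/funext => z; rewrite /E; ring.
have cG := subc x y t t0 h5 h6 h7 h8.
have cE : rect_cont E x (x + t * a) y (y + t * b).
  move=> z zr; have Gz := cG z zr; have cz := cA (- A) (- c) _ _ _ _ z zr; move=> r r0.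
  have r2 : 0 < r / 2 by lra.
  have [d1 d10 D1] := Gz _ r2; have [d2 d20 D2] := cz _ r2.
  exists (Num.min d1 d2); first by rewrite lt_min d10.
  move=> w; rewrite lt_min => /andP[/D1 w1 /D2 w2].
  rewrite (_ : E w - E z = (G w - G z) + ((-A + - c * w) - (- A + - c * z))); last by rewrite /E; ring.
  by apply: le_lt_trans (cabsD _ _) _; lra.
rewrite GE rect_intD// rect_int_affine// addr0.
apply: (@le_trans _ _ (k * (t * (a + b)) * (2 * ((x + t * a - x) + (y + t * b - y))))); last first.
  rewrite (addrC x) addrK (addrC y) addrK -mulrDr -kE.
  set u := a + b; have u0 : 0 <= u by exact: addr_ge0.
  rewrite (_ : _ * _ = k * (2 * u ^+2) * t ^+ 2); last ring.
  by rewrite ler_wpM2r ?sqr_ge0// ler_wpM2l ?(ltW k0)// lerDr.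
apply: rect_int_le => // z [/andP[z1 z2] /andP[z3 z4]].
have zpq : cabs (z - (p +i* q)) <= t * (a + b).
  apply: le_trans (cabs_leD _) _; rewrite !ReImE /= mulrDr.
  exact: (lerD (itv_dist p1 p2 z1 z2) (itv_dist q1 q2 z3 z4)).
have := H (z - (p +i* q)); rewrite [p +i* q + _]addrC subrK => /(_ _)/wrap[].
  by apply: le_lt_trans zpq (lt_trans _ td); rewrite [ltRHS]mulrDr mulr1 ltrDr.
rewrite (_ : G z - _ - _ = E z); last by rewrite /E /A; ring.
by move/le_trans; apply; rewrite ler_wpM2l// ltW.
Qed.

End Goursat.

(** * The complex exponential *)

Section ComplexExponential.
Variable R : realType.
Implicit Types (z w : R[i]) (x y s t : R).

Definition cexp z : R[i] := (expR (Re z) * cos (Im z)) +i* (expR (Re z) * sin (Im z)).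

Lemma cexpD z w : cexp (z + w) = cexp z * cexp w.
Proof.
by case: z w => [a b] [c d]; apply: complex_eqP; rewrite /= expRD ?cosD ?sinD; ring.
Qed.

Lemma cexp0 : cexp 0 = 1.
Proof. by apply: complex_eqP; rewrite /= ?expR0 ?cos0 ?sin0; ring. Qed.

Lemma cabs_cexp z : cabs (cexp z) = expR (Re z).
Proof.
rewrite /cabs /= !exprMn -mulrDr cos2Dsin2 mulr1 sqrtr_sqr ger0_norm// expR_ge0.
Qed.

Lemma is_derive_eps (f : R -> R) x (l : R) : is_derive x 1 f l ->
  forall e : R, 0 < e -> exists2 d : R, 0 < d &
  forall h, `|h| < d -> `|f (x + h) - f x - l * h| <= e * `|h|.
Proof.
move=> [fd fl] e e0.
move: fd; rewrite /derivable => /cvg_ex[k /= fk].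
have kl : k = l by rewrite -fl; apply/esym/cvg_lim.
move: fk; rewrite {}kl => /cvgrPdist_lt /(_ e e0).
rewrite /dnbhs => /nbhs_ballP[d /= d0 H]; exists d => // h hd.
have [->|h0] := eqVneq h 0; first by rewrite addr0 subrr mulr0 subrr normr0 mulr0.
have := H h; rewrite /ball /= sub0r normrN => /(_ hd h0) /ltW.
rewrite /GRing.scale /= mulr1 distrC => H'.
have -> : f (x + h) - f x - l * h = (h^-1 * (f (h + x) - f x) - l) * h.
  by rewrite mulrBl mulrAC mulVf// mul1r (addrC h).
by rewrite normrM ler_wpM2r.
Qed.

Lemma cderiv_cexp0 : cderiv cexp 0 1.
Proof.
move=> e e0.
have [k [k0 k1 ke]] : exists k : R, [/\ 0 < k, k <= 1 & k <= e / 16].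
  exists (Num.min 1 (e / 16)); split; rewrite ?ge_min ?lexx ?orbT//.
  by rewrite lt_min ltr01/=; lra.
have [d1 d10 H1] := is_derive_eps (is_derive_expR 0) k0.
have [d2 d20 H2] := is_derive_eps (is_derive_cos 0) k0.
have [d3 d30 H3] := is_derive_eps (is_derive_sin 0) k0.
exists (Num.min k (Num.min d1 (Num.min d2 d3))).
  by rewrite lt_min k0 lt_min d10 lt_min d20 d30.
move=> h; rewrite !lt_min => /and4P[hk hd1 hd2 hd3].
have [x_le y_le] := (Re_le_cabs h, Im_le_cabs h).
have := H1 _ (le_lt_trans x_le hd1); have := H2 _ (le_lt_trans y_le hd2).
have := H3 _ (le_lt_trans y_le hd3).
rewrite !add0r expR0 cos0 sin0 oppr0 mul0r !subr0 !addr0 !mul1r => S C E.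
apply: le_trans (cabs_leD _) _; rewrite cexp0 !ReImE/=.
set x := Re h in x_le E *; set y := Im h in y_le S C *.
have h0 := cabs_ge0 h.
set u := expR x - 1 - x in E; set v := cos y - 1 in C; set w := sin y - y in S.
have cy : `|cos y| <= 1 by rewrite ler_norml cos_geN1 cos_le1.
have -> : expR x * cos y - 1 - x = u * cos y + (1 + x) * v.
  by rewrite /u /v; ring.
have -> : expR x * sin y - 0 - y = (u + x) * (w + y) + w.
  by rewrite /u /w; ring.
have A1 : `|u * cos y + (1 + x) * v| <= k * cabs h + 2 * (k * cabs h).
  apply: le_trans (ler_normD _ _) _; rewrite !normrM; apply: lerD.
    rewrite -[leRHS]mulr1 ler_pM// (le_trans E)// ler_wpM2l// ltW//.
  apply: ler_pM => //; last by apply: le_trans C _; rewrite ler_wpM2l// ltW.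
  by apply: le_trans (ler_normD _ _) _; rewrite normr1; lra.
have A2 : `|(u + x) * (w + y) + w| <= (2 * cabs h) * (2 * k) + k * cabs h.
  apply: le_trans (ler_normD _ _) _; rewrite !normrM; apply: lerD.
    apply: ler_pM => //.
      apply: le_trans (ler_normD _ _) _; rewrite (_ : 2 * cabs h = 1 * cabs h + cabs h); last ring.
      apply: lerD => //; apply: le_trans E _; apply: ler_pM => //; exact: ltW.
    apply: le_trans (ler_normD _ _) _; rewrite (_ : 2 * k = 1 * k + k); last ring.
    apply: lerD; last lra.
    by apply: le_trans S _; apply: ler_pM => //; [exact: ltW|lra].
  by apply: le_trans S _; rewrite ler_wpM2l// ltW.
apply: le_trans (lerD A1 A2) _; nra.
Qed.

(** The addition formula reduces the claim to the derivative at [0], where the real derivatives of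
    [expR], [cos] and [sin] combine. *)
Lemma cderiv_cexp z : cderiv cexp z (cexp z).
Proof.
move=> e e0; have [d d0 H] := cderiv_cexp0 (divr_gt0 e0 (expR_gt0 (Re z))).
exists d => // h /H; rewrite add0r cexp0 cexpD.
rewrite (_ : _ * cexp h - _ - _ = cexp z * (cexp h - 1 - 1 * h)); last by ring.
rewrite cabsM cabs_cexp => H'.
apply: le_trans (ler_wpM2l (expR_ge0 _) H') _.
by rewrite mulrA (mulrC (expR _)) divfK// gt_eqF// expR_gt0.
Qed.

End ComplexExponential.

(** * Integrals over circles and Cauchy's formula *)

Section CircleIntegral.
Variable R : realType.
Implicit Types (F G H : R[i] -> R[i]) (c w z : R[i]) (s t : R).

(** The radius is given by its logarithm: an annulus is then the image of a rectangle under
    [c + cexp]. *)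
Definition circ c s t : R[i] := c + cexp (s +i* t).

(** Integration is with respect to the angle, that is, against [dz / (i (z - c))]; hence the factors
    [z - c] in the formulas below. *)
Definition circ_int F c s : R[i] := cint 0 (2 * pi) (fun t => F (circ c s t)).

Lemma cabs_circ c s t : cabs (circ c s t - c) = expR s.
Proof. by rewrite /circ addrC addKr cabs_cexp. Qed.

Lemma rcont_circ c s t : rcont (circ c s) t.
Proof.
apply: (@ccont_rcont _ (fun z => c + cexp z) (fun t => s +i* t)).
  exact: rcont_vertical.
apply: cderiv_cont; apply: cderivD; [exact: cderiv_cst|exact: cderiv_cexp].
Qed.

Lemma circ_path F c s : (forall z, cabs (z - c) = expR s -> ccont F z) ->
  path_cont 0 (2 * pi) (fun t => F (circ c s t)).
Proof.
move=> Fc t _; apply: ccont_rcont; first exact: rcont_circ.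
by apply: Fc; rewrite cabs_circ.
Qed.

Lemma pi2_ge0 : 0 <= 2 * pi :> R.
Proof. by rewrite mulr_ge0// pi_ge0. Qed.

(** Goursat's theorem for [F (c + cexp w)] on the rectangle with sides [[s1, s2]] and [[0, 2 pi]]:
    the horizontal sides cancel by periodicity, the vertical ones are the two circle integrals. *)
Lemma circ_int_const F c s1 s2 : s1 <= s2 ->
  (forall z, expR s1 <= cabs (z - c) <= expR s2 -> exists a, cderiv F z a) ->
  circ_int F c s1 = circ_int F c s2.
Proof.
move=> s12 Fd; have := @goursat R (fun w => F (c + cexp w)) s1 s2 0 (2 * pi) s12 pi2_ge0.
move=> /(_ _)/wrap[].
  move=> w [/andP[w1 w2] _].
  have [|a Fa] := Fd (c + cexp w); first by rewrite addrC addKr cabs_cexp !ler_expR w1 w2.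
  exists (a * cexp w); apply: (@cderiv_comp _ (fun w => c + cexp w) F) => //.
  by rewrite -(add0r (cexp w)); apply: cderivD; [exact: cderiv_cst|exact: cderiv_cexp].
rewrite /rect_int => /eqP.
have -> : cint s1 s2 (fun t => F (c + cexp (t +i* 0))) =
          cint s1 s2 (fun t => F (c + cexp (t +i* (2 * pi)))).
  apply: eq_cint => t _; rewrite /cexp/= (_ : 2 * pi = pi *+ 2); last by rewrite mulr_natl.
  by rewrite cos2pi sin2pi cos0 sin0.
have i0 : ('i : R[i]) != 0 by rewrite eq_complex/= oner_eq0 andbF.
rewrite subrr add0r mulf_eq0 (negbTE i0)/=.
by rewrite subr_eq0 => /eqP/esym.
Qed.

Lemma circ_int_le F c s (M : R) : (forall z, cabs (z - c) = expR s -> ccont F z) ->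
  (forall z, cabs (z - c) = expR s -> cabs (F z) <= M) ->
  cabs (circ_int F c s) <= M * (2 * pi).
Proof.
move=> Fc FM; rewrite -[X in _ * X]subr0; apply: cint_le => //; first exact: pi2_ge0.
  exact: circ_path.
by move=> t _; apply: FM; rewrite cabs_circ.
Qed.

Lemma circ_intD F G c s : (forall z, cabs (z - c) = expR s -> ccont F z) ->
  (forall z, cabs (z - c) = expR s -> ccont G z) ->
  circ_int (fun z => F z + G z) c s = circ_int F c s + circ_int G c s.
Proof. by move=> Fc Gc; rewrite /circ_int cintD//; exact: circ_path. Qed.

Lemma circ_intZ (k : R[i]) F c s : (forall z, cabs (z - c) = expR s -> ccont F z) ->
  circ_int (fun z => k * F z) c s = k * circ_int F c s.
Proof. by move=> Fc; rewrite /circ_int cintZ//; exact: circ_path. Qed.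

Lemma circ_int_cst (k : R[i]) c s : circ_int (fun=> k) c s = k * (2 * pi)%:C.
Proof. by rewrite /circ_int cint_cst ?pi2_ge0// subr0. Qed.

Lemma eq_circ_int F G c s : (forall z, cabs (z - c) = expR s -> F z = G z) ->
  circ_int F c s = circ_int G c s.
Proof. by move=> FG; apply: eq_cint => t _; apply: FG; rewrite cabs_circ. Qed.

Lemma ccont_cst (k z : R[i]) : ccont (fun=> k) z.
Proof. by apply: cderiv_cont; exact: cderiv_cst. Qed.

Lemma ccontD F G z : ccont F z -> ccont G z -> ccont (fun w => F w + G w) z.
Proof.
move=> ft gt e e0; have e2 : 0 < e / 2 by lra.
have [d d0 H] := ft _ e2; have [d' d'0 H'] := gt _ e2.
exists (Num.min d d'); first by rewrite lt_min d0.
move=> u; rewrite lt_min => /andP[/H ? /H' ?].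
rewrite (_ : F u + G u - (F z + G z) = (F u - F z) + (G u - G z)); last ring.
by apply: le_lt_trans (cabsD _ _) _; lra.
Qed.

Lemma ccontM F G z : ccont F z -> ccont G z -> ccont (fun w => F w * G w) z.
Proof.
move=> ft gt e e0.
have [a0 b0] := (cabs_ge0 (F z), cabs_ge0 (G z)).
pose k := Num.min 1 (e / (2 + cabs (F z) + cabs (G z))).
have p0 : 0 < 2 + cabs (F z) + cabs (G z) by lra.
have k0 : 0 < k by rewrite lt_min ltr01 divr_gt0.
have k1 : k <= 1 by rewrite ge_min lexx.
have ke : k * (2 + cabs (F z) + cabs (G z)) <= e.
  by rewrite -ler_pdivlMr// ge_min lexx orbT.
have [d d0 H] := ft _ k0; have [d' d'0 H'] := gt _ k0.
exists (Num.min d d'); first by rewrite lt_min d0.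
move=> u; rewrite lt_min => /andP[/H Fu /H' Gu].
rewrite (_ : F u * G u - F z * G z =
  (F u - F z) * (G u - G z) + (F z * (G u - G z) + (F u - F z) * G z)); last ring.
apply: le_lt_trans (cabsD _ _) _; apply: le_lt_trans (lerD (lexx _) (cabsD _ _)) _.
rewrite !cabsM.
have [u0 v0] := (cabs_ge0 (F u - F z), cabs_ge0 (G u - G z)).
set a := cabs (F z) in a0 p0 ke *; set b := cabs (G z) in b0 p0 ke *.
move: Fu Gu u0 v0; set u' := cabs (F u - F z); set v' := cabs (G u - G z) => Fu Gu u0 v0.
apply: lt_le_trans ke.
have : u' * v' <= 1 * v' by rewrite ler_wpM2r//; lra.
have : a * v' <= k * a by rewrite mulrC ler_wpM2r// ltW.
have : u' * b <= k * b by rewrite ler_wpM2r// ltW.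
lra.
Qed.

Lemma ccont_inv F z : ccont F z -> F z != 0 -> ccont (fun w => (F w)^-1) z.
Proof.
move=> Fz Fz0 e e0; have [d d0 H] := cderiv_cont (cderiv_inv Fz0) e0.
by have [d' d'0 H'] := Fz _ d0; exists d' => // w /H' /H.
Qed.

Lemma ccont_sub z w : ccont (fun v => v - w) z.
Proof. by apply: ccontD; [exact: (cderiv_cont (cderiv_id z))|exact: ccont_cst]. Qed.

(* Uniform continuity along the circle, by bisection of the parameter interval. *)
Lemma circ_int_cont F c s0 : (forall z, cabs (z - c) = expR s0 -> ccont F z) ->
  forall e : R, 0 < e -> exists2 d : R, 0 < d & forall s, `|s - s0| < d ->
    (forall z, cabs (z - c) = expR s -> ccont F z) ->
    cabs (circ_int F c s - circ_int F c s0) <= e.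
Proof.
move=> Fc e e0.
have pi0 : 0 < 2 * pi :> R by rewrite mulr_gt0// pi_gt0.
pose k := e / (2 * pi).
have k0 : 0 < k by rewrite divr_gt0.
pose P (x y t : R) := exists2 d : R, 0 < d & forall s, `|s - s0| < d ->
  forall u, y <= u <= y + t * (2 * pi) -> cabs (F (circ c s u) - F (circ c s0 u)) <= k.
have [d d0 H] : P 0 0 1.
  apply: (@rectangle_ind R P 0 (2 * pi)) => //; first exact: ltW.
    move=> x y t t0 [d1 d10 H1] _ [d2 d20 H2] _.
    exists (Num.min d1 d2); first by rewrite lt_min d10.
    move=> s; rewrite lt_min => /andP[/H1{}H1 /H2{}H2] u /andP[u1 u2].
    have [u3|u3] := leP u (y + t / 2 * (2 * pi)).
      by apply: H1; rewrite u1.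
    by apply: H2; rewrite (ltW u3)/=; move: u2; congr (_ <= _); field.
  move=> p q _ _.
  have k2 : 0 < k / 2 by rewrite divr_gt0.
  have [|d d0 H] := Fc (circ c s0 q) _ _ k2; first exact: cabs_circ.
  have cc : ccont (fun z => c + cexp z) (s0 +i* q).
    by apply: cderiv_cont; apply: cderivD; [exact: cderiv_cst|exact: cderiv_cexp].
  have [d1 d10 H1] := cc _ d0.
  exists (d1 / (4 * pi)); first by rewrite divr_gt0// mulr_gt0// pi_gt0.
  move=> x y t /andP[t0 td] _ _ _ _ _ /andP[q1 q2].
  rewrite ltr_pdivlMr ?mulr_gt0 ?pi_gt0// in td.
  exists (d1 / 2); first by rewrite divr_gt0.
  move=> s ss u /andP[u1 u2].
  have near v : `|v - s0| < d1 / 2 -> cabs (F (circ c v u) - F (circ c s0 q)) < k / 2.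
    move=> vs; apply: H; apply: H1; apply: le_lt_trans (cabs_leD _) _.
    rewrite !ReImE/=; have : `|u - q| <= t * (2 * pi) by rewrite ler_norml; apply/andP; split; lra.
    by move: td; lra.
  apply: le_trans (cabs_distD _ _ (F (circ c s0 q))) _.
  have := near s ss; have := near s0; rewrite subrr normr0 => /(_ _)/wrap[|].
    by rewrite divr_gt0.
  by rewrite cabsB; lra.
exists d => // s sd Fs.
have -> : circ_int F c s - circ_int F c s0 =
    cint 0 (2 * pi) (fun t => F (circ c s t) + (-1) * F (circ c s0 t)).
  rewrite cintD; [|exact: circ_path|].
    by rewrite cintZ ?mulN1r//; exact: circ_path.
  by move=> t tt; apply: rcontZ; exact: (circ_path Fc).
have -> : e = k * (2 * pi - 0) by rewrite subr0 /k divfK// gt_eqF.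
apply: cint_le; first exact: ltW.
  by move=> t tt; apply: rcontD; [exact: (circ_path Fs)|apply: rcontZ; exact: (circ_path Fc)].
move=> t /andP[t0 t1]; rewrite mulN1r; apply: H => //.
by rewrite t0 add0r mul1r.
Qed.

(* A single point where [H] is only continuous does no harm, since the integral
   depends continuously on the radius. *)
Lemma circ_int_eq0 H c w (r : R) :
  (forall z, cabs (z - c) < r -> ccont H z) ->
  (forall z, cabs (z - c) < r -> z != w -> exists a, cderiv H z a) ->
  H c = 0 -> forall s, expR s < r -> circ_int H c s = 0.
Proof.
move=> Hc Hd H0.
have Hcs s : expR s < r -> forall z, cabs (z - c) = expR s -> ccont H z.
  by move=> sr z zs; apply: Hc; rewrite zs.
have pi0 : 0 < 2 * pi :> R by rewrite mulr_gt0// pi_gt0.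
(* If [H] is differentiable off the centre, the circle can be shrunk to a radius where [H] is close
   to [H c = 0]. *)
have small s : expR s < r -> (forall z, cabs (z - c) <= expR s -> z != c -> exists a, cderiv H z a) ->
    circ_int H c s = 0.
  move=> sr Hs; apply/eqP; rewrite -cabs0_eq0 eq_le cabs_ge0 andbT.
  apply/ler_addgt0Pl => e e0; rewrite addr0.
  have k0 : 0 < e / (2 * pi) by rewrite divr_gt0.
  have [|d d0 dH] := Hc c _ _ k0; first by rewrite subrr cabs0 (lt_trans _ sr)// expR_gt0.
  pose s1 := Num.min s (ln (d / 2)).
  have s1s : s1 <= s by rewrite ge_min lexx.
  have s1d : expR s1 < d.
    have : expR s1 <= d / 2.
      by rewrite -[leRHS]lnK ?posrE ?divr_gt0// ler_expR ge_min lexx orbT.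
    by lra.
  rewrite -(@circ_int_const H c s1 s)//; last first.
    move=> z /andP[z1 z2]; apply: Hs => //.
    by rewrite -subr_eq0 -cabs_gt0 (lt_le_trans _ z1)// expR_gt0.
  have -> : e = e / (2 * pi) * (2 * pi) by rewrite divfK// gt_eqF.
  apply: circ_int_le; first by apply: Hcs; apply: le_lt_trans sr; rewrite ler_expR.
  by move=> z zs; rewrite -[H z]subr0 -H0 ltW// dH// zs.
have [wc|wc] := eqVneq w c.
  move=> s sr; apply: small => // z zs; rewrite -wc => zw; apply: Hd => //.
  exact: le_lt_trans sr.
(* The circle through [w] separates three cases: smaller radii by shrinking, the radius [s0] by
   continuity from below, and larger radii by decreasing them to [s0] from above. *)
pose s0 := ln (cabs (w - c)).
have wc0 : 0 < cabs (w - c) by rewrite cabs_gt0 subr_eq0.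
have s0E : expR s0 = cabs (w - c) by rewrite lnK.
have below s : expR s < r -> s < s0 -> circ_int H c s = 0.
  move=> sr ss; apply: small => // z zs _; apply: Hd; first exact: le_lt_trans sr.
  by apply: contraTneq zs => ->; rewrite -s0E ler_expR -ltNge.
have at0 : expR s0 < r -> circ_int H c s0 = 0.
  move=> sr; apply/eqP; rewrite -cabs0_eq0 eq_le cabs_ge0 andbT.
  apply/ler_addgt0Pl => e e0; rewrite addr0.
  have [d d0 dH] := circ_int_cont (Hcs _ sr) e0.
  have ss : s0 - d / 2 < s0 by lra.
  have sr' : expR (s0 - d / 2) < r by apply: lt_trans sr; rewrite ltr_expR.
  have := dH (s0 - d / 2); rewrite (below _ sr' ss) sub0r cabsN; apply.
    by rewrite addrC addKr normrN ger0_norm; lra.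
  exact: Hcs.
move=> s sr; have [/below->//|ss|ss] := ltgtP s s0; last by rewrite ss; apply: at0; rewrite -ss.
have s0r : expR s0 < r by apply: lt_trans sr; rewrite ltr_expR.
apply/eqP; rewrite -cabs0_eq0 eq_le cabs_ge0 andbT.
apply/ler_addgt0Pl => e e0; rewrite addr0.
have [d d0 dH] := circ_int_cont (Hcs _ s0r) e0.
pose s1 := Num.min s (s0 + d / 2).
have s1s : s1 <= s by rewrite ge_min lexx.
have s01 : s0 < s1 by rewrite lt_min ss/=; lra.
have s1d : s1 <= s0 + d / 2 by rewrite ge_min lexx orbT.
rewrite -(@circ_int_const H c s1 s)//; last first.
  move=> z /andP[z1 z2]; apply: Hd; first exact: le_lt_trans sr.
  by apply: contraTneq z1 => ->; rewrite -s0E ler_expR -ltNge.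
have := dH s1; rewrite (at0 s0r) subr0; apply.
  by rewrite ger0_norm; lra.
by apply: Hcs; apply: le_lt_trans sr; rewrite ler_expR.
Qed.

(** [circ_int_eq0] applied to [F - F c], with the centre itself as the exceptional point. *)
Lemma mean_value F c (r s : R) :
  (forall z, cabs (z - c) < r -> exists a, cderiv F z a) -> expR s < r ->
  circ_int F c s = F c * (2 * pi)%:C.
Proof.
move=> Fd sr.
have Fc z : cabs (z - c) < r -> ccont F z by move=> /Fd[a]; exact: cderiv_cont.
have := @circ_int_eq0 (fun z => F z + - F c) c c r _ _ _ s sr => /(_ _ _ _)/wrap[].
- by move=> z zr; apply: ccontD; [exact: Fc|exact: ccont_cst].
- by move=> z /Fd[a Fa] _; exists (a + 0); apply: cderivD => //; exact: cderiv_cst.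
- by rewrite subrr.
rewrite circ_intD; [|by move=> z zs; apply: Fc; rewrite zs|by move=> z _; exact: ccont_cst].
by rewrite circ_int_cst mulNr => /eqP; rewrite subr_eq0 => /eqP.
Qed.

(** The integrand is holomorphic away from [w], so the circle may be enlarged; far away
    [(z - c) / (z - w)] is uniformly close to [1]. *)
Lemma kernel_int c w s : cabs (w - c) < expR s ->
  circ_int (fun z => (z - c) / (z - w)) c s = (2 * pi)%:C.
Proof.
move=> ws; apply/eqP; rewrite -subr_eq0 -cabs0_eq0 eq_le cabs_ge0 andbT.
apply/ler_addgt0Pl => e e0; rewrite addr0.
have pi0 : 0 < 2 * pi :> R by rewrite mulr_gt0// pi_gt0.
have k0 : 0 < e / (2 * pi) by rewrite divr_gt0.
set k := e / (2 * pi) in k0.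
have a0 := cabs_ge0 (w - c).
(* The integrand differs from [1] by [(w - c) / (z - w)]. The last summand makes this at most [k] on
   the large circle, and the [1] keeps [w] inside even when [w = c]. *)
pose s1 := Num.max s (ln (cabs (w - c) + 1 + cabs (w - c) / k)).
have ss1 : s <= s1 by rewrite le_max lexx.
have ak : 0 <= cabs (w - c) / k by rewrite divr_ge0// ltW.
have s1w : cabs (w - c) + 1 + cabs (w - c) / k <= expR s1.
  rewrite -[leLHS]lnK ?ler_expR ?le_max ?lexx ?orbT// posrE; lra.
have zw z t : cabs (w - c) < t -> cabs (z - c) = t -> z - w != 0.
  move=> wt zt; rewrite -cabs_gt0.
  have := cabs_leB (z - c) (w - c); rewrite (_ : z - c - (w - c) = z - w); [lra|ring].
have ws1 : cabs (w - c) < expR s1 by lra.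
rewrite (@circ_int_const _ c s s1)//; last first.
  move=> z /andP[z1 _].
  exists (1 * (z - w)^-1 + (z - c) * (- (z - w) ^- 2 * (1 + 0))).
  apply: cderivM.
    by rewrite -(addr0 1); apply: cderivD; [exact: cderiv_id|exact: cderiv_cst].
  apply: (@cderiv_comp _ (fun z => z + - w) (fun z => z^-1)).
    by apply: cderivD; [exact: cderiv_id|exact: cderiv_cst].
  by apply: cderiv_inv; apply: (zw z (cabs (z - c))) => //; exact: lt_le_trans z1.
have cK z : cabs (z - c) = expR s1 -> ccont (fun z => (z - c) / (z - w)) z.
  move=> zs; apply: ccontM; first exact: ccont_sub.
  by apply: ccont_inv; [exact: ccont_sub|exact: (zw z (expR s1))].
rewrite (_ : circ_int _ c s1 - _ = circ_int (fun z => (z - c) / (z - w) + -1) c s1); last first.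
  by rewrite circ_intD//; [rewrite circ_int_cst mulN1r|move=> z _; exact: ccont_cst].
have -> : e = k * (2 * pi) by rewrite divfK// gt_eqF.
apply: circ_int_le.
  by move=> z zs; apply: ccontD; [exact: cK|exact: ccont_cst].
move=> z zs; have zw0 := zw _ _ ws1 zs.
have -> : (z - c) / (z - w) + -1 = (w - c) / (z - w) by field.
rewrite cabsM cabsV ler_pdivrMr ?cabs_gt0//.
have := cabs_leB (z - c) (w - c); rewrite (_ : z - c - (w - c) = z - w); last ring.
rewrite zs => zz.
have -> : cabs (w - c) = k * (cabs (w - c) / k).
  by rewrite mulrCA divff ?mulr1// gt_eqF.
by rewrite ler_wpM2l ?(ltW k0)//; lra.
Qed.

(** The difference quotient [G] of [F] at [w], completed by the derivative, is continuous and is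
    differentiable off [w]; moreover [G z * (z - c)] vanishes at [c]. Hence [circ_int_eq0] applies,
    and [kernel_int] evaluates the term with [F w]. *)
Theorem cauchy_formula F c w (r s : R) :
  (forall z, cabs (z - c) < r -> exists a, cderiv F z a) ->
  expR s < r -> cabs (w - c) < expR s ->
  circ_int (fun z => F z * (z - c) / (z - w)) c s = F w * (2 * pi)%:C.
Proof.
move=> Fd sr ws.
have wr : cabs (w - c) < r by exact: lt_trans sr.
have [b Fb] := Fd w wr.
pose G z := if z == w then b else (F z - F w) / (z - w).
have GE z : z != w -> G z = (F z - F w) / (z - w) by rewrite /G => /negbTE->.
have Gd z : cabs (z - c) < r -> z != w -> exists a, cderiv G z a.
  move=> zr zw; have [a Fa] := Fd z zr; have zw0 : z - w != 0 by rewrite subr_eq0.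
  exists ((a + 0) * (z - w)^-1 + (F z - F w) * (- (z - w) ^- 2 * (1 + 0))).
  apply: (@cderiv_eq _ (fun z => (F z - F w) / (z - w))).
    exists (cabs (z - w)); first by rewrite cabs_gt0.
    move=> v vz; rewrite GE//; apply: contraTneq vz => ->.
    by rewrite cabsB ltxx.
  apply: cderivM; first by apply: cderivD => //; exact: cderiv_cst.
  apply: (@cderiv_comp _ (fun z => z + - w) (fun z => z^-1)).
    by apply: cderivD; [exact: cderiv_id|exact: cderiv_cst].
  exact: cderiv_inv.
have Gc z : cabs (z - c) < r -> ccont G z.
  move=> zr; have [->{z zr}|zw] := eqVneq z w; last by have [a] := Gd z zr zw; exact: cderiv_cont.
  move=> e e0; have e2 : 0 < e / 2 by lra.
  have [d d0 H] := Fb _ e2; exists d => // z zd.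
  have [->|zw] := eqVneq z w; first by rewrite subrr cabs0.
  have zw0 : z - w != 0 by rewrite subr_eq0.
  rewrite GE// /G eqxx.
  have := H (z - w) zd; rewrite [w + _]addrC subrK => {}H.
  have -> : (F z - F w) / (z - w) - b = (F z - F w - b * (z - w)) / (z - w) by field.
  rewrite cabsM cabsV; apply: (@le_lt_trans _ _ (e / 2)); last lra.
  by rewrite ler_pdivrMr ?cabs_gt0.
have := @circ_int_eq0 (fun z => G z * (z - c)) c w r _ _ _ s sr => /(_ _ _ _)/wrap[].
- by move=> z zr; apply: ccontM; [exact: Gc|exact: ccont_sub].
- move=> z zr zw; have [a Ga] := Gd z zr zw; exists (a * (z - c) + G z * (1 + 0)).
  by apply: cderivM => //; apply: cderivD; [exact: cderiv_id|exact: cderiv_cst].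
- by rewrite subrr mulr0.
have zw z : cabs (z - c) = expR s -> z - w != 0.
  by move=> zs; rewrite subr_eq0; apply: contraTneq ws => <-; rewrite zs ltxx.
rewrite (@eq_circ_int _ (fun z => F z * (z - c) / (z - w) + (- F w) * ((z - c) / (z - w)))); last first.
  move=> z /zw zw0; rewrite GE; last by rewrite -subr_eq0.
  by ring.
have cK z : cabs (z - c) = expR s -> ccont (fun z => (z - c) / (z - w)) z.
  move=> zs; apply: ccontM; first exact: ccont_sub.
  by apply: ccont_inv; [exact: ccont_sub|exact: zw].
have cF z : cabs (z - c) = expR s -> ccont (fun z => F z * (z - c) / (z - w)) z.
  move=> zs; apply: ccontM; last by apply: ccont_inv; [exact: ccont_sub|exact: zw].
  apply: ccontM; last exact: ccont_sub.
  by have [|a] := Fd z; [rewrite zs|exact: cderiv_cont].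
rewrite circ_intD//; last by move=> z zs; apply: ccontM; [exact: ccont_cst|exact: cK].
by rewrite circ_intZ// kernel_int// mulNr => /eqP; rewrite subr_eq0 => /eqP.
Qed.

End CircleIntegral.

(** * Cauchy transforms and their derivatives *)

Section CauchyTransform.
Variable R : realType.
Implicit Types (F : R[i] -> R[i]) (c w z h : R[i]) (s t : R) (phi : R -> R[i]).

Definition cauchy_transform phi c s w : R[i] :=
  cint 0 (2 * pi) (fun t => phi t / (circ c s t - w)).

Lemma circ_dist c s w t : expR s - cabs (w - c) <= cabs (circ c s t - w).
Proof.
have := cabs_leB (circ c s t - c) (w - c).
by rewrite cabs_circ (_ : _ - c - (w - c) = circ c s t - w)//; ring.
Qed.

Lemma circ_neq c s w t : cabs (w - c) < expR s -> circ c s t - w != 0.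
Proof.
by move=> ws; rewrite -cabs_gt0; apply: lt_le_trans (circ_dist _ _ _ _); rewrite subr_gt0.
Qed.

Lemma rcontM phi psi t : rcont phi t -> rcont psi t -> rcont (fun u => phi u * psi u) t.
Proof.
move=> ft gt e e0.
have [a0 b0] := (cabs_ge0 (phi t), cabs_ge0 (psi t)).
have p0 : 0 < 2 + cabs (phi t) + cabs (psi t) by lra.
have [k [k0 k1 ke]] : exists k : R, [/\ 0 < k, k <= 1 &
    k * (2 + cabs (phi t) + cabs (psi t)) <= e].
  exists (Num.min 1 (e / (2 + cabs (phi t) + cabs (psi t)))); split.
  - by rewrite lt_min ltr01 divr_gt0.
  - by rewrite ge_min lexx.
  - by rewrite -ler_pdivlMr// ge_min lexx orbT.
have [d d0 H] := ft _ k0; have [d' d'0 H'] := gt _ k0.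
exists (Num.min d d'); first by rewrite lt_min d0.
move=> u; rewrite lt_min => /andP[/H Fu /H' Gu].
rewrite (_ : phi u * psi u - phi t * psi t =
  (phi u - phi t) * (psi u - psi t) + (phi t * (psi u - psi t) + (phi u - phi t) * psi t)); last ring.
apply: le_lt_trans (cabsD _ _) _; apply: le_lt_trans (lerD (lexx _) (cabsD _ _)) _.
rewrite !cabsM.
have [u0 v0] := (cabs_ge0 (phi u - phi t), cabs_ge0 (psi u - psi t)).
set a := cabs (phi t) in a0 p0 ke *; set b := cabs (psi t) in b0 p0 ke *.
move: Fu Gu u0 v0; set u' := cabs (phi u - _); set v' := cabs (psi u - _) => Fu Gu u0 v0.
apply: lt_le_trans ke.
have : u' * v' <= 1 * v' by rewrite ler_wpM2r//; lra.
have : a * v' <= k * a by rewrite mulrC ler_wpM2r// ltW.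
have : u' * b <= k * b by rewrite ler_wpM2r// ltW.
lra.
Qed.

Lemma rcont_kernel c s w t : cabs (w - c) < expR s -> rcont (fun t => (circ c s t - w)^-1) t.
Proof.
move=> ws; apply: (@ccont_rcont _ (fun z => (z - w)^-1) (circ c s)).
  exact: rcont_circ.
apply: ccont_inv; first exact: ccont_sub.
exact: circ_neq.
Qed.

Lemma path_contM phi psi a b : path_cont a b phi -> path_cont a b psi ->
  path_cont a b (fun t => phi t * psi t).
Proof. by move=> p q t tt; apply: rcontM; [exact: p|exact: q]. Qed.

Lemma path_cont_kernel c s w : cabs (w - c) < expR s ->
  path_cont 0 (2 * pi) (fun t => (circ c s t - w)^-1).
Proof. by move=> ws t _; exact: rcont_kernel. Qed.

(** [path2] and [path3] are the first and second derivatives of [cauchy_transform] in [w]; see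
    [cauchy_transform_deriv]. *)
Definition path2 phi c s w : R[i] :=
  cint 0 (2 * pi) (fun t => phi t / (circ c s t - w) ^+ 2).
Definition path3 phi c s w : R[i] :=
  cint 0 (2 * pi) (fun t => 2 * phi t / (circ c s t - w) ^+ 3).

(** Differentiation under the integral sign: a remainder of second order in [h], uniform in [t], can
    simply be integrated. *)
Lemma cint_cderiv phi (K K' : R -> R[i] -> R[i]) w (M B : R) :
  path_cont 0 (2 * pi) phi -> (forall t, 0 <= t <= 2 * pi -> cabs (phi t) <= M) ->
  (exists2 d : R, 0 < d & forall h, cabs h < d ->
    path_cont 0 (2 * pi) (fun t => K t (w + h)) /\
    forall t, 0 <= t <= 2 * pi -> cabs (K t (w + h) - K t w - K' t w * h) <= B * cabs h ^+ 2) ->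
  path_cont 0 (2 * pi) (fun t => K' t w) ->
  cderiv (fun w => cint 0 (2 * pi) (fun t => phi t * K t w)) w
    (cint 0 (2 * pi) (fun t => phi t * K' t w)).
Proof.
move=> phic phiM [d d0 HK] K'c e e0.
have pi20 := @pi2_ge0 R.
have M0 : 0 <= M by apply: le_trans (cabs_ge0 (phi 0)) (phiM _ _); rewrite lexx.
have p0 : 0 < 1 + M * `|B| * (2 * pi).
  by rewrite ltr_pwDl// !mulr_ge0// pi_ge0.
exists (Num.min d (e / (1 + M * `|B| * (2 * pi)))); first by rewrite lt_min d0 divr_gt0.
move=> h; rewrite lt_min => /andP[hd]; rewrite ltr_pdivlMr// => he.
have [Kh KhB] := HK h hd.
have [Kw _] := HK 0 (eq_ind_r (fun x => x < d) d0 (@cabs0 R)); rewrite addr0 in Kw.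
have c1 := path_contM phic Kh; have c2 := path_contM phic Kw; have c3 := path_contM phic K'c.
have -> : cint 0 (2 * pi) (fun t => phi t * K t (w + h)) - cint 0 (2 * pi) (fun t => phi t * K t w)
    - cint 0 (2 * pi) (fun t => phi t * K' t w) * h =
    cint 0 (2 * pi) (fun t => phi t * K t (w + h) + (- 1) * (phi t * K t w) +
      (- h) * (phi t * K' t w)).
  rewrite cintD; [rewrite cintD//; [rewrite !cintZ//; ring|by move=> t /c2; exact: rcontZ]| |
     by move=> t /c3; exact: rcontZ].
  by move=> t tt; apply: rcontD; [exact: c1|apply: rcontZ; exact: c2].
apply: (@le_trans _ _ (M * `|B| * cabs h ^+ 2 * (2 * pi - 0))).
  apply: cint_le => //.
    by move=> t tt; apply: rcontD; [apply: rcontD; [exact: c1|apply: rcontZ; exact: c2]|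
      apply: rcontZ; exact: c3].
  move=> t tt.
  have -> : phi t * K t (w + h) + (- 1) * (phi t * K t w) + (- h) * (phi t * K' t w) =
     phi t * (K t (w + h) - K t w - K' t w * h) by ring.
  rewrite cabsM -mulrA ler_pM ?cabs_ge0// ?phiM//.
  by apply: le_trans (KhB _ tt) _; rewrite ler_wpM2r ?sqr_ge0 ?ler_norm.
rewrite subr0 (_ : _ * _ = (cabs h * (M * `|B| * (2 * pi))) * cabs h); last ring.
by rewrite ler_wpM2r ?cabs_ge0//; have := cabs_ge0 h; lra.
Qed.

Lemma kernel_near c s w : cabs (w - c) < expR s -> exists2 d : R, 0 < d &
  forall h, cabs h < d -> cabs (w + h - c) < expR s /\
    forall t, cabs (circ c s t - (w + h))^-1 <= 2 / (expR s - cabs (w - c)).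
Proof.
move=> ws; exists ((expR s - cabs (w - c)) / 2); first by lra.
move=> h hd.
have lt1 : cabs (w + h - c) <= cabs (w - c) + cabs h.
  by rewrite (_ : w + h - c = (w - c) + h) ?cabsD//; ring.
split; first by lra.
move=> t; have D := circ_dist c s (w + h) t.
rewrite cabsV ler_pdivlMr; last lra.
by rewrite mulrC ler_pdivrMr; lra.
Qed.

Lemma cauchy_transform_deriv phi c s w (M : R) : cabs (w - c) < expR s ->
  path_cont 0 (2 * pi) phi -> (forall t, 0 <= t <= 2 * pi -> cabs (phi t) <= M) ->
  cderiv (cauchy_transform phi c s) w (path2 phi c s w) /\
  cderiv (path2 phi c s) w (path3 phi c s w).
Proof.
move=> ws phic phiM.
have [d d0 H] := kernel_near ws.
set B := 2 / _ in H.
have B0 : 0 <= B by rewrite divr_ge0// subr_ge0 ltW.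
have ic := path_cont_kernel.
have [_ Bw] : cabs (w + 0 - c) < expR s /\ forall t, cabs (circ c s t - (w + 0))^-1 <= B.
  by apply: H; rewrite cabs0.
rewrite addr0 in Bw.
split.
  apply: (@cint_cderiv phi (fun t w => (circ c s t - w)^-1) (fun t w => ((circ c s t - w) ^+ 2)^-1)
    w M (B * B * B)) => //.
    exists d => // h hd; have [wh Bh] := H h hd; split; first exact: ic.
    move=> t _; have z1 := circ_neq t ws; have z2 := circ_neq t wh.
    (* The exact second-order remainder of the kernel; each of its three inverse factors has modulus
       at most [B]. *)
    have -> : (circ c s t - (w + h))^-1 - (circ c s t - w)^-1 - (circ c s t - w) ^- 2 * h =
        (circ c s t - w)^-1 * (circ c s t - w)^-1 * (circ c s t - (w + h))^-1 * h ^+ 2.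
      by field; rewrite z1 z2.
    rewrite (cabsM _ (h ^+ 2)) (cabsX h) ler_wpM2r ?sqr_ge0// !cabsM.
    by rewrite ler_pM ?mulr_ge0 ?cabs_ge0// ler_pM ?cabs_ge0.
  have := path_contM (ic _ _ _ ws) (ic _ _ _ ws).
  by move=> H' t /H'; congr rcont; apply/funext => u; rewrite -invfM expr2.
have -> : path3 phi c s w = cint 0 (2 * pi) (fun t => phi t * (2 / (circ c s t - w) ^+ 3)).
  by apply: eq_cint => t _; ring.
apply: (@cint_cderiv phi (fun t w => ((circ c s t - w) ^+ 2)^-1)
    (fun t w => 2 / (circ c s t - w) ^+ 3) w M (B * B * B * (B + 2 * B))) => //.
  exists d => // h hd; have [wh Bh] := H h hd; split.
    have := path_contM (ic _ _ _ wh) (ic _ _ _ wh).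
    by move=> H' t /H'; congr rcont; apply/funext => u; rewrite -invfM expr2.
  move=> t _; have z1 := circ_neq t ws; have z2 := circ_neq t wh.
  have -> : (circ c s t - (w + h)) ^- 2 - (circ c s t - w) ^- 2 - 2 / (circ c s t - w) ^+ 3 * h =
      (circ c s t - w)^-1 * (circ c s t - w)^-1 * (circ c s t - (w + h))^-1 *
      ((circ c s t - (w + h))^-1 + 2 * (circ c s t - w)^-1) * h ^+ 2.
    by field; rewrite z1 z2.
  rewrite (cabsM _ (h ^+ 2)) (cabsX h) ler_wpM2r ?sqr_ge0// !cabsM.
  rewrite ler_pM ?mulr_ge0 ?cabs_ge0//.
    by rewrite ler_pM ?mulr_ge0 ?cabs_ge0// ler_pM ?cabs_ge0.
  apply: le_trans (cabsD _ _) _; rewrite lerD// cabsM.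
  rewrite ler_pM ?cabs_ge0//.
  by apply: le_trans (cabsD 1 1) _; rewrite cabs1.
have := path_contM (ic _ _ _ ws) (path_contM (ic _ _ _ ws) (ic _ _ _ ws)).
move=> H' t /H'/(rcontZ 2); congr rcont; apply/funext => u.
by rewrite -!invfM !exprS expr0 mulr1.
Qed.

Lemma cauchy_transform_le phi c s w (M : R) : cabs (w - c) < expR s ->
  path_cont 0 (2 * pi) phi -> (forall t, 0 <= t <= 2 * pi -> cabs (phi t) <= M) ->
  cabs (cauchy_transform phi c s w) <= M / (expR s - cabs (w - c)) * (2 * pi).
Proof.
move=> ws phic phiM; rewrite -[X in _ * X]subr0.
apply: cint_le; first exact: pi2_ge0.
  by apply: path_contM => //; exact: path_cont_kernel.
move=> t tt; rewrite cabsM cabsV ler_pM ?invr_ge0 ?cabs_ge0// ?phiM//.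
by rewrite lef_pV2 ?posrE ?cabs_gt0 ?circ_neq ?subr_gt0// circ_dist.
Qed.

Lemma cauchy_transform_shift phi c s w (M : R) : cabs (w - c) < expR s ->
  path_cont 0 (2 * pi) phi ->
  cauchy_transform phi c s w = cauchy_transform phi c s c +
    (w - c) * cauchy_transform (fun t => phi t / (circ c s t - c)) c s w.
Proof.
move=> ws phic.
have cs : cabs (c - c) < expR s by rewrite subrr cabs0 expR_gt0.
have ic := path_cont_kernel.
have c1 := path_contM phic (ic _ _ _ cs).
rewrite /cauchy_transform -cintZ; last exact: path_contM c1 (ic _ _ _ ws).
rewrite -cintD//; last by move=> t /(path_contM c1 (ic _ _ _ ws)); exact: rcontZ.
apply: eq_cint => t _; have z1 := circ_neq t ws; have z2 := circ_neq t cs.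
by field; rewrite z1 z2.
Qed.

End CauchyTransform.

(** * Holomorphy of derivatives and Taylor expansion *)

Section Regularity.
Variable R : realType.
Implicit Types (F : R[i] -> R[i]) (c w z h : R[i]).

Lemma pi2C_neq0 : (2 * pi)%:C != 0 :> R[i].
Proof. by rewrite (inj_eq (@complexI R)) gt_eqF// mulr_gt0// pi_gt0. Qed.

Lemma cauchy_transform_eq F c w (r s : R) :
  (forall z, cabs (z - c) < r -> exists a, cderiv F z a) ->
  expR s < r -> cabs (w - c) < expR s ->
  F w = (2 * pi)%:C^-1 * cauchy_transform (fun t => F (circ c s t) * (circ c s t - c)) c s w.
Proof.
move=> Fd sr ws; rewrite -[LHS](mulfK pi2C_neq0) mulrC; congr (_ * _).
exact/esym/(cauchy_formula Fd sr ws).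
Qed.

Lemma path_cont_bounded (phi : R -> R[i]) a b : a <= b -> path_cont a b phi ->
  exists M : R, forall t, a <= t <= b -> cabs (phi t) <= M.
Proof.
move=> ab pc.
(* Compactness by bisection: in [rectangle_ind] the horizontal side is [0], so only the parameter
   interval is divided. *)
pose P (x y t : R) := exists M : R, forall u, a <= u <= b -> y <= u <= y + t * (b - a) -> cabs (phi u) <= M.
have [M HM] : P 0 a 1.
  apply: (@rectangle_ind R P 0 (b - a)) => //; first by rewrite subr_ge0.
    move=> x y t t0 [M1 H1] _ [M2 H2] _; exists (Num.max M1 M2) => u uab /andP[u1 u2].
    rewrite le_max; have [u3|u3] := leP u (y + t / 2 * (b - a)).
      by rewrite H1// u1.
    by rewrite H2 ?orbT// (ltW u3)/=; move: u2; congr (_ <= _); field.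
  move=> p q _ /andP[q1 q2].
  have qab : a <= q <= b by rewrite q1/=; lra.
  have [d d0 H] := pc q qab 1 ltr01.
  exists (d / (1 + (b - a))); first by rewrite divr_gt0//; lra.
  move=> x y t /andP[t0 td] _ _ _ _ _ /andP[q3 q4].
  rewrite ltr_pdivlMr in td; last lra.
  exists (1 + cabs (phi q)) => u _ /andP[u1 u2].
  have := H u; have := cabs_leB (phi u) (phi q) => A /(_ _)/wrap[]; last lra.
  by rewrite ltr_norml; apply/andP; split; nra.
by exists M => t /[dup] tab /andP[t1 t2]; apply: HM => //; rewrite t1/=; lra.
Qed.

(** Near each point Cauchy's formula makes [F] a Cauchy transform, which can be differentiated
    twice; uniqueness of the derivative identifies [F'] with the first of the two derivatives. *)
Lemma holo_deriv U F F' : copen U -> holo U F F' -> exists F'', holo U F' F''.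
Proof.
move=> oU hF.
suff H z : exists a, U z -> cderiv F' z a.
  have [f Hf] := choice H; exists f => z; exact: Hf.
have [Uz|nUz] := pselect (U z); last by exists 0.
have [r r0 rU] := oU z Uz.
have Fd w : cabs (w - z) < r -> exists a, cderiv F w a by move=> /rU/hF ?; exists (F' w).
pose s := ln (r / 2).
have sE : expR s = r / 2 by rewrite lnK// posrE divr_gt0.
have sr : expR s < r by rewrite sE; lra.
pose phi t := F (circ z s t) * (circ z s t - z).
have phic : path_cont 0 (2 * pi) phi.
  apply: (@circ_path _ (fun w => F w * (w - z))) => w ws; apply: ccontM; last exact: ccont_sub.
  by have [|a] := Fd w; [rewrite ws|exact: cderiv_cont].
have [M HM] := path_cont_bounded (@pi2_ge0 R) phic.
have FE w : cabs (w - z) < expR s -> F w = (2 * pi)%:C^-1 * cauchy_transform phi z s w.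
  by move=> ws; exact: (cauchy_transform_eq Fd sr ws).
have F'E w : cabs (w - z) < expR s -> F' w = (2 * pi)%:C^-1 * path2 phi z s w.
  move=> ws; apply: (@cderiv_uniq _ F w); first by apply/hF/rU/(lt_trans ws).
  apply: (@cderiv_eq _ (fun w => (2 * pi)%:C^-1 * cauchy_transform phi z s w)).
    exists (expR s - cabs (w - z)); first by rewrite subr_gt0.
    by move=> v vw; rewrite FE//; apply: le_lt_trans (cabs_distD _ _ w) _; lra.
  by apply: cderivZ; have [] := cauchy_transform_deriv ws phic HM.
exists ((2 * pi)%:C^-1 * path3 phi z s z) => _.
apply: (@cderiv_eq _ (fun w => (2 * pi)%:C^-1 * path2 phi z s w)).
  by exists (expR s); rewrite ?expR_gt0// => v vw; rewrite F'E.
have zs : cabs (z - z) < expR s by rewrite subrr cabs0 expR_gt0.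
by apply: cderivZ; have [] := cauchy_transform_deriv zs phic HM.
Qed.

(* Taylor expansion with the remainders [G n], obtained by iterating
   [1/(ζ-z) = 1/(ζ-c) + (z-c)/((ζ-c)(ζ-z))] in Cauchy's formula. *)
Lemma taylor F c (r rho M : R) :
  (forall z, cabs (z - c) < r -> exists a, cderiv F z a) -> 0 < rho -> rho < r ->
  (forall z, cabs (z - c) = rho -> cabs (F z) <= M) ->
  exists G : nat -> R[i] -> R[i],
    [/\ forall z, cabs (z - c) < rho -> G 0%N z = F z,
      forall n z, cabs (z - c) < rho -> G n z = G n c + (z - c) * G n.+1 z,
      forall n z, cabs (z - c) < rho -> cabs (G n z) <= M * rho / rho ^+ n / (rho - cabs (z - c)) &
      forall n, exists G', holo (cball c rho) (G n) G'].
Proof.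
move=> Fd rho0 rhor FM.
pose s := ln rho.
have sE : expR s = rho by rewrite lnK.
pose phi n t := F (circ c s t) * (circ c s t - c) / (circ c s t - c) ^+ n.
have cs : cabs (c - c) < expR s by rewrite subrr cabs0 expR_gt0.
have phic n : path_cont 0 (2 * pi) (phi n).
  apply: (@circ_path _ (fun w => F w * (w - c) / (w - c) ^+ n)) => w ws; apply: ccontM.
    apply: ccontM; last exact: ccont_sub.
    by have [|a] := Fd w; [rewrite ws sE|exact: cderiv_cont].
  have wc0 : w - c != 0 by rewrite -cabs_gt0 ws expR_gt0.
  apply: ccont_inv; last by rewrite expf_neq0.
  elim: n => [|n IH]; first exact: ccont_cst.
  have -> : (fun w => (w - c) ^+ n.+1) = (fun w => (w - c) * (w - c) ^+ n).
    by apply/funext => v; rewrite exprS.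
  by apply: ccontM => //; exact: ccont_sub.
have phiM n t : 0 <= t <= 2 * pi -> cabs (phi n t) <= M * rho / rho ^+ n.
  move=> _; rewrite /phi !cabsM cabsV cabsX !cabs_circ sE.
  apply: ler_wpM2r; first by rewrite invr_ge0 exprn_ge0// ltW.
  by apply: ler_wpM2r; [exact: ltW|apply: FM; rewrite cabs_circ].
exists (fun n z => (2 * pi)%:C^-1 * cauchy_transform (phi n) c s z); split.
- move=> z zs; rewrite (@cauchy_transform_eq F c z r s) ?sE//; congr (_ * _).
  by apply: eq_cint => t _; rewrite /phi expr0 divr1.
- move=> n z zs; rewrite (@cauchy_transform_shift _ (phi n) c s z)// ?sE// mulrDr; congr (_ + _).
  rewrite mulrCA; congr (_ * (_ * _)); apply: eq_cint => t _.
  by rewrite /phi exprSr invfM mulrA.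
- move=> n z zs; rewrite cabsM cabsV cabs_real ger0_norm ?pi2_ge0//.
  have pi0 : 0 < 2 * pi :> R by rewrite mulr_gt0// pi_gt0.
  rewrite mulrC ler_pdivrMr//.
  have := @cauchy_transform_le _ (phi n) c s z (M * rho / rho ^+ n).
  by rewrite sE; apply=> //; exact: phiM.
- move=> n; exists (fun z => (2 * pi)%:C^-1 * path2 (phi n) c s z) => z zs.
  have zs' : cabs (z - c) < expR s by rewrite sE.
  by apply: cderivZ; have [] := cauchy_transform_deriv zs' (phic n) (phiM n).
Qed.

(* The mean value property bounds the value at the centre of a disc. *)
Lemma max_modulus F c (r rho M : R) :
  (forall z, cabs (z - c) < r -> exists a, cderiv F z a) -> 0 < rho -> rho < r ->
  (forall t, 0 <= t <= 2 * pi -> cabs (F (circ c (ln rho) t)) <= M) -> cabs (F c) <= M.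
Proof.
move=> Fd rho0 rhor FM.
have sE : expR (ln rho) = rho by rewrite lnK.
have pi0 : 0 < 2 * pi :> R by rewrite mulr_gt0// pi_gt0.
rewrite -(ler_pM2r pi0).
have -> : cabs (F c) * (2 * pi) = cabs (circ_int F c (ln rho)).
  by rewrite (mean_value Fd) ?sE// cabsM cabs_real ger0_norm// ltW.
rewrite -[X in _ * X]subr0; apply: cint_le => //; first exact: ltW.
by apply: circ_path => z; rewrite sE => zs; have [|a] := Fd z; [rewrite zs|exact: cderiv_cont].
Qed.

End Regularity.

(** * Injective holomorphic functions *)

Section InjectiveHolomorphic.
Variable R : realType.
Implicit Types (F f : R[i] -> R[i]) (c w z h v : R[i]) (U : set R[i]).

(** The bound with slope [B |v| + e] is additive over adjacent intervals, and differentiability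
    gives it on short intervals about any point. Bisection concludes, and [e] is arbitrary. *)
Lemma segment_le F z v (B : R) :
  (forall t : R, 0 <= t <= 1 -> exists2 a, cderiv F (z + t%:C * v) a & cabs a <= B) ->
  cabs (F (z + v) - F z) <= B * cabs v.
Proof.
move=> H; apply/ler_addgt0Pl => e e0.
have B0 : 0 <= B.
  have [|a _] := H 0; first by rewrite lexx ler01.
  by apply: le_trans; exact: cabs_ge0.
pose P (x y t : R) := 0 <= y -> y + t <= 1 ->
  cabs (F (z + (y + t)%:C * v) - F (z + y%:C * v)) <= (B * cabs v + e) * t.
suff : P 0 0 1.
  move=> /(_ (lexx _)); rewrite !add0r lexx => /(_ isT).
  by rewrite mul1r mul0r addr0 mulr1 (addrC e).
apply: (@rectangle_ind R P 0 1) => //.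
  move=> x y t t0 P1 _ P2 _ y0 yt1.
  apply: le_trans (cabs_distD _ _ (F (z + (y + t / 2)%:C * v))) _.
  have -> : (B * cabs v + e) * t = (B * cabs v + e) * (t / 2) + (B * cabs v + e) * (t / 2) by field.
  apply: lerD.
    rewrite (_ : y + t = y + t / 2 * 1 + t / 2); last by field.
    by rewrite -[in X in _ - X](mulr1 (t / 2)); apply: P2; lra.
  by apply: P1; lra.
move=> p q _; rewrite mul1r add0r => q01.
have [a Fa aB] := H q q01.
have v0 := cabs_ge0 v.
have k0 : 0 < e / (1 + cabs v) by rewrite divr_gt0// ltr_pwDl.
have [d d0 D] := Fa _ k0.
exists (d / (1 + cabs v)); first by rewrite divr_gt0// ltr_pwDl.
move=> x y t /andP[t0 td] _ _ _ _ _ /andP[q1 q2] y0 yt1.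
rewrite ltr_pdivlMr ?ltr_pwDl// in td.
rewrite mulr1 in q2.
have bound u : `|u - q| <= t -> cabs (F (z + u%:C * v) - F (z + q%:C * v) - a * ((u - q)%:C * v))
     <= e * `|u - q|.
  move=> uq; have := D ((u - q)%:C * v).
  have -> : z + q%:C * v + (u - q)%:C * v = z + u%:C * v by rewrite rmorphB/=; ring.
  rewrite cabsM cabs_real => /(_ _)/wrap[].
    apply: le_lt_trans td; rewrite mulrDr mulr1.
    by apply: le_trans (ler_wpM2r v0 uq) _; rewrite lerDr ltW.
  move/le_trans; apply; rewrite mulrCA mulrC ler_wpM2r//.
  by rewrite mulrAC ler_pdivrMr ?ltr_pwDl// ler_wpM2l ?(ltW e0)//; lra.
have -> : F (z + (y + t)%:C * v) - F (z + y%:C * v) =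
  (F (z + (y + t)%:C * v) - F (z + q%:C * v) - a * ((y + t - q)%:C * v)) -
  (F (z + y%:C * v) - F (z + q%:C * v) - a * ((y - q)%:C * v)) + a * (t%:C * v).
  by rewrite !rmorphB !rmorphD/=; ring.
apply: le_trans (cabsD _ _) _; apply: le_trans (lerD (cabsD _ _) (lexx _)) _.
rewrite cabsN !cabsM cabs_real (gtr0_norm t0).
have b1 := bound (y + t); have b2 := bound y.
have n1 : `|y + t - q| = y + t - q by rewrite ger0_norm//; lra.
have n2 : `|y - q| = q - y by rewrite ler0_norm; lra.
rewrite n1 in b1; rewrite n2 in b2.
have b1' := b1 (ltac:(lra)); have b2' := b2 (ltac:(lra)).
have : cabs a * (t * cabs v) <= B * (t * cabs v) by rewrite ler_wpM2r// mulr_ge0// ltW.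
lra.
Qed.

Lemma cball_bounded F c (rho : R) : 0 <= rho ->
  (forall z, cabs (z - c) <= rho -> ccont F z) ->
  exists2 M : R, 0 < M & forall z, cabs (z - c) <= rho -> cabs (F z) <= M.
Proof.
move=> rho0 Fc.
pose P (x y t : R) := exists2 M : R, 0 < M & forall z, cabs (z - c) <= rho ->
   x <= Re z <= x + t * (2 * rho) -> y <= Im z <= y + t * (2 * rho) -> cabs (F z) <= M.
have [M M0 HM] : P (Re c - rho) (Im c - rho) 1.
  apply: (@rectangle_ind R P (2 * rho) (2 * rho)) => //; [lra|lra| |].
    move=> x y t t0 [M1 M10 H1] [M2 _ H2] [M3 _ H3] [M4 _ H4].
    exists (Num.max (Num.max M1 M2) (Num.max M3 M4)).
      by rewrite !lt_max M10.
    move=> z zr /andP[x1 x2] /andP[y1 y2]; rewrite !le_max.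
    have Ex : x + t * (2 * rho) = x + t / 2 * (2 * rho) + t / 2 * (2 * rho) by field.
    have Ey : y + t * (2 * rho) = y + t / 2 * (2 * rho) + t / 2 * (2 * rho) by field.
    rewrite Ex in x2; rewrite Ey in y2.
    have [x3|/ltW x3] := leP (Re z) (x + t / 2 * (2 * rho)); have [y3|/ltW y3] := leP (Im z) (y + t / 2 * (2 * rho)).
    - by rewrite H1// ?x1 ?y1.
    - by rewrite (H3 z)// ?x1 ?y3 ?orbT.
    - by rewrite (H2 z)// ?x3 ?y1 ?orbT.
    - by rewrite (H4 z)// ?x3 ?y3 ?orbT.
  move=> p q _ _.
  have [pq|pq] := leP (cabs (p +i* q - c)) rho.
    have [d d0 H] := Fc _ pq 1 ltr01.
    exists (d / (1 + 4 * rho)); first by rewrite divr_gt0//; lra.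
    move=> x y t /andP[t0 td] _ _ _ _ /andP[p1 p2] /andP[q1 q2].
    rewrite ltr_pdivlMr in td; last lra.
    exists (1 + cabs (F (p +i* q))); first by rewrite ltr_pwDl ?cabs_ge0.
    move=> z _ /andP[x1 x2] /andP[y1 y2].
    have := H z; have := cabs_leB (F z) (F (p +i* q)) => A /(_ _)/wrap[]; last lra.
    apply: le_lt_trans (cabs_leD _) _; rewrite !ReImE/=.
    have : `|Re z - p| <= t * (2 * rho) by rewrite ler_norml; apply/andP; split; lra.
    have : `|Im z - q| <= t * (2 * rho) by rewrite ler_norml; apply/andP; split; lra.
    lra.
  (* Around a point outside the closed disc, small squares miss the disc, and the bound is vacuous
     on them. *)
  exists ((cabs (p +i* q - c) - rho) / (1 + 4 * rho)).
    by rewrite divr_gt0//; lra.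
  move=> x y t /andP[t0 td] _ _ _ _ /andP[p1 p2] /andP[q1 q2].
  rewrite ltr_pdivlMr in td; last lra.
  exists 1 => // z zr /andP[x1 x2] /andP[y1 y2]; exfalso.
  have := cabs_distD (p +i* q) c z.
  have := cabs_leD (p +i* q - z); rewrite !ReImE/=.
  have : `|p - Re z| <= t * (2 * rho) by rewrite ler_norml; apply/andP; split; lra.
  have : `|q - Im z| <= t * (2 * rho) by rewrite ler_norml; apply/andP; split; lra.
  lra.
exists M => // z zr; apply: HM => //.
  have := le_trans (Re_le_cabs (z - c)) zr; rewrite !ReImE ler_norml => /andP[? ?].
  by apply/andP; split; lra.
have := le_trans (Im_le_cabs (z - c)) zr; rewrite !ReImE ler_norml => /andP[? ?].
by apply/andP; split; lra.
Qed.

(** Compactness of the circle, in the form of boundedness of [1 / F]. *)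
Lemma circ_away F c (rho : R) : 0 < rho ->
  (forall z, cabs (z - c) = rho -> ccont F z /\ F z != 0) ->
  exists2 m : R, 0 < m & forall t, 0 <= t <= 2 * pi -> m <= cabs (F (circ c (ln rho) t)).
Proof.
move=> rho0 H.
have E t : cabs (circ c (ln rho) t - c) = rho by rewrite cabs_circ lnK.
have [|M HM] := @path_cont_bounded R (fun t => (F (circ c (ln rho) t))^-1) _ _ (@pi2_ge0 R).
  apply: (@circ_path _ (fun z => (F z)^-1)) => z; rewrite lnK// => /H[Fc F0].
  exact: ccont_inv.
have M0 : 0 < M.
  apply: lt_le_trans (HM 0 _); last by rewrite lexx pi2_ge0.
  by rewrite cabs_gt0 invr_eq0; have [] := H _ (E 0).
exists M^-1; first by rewrite invr_gt0.
move=> t /HM; rewrite cabsV => MV.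
have F0 : 0 < cabs (F (circ c (ln rho) t)) by rewrite cabs_gt0; have [] := H _ (E t).
by rewrite -[leRHS]invrK lef_pV2// posrE ?invr_gt0.
Qed.

Lemma cderivB F w z a : cderiv F z a -> cderiv (fun v => F v - w) z a.
Proof. by move=> Fa; rewrite -(addr0 a); apply: cderivD => //; exact: cderiv_cst. Qed.

(** If [w] were omitted, [1 / (f - w)] would be holomorphic; on the circle it is at most [2 / m],
    while at the centre it exceeds [2 / m], against [max_modulus]. *)
Lemma open_mapping f c (r : R) : 0 < r ->
  (forall z, cabs (z - c) < r -> exists a, cderiv f z a) ->
  (forall z, cabs (z - c) < r -> f z = f c -> z = c) ->
  exists2 d : R, 0 < d & forall w, cabs (w - f c) < d -> exists2 z, cabs (z - c) < r & f z = w.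
Proof.
move=> r0 fd finj.
have r2 : 0 < r / 2 by lra.
have [|m m0 Hm] := @circ_away (fun z => f z - f c) c (r / 2) r2.
  move=> z zr; have zr' : cabs (z - c) < r by rewrite zr; lra.
  split; first by have [a /cderivB fa] := fd z zr'; exact: cderiv_cont (fa _).
  rewrite subr_eq0; apply/eqP => /(finj _ zr') zc.
  by move: zr; rewrite zc subrr cabs0; lra.
exists (m / 2); first by lra.
move=> w wm; apply: contrapT => nz.
have fw z : cabs (z - c) < r -> f z - w != 0.
  by move=> zr; rewrite subr_eq0; apply/eqP => fzw; apply: nz; exists z.
have rr : r / 2 < r by lra.
have := @max_modulus R (fun z => (f z - w)^-1) c r (r / 2) (2 / m) _ r2 rr => /(_ _ _)/wrap[].
- move=> z zr; have [a fa] := fd z zr.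
  exists (- (f z - w) ^- 2 * a); apply: (@cderiv_comp _ (fun z => f z - w) (fun z => z^-1)).
    exact: cderivB.
  exact: cderiv_inv (fw z zr).
- move=> t tt; have := Hm t tt.
  have := cabs_distD (f (circ c (ln (r / 2)) t)) (f c) w => A B.
  by rewrite cabsV ler_pdivlMr// mulrC ler_pdivrMr; lra.
have fc0 : 0 < cabs (f c - w) by rewrite cabs_gt0 fw// subrr cabs0.
by move: fc0; rewrite cabsV (cabsB (f c)) => fc0; rewrite ler_pdivlMr// mulrC ler_pdivrMr//; lra.
Qed.

Lemma taylor_holo F c (r rho M : R) :
  (forall z, cabs (z - c) < r -> exists a, cderiv F z a) -> 0 < rho -> rho < r ->
  (forall z, cabs (z - c) = rho -> cabs (F z) <= M) ->
  (forall a, cderiv F c a -> forall h, cabs h <= rho / 2 ->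
    cabs (F (c + h) - F c - a * h) <= (2 * M / rho ^+ 2) * cabs h ^+ 2).
Proof.
move=> Fd rho0 rhor FM a Fa h hr.
have [G [G0 GS GB GD]] := taylor Fd rho0 rhor FM.
have cc : cabs (c - c) < rho by rewrite subrr cabs0.
have hE z : cabs (z - c) < rho -> F z = F c + (z - c) * G 1%N c + (z - c) ^+ 2 * G 2%N z.
  move=> zr; rewrite -!G0// (GS 0%N z zr) (GS 1%N z zr); ring.
have aE : a = G 1%N c.
  have [G1 hG1] := GD 1%N.
  apply: (@cderiv_uniq _ F c) => //.
  apply: (@cderiv_eq _ (fun z => F c + (z - c) * G 1%N z)).
    exists rho => // w wr; rewrite -(G0 w wr) (GS 0%N w wr) G0//.
  have := cderivD (cderiv_cst (F c) c) (cderivM (cderivB c (cderiv_id c)) (hG1 c cc)).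
  by rewrite add0r mul1r subrr mul0r addr0.
have hr' : cabs (c + h - c) < rho by rewrite addrC addKr; lra.
rewrite (hE _ hr') aE.
have E : c + h - c = h by ring.
rewrite E; have -> : F c + h * G 1%N c + h ^+ 2 * G 2%N (c + h) - F c - G 1%N c * h = h ^+ 2 * G 2%N (c + h) by ring.
rewrite cabsM cabsX mulrC ler_wpM2r ?sqr_ge0//.
apply: le_trans (GB 2%N _ hr') _; rewrite E.
have h0 := cabs_ge0 h.
have M0 : 0 <= M.
  apply: le_trans (cabs_ge0 (F (c + rho%:C))) (FM _ _).
  by rewrite addrC addKr cabs_real gtr0_norm.
rewrite ler_pdivrMr; last lra.
have -> : M * rho / rho ^+ 2 = M / rho ^+ 2 * rho by ring.
have -> : 2 * M / rho ^+ 2 * (rho - cabs h) = M / rho ^+ 2 * (2 * (rho - cabs h)) by ring.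
by rewrite ler_wpM2l ?divr_ge0 ?sqr_ge0//; lra.
Qed.

(* The geometric bound on the remainders makes the function vanish when all
   Taylor coefficients do. *)
Lemma taylor_dichotomy F c (r : R) : 0 < r ->
  (forall z, cabs (z - c) < r -> exists a, cderiv F z a) ->
  (forall z, cabs (z - c) < r -> F z = 0) \/
  exists n G, [/\ ccont G c, G c != 0 &
    exists2 d : R, 0 < d & forall z, cabs (z - c) < d -> F z = (z - c) ^+ n * G z].
Proof.
move=> r0 Fd.
have tay rho : 0 < rho -> rho < r -> exists2 M, 0 < M & exists G : nat -> R[i] -> R[i],
    [/\ forall z, cabs (z - c) < rho -> G 0%N z = F z,
      forall n z, cabs (z - c) < rho -> G n z = G n c + (z - c) * G n.+1 z,
      forall n z, cabs (z - c) < rho -> cabs (G n z) <= M * rho / rho ^+ n / (rho - cabs (z - c)) &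
      forall n, exists G', holo (cball c rho) (G n) G'].
  move=> rho0 rhor.
  have [|M M0 HM] := @cball_bounded F c rho (ltW rho0).
    by move=> z zr; have [|a] := Fd z; [exact: le_lt_trans rhor|exact: cderiv_cont].
  exists M => //; apply: (taylor Fd) => // z zr; apply: HM; by rewrite zr.
have expand (G : nat -> R[i] -> R[i]) (rho : R) n :
    (forall n z, cabs (z - c) < rho -> G n z = G n c + (z - c) * G n.+1 z) ->
    (forall m, (m < n)%N -> G m c = 0) -> forall z, cabs (z - c) < rho ->
    G 0%N z = (z - c) ^+ n * G n z.
  move=> GS; elim: n => [|n IH] Gm z zr; first by rewrite expr0 mul1r.
  rewrite IH//; last by move=> m mn; apply: Gm; exact: ltnW.
  by rewrite GS// Gm// add0r exprSr mulrA.
have [|nex] := pselect (exists n G, [/\ ccont G c, G c != 0 &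
    exists2 d : R, 0 < d & forall z, cabs (z - c) < d -> F z = (z - c) ^+ n * G z]); first by right.
left=> z zr.
pose rho := (cabs (z - c) + r) / 2.
have z0 := cabs_ge0 (z - c).
have rho0 : 0 < rho by rewrite /rho; lra.
have rhor : rho < r by rewrite /rho; lra.
have zrho : cabs (z - c) < rho by rewrite /rho; lra.
have [M M0 [G [G0 GS GB GD]]] := tay rho rho0 rhor.
have Gc0 n : G n c = 0.
  elim/ltn_ind: n => n IH; apply: contrapT => /eqP Gn0; apply: nex.
  exists n, (G n); split => //.
    have [G' hG'] := GD n; apply: cderiv_cont (hG' c _).
    by rewrite /cball/= subrr cabs0.
  exists rho => // v vr; rewrite -G0//; exact: (expand G rho).
apply/eqP; rewrite -cabs0_eq0 eq_le cabs_ge0 andbT.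
have bnd n : cabs (F z) <= (cabs (z - c) / rho) ^+ n * (M * rho / (rho - cabs (z - c))).
  rewrite -G0// (expand G rho n)//; rewrite cabsM cabsX.
  apply: le_trans (ler_wpM2l _ (GB n z zrho)) _; first exact: exprn_ge0.
  rewrite (expr_div_n (cabs (z - c)) rho).
  by rewrite le_eqVlt; apply/orP; left; apply/eqP; ring.
set q := cabs (z - c) / rho in bnd; set K := M * rho / _ in bnd.
have q1 : `|q| < 1.
  have q0 : 0 <= q by rewrite divr_ge0// ltW.
  by rewrite (ger0_norm q0) ltr_pdivrMr// mul1r.
apply/ler_addgt0Pl => e e0; rewrite addr0.
have K0 : 0 < K by rewrite divr_gt0 ?mulr_gt0//; lra.
have /cvgrPdist_lt/(_ (e / K) (divr_gt0 e0 K0)) [N _ HN] := cvg_expr q1.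
have := HN N (leqnn N); rewrite sub0r normrN => /ltW qe.
apply: le_trans (bnd N) _; apply: le_trans (ler_wpM2r (ltW K0) (ler_norm _)) _.
by rewrite -ler_pdivlMr.
Qed.

(* Hurwitz: were [f' c = 0], the nonvanishing quotients [(f (z + h) - f z) / h]
   would violate the maximum principle for their inverses as [h] tends to 0. *)
Lemma injective_deriv_neq0 U f f' c : copen U -> holo U f f' -> set_inj U f -> U c -> f' c != 0.
Proof.
move=> oU hf finj Uc; apply/negP => /eqP f'c.
have [f'' hf'] := holo_deriv oU hf.
have [r r0 rU] := oU c Uc.
have fd z : cabs (z - c) < r -> exists a, cderiv f z a by move=> /rU/hf ?; exists (f' z).
have f'd z : cabs (z - c) < r -> exists a, cderiv f' z a by move=> /rU/hf' ?; exists (f'' z).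
(* If [f'] vanishes on the whole disc, [f] is constant there and not injective; otherwise the zero
   of [f'] at [c] is isolated. *)
have [f'0|[n [G [Gc G0 [d d0 f'E]]]]] := taylor_dichotomy r0 f'd.
  have r2 : cabs ((r / 2)%:C : R[i]) = r / 2 by rewrite cabs_real gtr0_norm//; lra.
  have : cabs (f (c + (r / 2)%:C) - f c) <= 0 * cabs ((r / 2)%:C : R[i]).
    apply: segment_le => t /andP[t0 t1].
    have tr : cabs (c + t%:C * (r / 2)%:C - c) < r.
      by rewrite addrC addKr cabsM r2 cabs_real ger0_norm//; nra.
    exists (f' (c + t%:C * (r / 2)%:C)); first exact/hf/rU.
    by rewrite f'0// cabs0.
  rewrite mul0r => le0.
  have : cabs (f (c + (r / 2)%:C) - f c) == 0 by rewrite eq_le le0 cabs_ge0.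
  have Ucr : U (c + (r / 2)%:C) by apply: rU; rewrite addrC addKr r2; lra.
  rewrite cabs0_eq0 subr_eq0 => /eqP/finj.
  rewrite !inE => /(_ Ucr Uc)/(congr1 (fun x => x - c)).
  rewrite addrC addKr subrr => /(congr1 (@cabs R)); rewrite r2 cabs0; lra.
have Gc0 : 0 < cabs (G c) by rewrite cabs_gt0.
have [d1 d10 Gn0] := Gc _ Gc0.
(* Small enough for the factorization of [f'] to hold and for [G] to have no zero, so that [f'] does
   not vanish on the circle of radius [rho]. *)
pose rho := Num.min r (Num.min d d1) / 2.
have min0 : 0 < Num.min r (Num.min d d1) by rewrite !lt_min r0 d0.
have rho0 : 0 < rho by rewrite divr_gt0.
have [rhor [rhod rhod1]] : 2 * rho <= r /\ 2 * rho <= d /\ 2 * rho <= d1.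
  have -> : 2 * rho = Num.min r (Num.min d d1) by rewrite /rho; field.
  by rewrite !ge_min !lexx !orbT.
have [|m m0 Hm] := @circ_away f' c rho rho0.
  move=> z zr; split.
    by have [|a] := f'd z; [rewrite zr; lra|exact: cderiv_cont].
  rewrite f'E; last by rewrite zr; lra.
  rewrite mulf_neq0//.
    by rewrite expf_neq0// -cabs_gt0 zr.
  have := Gn0 z; rewrite zr => /(_ _)/wrap[|H]; first lra.
  by apply: contraTneq H => ->; rewrite sub0r cabsN ltxx.
have [||M M0 HM] := @cball_bounded f c (3 / 2 * rho).
- by lra.
- by move=> z zr; have [|a] := fd z; [lra|exact: cderiv_cont].
pose K := 2 * M / (rho / 4) ^+ 2.
have K0 : 0 < K by rewrite divr_gt0 ?mulr_gt0 ?exprn_gt0//; lra.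
have quad z h : cabs (z - c) <= rho -> cabs h <= rho / 8 ->
    cabs (f (z + h) - f z - f' z * h) <= K * cabs h ^+ 2.
  move=> zr hr; have zz : forall v, cabs (v - z) < rho / 2 -> cabs (v - c) < 3 / 2 * rho.
    move=> v vz; apply: le_lt_trans (cabs_distD _ _ z) _; lra.
  apply: (@taylor_holo f z (rho / 2) (rho / 4) M) => //.
  - by move=> v /zz vr; apply: fd; lra.
  - by lra.
  - by lra.
  - by move=> v vr; apply: HM; apply/ltW/zz; rewrite vr; lra.
  - by apply/hf/rU; lra.
  - by lra.
(* The quadratic error [K h0^2] is then at most [m h0 / 8], small against [|f' z h| >= m h0] on the
   circle. *)
pose h0 := Num.min (rho / 8) (m / (8 * K)).
have h00 : 0 < h0 by rewrite lt_min !divr_gt0// mulr_gt0.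
have [h0r h0m] : h0 <= rho / 8 /\ h0 * K <= m / 8.
  split; first by rewrite ge_min lexx.
  have -> : m / 8 = m / (8 * K) * K by field; rewrite gt_eqF.
  by rewrite ler_wpM2r ?(ltW K0)// ge_min lexx orbT.
pose h : R[i] := h0%:C.
have hE : cabs h = h0 by rewrite cabs_real gtr0_norm.
have h_neq0 : h != 0 by rewrite -cabs_gt0 hE.
have hh : cabs h <= rho / 8 by rewrite hE.
have Uz z : cabs (z - c) < 9 / 8 * rho -> U z /\ U (z + h).
  move=> zr; split; apply: rU; first lra.
  rewrite (_ : z + h - c = (z - c) + h); last ring.
  by apply: le_lt_trans (cabsD _ _) _; lra.
have q0 z : cabs (z - c) < 9 / 8 * rho -> f (z + h) - f z != 0.
  move=> /Uz[Uz1 Uz2]; rewrite subr_eq0; apply/eqP => /finj; rewrite !inE => /(_ Uz2 Uz1).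
  by move/(congr1 (fun x => x - z)); rewrite addrC addKr subrr => /eqP; rewrite (negbTE h_neq0).
have rr : rho < 9 / 8 * rho by lra.
have := @max_modulus R (fun z => (f (z + h) - f z)^-1) c (9 / 8 * rho) rho (2 / (m * h0)) _ rho0 rr
   => /(_ _ _)/wrap[].
- move=> z zr; have [/hf Uz1 /hf Uz2] := Uz z zr.
  exists (- (f (z + h) - f z) ^- 2 * (f' (z + h) * (1 + 0) + (-1) * f' z)).
  apply: (@cderiv_comp _ (fun z => f (z + h) - f z) (fun z => z^-1)).
    apply: cderivD.
      apply: (@cderiv_comp _ (fun z => z + h) f) => //.
      by apply: cderivD; [exact: cderiv_id|exact: cderiv_cst].
    rewrite (_ : (fun w => - f w) = (fun w => -1 * f w)); first exact: cderivZ.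
    by apply/funext => w; rewrite mulN1r.
  exact: cderiv_inv (q0 z zr).
- move=> t tt; have ct : cabs (circ c (ln rho) t - c) = rho by rewrite cabs_circ lnK.
  have A := Hm t tt.
  have := quad (circ c (ln rho) t) h; rewrite ct lexx => /(_ isT hh).
  have := cabs_leB (f' (circ c (ln rho) t) * h)
    (- (f (circ c (ln rho) t + h) - f (circ c (ln rho) t) - f' (circ c (ln rho) t) * h)).
  rewrite opprK (addrC _ (_ - _ - _)) subrK cabsN cabsM hE => C D.
  rewrite cabsV ler_pdivlMr ?mulr_gt0// mulrC ler_pdivrMr; last first.
    by rewrite cabs_gt0 q0// ct.
  have : m * h0 <= cabs (f' (circ c (ln rho) t)) * h0 by rewrite ler_wpM2r// ltW.
  have : K * h0 ^+ 2 <= m / 8 * h0 by rewrite expr2 mulrA ler_wpM2r ?(ltW h00)// mulrC.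
  have : 0 < m * h0 by rewrite mulr_gt0.
  lra.
(* At the centre [f' c = 0] leaves [|f (c + h) - f c| <= m h0 / 8], whereas the maximum principle
   just applied yields at least [m h0 / 2]. *)
have cc : cabs (c - c) <= rho by rewrite subrr cabs0 ltW.
have := quad c h cc hh; rewrite f'c mul0r subr0 hE => Q.
rewrite cabsV ler_pdivlMr ?mulr_gt0// mulrC ler_pdivrMr; last first.
  by rewrite cabs_gt0 q0// (le_lt_trans cc).
have : K * h0 ^+ 2 <= m / 8 * h0 by rewrite expr2 mulrA ler_wpM2r ?(ltW h00)// mulrC.
have : 0 < m * h0 by rewrite mulr_gt0.
lra.
Qed.

Lemma image_copen U f f' : copen U -> holo U f f' -> set_inj U f -> copen (f @` U).
Proof.
move=> oU hf finj _ [c Uc <-].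
have [r r0 rU] := oU c Uc.
have [||d d0 H] := @open_mapping f c r r0.
- by move=> z /rU/hf; exists (f' z).
- by move=> z /rU Uz /finj; rewrite !inE; apply.
by exists d => // w /H[z /rU Uz <-]; exists z.
Qed.

(** By the open mapping property every small [h] is attained as [f z - f c] with [z] near [c], so
    the inverse may be estimated at image points. *)
Lemma inverse_holo U f f' g : copen U -> holo U f f' -> set_inj U f ->
  (forall z, U z -> g (f z) = z) -> holo (f @` U) g (fun w => (f' (g w))^-1).
Proof.
move=> oU hf finj gK _ [c Uc <-] e e0; rewrite gK//.
have f'0 : 0 < cabs (f' c) by rewrite cabs_gt0 (injective_deriv_neq0 oU hf finj Uc).
set m := cabs (f' c) in f'0.
(* With [k = z - c], the tolerance [m / 2] gives [(m / 2) |k| <= |h|]; the tolerance [e m^2 / 2]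
   then bounds the error, after division by [m], by [e |h|]. *)
have k0 : 0 < Num.min (m / 2) (e * m * m / 2) by rewrite lt_min !divr_gt0 ?mulr_gt0.
have [d d0 H] := hf c Uc _ k0.
have [r r0 rU] := oU c Uc.
have min0 : 0 < Num.min r d by rewrite lt_min r0.
have [||d1 d10 H1] := @open_mapping f c (Num.min r d) min0.
- by move=> z; rewrite lt_min => /andP[/rU/hf ? _]; exists (f' z).
- by move=> z; rewrite lt_min => /andP[/rU Uz _] /finj; rewrite !inE; apply.
exists d1 => // h hd.
have [|z] := H1 (f c + h); first by rewrite addrC addKr.
rewrite lt_min => /andP[/rU Uz zd] fz.
rewrite -fz gK//.
have hE : h = f z - f c by rewrite fz addrC addKr.
have := H (z - c) zd; rewrite (addrC c) subrK => D.
set k := z - c in zd D *.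
have k_ge0 := cabs_ge0 k.
have D1 : cabs (f z - f c - f' c * k) <= m / 2 * cabs k.
  by apply: le_trans D _; rewrite ler_wpM2r// ge_min lexx.
have D2 : cabs (f z - f c - f' c * k) <= e * m * m / 2 * cabs k.
  by apply: le_trans D _; rewrite ler_wpM2r// ge_min lexx orbT.
have kh : m / 2 * cabs k <= cabs h.
  have := cabs_leB (f' c * k) (- (f z - f c - f' c * k)).
  rewrite opprK (addrC _ (_ - _ - _)) subrK cabsN cabsM -/m -hE; move: D1; rewrite -hE; lra.
have f'n0 : f' c != 0 by rewrite -cabs_gt0.
have -> : k - (f' c)^-1 * h = - (f' c)^-1 * (f z - f c - f' c * k).
  by rewrite hE; field.
rewrite cabsM cabsN cabsV -/m mulrC ler_pdivrMr//.
apply: le_trans D2 _.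
have -> : e * m * m / 2 * cabs k = (e * m) * (m / 2 * cabs k) by ring.
have -> : e * cabs h * m = (e * m) * cabs h by ring.
by rewrite ler_wpM2l// mulr_ge0// ltW.
Qed.

End InjectiveHolomorphic.

(** * Smooth functions of two real variables *)

Section Differentiability.
Variable R : realType.
Implicit Types (x y : R * R) (phi psi : R * R -> R) (U V : set (R * R)).

(** Total differentiability with gradient [(a, b)]. Unlike the existence of partial derivatives it
    is stable under composition. *)
Definition rdiff phi x (a b : R) : Prop := forall e : R, 0 < e ->
  exists2 d : R, 0 < d & forall h k : R, `|h| < d -> `|k| < d ->
    `|phi (x.1 + h, x.2 + k) - phi x - (a * h + b * k)| <= e * (`|h| + `|k|).

Lemma nbhs2P x (P : set (R * R)) : nbhs x P <->
  exists2 d : R, 0 < d & forall h k : R, `|h| < d -> `|k| < d -> P (x.1 + h, x.2 + k).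
Proof.
split.
  move=> /nbhs_ballP[d /= d0 H]; exists d => // h k hd kd; apply: H.
  by split; rewrite /ball /= opprD addrA subrr sub0r normrN.
move=> [d d0 H]; apply/nbhs_ballP; exists d => //= -[u v] [/= ud vd].
have := H (u - x.1) (v - x.2); rewrite !(addrC _ (_ - _)) !subrK; apply.
  by rewrite distrC.
by rewrite distrC.
Qed.

Lemma open2P U : open U <-> forall x, U x ->
  exists2 d : R, 0 < d & forall h k : R, `|h| < d -> `|k| < d -> U (x.1 + h, x.2 + k).
Proof.
rewrite openE; split => [oU x /oU /nbhs2P//|H x /H].
by move=> ?; apply/nbhs2P.
Qed.

Lemma cont2P phi x : {for x, continuous phi} <-> forall e : R, 0 < e ->
  exists2 d : R, 0 < d & forall h k : R, `|h| < d -> `|k| < d ->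
    `|phi (x.1 + h, x.2 + k) - phi x| < e.
Proof.
split.
  move=> /cvgrPdist_lt H e /H/nbhs2P[d d0 D]; exists d => // h k hd kd.
  by rewrite distrC D.
move=> H; apply/cvgrPdist_lt => e /H[d d0 D]; apply/nbhs2P.
by exists d => // h k hd kd; rewrite distrC D.
Qed.

Lemma rdiff_cont phi x a b : rdiff phi x a b -> {for x, continuous phi}.
Proof.
move=> H; apply/cont2P => e e0; have [d d0 D] := H 1 ltr01.
have p0 : 0 < 2 * (1 + `|a| + `|b|) by rewrite mulr_gt0// -addrA ltr_pwDl// addr_ge0.
exists (Num.min d (e / (2 * (1 + `|a| + `|b|)))); first by rewrite lt_min d0 divr_gt0.
move=> h k; rewrite !lt_min => /andP[hd he] /andP[kd ke].
have {D} := D h k hd kd; set u := phi _ - phi x => D.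
have -> : u = (u - (a * h + b * k)) + (a * h + b * k) by ring.
apply: le_lt_trans (ler_normD _ _) _.
apply: le_lt_trans (lerD D (ler_normD _ _)) _; rewrite !normrM.
rewrite !ltr_pdivlMr// in he ke.
have [h0 k0] := (normr_ge0 h, normr_ge0 k).
have [a0 b0] := (normr_ge0 a, normr_ge0 b).
move: `|h| `|k| `|a| `|b| he ke h0 k0 a0 b0 => h' k' a' b' *; nra.
Qed.

Lemma derivable_eps phi x v (l : R) :
  (forall e : R, 0 < e -> exists2 d : R, 0 < d & forall t : R, `|t| < d ->
    `|phi (x.1 + t * v.1, x.2 + t * v.2) - phi x - t * l| <= e * `|t|) ->
  is_derive x v phi l.
Proof.
move=> H.
have cv : h^-1 *: (phi (h *: v + x) - phi x) @[h --> 0^'] --> l.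
  apply/cvgrPdist_lt => e e0; have e2 : 0 < e / 2 by lra.
  have [d d0 D] := H _ e2.
  apply/nbhs_ballP; exists d => //= t; rewrite /ball/= sub0r normrN => td t0.
  have := D t td.
  have -> : (x.1 + t * v.1, x.2 + t * v.2) = t *: v + x.
    by rewrite [x in RHS]surjective_pairing; congr (_, _); rewrite addrC.
  move=> {}D; rewrite distrC /GRing.scale /=.
  have -> : t^-1 * (phi (t *: v + x) - phi x) - l = t^-1 * (phi (t *: v + x) - phi x - t * l).
    by field.
  have nt : 0 < `|t| by rewrite normr_gt0.
  by rewrite normrM normfV mulrC ltr_pdivrMr// (le_lt_trans D)// ltr_pM2r//; lra.
split; first by apply/cvg_ex; exists l.
exact/cvg_lim.
Qed.

Lemma rdiff_derive phi x a b (i : bool) : rdiff phi x a b ->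
  is_derive x (coord_dir R i) phi (if i then b else a).
Proof.
move=> H; apply: derivable_eps => e e0; have [d d0 D] := H e e0; exists d => // t td.
have zd : `|0 : R| < d by rewrite normr0.
case: i => /=.
  have := D 0 t zd td; rewrite !mulr0 !addr0 mulr1 normr0 add0r add0r.
  by rewrite (mulrC t).
have := D t 0 td zd; rewrite !mulr0 !addr0 mulr1 normr0 addr0.
by rewrite (mulrC t).
Qed.

Lemma rdiff_derivable phi x a b i : rdiff phi x a b -> derivable phi x (coord_dir R i).
Proof. by move=> /(rdiff_derive i)[]. Qed.

Lemma rdiff_partial phi x a b i : rdiff phi x a b -> partial i phi x = if i then b else a.
Proof. by move=> /(rdiff_derive i)[_ ]. Qed.

Lemma rdiff_eq phi psi x a b :
  (exists2 d : R, 0 < d & forall h k : R, `|h| < d -> `|k| < d ->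
     phi (x.1 + h, x.2 + k) = psi (x.1 + h, x.2 + k)) ->
  rdiff phi x a b -> rdiff psi x a b.
Proof.
move=> [d d0 E] H e e0; have [d1 d10 D] := H e e0.
exists (Num.min d d1); first by rewrite lt_min d0.
move=> h k; rewrite !lt_min => /andP[h1 h2] /andP[k1 k2].
have := E 0 0; rewrite normr0 !addr0 -surjective_pairing => /(_ d0 d0) <-.
by rewrite -E//; exact: D.
Qed.

Lemma rdiff_cst (c : R) x : rdiff (fun=> c) x 0 0.
Proof.
move=> e e0; exists 1 => // h k _ _; rewrite subrr !mul0r addr0 subr0 normr0.
by rewrite mulr_ge0 ?(ltW e0)// addr_ge0.
Qed.

Lemma rdiff_fst x : rdiff fst x 1 0.
Proof.
move=> e e0; exists 1 => // h k _ _.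
by rewrite (_ : _ - _ = 0) ?normr0 ?mulr_ge0 ?(ltW e0) ?addr_ge0//=; ring.
Qed.

Lemma rdiff_snd x : rdiff snd x 0 1.
Proof.
move=> e e0; exists 1 => // h k _ _.
by rewrite (_ : _ - _ = 0) ?normr0 ?mulr_ge0 ?(ltW e0) ?addr_ge0//=; ring.
Qed.

Lemma rdiff_comp phi (f g : R * R -> R) x a b p q r s :
  rdiff phi (f x, g x) a b -> rdiff f x p q -> rdiff g x r s ->
  rdiff (fun y => phi (f y, g y)) x (a * p + b * r) (a * q + b * s).
Proof.
move=> Dphi Df Dg e e0.
set A := `|a| + `|b|; set B := 2 + `|p| + `|q| + `|r| + `|s|.
have A0 : 0 <= A by rewrite addr_ge0.
have B0 : 0 < B by rewrite /B -!addrA ltr_pwDl// !addr_ge0.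
have [k [k0 k1 ke]] : exists k : R, [/\ 0 < k, k <= 1 & k * (2 * A) <= e / 2].
  exists (Num.min 1 (e / (2 * (1 + 2 * A)))); split.
  - by rewrite lt_min ltr01 divr_gt0// mulr_gt0//; lra.
  - by rewrite ge_min lexx.
  have le2 : Num.min 1 (e / (2 * (1 + 2 * A))) <= e / (2 * (1 + 2 * A)).
    by rewrite ge_min lexx orbT.
  apply: (@le_trans _ _ (e / (2 * (1 + 2 * A)) * (1 + 2 * A))).
    by rewrite ler_pM//; [rewrite le_min ler01 divr_ge0 ?ltW// mulr_gt0//; lra|lra|lra].
  rewrite le_eqVlt; apply/orP; left; apply/eqP; field.
  by rewrite gt_eqF//; lra.
have l0 : 0 < e / (4 * B) by rewrite divr_gt0// mulr_gt0.
have lB : e / (4 * B) * (2 * B) = e / 2 by field; rewrite gt_eqF.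
set l := e / (4 * B) in l0 lB.
have [d1 d10 D1] := Dphi l l0.
have [d2 d20 D2] := Df k k0; have [d3 d30 D3] := Dg k k0.
exists (Num.min (d1 / (2 * B)) (Num.min d2 d3)).
  by rewrite !lt_min d20 d30 divr_gt0// mulr_gt0.
move=> u v; rewrite !lt_min => /and3P[u1 u2 u3] /and3P[v1 v2 v3].
have {D2} := D2 u v u2 v2; have {D3} := D3 u v u3 v3.
set f' := f (_, _); set g' := g (_, _) => G F.
rewrite !ltr_pdivlMr ?mulr_gt0// in u1 v1.
have nn : 0 <= `|u| + `|v| by rewrite addr_ge0.
have [np nq nr ns] : [/\ 0 <= `|p|, 0 <= `|q|, 0 <= `|r| & 0 <= `|s|] by [].
have lin (m n : R) : `|m| <= B - 2 -> `|n| <= B - 2 -> `|m| + `|n| <= B - 2 ->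
    `|m * u + n * v| <= (B - 2) * (`|u| + `|v|).
  move=> mB nB mn; apply: le_trans (ler_normD _ _) _; rewrite !normrM mulrDr.
  by apply: lerD; rewrite ler_wpM2r.
have hf : `|f' - f x| <= B * (`|u| + `|v|) / 1.
  rewrite divr1 (_ : f' - f x = (f' - f x - (p * u + q * v)) + (p * u + q * v)); last ring.
  apply: le_trans (ler_normD _ _) _; apply: le_trans (lerD F (lin p q _ _ _)) _.
  - by rewrite /B; clear -np nq nr ns; lra.
  - by rewrite /B; clear -np nq nr ns; lra.
  - by rewrite /B; clear -np nq nr ns; lra.
  by rewrite -mulrDl ler_wpM2r//; clear -k1; lra.
have hg : `|g' - g x| <= B * (`|u| + `|v|) / 1.
  rewrite divr1 (_ : g' - g x = (g' - g x - (r * u + s * v)) + (r * u + s * v)); last ring.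
  apply: le_trans (ler_normD _ _) _; apply: le_trans (lerD G (lin r s _ _ _)) _.
  - by rewrite /B; clear -np nq nr ns; lra.
  - by rewrite /B; clear -np nq nr ns; lra.
  - by rewrite /B; clear -np nq nr ns; lra.
  by rewrite -mulrDl ler_wpM2r//; clear -k1; lra.
rewrite divr1 in hf hg.
have uvd : B * (`|u| + `|v|) < d1 by clear -u1 v1; lra.
have := D1 (f' - f x) (g' - g x) (le_lt_trans hf uvd) (le_lt_trans hg uvd).
rewrite /= !(addrC _ (_ - _)) !subrK => P.
set w := phi (f', g') - phi (f x, g x) in P *.
have -> : w - ((a * p + b * r) * u + (a * q + b * s) * v) =
  (w - (a * (f' - f x) + b * (g' - g x))) + (a * (f' - f x - (p * u + q * v)) + b * (g' - g x - (r * u + s * v))).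
  by ring.
apply: le_trans (ler_normD _ _) _.
have A1 : `|a * (f' - f x - (p * u + q * v)) + b * (g' - g x - (r * u + s * v))| <= A * (k * (`|u| + `|v|)).
  apply: le_trans (ler_normD _ _) _; rewrite !normrM mulrDl.
  by apply: lerD; rewrite ler_wpM2l.
have A2 : l * (`|f' - f x| + `|g' - g x|) <= l * (2 * B * (`|u| + `|v|)).
  by rewrite ler_wpM2l ?(ltW l0)//; clear -hf hg; lra.
have A3 : A * (k * (`|u| + `|v|)) <= e / 4 * (`|u| + `|v|).
  by rewrite mulrA ler_wpM2r//; clear -ke; lra.
have A5 : 0 <= e * (`|u| + `|v|) by rewrite mulr_ge0// ltW.
have A4 : l * (2 * B * (`|u| + `|v|)) = e / 2 * (`|u| + `|v|) by rewrite mulrA lB.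
clear -P A1 A2 A3 A4 A5; lra.
Qed.

Lemma rdiff_mul x : rdiff (fun y => y.1 * y.2) x x.2 x.1.
Proof.
move=> e e0; exists e => // h k he ke.
rewrite (_ : _ - _ = h * k) ?normrM /=; last by ring.
by have [] := (normr_ge0 h, normr_ge0 k); nra.
Qed.

Lemma rdiff_add x : rdiff (fun y => y.1 + y.2) x 1 1.
Proof.
move=> e e0; exists 1 => // h k _ _.
by rewrite (_ : _ - _ = 0) ?normr0 ?mulr_ge0 ?(ltW e0) ?addr_ge0//=; ring.
Qed.

Lemma rdiffD phi psi x a b a' b' : rdiff phi x a b -> rdiff psi x a' b' ->
  rdiff (fun y => phi y + psi y) x (a + a') (b + b').
Proof.
by move=> H H'; have := rdiff_comp (rdiff_add (phi x, psi x)) H H'; rewrite !mul1r.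
Qed.

Lemma rdiffM phi psi x a b a' b' : rdiff phi x a b -> rdiff psi x a' b' ->
  rdiff (fun y => phi y * psi y) x (psi x * a + phi x * a') (psi x * b + phi x * b').
Proof. by move=> H H'; exact: (rdiff_comp (rdiff_mul (phi x, psi x)) H H'). Qed.

(** The coordinates are moved one at a time, with the one-variable mean value theorem on each leg;
    continuity of the partial derivatives brings the intermediate points back to [x]. *)
Lemma C1_rdiff phi x :
  (forall i y, derivable phi y (coord_dir R i)) -> (forall i, {for x, continuous (partial i phi)}) ->
  rdiff phi x (partial false phi x) (partial true phi x).
Proof.
move=> Dphi Cphi e e0.
have [d1 d10 D1] := (cont2P _ _).1 (Cphi false) _ e0.
have [d2 d20 D2] := (cont2P _ _).1 (Cphi true) _ e0.
exists (Num.min d1 d2); first by rewrite lt_min d10.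
have deriv (i : bool) y (t : R) : is_derive t (1 : R) (fun s => phi (y.1 + s * (coord_dir R i).1, y.2 + s * (coord_dir R i).2))
    (partial i phi (y.1 + t * (coord_dir R i).1, y.2 + t * (coord_dir R i).2)).
  set v := coord_dir R i; set z := (_, _).
  have Hd := Dphi i z.
  have E h : phi (h *: v + z) = phi (y.1 + (h *: 1 + t) * v.1, y.2 + (h *: 1 + t) * v.2).
    have -> : h *: v + z = (h * v.1 + (y.1 + t * v.1), h * v.2 + (y.2 + t * v.2)) by [].
    by rewrite -[h%:A]/(h * 1) mulr1; congr phi; congr (_, _); ring.
  pose F s := phi (y.1 + s * v.1, y.2 + s * v.2).
  have EF : (fun h : R => h^-1 *: ((phi \o shift z) (h *: v) - phi z)) =
      (fun h : R => h^-1 *: ((F \o shift t) (h *: 1) - F t)).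
    by apply/funext => h; congr (_ *: (_ - _)); exact: E.
  split; first by move: Hd; rewrite /derivable -/v EF.
  by rewrite /partial /derive -/v EF.
have mvt (i : bool) y (t : R) : exists2 s : R, `|s| <= `|t| &
    phi (y.1 + t * (coord_dir R i).1, y.2 + t * (coord_dir R i).2) - phi y =
    partial i phi (y.1 + s * (coord_dir R i).1, y.2 + s * (coord_dir R i).2) * t.
  pose F s := phi (y.1 + s * (coord_dir R i).1, y.2 + s * (coord_dir R i).2).
  have F0 : phi y = F 0 by rewrite /F !mul0r !addr0 -surjective_pairing.
  have Fc (a b : R) : {within `[a, b], continuous F}.
    apply: continuous_subspaceT => s; apply/differentiable_continuous/derivable1_diffP.
    by have [] := deriv i y s.
  have [t0|t0|->] := ltgtP t 0.
  - have [s st E] := @MVT R F (fun s => partial i phi (y.1 + s * (coord_dir R i).1, y.2 + s * (coord_dir R i).2)) t 0 t0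
      (fun s _ => deriv i y s) (Fc t 0).
    exists s.
      move: st; rewrite in_itv/= => /andP[s1 s2].
      by rewrite !ltr0_norm//; lra.
    by rewrite F0 -[X in X - _]/(F t) -opprB E sub0r mulrN opprK.
  - have [s st E] := @MVT R F (fun s => partial i phi (y.1 + s * (coord_dir R i).1, y.2 + s * (coord_dir R i).2)) 0 t t0
      (fun s _ => deriv i y s) (Fc 0 t).
    exists s.
      move: st; rewrite in_itv/= => /andP[s1 s2].
      by rewrite !gtr0_norm//; lra.
    by rewrite F0 -[X in X - _]/(F t) E subr0.
  - by exists 0 => //; rewrite !mul0r mulr0 !addr0 -surjective_pairing subrr.
move=> h k; rewrite !lt_min => /andP[h1 h2] /andP[k1 k2].
have [s sh Es] := mvt false (x.1, x.2 + k) h.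
have [t tk Et] := mvt true x k.
move: Es Et; rewrite /= !mulr1 !mulr0 !addr0 => Es Et.
have -> : phi (x.1 + h, x.2 + k) - phi x = (phi (x.1 + h, x.2 + k) - phi (x.1, x.2 + k)) + (phi (x.1, x.2 + k) - phi x) by ring.
rewrite Es Et.
have B1 := ltW (D1 s k (le_lt_trans sh h1) k1).
have B2 := D2 0 t; rewrite normr0 addr0 in B2.
have {B2}B2 := ltW (B2 d20 (le_lt_trans tk k2)).
have -> : forall p q p' q' : R, p * h + q * k - (p' * h + q' * k) = (p - p') * h + (q - q') * k.
  by move=> *; ring.
apply: le_trans (ler_normD _ _) _; rewrite !normrM mulrDr.
exact: (lerD (ler_wpM2r (normr_ge0 _) B1) (ler_wpM2r (normr_ge0 _) B2)).
Qed.

End Differentiability.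

(** * Functions of class C^n on an open set *)

Section SmoothClasses.
Variable R : realType.
Implicit Types (x y : R * R) (phi psi : R * R -> R) (U V : set (R * R)).

(** The gradient is existentially quantified, so that closure under sums, products and composition
    is a plain induction that never computes [partial]. *)
Fixpoint Cn (n : nat) U phi : Prop :=
  if n is m.+1 then
    exists a b, [/\ forall x, U x -> rdiff phi x (a x) (b x), Cn m U a & Cn m U b]
  else forall x, U x -> {for x, continuous phi}.

Lemma CnW n U phi : Cn n.+1 U phi -> Cn n U phi.
Proof.
elim: n phi => [|n IH] phi [a [b [D A B]]].
  by move=> x /D; exact: rdiff_cont.
by exists a, b; split => //; exact: IH.
Qed.

Lemma Cn_eq n U phi psi : open U -> (forall x, U x -> phi x = psi x) -> Cn n U phi -> Cn n U psi.
Proof.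
move=> oU E; have loc x : U x -> exists2 d : R, 0 < d & forall h k : R, `|h| < d -> `|k| < d ->
     phi (x.1 + h, x.2 + k) = psi (x.1 + h, x.2 + k).
  by move=> Ux; have [d d0 H] := (open2P U).1 oU x Ux; exists d => // h k hd kd; apply/E/H.
case: n => [|n] H.
  move=> x Ux; apply/cont2P => e e0; have [d d0 D] := (cont2P _ _).1 (H x Ux) e e0.
  have [d' d'0 D'] := loc x Ux.
  exists (Num.min d d'); first by rewrite lt_min d0.
  move=> h k; rewrite !lt_min => /andP[h1 h2] /andP[k1 k2].
  by rewrite -D'// -E//; exact: D.
case: H => a [b [D A B]]; exists a, b; split => // x Ux.
by apply: (rdiff_eq (loc x Ux)); exact: D.
Qed.

Lemma Cn_partial n U phi : open U -> Cn n.+1 U phi <->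
  (forall x, U x -> rdiff phi x (partial false phi x) (partial true phi x)) /\
  forall i, Cn n U (partial i phi).
Proof.
move=> oU; split.
  move=> [a [b [D A B]]]; split.
    by move=> x Ux; rewrite (rdiff_partial false (D x Ux)) (rdiff_partial true (D x Ux)); exact: D.
  case.
    by apply: Cn_eq B => // x Ux; rewrite (rdiff_partial true (D x Ux)).
  by apply: Cn_eq A => // x Ux; rewrite (rdiff_partial false (D x Ux)).
by move=> [D H]; exists (partial false phi), (partial true phi); split.
Qed.

(** Regularity is local; this serves to glue a pulled-back test function to its extension by [0]. *)
Lemma Cn_setU n U V phi : open U -> open V -> Cn n U phi -> Cn n V phi -> Cn n (U `|` V) phi.
Proof.
move=> oU oV; elim: n phi => [|n IH] phi.
  by move=> HU HV x [/HU|/HV].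
move=> /(Cn_partial _ _ oU)[DU HU] /(Cn_partial _ _ oV)[DV HV].
apply/Cn_partial; first exact: openU.
by split=> [x [/DU|/DV]//|i]; exact: IH.
Qed.

Lemma Cn_cst n U (c : R) : Cn n U (fun=> c).
Proof.
elim: n c => [|n IH] c; first by move=> x _; exact: cst_continuous.
by exists (fun=> 0), (fun=> 0); split => // x _; exact: rdiff_cst.
Qed.

Lemma Cn_fst n U : Cn n U fst.
Proof.
case: n => [|n]; first by move=> x _; apply: rdiff_cont (rdiff_fst x).
by exists (fun=> 1), (fun=> 0); split; [move=> x _; exact: rdiff_fst|exact: Cn_cst|exact: Cn_cst].
Qed.

Lemma Cn_snd n U : Cn n U snd.
Proof.
case: n => [|n]; first by move=> x _; apply: rdiff_cont (rdiff_snd x).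
by exists (fun=> 0), (fun=> 1); split; [move=> x _; exact: rdiff_snd|exact: Cn_cst|exact: Cn_cst].
Qed.

Lemma CnD n U phi psi : Cn n U phi -> Cn n U psi -> Cn n U (fun x => phi x + psi x).
Proof.
elim: n phi psi => [|n IH] phi psi.
  by move=> H H' x Ux; apply: continuousD; [exact: H|exact: H'].
move=> [a [b [D A B]]] [a' [b' [D' A' B']]].
exists (fun x => a x + a' x), (fun x => b x + b' x); split; [|exact: IH|exact: IH].
by move=> x Ux; apply: rdiffD; [exact: D|exact: D'].
Qed.

Lemma CnM n U phi psi : Cn n U phi -> Cn n U psi -> Cn n U (fun x => phi x * psi x).
Proof.
elim: n phi psi => [|n IH] phi psi.
  by move=> H H' x Ux; apply: continuousM; [exact: H|exact: H'].
move=> H H'; have [W W'] := (CnW H, CnW H').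
case: H H' => a [b [D A B]] [a' [b' [D' A' B']]].
exists (fun x => psi x * a x + phi x * a' x), (fun x => psi x * b x + phi x * b' x).
split; [|by apply: CnD; exact: IH|by apply: CnD; exact: IH].
by move=> x Ux; apply: rdiffM; [exact: D|exact: D'].
Qed.

Lemma CnX n U phi m : Cn n U phi -> Cn n U (fun x => phi x ^+ m).
Proof.
move=> H; elim: m => [|m IH].
  by rewrite (_ : (fun _ => _) = fun=> 1); [exact: Cn_cst|apply/funext => x; rewrite expr0].
rewrite (_ : (fun _ => _) = fun x => phi x * phi x ^+ m); first exact: CnM.
by apply/funext => x; rewrite exprS.
Qed.

Lemma Cn_comp n U V phi (f g : R * R -> R) : Cn n V phi -> Cn n U f -> Cn n U g ->
  (forall x, U x -> V (f x, g x)) -> Cn n U (fun x => phi (f x, g x)).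
Proof.
move=> + + + UV; elim: n phi f g UV => [|n IH] phi f g UV.
  move=> Hp Hf Hg x Ux; apply/cont2P => e e0.
  have [d d0 D] := (cont2P _ _).1 (Hp _ (UV x Ux)) e e0.
  have [d1 d10 D1] := (cont2P _ _).1 (Hf x Ux) d d0.
  have [d2 d20 D2] := (cont2P _ _).1 (Hg x Ux) d d0.
  exists (Num.min d1 d2); first by rewrite lt_min d10.
  move=> h k; rewrite !lt_min => /andP[h1 h2] /andP[k1 k2].
  have := D _ _ (D1 h k h1 k1) (D2 h k h2 k2).
  by rewrite /= !(addrC _ (_ - _)) !subrK.
move=> Hp Hf Hg; have [Wf Wg] := (CnW Hf, CnW Hg).
case: Hp Hf Hg => a [b [D A B]] [a1 [b1 [D1 A1 B1]]] [a2 [b2 [D2 A2 B2]]].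
exists (fun x => a (f x, g x) * a1 x + b (f x, g x) * a2 x),
       (fun x => a (f x, g x) * b1 x + b (f x, g x) * b2 x).
split.
- by move=> x Ux; apply: rdiff_comp; [exact/D/UV|exact: D1|exact: D2].
- by apply: CnD; apply: CnM => //; exact: IH.
- by apply: CnD; apply: CnM => //; exact: IH.
Qed.

(** [smooth] speaks of partial derivatives only, so total differentiability comes from [C1_rdiff] in
    one direction; the other direction is an induction on the list of coordinates. *)
Lemma smoothP phi : smooth phi <-> forall n, Cn n setT phi.
Proof.
split.
  move=> sm n; suff : forall s, Cn n setT (iter_partial s phi) by move=> /(_ [::]).
  elim: n => [|n IH] s; first by move=> x _; have [+ _] := sm s; apply.
  apply/Cn_partial; first exact: openT.
  split=> [x _|i]; last exact: (IH (i :: s)).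
  apply: C1_rdiff; first by have [] := sm s.
  by move=> i; have [+ _] := sm (i :: s); apply.
move=> H s; have {}H n : Cn n setT (iter_partial s phi).
  elim: s n => [//|i s IH] n /=.
  by have /Cn_partial[|_] := IH n.+1; [exact: openT|apply].
split; first by move=> x; exact: (H 0).
move=> i x; have [a [b [D _ _]]] := H 1.
exact: (@rdiff_derivable R (iter_partial s phi) x (a x) (b x) i (D x I)).
Qed.

End SmoothClasses.

(** * Conformal change of variables *)

Section PlaneMeasure.
Variable R : realType.
Local Notation plane := (measurableTypeR R * measurableTypeR R)%type.
Local Notation lambda := (@lebesgue_measure R).
Implicit Types (U : set (R * R)) (x : R * R).

(** The sigma-algebra is the product one, so an open set is exhibited as the countable union of the
    rational boxes that it contains. *)
Lemma open2_measurable U : open U -> measurable (U : set plane).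
Proof.
move=> oU.
pose box (q : rat * rat * (rat * rat)) : set plane :=
  `]ratr q.1.1, ratr q.1.2[%classic `*` `]ratr q.2.1, ratr q.2.2[%classic.
pose F q : set plane := if `[< box q `<=` U >] then box q else set0.
have -> : U = \bigcup_q F q.
  apply/seteqP; split=> [x Ux|x [q _]]; last first.
    by rewrite /F; case: asboolP => // qU; exact: qU.
  have [d d0 H] := (open2P U).1 oU x Ux.
  have rt (t : R) : exists p : rat * rat, [/\ ratr p.1 < t, t < ratr p.2,
      t - d < ratr p.1 & ratr p.2 < t + d].
    have t1 : t - d < t by lra. have t2 : t < t + d by lra.
    have [a] := rat_in_itvoo t1; have [b] := rat_in_itvoo t2.
    rewrite !in_itv/= => /andP[? ?] /andP[? ?].
    by exists (a, b).
  have [p [p1 p2 p3 p4]] := rt x.1; have [q [q1 q2 q3 q4]] := rt x.2.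
  have bU : box (p, q) `<=` U.
    move=> -[u v] [/=]; rewrite !in_itv/= => /andP[u1 u2] /andP[v1 v2].
    have := H (u - x.1) (v - x.2); rewrite !(addrC _ (_ - _)) !subrK; apply.
      by rewrite ltr_norml; apply/andP; split; lra.
    by rewrite ltr_norml; apply/andP; split; lra.
  exists (p, q) => //; rewrite /F; case: asboolP => // _.
  by split; rewrite /= in_itv/= ?p1 ?q1 ?p2 ?q2.
apply: countable_bigcupT_measurable => [|q]; first exact: countableP.
rewrite /F; case: asboolP => // _; apply: measurableX; exact: measurable_itv.
Qed.

Lemma cont2_measurable U (h : R * R -> R) : open U ->
  (forall x, U x -> {for x, continuous h}) -> measurable_fun (U : set plane) h.
Proof.
move=> oU hc; apply: (measurability _ (measurable_realfun.RGenOInfty.measurableE R)).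
move=> _ [_ [a ->] <-]; apply: open2_measurable; apply/open2P => x [Ux].
rewrite /= in_itv/= andbT => ax.
have [d1 d10 H1] := (open2P U).1 oU x Ux.
have e0 : 0 < h x - a by rewrite subr_gt0.
have [d2 d20 H2] := (cont2P _ _).1 (hc x Ux) _ e0.
exists (Num.min d1 d2); first by rewrite lt_min d10.
move=> s t; rewrite !lt_min => /andP[s1 s2] /andP[t1 t2]; split; first exact: H1.
rewrite /= in_itv/= andbT; have := H2 s t s2 t2; rewrite ltr_norml => /andP[? ?].
by lra.
Qed.

Lemma cont2_measurableT (h : R * R -> R) : continuous h -> measurable_fun (setT : set plane) h.
Proof. by move=> hc; apply: cont2_measurable => [|x _]; [exact: (@openT (R * R)%type)|exact: hc]. Qed.

Local Open Scope ereal_scope.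

(** The image of Lebesgue measure under the affine map, multiplied by [|a|], agrees with Lebesgue
    measure on half-open intervals, hence everywhere by uniqueness. *)
Lemma ge0_integral_affine (phi : measurableTypeR R -> \bar R) (a b : R) : a != 0%R ->
  measurable_fun setT phi -> (forall t, 0 <= phi t) ->
  \int[lambda]_t phi (a * t + b)%R = (`|a|^-1)%:E * \int[lambda]_t phi t.
Proof.
move=> a0 mphi phi0.
pose f (t : measurableTypeR R) : measurableTypeR R := (a * t + b)%R.
have mf : measurable_fun setT f.
  apply: continuous_measurable_fun => t; apply: cvgD; last exact: cvg_cst.
  by apply: cvgMr; exact: cvg_id.
have na : (0 <= `|a|)%R by [].
pose nu := measure_function_pushforward__canonical__measure_function_Measure lambda mf.
pose mu := mscale (NngNum na) nu.
have muE A : measurable A -> lambda A = mu A.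
  apply: lebesgue_measure_unique => //= _ [[u v] _ <-].
  rewrite /mu /nu /mscale /=.
  have [a_gt0|a_lt0|a_eq0] := ltgtP a 0%R; last by rewrite a_eq0 eqxx in a0.
  (* This is the case [a < 0]: the preimage of a half-open interval is half-open at the other
     end. *)
  - have -> : pushforward lambda f `]u, v]%classic = lambda `[((v - b) / a)%R, ((u - b) / a)%R[%classic.
      rewrite /pushforward; congr (lambda _); apply/seteqP; split => t /=; rewrite !in_itv/= /f => /andP[h1 h2]; apply/andP; split.
      + by rewrite ler_ndivrMr//; rewrite mulrC; lra.
      + by rewrite ltr_ndivlMr//; rewrite mulrC; lra.
      + by move: h2; rewrite ltr_ndivlMr// mulrC; lra.
      + by move: h1; rewrite ler_ndivrMr// mulrC; lra.
    rewrite !lebesgue_measure_itv/= !lte_fin ltr_nM2r ?invr_lt0//.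
    rewrite ltrD2r; case: ifPn => uv; last by rewrite mule0.
    by rewrite -!EFinD -EFinM (ltr0_norm a_gt0); congr EFin; field.
  - have -> : pushforward lambda f `]u, v]%classic = lambda `]((u - b) / a)%R, ((v - b) / a)%R]%classic.
      rewrite /pushforward; congr (lambda _); apply/seteqP; split => t /=; rewrite !in_itv/= /f => /andP[h1 h2]; apply/andP; split.
      + by rewrite ltr_pdivrMr//; rewrite mulrC; lra.
      + by rewrite ler_pdivlMr//; rewrite mulrC; lra.
      + by move: h1; rewrite ltr_pdivrMr// mulrC; lra.
      + by move: h2; rewrite ler_pdivlMr// mulrC; lra.
    rewrite !lebesgue_measure_itv/= !lte_fin ltr_pM2r ?invr_gt0//.
    rewrite ltrD2r; case: ifPn => uv; last by rewrite mule0.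
    by rewrite -!EFinD -EFinM (gtr0_norm a_lt0); congr EFin; field.
rewrite -[in RHS](@eq_measure_integral _ _ _ setT lambda mu); last first.
  by move=> A mA _; apply/esym/muE.
rewrite ge0_integral_mscale//.
rewrite (ge0_integral_pushforward mf)//=.
rewrite muleA -EFinM mulVf ?mul1e ?normr_eq0//.
Qed.

Lemma plane_measurable_affine (u v w : R) :
  measurable_fun (setT : set plane) (fun x : plane => u * x.1 + v * x.2 + w)%R.
Proof.
apply: cont2_measurableT => x; apply: (@rdiff_cont _ _ _ u v) => e e0.
exists 1%R => // s t _ _.
by rewrite (_ : _ - _ = 0)%R ?normr0 ?mulr_ge0 ?(ltW e0) ?addr_ge0//=; ring.
Qed.

Lemma plane_measurable_comp (h : plane -> \bar R) (f g : plane -> R) :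
  measurable_fun (setT : set plane) h ->
  measurable_fun (setT : set plane) f -> measurable_fun (setT : set plane) g ->
  measurable_fun (setT : set plane) (fun x => h (f x, g x)).
Proof. by move=> mh mf mg; apply: (measurableT_comp mh); exact: measurable_fun_pair. Qed.

Lemma ge0_integral_shear1 (h : plane -> \bar R) (u v b : R) : u != 0%R ->
  measurable_fun (setT : set plane) h -> (forall x, 0 <= h x) ->
  \int[area R]_x h (u * x.1 + v * x.2 + b, x.2)%R = (`|u|^-1)%:E * \int[area R]_x h x.
Proof.
move=> u0 mh h0.
rewrite /area [LHS]fubini_tonelli2//; last first.
  by apply: plane_measurable_comp => //; exact: plane_measurable_affine.
rewrite [in RHS]fubini_tonelli2//= /fubini_G /= -ge0_integralZl//=; last 2 first.
- exact: measurable_fun_fubini_tonelli_G.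
- by move=> y _; exact: integral_ge0.
apply: eq_integral => y _.
under eq_integral do rewrite -addrA.
apply: (@ge0_integral_affine (fun t => h (t, y)) u (v * y + b)%R) => //.
by apply: (measurableT_comp mh); exact: measurable_fun_pair.
Qed.

Lemma ge0_integral_shear2 (h : plane -> \bar R) (u v b : R) : v != 0%R ->
  measurable_fun (setT : set plane) h -> (forall x, 0 <= h x) ->
  \int[area R]_x h (x.1, u * x.1 + v * x.2 + b)%R = (`|v|^-1)%:E * \int[area R]_x h x.
Proof.
move=> v0 mh h0.
rewrite /area [LHS]fubini_tonelli1//; last first.
  by apply: plane_measurable_comp => //; exact: plane_measurable_affine.
rewrite [in RHS]fubini_tonelli1//= /fubini_F /= -ge0_integralZl//=; last 2 first.
- exact: measurable_fun_fubini_tonelli_F.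
- by move=> y _; exact: integral_ge0.
apply: eq_integral => x _.
under eq_integral do rewrite (addrC (u * x)%R) -addrA.
apply: (@ge0_integral_affine (fun t => h (x, t)) v (u * x + b)%R) => //.
by apply: (measurableT_comp mh); exact: measurable_fun_pair.
Qed.

(** With the pivot [u != 0] the map factors into two shears, each of which changes a single variable
    and is handled by Tonelli's theorem. *)
Lemma ge0_integral_linear (h : plane -> \bar R) (u v w z b c : R) : u != 0%R ->
  (u * z - v * w != 0)%R -> measurable_fun (setT : set plane) h -> (forall x, 0 <= h x) ->
  \int[area R]_x h (u * x.1 + v * x.2 + b, w * x.1 + z * x.2 + c)%R =
  (`|u * z - v * w|^-1)%:E * \int[area R]_x h x.
Proof.
move=> u0 d0 mh h0.
pose k (x : plane) := h (x.1, (w / u) * x.1 + ((u * z - v * w) / u) * x.2 + (c - w * b / u))%R.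
have mk : measurable_fun (setT : set plane) k.
  by apply: plane_measurable_comp => //; exact: plane_measurable_affine.
have -> : \int[area R]_x h (u * x.1 + v * x.2 + b, w * x.1 + z * x.2 + c)%R =
    \int[area R]_x k (u * x.1 + v * x.2 + b, x.2)%R.
  apply: eq_integral => x _; rewrite /k /=; congr (h (_, _)).
  by field.
have k0 x : 0 <= k x by exact: h0.
rewrite (ge0_integral_shear1 _ _ u0 mk k0) /k ge0_integral_shear2//; last first.
  by rewrite mulf_neq0// invr_eq0.
rewrite muleA -EFinM -invfM -normrM mulrCA mulrA (mulrC u) mulrK ?unitfE//.
Qed.

Lemma ge0_integral_rotation (h : plane -> \bar R) (p q b c : R) : (p ^+ 2 + q ^+ 2 != 0)%R ->
  measurable_fun (setT : set plane) h -> (forall x, 0 <= h x) ->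
  \int[area R]_x h (p * x.1 + - q * x.2 + b, q * x.1 + p * x.2 + c)%R =
  ((p ^+ 2 + q ^+ 2)^-1)%:E * \int[area R]_x h x.
Proof.
move=> N0 mh h0.
have E : (p * p - - q * q = p ^+ 2 + q ^+ 2)%R by ring.
have N1 : (0 <= p ^+ 2 + q ^+ 2)%R by rewrite addr_ge0// sqr_ge0.
have [p0|p0] := eqVneq p 0%R; last first.
  by rewrite ge0_integral_linear// ?E// ger0_norm.
have q0 : q != 0%R by apply: contraNneq N0 => ->; rewrite p0 !expr0n addr0.
(* For [p = 0] the pivot vanishes. Composing with the shear [(x, y) |-> (x + y, y)], of determinant
   [1], produces the pivot [- q]. *)
pose k (x : plane) := h (1 * x.1 + 1 * x.2 + 0, x.2)%R.
have mk : measurable_fun (setT : set plane) k.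
  by apply: plane_measurable_comp => //; exact: plane_measurable_affine.
have -> : \int[area R]_x h (p * x.1 + - q * x.2 + b, q * x.1 + p * x.2 + c)%R =
    \int[area R]_x k (- q * x.1 + - q * x.2 + (b - c), q * x.1 + 0 * x.2 + c)%R.
  apply: eq_integral => x _; rewrite /k p0 /=; congr (h (_, _)); ring.
have k0 x : 0 <= k x by exact: h0.
rewrite (@ge0_integral_linear k)// ?oppr_eq0//; last first.
  by rewrite mulr0 sub0r mulNr opprK mulf_neq0.
rewrite /k ge0_integral_shear1 ?oner_eq0// normr1 invr1 mul1e.
by rewrite mulr0 sub0r mulNr opprK p0 expr0n add0r ger0_norm// -expr2 sqr_ge0.
Qed.

End PlaneMeasure.

(** * Conformal maps with their inverses, and pullback of test functions *)

Section ConformalPair.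
Variable R : realType.
Implicit Types (x y : R * R) (z w : R[i]) (U V : set R[i]) (f g : R[i] -> R[i])
  (phi : R * R -> R).

Local Notation tc := (@to_complex R).

Definition of_complex z : R * R := (Re z, Im z).
Local Notation oc := of_complex.

Lemma to_complexK x : oc (tc x) = x. Proof. by case: x. Qed.
Lemma of_complexK z : tc (oc z) = z. Proof. by case: z. Qed.

Lemma to_complex_shift x (h k : R) : tc (x.1 + h, x.2 + k) = tc x + (h +i* k).
Proof. by apply: complex_eqP; rewrite !ReImE. Qed.

Lemma cabs_lt_coord (h k d : R) : `|h| < d / 2 -> `|k| < d / 2 -> cabs (h +i* k) < d.
Proof. by move=> hd kd; apply: le_lt_trans (cabs_leD _) _ => /=; lra. Qed.

Lemma copen_open U : copen U -> open (tc @^-1` U).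
Proof.
move=> oU; apply/open2P => x /oU[d d0 H]; exists (d / 2); first by lra.
move=> h k hd kd; apply: H; rewrite to_complex_shift addrC addKr.
exact: cabs_lt_coord.
Qed.

Lemma cderiv_rdiff f x a : cderiv f (tc x) a ->
  rdiff (fun y => Re (f (tc y))) x (Re a) (- Im a) /\
  rdiff (fun y => Im (f (tc y))) x (Im a) (Re a).
Proof.
move=> H.
have main (e : R) : 0 < e -> exists2 d : R, 0 < d & forall h k : R, `|h| < d -> `|k| < d ->
    cabs (f (tc (x.1 + h, x.2 + k)) - f (tc x) - a * (h +i* k)) <= e * (`|h| + `|k|).
  move=> e0; have [d d0 D] := H e e0; exists (d / 2); first by lra.
  move=> h k hd kd; rewrite to_complex_shift.
  apply: le_trans (D _ (cabs_lt_coord hd kd)) _.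
  by rewrite ler_wpM2l ?(ltW e0)//; exact: cabs_leD.
split=> e /main[d d0 D]; exists d => // h k hd kd.
  apply: le_trans (D h k hd kd); apply: le_trans _ (Re_le_cabs _).
  by rewrite !ReImE /= mulNr.
apply: le_trans (D h k hd kd); apply: le_trans _ (Im_le_cabs _).
by rewrite !ReImE /= (addrC (Re a * k)).
Qed.

Lemma holo_Cn n U f f' : copen U -> holo U f f' ->
  Cn n (tc @^-1` U) (fun x => Re (f (tc x))) /\ Cn n (tc @^-1` U) (fun x => Im (f (tc x))).
Proof.
move=> oU; elim: n f f' => [|n IH] f f' hf.
  split=> x /hf/cderiv_rdiff[? ?]; apply: rdiff_cont; eassumption.
have [f'' hf'] := holo_deriv oU hf.
have [A B] := IH _ _ hf'.
have NB : Cn n (tc @^-1` U) (fun x => - Im (f' (tc x))).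
  rewrite (_ : (fun x => _) = (fun x => (-1) * Im (f' (tc x)))).
    by apply: CnM => //; exact: Cn_cst.
  by apply/funext => x; rewrite mulN1r.
split.
  exists (fun x => Re (f' (tc x))), (fun x => - Im (f' (tc x))); split => //.
  by move=> x /hf/cderiv_rdiff[].
exists (fun x => Im (f' (tc x))), (fun x => Re (f' (tc x))); split => //.
by move=> x /hf/cderiv_rdiff[].
Qed.

(** Both directions are recorded on the same footing, so that by [conf_pair_sym] a one-sided
    estimate immediately yields the reverse one. *)
Record conf_pair U V f f' g g' : Prop := ConfPair {
  cp_openU : copen U; cp_openV : copen V;
  cp_holof : holo U f f'; cp_holog : holo V g g';
  cp_f : forall z, U z -> V (f z) /\ g (f z) = z;
  cp_g : forall w, V w -> U (g w) /\ f (g w) = w }.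

Lemma conf_pair_sym U V f f' g g' : conf_pair U V f f' g g' -> conf_pair V U g g' f f'.
Proof. by case. Qed.

Lemma conf_pair_deriv U V f f' g g' : conf_pair U V f f' g g' ->
  forall z, U z -> g' (f z) * f' z = 1.
Proof.
case=> oU oV hf hg Hf Hg z Uz; have [Vfz gf] := Hf z Uz.
apply: (@cderiv_uniq _ (fun z => g (f z)) z).
  by apply: cderiv_comp; [exact: hf|exact: hg].
apply: (@cderiv_eq _ id); last exact: cderiv_id.
by have [d d0 H] := oU z Uz; exists d => // w /H/Hf[_ ->].
Qed.

Lemma conf_pair_deriv_neq0 U V f f' g g' : conf_pair U V f f' g g' ->
  forall z, U z -> f' z != 0.
Proof.
move=> cp z /(conf_pair_deriv cp) E; apply/eqP => f0.
by move: E; rewrite f0 mulr0 => /esym/eqP; rewrite oner_eq0.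
Qed.

Definition rmap f x : R * R := oc (f (tc x)).

Definition pullback f U phi : R * R -> R := (phi \o rmap f) \_ (tc @^-1` U).

Definition energy_density phi x : R := partial false phi x ^+ 2 + partial true phi x ^+ 2.

Lemma rmap_cont U f f' x : holo U f f' -> U (tc x) -> {for x, continuous (rmap f)}.
Proof.
move=> hf Ux; have [D1 D2] := cderiv_rdiff (hf _ Ux).
have C1 := rdiff_cont D1; have C2 := rdiff_cont D2.
exact: (cvg_pair C1 C2).
Qed.

Definition supp phi : set (R * R) := closure [set x | phi x != 0].

Lemma supp_notin phi x : ~ supp phi x -> phi x = 0.
Proof.
by move=> nx; apply: contrapT => /eqP px; apply: nx; exact: subset_closure.
Qed.

Lemma supp_partial phi i x : ~ supp phi x -> partial i phi x = 0.
Proof.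
move=> nx.
have oS : open (~` supp phi) by apply: closed_openC; exact: closed_closure.
have [d d0 H] := (open2P _).1 oS x nx.
have : rdiff phi x 0 0.
  apply: (@rdiff_eq _ (fun=> 0)); last exact: rdiff_cst.
  by exists d => // h k hd kd; rewrite supp_notin//; exact: H.
by move/(rdiff_partial i) => ->; case: i.
Qed.

Lemma supp_energy phi x : ~ supp phi x -> energy_density phi x = 0.
Proof. by move=> nx; rewrite /energy_density !supp_partial// expr0n addr0. Qed.

Lemma energy_density_ge0 phi x : 0 <= energy_density phi x.
Proof. by rewrite addr_ge0 ?sqr_ge0. Qed.

Section Pullback.
Variables (U V : set R[i]) (f f' g g' : R[i] -> R[i]).
Hypothesis cp : conf_pair U V f f' g g'.

Lemma pullbackE phi x : U (tc x) -> pullback f U phi x = phi (rmap f x).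
Proof. by move=> Ux; rewrite /pullback patchT// inE. Qed.

Lemma pullback_notin phi x : ~ U (tc x) -> pullback f U phi x = 0.
Proof. by move=> Ux; rewrite /pullback patchC// inE. Qed.

Lemma rmapK x : U (tc x) -> rmap g (rmap f x) = x.
Proof.
by case: cp => _ _ _ _ Hf _ Ux; have [_ gf] := Hf _ Ux; rewrite /rmap of_complexK gf to_complexK.
Qed.

Lemma rmap_in x : U (tc x) -> V (tc (rmap f x)).
Proof. by case: cp => _ _ _ _ Hf _ Ux; have [Vf _] := Hf _ Ux; rewrite /rmap of_complexK. Qed.

End Pullback.

Section PullbackTest.
Variables (U V : set R[i]) (f f' g g' : R[i] -> R[i]).
Hypothesis cp : conf_pair U V f f' g g'.
Variables (phi : R * R -> R).
Hypothesis tphi : test_function (tc @^-1` V) phi.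

Let K' := rmap g @` supp phi.

Lemma pullback_compact : compact K'.
Proof.
case: tphi => _ cK KV; apply: continuous_compact => //.
apply: continuous_in_subspaceT => x /[!inE] /KV Vx.
by apply: (rmap_cont (cp_holog cp)).
Qed.

Lemma pullback_supp_sub : K' `<=` tc @^-1` U.
Proof.
case: tphi => _ _ KV _ [x /KV Vx <-].
exact: (rmap_in (conf_pair_sym cp)).
Qed.

Lemma pullback_neq0 x : pullback f U phi x != 0 -> K' x.
Proof.
have [Ux|Ux] := pselect (U (tc x)); last by rewrite pullback_notin// eqxx.
rewrite pullbackE// => p0; exists (rmap f x); last exact: rmapK cp _ Ux.
exact: subset_closure.
Qed.

Lemma pullback_closed : closed K'.
Proof. apply: compact_closed; [exact: norm_hausdorff|exact: pullback_compact]. Qed.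

Lemma pullback_supp : supp (pullback f U phi) `<=` K'.
Proof.
apply: subset_trans pullback_closed.
by apply: closure_subset => x; exact: pullback_neq0.
Qed.

(** The pullback is smooth on the preimage of [U] by the chain rule, and it vanishes off the compact
    set [K']. These two open sets cover the plane. *)
Lemma pullback_test : test_function (tc @^-1` U) (pullback f U phi).
Proof.
split.
- apply/smoothP => n.
  have -> : [set: R * R] = (tc @^-1` U) `|` ~` K'.
    by apply/seteqP; split=> // x _; have [/pullback_supp_sub|] := pselect (K' x); [left|right].
  have oU := copen_open (cp_openU cp).
  have oK : open (~` K') by apply: closed_openC; exact: pullback_closed.
  apply: Cn_setU => //.
    have [F1 F2] := holo_Cn n (cp_openU cp) (cp_holof cp).
    apply: (@Cn_eq _ n _ (fun x => phi (Re (f (tc x)), Im (f (tc x))))) => //.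
      by move=> x Ux; rewrite pullbackE.
    apply: (@Cn_comp _ n _ setT) => //.
    by have [sm _ _] := tphi; exact: (smoothP _).1 sm n.
  apply: (@Cn_eq _ n _ (fun=> 0)) => //; last exact: Cn_cst.
  move=> x nx; apply/esym/eqP; apply: contrapT => /negP/pullback_neq0; exact: nx.
- exact: (subclosed_compact (@closed_closure _ _) pullback_compact pullback_supp).
- exact: subset_trans pullback_supp pullback_supp_sub.
Qed.

(** By the Cauchy-Riemann equations the Jacobian matrix is [|f'|] times a rotation, so the mixed
    terms of the squared gradient cancel. *)
Lemma pullback_energy x : U (tc x) ->
  energy_density (pullback f U phi) x = energy_density phi (rmap f x) * cabs (f' (tc x)) ^+ 2.
Proof.
move=> Ux.
have [D1 D2] := cderiv_rdiff (cp_holof cp Ux).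
have [/smoothP/(_ 1)[a [b [Dphi _ _]]] _ _] := tphi.
have D0 := Dphi (rmap f x) I.
have Dp : rdiff (pullback f U phi) x (a (rmap f x) * Re (f' (tc x)) + b (rmap f x) * Im (f' (tc x)))
    (a (rmap f x) * - Im (f' (tc x)) + b (rmap f x) * Re (f' (tc x))).
  apply: (@rdiff_eq _ (fun x => phi (Re (f (tc x)), Im (f (tc x))))).
    have [d d0 H] := (open2P _).1 (copen_open (cp_openU cp)) x Ux.
    by exists d => // h k hd kd; rewrite pullbackE//; exact: H.
  exact: rdiff_comp D0 D1 D2.
rewrite /energy_density (rdiff_partial false Dp) (rdiff_partial true Dp).
by rewrite (rdiff_partial false D0) (rdiff_partial true D0) sqr_cabs; ring.
Qed.

End PullbackTest.

End ConformalPair.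

(** * Change of variables by comparison of small squares *)

Section ChangeOfVariables.
Variable R : realType.
Local Notation tc := (@to_complex R).
Local Notation plane := (measurableTypeR R * measurableTypeR R)%type.
Implicit Types (U V : set R[i]) (f g : R[i] -> R[i]) (h : R * R -> R).

(** Half-open, so that the four quarters of a square are disjoint. *)
Definition square (x y t : R) : set (R * R) := `[x, (x + t)[%classic `*` `[y, (y + t)[%classic.

Lemma squareP (x y t : R) v : square x y t v <->
  (x <= v.1 < x + t) /\ (y <= v.2 < y + t).
Proof. by rewrite /square /= !in_itv/=. Qed.

Lemma square_measurable (x y t : R) : measurable (square x y t : set plane).
Proof. by apply: measurableX; exact: measurable_itv. Qed.

Lemma area_square (x y t : R) : 0 <= t -> area R (square x y t) = (t ^+ 2)%:E.
Proof.
move=> t0.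
transitivity (@lebesgue_measure R `[x, (x + t)%R[%classic * @lebesgue_measure R `[y, (y + t)%R[%classic)%E.
  by apply: product_measure1E; exact: measurable_itv.
rewrite !lebesgue_measure_itv/= !lte_fin !ltrDl.
move: t0; rewrite le_eqVlt => /predU1P[<-|t0]; first by rewrite ltxx mule0 expr0n.
by rewrite t0 -!EFinB -EFinM !(addrC _ t) !addrK expr2.
Qed.

Lemma square_split (x y t : R) : 0 < t -> square x y t =
  (square x y (t / 2) `|` square (x + t / 2) y (t / 2)) `|`
  (square x (y + t / 2) (t / 2) `|` square (x + t / 2) (y + t / 2) (t / 2)).
Proof.
move=> t0; apply/seteqP; split=> v.
  move=> /squareP[/andP[a b] /andP[c d]].
  have [e|e] := ltP v.1 (x + t / 2); have [k|k] := ltP v.2 (y + t / 2).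
  - by left; left; apply/squareP; split; apply/andP; split; lra.
  - by right; left; apply/squareP; split; apply/andP; split; lra.
  - by left; right; apply/squareP; split; apply/andP; split; lra.
  - by right; right; apply/squareP; split; apply/andP; split; lra.
by move=> [[|]|[|]] /squareP[/andP[a b] /andP[c d]]; apply/squareP; split; apply/andP; split; lra.
Qed.

Local Open Scope ereal_scope.

(** The preimage under [G] covers both sides of the change of variables: [G = id] on [U], and
    [G = rmap g] on [V], where the pieces are images of squares under [f]. *)
Lemma integral_square_split (D : set plane) (G : plane -> plane) (k : plane -> R) (x y t : R) :
  (0 < t)%R -> measurable D -> (forall x y t, measurable (D `&` G @^-1` square x y t)) ->
  measurable_fun D k -> (forall v, D v -> 0 <= k v)%R ->
  \int[area R]_(v in D `&` G @^-1` square x y t) (k v)%:E =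
  (\int[area R]_(v in D `&` G @^-1` square x y (t / 2)) (k v)%:E +
  \int[area R]_(v in D `&` G @^-1` square (x + t / 2)%R y (t / 2)) (k v)%:E) +
  (\int[area R]_(v in D `&` G @^-1` square x (y + t / 2)%R (t / 2)) (k v)%:E +
  \int[area R]_(v in D `&` G @^-1` square (x + t / 2)%R (y + t / 2)%R (t / 2)) (k v)%:E).
Proof.
move=> t0 mD mDG mk k0.
have dis x1 y1 x2 y2 v : (x1 + t / 2 <= x2 \/ y1 + t / 2 <= y2)%R ->
    (D `&` G @^-1` square x1 y1 (t / 2)) v -> (D `&` G @^-1` square x2 y2 (t / 2)) v -> False.
  move=> H [_ /squareP[/andP[a b] /andP[c d]]].
  by move=> [_ /squareP[/andP[a' b'] /andP[c' d']]]; case: H => ?; lra.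
have msub A : A `<=` D -> measurable_fun A (EFin \o k).
  by move=> AD; apply/measurable_EFinP; exact: measurable_funS mk.
have sub Q : D `&` Q `<=` D by move=> v [].
have subU Q Q' : (D `&` Q) `|` (D `&` Q') `<=` D by move=> v [[]|[]].
have ge0 A v : A `<=` D -> A v -> 0 <= (k v)%:E by move=> AD /AD/k0; rewrite lee_fin.
rewrite {1}square_split// !preimage_setU !setIUr.
rewrite ge0_integral_setU//=; last first.
- apply/eqP/seteqP; split=> // v [[|] A [|] B]; move: A B.
  + by apply: dis; right; rewrite lexx.
  + by apply: dis; right; rewrite lexx.
  + by apply: dis; right; rewrite lexx.
  + by apply: dis; right; rewrite lexx.
- by move=> v; rewrite lee_fin => -[[[/k0]|[/k0]]|[[/k0]|[/k0]]].
- by apply: msub => v [[]|[]] [].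
- by apply: measurableU.
- by apply: measurableU.
rewrite !ge0_integral_setU//=.
- by apply: msub => v [] [].
- by move=> v; rewrite lee_fin => -[[/k0]|[/k0]].
- by apply/eqP/seteqP; split=> // v [A B]; move: A B; apply: dis; left; rewrite lexx.
- by apply: msub => v [] [].
- by move=> v; rewrite lee_fin => -[[/k0]|[/k0]].
- by apply/eqP/seteqP; split=> // v [A B]; move: A B; apply: dis; left; rewrite lexx.
Qed.

(** The set is the image of the square under the similarity [z |-> w0 + a (z - z0)] of ratio [|a|],
    written as a preimage. *)
Lemma area_rotated_square (z0 w0 a : R[i]) (x y t : R) : a != 0%R -> (0 <= t)%R ->
  area R [set v | square x y t (of_complex (z0 + a^-1 * (tc v - w0))%R)] =
  (cabs a ^+ 2 * t ^+ 2)%:E.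
Proof.
move=> a0 t0.
pose p := Re (a^-1)%R; pose q := Im (a^-1)%R.
pose b := Re (z0 - a^-1 * w0)%R; pose c := Im (z0 - a^-1 * w0)%R.
have E v : of_complex (z0 + a^-1 * (tc v - w0))%R = (p * v.1 + - q * v.2 + b, q * v.1 + p * v.2 + c)%R.
  rewrite (_ : z0 + a^-1 * (tc v - w0) = a^-1 * tc v + (z0 - a^-1 * w0))%R; last by ring.
  rewrite /of_complex !(Re_add (_ * tc v)%R) !(Im_add (_ * tc v)%R) Re_mul Im_mul.
  by rewrite -/p -/q -/b -/c /=; congr (_, _); ring.
have N : (p ^+ 2 + q ^+ 2 = cabs a ^- 2)%R by rewrite -sqr_cabs cabsV exprVn.
have N0 : (p ^+ 2 + q ^+ 2 != 0)%R by rewrite N invr_eq0 expf_neq0// cabs0_eq0.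
set T := [set v | _].
have mT : measurable (T : set plane).
  rewrite (_ : T = (fun v : plane => (p * v.1 + - q * v.2 + b, q * v.1 + p * v.2 + c)%R : plane) @^-1` square x y t).
    rewrite -[X in measurable X]setTI.
    have m : measurable_fun setT (fun v : plane => (p * v.1 + - q * v.2 + b, q * v.1 + p * v.2 + c)%R : plane).
      by apply: measurable_fun_pair; exact: plane_measurable_affine.
    exact: (m measurableT _ (square_measurable x y t)).
  by apply/funext => v; rewrite /T /mkset /preimage E.
have mQ := square_measurable x y t.
rewrite -(setIT T) -integral_indic//.
pose k (v : plane) : \bar R := (\1_(square x y t : set plane) v)%:E.
have -> : \int[area R]_v (\1_T v)%:E = \int[area R]_v k (p * v.1 + - q * v.2 + b, q * v.1 + p * v.2 + c)%R.
  apply: eq_integral => v _; rewrite /k !indicE; congr ((nat_of_bool _)%:R%:E).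
  by apply/asboolP/asboolP; rewrite /T /= E.
rewrite ge0_integral_rotation//; last first.
- by move=> v; rewrite lee_fin.
- by apply/measurable_EFinP; exact: measurable_indic.
by rewrite /k integral_indic// setIT area_square// N invrK -EFinM.
Qed.

Section OneSided.
Variables (U V : set R[i]) (f f' g g' : R[i] -> R[i]).
Hypothesis cp : conf_pair U V f f' g g'.
Variables (h : R * R -> R) (K : set (R * R)) (B : R).
Hypothesis U_bounded : forall x, U (tc x) -> (`|x.1| < B /\ `|x.2| < B)%R.
Hypothesis h_cont : forall x, V (tc x) -> {for x, continuous h}.
Hypothesis h_ge0 : forall x, V (tc x) -> (0 <= h x)%R.
Hypothesis compactK : compact K.
Hypothesis K_sub : K `<=` tc @^-1` V.
Hypothesis h_supp : forall x, V (tc x) -> ~ K x -> h x = 0%R.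

Let k (u : R * R) := (h (rmap f u) * cabs (f' (tc u)) ^+ 2)%R.
Let U' : set plane := tc @^-1` U.
Let V' : set plane := tc @^-1` V.

Lemma jacobian_cont x : U (tc x) -> {for x, continuous (fun u => (cabs (f' (tc u)) ^+ 2)%R)}.
Proof.
have [f'' hf'] := holo_deriv (cp_openU cp) (cp_holof cp).
have [A C] := holo_Cn 0 (cp_openU cp) hf'.
have D := CnD (CnX 2 A) (CnX 2 C).
move=> Ux; rewrite (_ : (fun u => _) = (fun u => Re (f' (tc u)) ^+ 2 + Im (f' (tc u)) ^+ 2)%R).
  exact: D.
by apply/funext => u; rewrite sqr_cabs.
Qed.

Lemma weighted_pullback_cont x : U (tc x) -> {for x, continuous k}.
Proof.
move=> Ux; have [A C] := holo_Cn 0 (cp_openU cp) (cp_holof cp).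
have H : Cn 0 V' h by exact: h_cont.
have := Cn_comp H A C; move=> /(_ _)/wrap[].
  by move=> u Uu; exact: (rmap_in cp).
move=> /(_ x Ux) hc.
exact: (@continuousM _ _ _ _ _ hc (jacobian_cont Ux)).
Qed.

Lemma weighted_pullback_ge0 x : U (tc x) -> (0 <= k x)%R.
Proof. by move=> Ux; rewrite mulr_ge0 ?sqr_ge0 ?h_ge0//; exact: rmap_in cp _ Ux. Qed.

Lemma rmap_square_measurable x y t : measurable (V' `&` rmap g @^-1` square x y t).
Proof.
have oV : open V' by exact: copen_open (cp_openV cp).
have [A C] := holo_Cn 0 (cp_openV cp) (cp_holog cp).
have -> : V' `&` rmap g @^-1` square x y t =
    (V' `&` (fun v => Re (g (tc v))) @^-1` `[x, (x + t)%R[) `&`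
    (V' `&` (fun v => Im (g (tc v))) @^-1` `[y, (y + t)%R[).
  by apply/seteqP; split=> v; [move=> [Vv [? ?]]|move=> [[Vv ?] [_ ?]]].
have mV := open2_measurable oV.
apply: measurableI; [have m := cont2_measurable oV A|have m := cont2_measurable oV C].
  exact: (m mV _ (measurable_itv _)).
exact: (m mV _ (measurable_itv _)).
Qed.

Lemma id_square_measurable x y t : measurable (U' `&` id @^-1` square x y t).
Proof.
apply: measurableI; first by apply: open2_measurable; apply: copen_open; exact: (cp_openU cp).
exact: square_measurable.
Qed.

(** A small square about [z0] is mapped by [f] into the image, under the linearization of [f] at
    [z0], of the square enlarged by [e * t] on every side. *)
Lemma area_image_square (e : R) z0 : (0 < e)%R -> U z0 ->
  exists2 d : R, (0 < d)%R & forall x y t, (0 < t < d)%R ->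
    (x <= Re z0 <= x + t)%R -> (y <= Im z0 <= y + t)%R ->
    area R (V' `&` rmap g @^-1` square x y t) <= (cabs (f' z0) ^+ 2 * ((1 + 2 * e) * t) ^+ 2)%:E.
Proof.
move=> e0 Uz0.
have a0 := conf_pair_deriv_neq0 cp Uz0.
set a := f' z0 in a0 *.
have A0 : (0 < cabs a)%R by rewrite cabs_gt0.
have k0 : (0 < e * cabs a / 2)%R by rewrite divr_gt0// mulr_gt0.
have [d d0 D] := cp_holof cp Uz0 k0.
exists (d / 2)%R; first by rewrite divr_gt0.
move=> x y t /andP[t0 td] /andP[x1 x2] /andP[y1 y2].
rewrite -(@area_rotated_square z0 (f z0) a (x - e * t)%R (y - e * t)%R) => [|//|]; last first.
  by rewrite mulr_ge0 ?(ltW t0)//; lra.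
have et : (0 <= e * t)%R by rewrite mulr_ge0// ltW.
apply: le_measure.
- by rewrite inE; exact: rmap_square_measurable.
- rewrite inE.
  have -> : [set v | square (x - e * t)%R (y - e * t)%R ((1 + 2 * e) * t)%R (of_complex (z0 + a^-1 * (tc v - f z0))%R)] =
      (fun v : plane => (Re (z0 + a^-1 * (tc v - f z0))%R, Im (z0 + a^-1 * (tc v - f z0))%R) : plane)
        @^-1` square (x - e * t)%R (y - e * t)%R ((1 + 2 * e) * t)%R by [].
  rewrite -[X in measurable X]setTI.
  have m : measurable_fun setT (fun v : plane => (Re (z0 + a^-1 * (tc v - f z0))%R, Im (z0 + a^-1 * (tc v - f z0))%R) : plane).
    apply: measurable_fun_pair.
      have := plane_measurable_affine (Re (a^-1)%R) (- Im (a^-1)%R) (Re (z0 - a^-1 * f z0)%R).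
      congr measurable_fun; apply/funext => v.
      by rewrite !ReImE /=; ring.
    have := plane_measurable_affine (Im (a^-1)%R) (Re (a^-1)%R) (Im (z0 - a^-1 * f z0)%R).
    congr measurable_fun; apply/funext => v.
    by rewrite !ReImE /=; ring.
  exact: (m measurableT _ (square_measurable _ _ _)).
move=> v [Vv]; rewrite /preimage /= => /squareP[/= /andP[u1 u2] /andP[w1 w2]].
have [Ug fg] := cp_g cp Vv.
set u := g (tc v) in u1 u2 w1 w2 Ug fg.
have ud : (cabs (u - z0) <= 2 * t)%R.
  apply: le_trans (cabs_leD _) _; rewrite !ReImE.
  have : (`|Re u - Re z0| <= t)%R by rewrite ler_norml; apply/andP; split; lra.
  have : (`|Im u - Im z0| <= t)%R by rewrite ler_norml; apply/andP; split; lra.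
  lra.
have := D (u - z0)%R; rewrite [(z0 + _)%R]addrC subrK => /(_ _)/wrap[|E]; first lra.
set r := (f u - f z0 - a * (u - z0))%R in E.
have -> : (z0 + a^-1 * (tc v - f z0) = u + a^-1 * r)%R by rewrite /r -fg; field.
have rt : (cabs (a^-1 * r) <= e * t)%R.
  rewrite cabsM cabsV mulrC ler_pdivrMr//.
  apply: le_trans E _; apply: le_trans (ler_wpM2l (ltW k0) ud) _.
  by rewrite le_eqVlt; apply/orP; left; apply/eqP; field.
have := le_trans (Re_le_cabs _) rt; have := le_trans (Im_le_cabs _) rt.
rewrite !ler_norml => /andP[r1 r2] /andP[r3 r4].
by apply/squareP; rewrite /= Re_add Im_add; split; apply/andP; split; lra.
Qed.

(** Bisection of a large square around [U], with an error [e * t ^+ 2] that is additive under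
    quartering. Near a point of [U] the image area is bounded above and the integrands are nearly
    constant; upper bounds are enough, since the reverse inequality is this one for the inverse
    map. *)
Lemma change_of_variables_le :
  \int[area R]_(v in V') (h v)%:E <= \int[area R]_(u in U') (k u)%:E.
Proof.
have oU : open U' by exact: copen_open (cp_openU cp).
have oV : open V' by exact: copen_open (cp_openV cp).
have [mU mV] := (open2_measurable oU, open2_measurable oV).
have mh : measurable_fun V' h by exact: cont2_measurable.
have mk : measurable_fun U' k by apply: cont2_measurable => // x; exact: weighted_pullback_cont.
pose C : R := (1 + `|B|)%R.
have C0 : (0 < C)%R by rewrite /C ltr_pwDl.
have squareC u : U' u -> square (- C) (- C) (2 * C) u.
  move=> /U_bounded[]; rewrite !ltr_norml => /andP[a b] /andP[c d].
  have := ler_norm B; rewrite -/C => ?.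
  by apply/squareP; split; apply/andP; split; rewrite /C; lra.
apply/lee_addgt0Pr => e0 e0_gt0.
have C2 : (0 < (2 * C) ^+ 2)%R by rewrite exprn_gt0// mulr_gt0.
pose e : R := (e0 / (2 * C) ^+ 2)%R.
have e_gt0 : (0 < e)%R by rewrite divr_gt0.
pose P x y t := \int[area R]_(v in V' `&` rmap g @^-1` square x y t) (h v)%:E <=
  \int[area R]_(u in U' `&` id @^-1` square x y t) (k u)%:E + (e * t ^+ 2)%:E.
suff : P (- C)%R (- C)%R (2 * C)%R.
  rewrite /P (_ : V' `&` _ = V'); last first.
    apply/seteqP; split=> [v []//|v Vv]; split => //.
    by apply: squareC; exact: (rmap_in (conf_pair_sym cp)).
  rewrite (_ : U' `&` _ = U'); last first.
    by apply/seteqP; split=> [v []//|v Uv]; split => //; exact: squareC.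
  by rewrite /e divfK// gt_eqF.
apply: (@rectangle_ind R P 1 1) => //; first by rewrite mulr_gt0.
  move=> x y t t0; rewrite !mulr1 /P => P1 P2 P3 P4.
  rewrite (integral_square_split _ _ t0 mV rmap_square_measurable mh h_ge0).
  rewrite (integral_square_split _ _ t0 mU id_square_measurable mk weighted_pullback_ge0).
  apply: le_trans (leeD (leeD P1 P2) (leeD P3 P4)) _.
  rewrite (_ : e * t ^+ 2 = e * (t / 2) ^+ 2 + e * (t / 2) ^+ 2 + (e * (t / 2) ^+ 2 + e * (t / 2) ^+ 2))%R; last by field.
  rewrite !EFinD; set r := (e * _)%:E.
  have H (a b c d : \bar R) : (a + r + (b + r)) + (c + r + (d + r)) = (a + b + (c + d)) + (r + r + (r + r)).
    by rewrite (addeACA a) (addeACA c) (addeACA (a + b)).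
  by rewrite H.
move=> p q _ _.
have [Uz|nUz] := pselect (U (p +i* q)%C); last first.
  (* At a point outside [U], which may lie on its boundary, the compact set that carries the
     integrand stays away, so the left-hand integral vanishes on small squares. *)
  have cK : closed (rmap g @` K).
    apply: compact_closed; first exact: norm_hausdorff.
    apply: continuous_compact => //; apply: continuous_in_subspaceT => x /[!inE] /K_sub Vx.
    exact: (rmap_cont (cp_holog cp)).
  have nK : (~` (rmap g @` K)) (p, q).
    by move=> [v /K_sub Vv E]; apply: nUz; have := rmap_in (conf_pair_sym cp) Vv; rewrite E.
  have [d d0 D] := (open2P _).1 (closed_openC cK) _ nK.
  exists d => // x y t /andP[t0 td]; rewrite !mulr1 => _ _ _ _ /andP[x1 x2] /andP[y1 y2].
  rewrite /P integral0_eq; last first.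
    move=> v [Vv]; rewrite /preimage /= => /squareP[/andP[u1 u2] /andP[w1 w2]].
    congr EFin; apply: h_supp => // Kv.
    have := D ((rmap g v).1 - p)%R ((rmap g v).2 - q)%R.
    rewrite (_ : (_, _) = rmap g v); last by rewrite [RHS]surjective_pairing; congr (_, _) => /=; ring.
    apply.
    - by rewrite ltr_norml; apply/andP; split; lra.
    - by rewrite ltr_norml; apply/andP; split; lra.
    - by exists v.
  apply: adde_ge0; last by rewrite lee_fin mulr_ge0 ?sqr_ge0// ltW.
  by apply: integral_ge0 => u [Uu _]; rewrite lee_fin weighted_pullback_ge0.
set m := h (rmap f (p, q)); set A := (cabs (f' (p +i* q)%C) ^+ 2)%R.
have Upq : U (tc (p, q)) by [].
have m0 : (0 <= m)%R by apply: h_ge0; exact: (rmap_in cp).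
have A0 : (0 <= A)%R by exact: sqr_ge0.
(* [eta] is the tolerated oscillation of [h (rmap f u)] and of [k], and [eps] the relative
   enlargement of the square. The terms [eta], [eta * A] and the excess area cost at most [e / 4]
   each. *)
have [eta [eta0 eta1 eta2 eta3]] : exists eta : R, [/\ 0 < eta, eta <= 1, eta <= e / 4 & eta * A <= e / 4]%R.
  exists (Num.min 1 (e / (4 * (1 + A))))%R; split.
  - by rewrite lt_min ltr01 divr_gt0// mulr_gt0//; lra.
  - by rewrite ge_min lexx.
  - rewrite ge_min; apply/orP; right; rewrite ler_pdivrMr; last by rewrite mulr_gt0//; lra.
    by nra.
  - apply: (@le_trans _ _ (e / (4 * (1 + A)) * A)%R).
      by rewrite ler_wpM2r// ge_min lexx orbT.
    rewrite mulrAC ler_pdivrMr; last by rewrite mulr_gt0//; lra.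
    by nra.
have [eps [eps0 eps1 eps2]] : exists eps : R, [/\ 0 < eps, eps <= 1 & 8 * eps * ((m + 1) * (A + 1)) <= e / 4]%R.
  have p0 : (0 < 32 * ((m + 1) * (A + 1)))%R by rewrite !mulr_gt0//; lra.
  exists (Num.min 1 (e / (32 * ((m + 1) * (A + 1)))))%R; split.
  - by rewrite lt_min ltr01 divr_gt0.
  - by rewrite ge_min lexx.
  - have : (Num.min 1 (e / (32 * ((m + 1) * (A + 1)))) * (32 * ((m + 1) * (A + 1))) <= e)%R.
      by rewrite -ler_pdivlMr// ge_min lexx orbT.
    by move: (Num.min _ _) => w; lra.
have [d1 d10 D1] := area_image_square eps0 Uz.
have [d2 d20 D2] := (open2P _).1 oU (p, q) Upq.
have hfc : {for (p, q), continuous (fun u => h (rmap f u))}.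
  have [X Y] := holo_Cn 0 (cp_openU cp) (cp_holof cp).
  have H : Cn 0 V' h by exact: h_cont.
  have := Cn_comp H X Y; move=> /(_ _)/wrap[|]; first by move=> u; exact: (rmap_in cp).
  by move=> /(_ (p, q) Upq).
have [d3 d30 D3] := (cont2P _ _).1 hfc eta eta0.
have [d4 d40 D4] := (cont2P _ _).1 (weighted_pullback_cont Upq) eta eta0.
exists (Num.min (Num.min d1 d2) (Num.min d3 d4)); first by rewrite !lt_min d10 d20 d30.
move=> x y t; rewrite !lt_min => /andP[t0 /andP[/andP[t1 t2] /andP[t3 t4]]].
rewrite !mulr1 => _ _ _ _ xp yq.
have t01 : (0 < t < d1)%R by rewrite t0.
have {D1} := D1 x y t t01 xp yq; rewrite -/A => D1.
move: xp yq => /andP[x1 x2] /andP[y1 y2].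
have near u : square x y t u -> [/\ U' u, (h (rmap f u) <= m + eta)%R & (m * A <= k u + eta)%R].
  move=> /squareP[/andP[u1 u2] /andP[w1 w2]].
  have E : u = (p + (u.1 - p), q + (u.2 - q))%R.
    by rewrite ![(p + _)%R]addrC ![(q + _)%R]addrC !subrK -surjective_pairing.
  have n1 : (`|u.1 - p| <= t)%R by exact: itv_dist x1 x2 u1 (ltW u2).
  have n2 : (`|u.2 - q| <= t)%R by exact: itv_dist y1 y2 w1 (ltW w2).
  split.
  - by rewrite E; apply: D2; exact: le_lt_trans t2.
  - have := D3 _ _ (le_lt_trans n1 t3) (le_lt_trans n2 t3); rewrite -E -/m ltr_norml => /andP[_].
    by rewrite ltrBlDl => /ltW.
  - have := D4 _ _ (le_lt_trans n1 t4) (le_lt_trans n2 t4); rewrite -E ltr_norml => /andP[+ _].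
    by rewrite -[k (p, q)]/(m * A)%R ltrBrDr addrC ltrBlDr => /ltW.
have mQ := square_measurable x y t.
have UQ : U' `&` id @^-1` square x y t = square x y t.
  by apply/seteqP; split=> [u []//|u Qu]; split => //; have [] := near u Qu.
have L1 : \int[area R]_(v in V' `&` rmap g @^-1` square x y t) (h v)%:E <=
    ((m + eta) * (A * ((1 + 2 * eps) * t) ^+ 2))%:E.
  apply: (@le_trans _ _ (\int[area R]_(v in V' `&` rmap g @^-1` square x y t) (cst (m + eta)%:E) v)).
    apply: ge0_le_integral.
    - exact: rmap_square_measurable.
    - by move=> v [Vv _]; rewrite lee_fin h_ge0.
    - by apply/measurable_EFinP; apply: measurable_funS mh.
    - exact: measurable_cst.
    - move=> v [Vv Qv]; rewrite lee_fin; have [_ + _] := near _ Qv.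
      by rewrite (rmapK (conf_pair_sym cp)).
  rewrite integral_cst; last exact: rmap_square_measurable.
  by rewrite EFinM lee_wpmul2l// lee_fin addr_ge0// ltW.
have L2 : (m * A * t ^+ 2)%:E <= \int[area R]_(u in square x y t) (k u)%:E + (eta * t ^+ 2)%:E.
  have -> : (eta * t ^+ 2)%:E = \int[area R]_(u in (square x y t : set plane)) (cst eta%:E) u.
    by rewrite integral_cst// area_square// ltW.
  have -> : (m * A * t ^+ 2)%:E = \int[area R]_(u in (square x y t : set plane)) (cst (m * A)%:E) u.
    by rewrite integral_cst// area_square// ltW.
  have mkQ : measurable_fun (square x y t : set plane) (EFin \o k).
    by apply/measurable_EFinP; apply: measurable_funS mk => // u /near[].
  rewrite -ge0_integralD//=; last first.
  - by move=> u _; rewrite lee_fin ltW.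
  - by move=> u /near[Uu _ _]; rewrite lee_fin weighted_pullback_ge0.
  apply: ge0_le_integral => //=.
  - by move=> u _; rewrite lee_fin mulr_ge0.
  - by apply: emeasurable_funD => //; exact: measurable_cst.
  - by move=> u /near[_ _ ?]; rewrite -EFinD lee_fin.
rewrite /P UQ; apply: le_trans L1 _.
have -> : (e * t ^+ 2)%:E = (eta * t ^+ 2)%:E + ((e - eta) * t ^+ 2)%:E by rewrite -EFinD; congr EFin; ring.
rewrite addeA; apply: le_trans (leeD L2 (lexx _)); rewrite -EFinD lee_fin.
have T0 : (0 <= t ^+ 2)%R by exact: sqr_ge0.
rewrite (_ : (m + eta) * (A * ((1 + 2 * eps) * t) ^+ 2) = (m + eta) * (A * (1 + 2 * eps) ^+ 2) * t ^+ 2)%R; last by ring.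
rewrite -mulrDl ler_wpM2r//.
have : ((m + eta) * A * (4 * eps + 4 * eps ^+ 2) <= 8 * eps * ((m + 1) * (A + 1)))%R.
  rewrite mulrC; apply: ler_pM.
  - by rewrite addr_ge0 ?mulr_ge0 ?sqr_ge0 ?(ltW eps0).
  - exact: mulr_ge0 (addr_ge0 m0 (ltW eta0)) A0.
  - by rewrite expr2; nra.
  - apply: ler_pM; [exact: addr_ge0 m0 (ltW eta0)|exact: A0|by rewrite lerD2l|by rewrite lerDl].
have -> : ((m + eta) * (A * (1 + 2 * eps) ^+ 2) = (m + eta) * A * (4 * eps + 4 * eps ^+ 2) + m * A + eta * A)%R by ring.
by move=> H; lra.
Qed.

End OneSided.

(** The reverse inequality is the same one-sided bound for the inverse map, applied to the
    transported integrand; the two Jacobian factors then multiply to [1]. *)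
Theorem change_of_variables (U V : set R[i]) f f' g g' h (K : set (R * R)) (B : R) :
  conf_pair U V f f' g g' ->
  (forall x, U (tc x) -> (`|x.1| < B /\ `|x.2| < B)%R) ->
  (forall x, V (tc x) -> (`|x.1| < B /\ `|x.2| < B)%R) ->
  (forall x, V (tc x) -> {for x, continuous h}) ->
  (forall x, V (tc x) -> (0 <= h x)%R) ->
  compact K -> K `<=` tc @^-1` V -> (forall x, V (tc x) -> ~ K x -> h x = 0%R) ->
  \int[area R]_(v in tc @^-1` V) (h v)%:E =
  \int[area R]_(u in tc @^-1` U) (h (rmap f u) * cabs (f' (tc u)) ^+ 2)%:E.
Proof.
move=> cp Ub Vb hc h0 cK KV hK; apply/eqP; rewrite eq_le; apply/andP; split.
  exact: (change_of_variables_le cp Ub hc h0 cK KV hK).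
have cp' := conf_pair_sym cp.
have := @change_of_variables_le V U g g' f f' cp' (fun u => (h (rmap f u) * cabs (f' (tc u)) ^+ 2)%R)
  (rmap g @` K) B Vb _ _ _ _ _ => /(_ _ _ _ _ _)/wrap[].
- by move=> x Ux; exact: (weighted_pullback_cont cp hc).
- by move=> x Ux; exact: (weighted_pullback_ge0 cp h0).
- apply: continuous_compact => //; apply: continuous_in_subspaceT => x /[!inE] /KV Vx.
  exact: (rmap_cont (cp_holog cp)).
- by move=> _ [x /KV Vx <-]; exact: (rmap_in cp').
- move=> x Ux nK; rewrite hK ?mul0r//; first exact: (rmap_in cp).
  by move=> Kx; apply: nK; exists (rmap f x) => //; exact: (rmapK cp).
move/le_trans; apply; rewrite le_eqVlt; apply/orP; left; apply/eqP.
apply: eq_integral => v /[!inE] Vv; congr EFin.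
rewrite (rmapK cp')// -mulrA -exprMn -cabsM /rmap of_complexK.
by rewrite (conf_pair_deriv cp' Vv) cabs1 expr1n mulr1.
Qed.

End ChangeOfVariables.

(** * A Sobolev inequality *)

Section CompactSupport.
Variable R : realType.
Local Notation plane := (measurableTypeR R * measurableTypeR R)%type.
Local Notation lambda := (@lebesgue_measure R).
Implicit Types (h phi w : R * R -> R) (x : R * R).

Lemma eps_is_derive (f : R -> R) (x l : R) :
  (forall e : R, 0 < e -> exists2 d : R, 0 < d & forall t : R, `|t| < d ->
    `|f (x + t) - f x - t * l| <= e * `|t|) ->
  is_derive x 1 f l.
Proof.
move=> H.
have cv : h^-1 *: (f (h *: 1 + x) - f x) @[h --> 0^'] --> l.
  apply/cvgrPdist_lt => e e0; have e2 : 0 < e / 2 by lra.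
  have [d d0 D] := H _ e2.
  apply/nbhs_ballP; exists d => //= t; rewrite /ball/= sub0r normrN => td t0.
  have := D t td.
  rewrite (_ : t *: 1 + x = x + t); last by rewrite addrC /GRing.scale/= mulr1.
  move=> {}D; rewrite distrC /GRing.scale /=.
  have -> : t^-1 * (f (x + t) - f x) - l = t^-1 * (f (x + t) - f x - t * l).
    by field.
  have nt : 0 < `|t| by rewrite normr_gt0.
  by rewrite normrM normfV mulrC ltr_pdivrMr// (le_lt_trans D)// ltr_pM2r//; lra.
split; first by apply/cvg_ex; exists l.
exact/cvg_lim.
Qed.

Lemma rdiff_slice1 phi x a b : rdiff phi x a b -> is_derive x.1 1 (fun t => phi (t, x.2)) a.
Proof.
move=> H; apply: eps_is_derive => e e0; have [d d0 D] := H e e0; exists d => // t td.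
have zd : `|0 : R| < d by rewrite normr0.
have := D t 0 td zd; rewrite !mulr0 !addr0 normr0 addr0 (mulrC t).
by rewrite -surjective_pairing.
Qed.

Lemma rdiff_slice2 phi x a b : rdiff phi x a b -> is_derive x.2 1 (fun t => phi (x.1, t)) b.
Proof.
move=> H; apply: eps_is_derive => e e0; have [d d0 D] := H e e0; exists d => // t td.
have zd : `|0 : R| < d by rewrite normr0.
have := D 0 t zd td; rewrite !mulr0 !addr0 normr0 !add0r (mulrC t).
by rewrite -surjective_pairing.
Qed.

Definition Cc h := continuous h /\ exists2 K, compact K & forall x, ~ K x -> h x = 0.

Lemma compact_box (K : set (R * R)) : compact K ->
  exists2 B : R, 0 < B & forall x, K x -> `|x.1| < B /\ `|x.2| < B.
Proof.
move=> /compact_bounded[M [_ H]].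
exists (`|M| + 2) => [|x Kx]; first by rewrite ltr_pwDr.
have := H (`|M| + 1) _ _ Kx => /(_ _)/wrap[|]; first by rewrite ltr_pwDr// ler_norm.
by rewrite /= prod_normE ge_max => /andP[A B]; split; lra.
Qed.

Lemma Cc_bound h : Cc h -> exists2 M : R, 0 <= M & forall x, `|h x| <= M.
Proof.
move=> [hc [K cK hK]].
have : compact (h @` K) by apply: continuous_compact => //; exact: continuous_subspaceT.
move=> /compact_bounded[M [_ H]].
exists (`|M| + 1) => [|x]; first by rewrite addr_ge0.
have [Kx|/hK ->] := pselect (K x); last by rewrite normr0 addr_ge0.
by apply: (H (`|M| + 1)); [rewrite ltr_pwDr// ler_norm|exists x].
Qed.

Definition box (B : R) : set (R * R) := `[- B, B]%classic `*` `[- B, B]%classic.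

Lemma boxP (B : R) x : box B x <-> `|x.1| <= B /\ `|x.2| <= B.
Proof. by rewrite /box /= !in_itv/= !ler_norml. Qed.

Lemma box_measurable (B : R) : measurable (box B : set plane).
Proof. by apply: measurableX; exact: measurable_itv. Qed.

Lemma area_box (B : R) : 0 <= B -> area R (box B) = ((2 * B) ^+ 2)%:E.
Proof.
move=> B0.
transitivity (lambda `[(- B)%R, B]%classic * lambda `[(- B)%R, B]%classic)%E.
  by apply: product_measure1E; exact: measurable_itv.
rewrite !lebesgue_measure_itv/= !lte_fin.
move: B0; rewrite le_eqVlt => /predU1P[<-|B0]; first by rewrite oppr0 ltxx mule0 mulr0 expr0n.
rewrite ifT; last by lra.
by rewrite -!EFinB -EFinM; congr EFin; ring.
Qed.

Lemma box_compact (B : R) : compact (box B).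
Proof. by apply: compact_setX; exact: segment_compact. Qed.

Lemma Cc_integrable h : Cc h -> (area R).-integrable setT (EFin \o h).
Proof.
move=> Ch; have [M M0 hM] := Cc_bound Ch; case: Ch => hc [K cK hK].
have [B B0 KB] := compact_box cK.
have -> : EFin \o h = (EFin \o h) \_ (box B).
  apply/funext => x; rewrite patchE; case: ifPn => // /negP; rewrite inE => xB.
  rewrite /= hK// => /KB[? ?]; apply: xB; apply/boxP; split; exact: ltW.
apply/(integrable_mkcond _ (box_measurable B)).
apply: measurable_bounded_integrable.
- exact: box_measurable.
- by rewrite /= area_box ?ltW// ltry.
- by apply: measurable_funTS; exact: cont2_measurableT.
exists M; split; first exact: num_real.
by move=> m Mm x _ /=; apply: le_trans (hM x) (ltW Mm).
Qed.

Lemma abs_powR_cont (p : R) : 0 < p -> continuous (fun t : R => `|t| `^ p).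
Proof.
move=> p0 t; have [->|t0] := eqVneq t 0.
  apply/cvgrPdist_lt => e e0; rewrite normr0 powR0 ?gt_eqF//.
  have d0 : 0 < e `^ p^-1 by rewrite powR_gt0.
  apply/nbhs_ballP; exists (e `^ p^-1) => //= s; rewrite /ball/= sub0r normrN => sd.
  rewrite sub0r normrN ger0_norm ?powR_ge0//.
  have -> : e = (e `^ p^-1) `^ p by rewrite -powRrM mulVf ?gt_eqF// powRr1 ?ltW.
  by rewrite gt0_ltr_powR// ?nnegrE ?ltW.
apply: (@continuous_comp _ _ _ (fun t : R => `|t|) (fun t : R => t `^ p)); first exact: norm_continuous.
apply: differentiable_continuous; apply/derivable1_diffP.
by apply: derivable_powR; rewrite in_itv/= normr_gt0 t0.
Qed.

Local Open Scope ereal_scope.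

Lemma integral_supp (D : set (R * R)) (k : R * R -> \bar R) : (forall x, ~ D x -> k x = 0) ->
  \int[area R]_(x in D) k x = \int[area R]_x k x.
Proof.
move=> kD; rewrite integral_mkcond; apply: eq_integral => x _.
by rewrite patchE; case: ifPn => // /negP; rewrite inE => /kD.
Qed.

Section OneVariable.
Variables (v v' : R -> R) (B : R).
Hypothesis v_derive : forall t : R, is_derive t (1%R : R) v (v' t).
Hypothesis v'_cont : continuous v'.
Hypothesis v_supp : forall t, (B <= `|t|)%R -> v t = 0%R.
Hypothesis v'_supp : forall t, (B <= `|t|)%R -> v' t = 0%R.

Lemma integral_deriv (a b : R) : (a < b)%R ->
  \int[lambda]_(t in `[a, b]) (v' t)%:E = (v b - v a)%:E.
Proof.
move=> ab; have vd t : derivable v t 1 by case: (v_derive t).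
have vc t : {for t, continuous v}.
  by apply: differentiable_continuous; apply/derivable1_diffP.
rewrite (@continuous_FTC2 _ v' v)//.
- exact: continuous_subspaceT.
- split => [t _//||]; first by apply: cvg_at_right_filter; exact: vc.
  by apply: cvg_at_left_filter; exact: vc.
- by move=> t _; rewrite derive1E; case: (v_derive t).
Qed.

(** The value at [t] is the integral of the derivative from a point [a] to the left of both [t] and
    the support. *)
Lemma abs_le_integral_deriv (t : R) : `|v t|%:E <= \int[lambda]_s `|v' s|%:E.
Proof.
set a := (- (`|B| + `|t|) - 1)%R.
have at_ : (a < t)%R by rewrite /a; have := ler_norm (- t); rewrite normrN; have := normr_ge0 B; lra.
have va : v a = 0%R.
  by apply: v_supp; have := ler_norm B; have := ler_norm (- a); rewrite normrN /a; have := normr_ge0 t; lra.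
have := integral_deriv at_; rewrite va subr0 => E.
rewrite -(@abse_EFin _ (v t)) -E.
have mv' : measurable_fun setT v' by exact: continuous_measurable_fun.
apply: le_trans (le_abse_integral _ _ _) _ => //.
  by apply/measurable_EFinP; exact: measurable_funTS.
apply: (@le_trans _ _ (\int[lambda]_(s in `[a, t]) `|v' s|%:E)); first exact: le_refl.
apply: ge0_subset_integral => //.
apply/measurable_EFinP; exact: measurableT_comp.
Qed.

Lemma integral_deriv_eq0 : \int[lambda]_t (v' t)%:E = 0.
Proof.
pose C := (`|B| + 1)%R.
have C0 : (- C < C)%R by rewrite /C; have := normr_ge0 B; lra.
have BC : (B <= `|C|)%R by have := ler_norm B; have := ler_norm C; rewrite /C; lra.
transitivity (\int[lambda]_(t in `[(- C)%R, C]) (v' t)%:E).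
  rewrite [RHS]integral_mkcond; apply: eq_integral => t _.
  rewrite patchE; case: ifPn => // /negP; rewrite inE/= in_itv/= -ler_norml => /negP.
  rewrite -ltNge => tC; rewrite v'_supp//.
  by have := ler_norm B; move: tC; rewrite /C; lra.
by rewrite integral_deriv// v_supp// (v_supp (t := (- C)%R)) ?subr0// normrN.
Qed.

End OneVariable.

End CompactSupport.

(** * Integration by parts and the Sobolev inequality *)

Section CompactC1.
Variable R : realType.
Local Notation plane := (measurableTypeR R * measurableTypeR R)%type.
Local Notation lambda := (@lebesgue_measure R).
Implicit Types (h phi w a b : R * R -> R) (x : R * R).

Lemma Cc_box h : Cc h -> exists2 B : R, 0 < B &
  forall x, B <= `|x.1| \/ B <= `|x.2| -> h x = 0.
Proof.
move=> [_ [K /compact_box[B B0 KB] hK]]; exists B => // x xB; apply: hK => /KB[].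
by case: xB => ? ? ?; lra.
Qed.

Lemma CcM h phi : continuous h -> Cc phi -> Cc (fun x => h x * phi x).
Proof.
move=> hc [pc [K cK pK]]; split; last by exists K => // x /pK ->; rewrite mulr0.
by move=> x; apply: continuousM; [exact: hc|exact: pc].
Qed.

Lemma CcD h phi : Cc h -> Cc phi -> Cc (fun x => h x + phi x).
Proof.
move=> [hc [K cK hK]] [pc [L cL pL]]; split.
  by move=> x; apply: continuousD; [exact: hc|exact: pc].
exists (K `|` L); first exact: compactU.
by move=> x /not_orP[/hK -> /pL ->]; rewrite addr0.
Qed.

(** The gradient [(a, b)] is carried along, so that the gradients of products and powers stay
    explicit. *)
Record Cc1 w a b : Prop := MkCc1 {
  Cc1_rdiff : forall x, rdiff w x (a x) (b x);
  Cc1_fun : Cc w; Cc1_fst : Cc a; Cc1_snd : Cc b }.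

Lemma Cc1M w a b w' a' b' : Cc1 w a b -> Cc1 w' a' b' ->
  Cc1 (fun x => w x * w' x) (fun x => w' x * a x + w x * a' x) (fun x => w' x * b x + w x * b' x).
Proof.
move=> [D W A B] [D' W' A' B']; have [[wc _] [w'c _]] := (W, W').
split; first by move=> x; apply: rdiffM.
- exact: CcM.
- by apply: CcD; exact: CcM.
- by apply: CcD; exact: CcM.
Qed.

Lemma Cc1X w a b n : Cc1 w a b ->
  Cc1 (fun x => w x ^+ n.+1) (fun x => n.+1%:R * w x ^+ n * a x) (fun x => n.+1%:R * w x ^+ n * b x).
Proof.
move=> H; elim: n => [|n IH].
  congr Cc1: H; apply/funext => x; rewrite ?expr1// expr0 mulr1 mul1r//.
congr Cc1: (Cc1M H IH); apply/funext => x.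
- by rewrite -[n.+2]addn1 natrD !exprS; ring.
- by rewrite -[n.+2]addn1 natrD !exprS; ring.
Qed.

Lemma compact_support_Cc D phi h : test_function D phi -> continuous h ->
  (forall x, ~ supp phi x -> h x = 0) -> Cc h.
Proof. by move=> [_ cK _] hc hK; split => //; exists (supp phi). Qed.

Lemma test_Cn D phi n : test_function D phi -> Cn n setT phi.
Proof. by move=> [/smoothP]. Qed.

Lemma test_cont D phi : test_function D phi -> continuous phi.
Proof. by move=> /(test_Cn 0) H x; exact: H. Qed.

Lemma test_partial_cont D phi i : test_function D phi -> continuous (partial i phi).
Proof. by move=> /(test_Cn 1)/(Cn_partial _ _ openT)[_ /(_ i)] H x; exact: H. Qed.

Lemma test_Cc1 D phi : test_function D phi -> Cc1 phi (partial false phi) (partial true phi).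
Proof.
move=> t; split.
- by move: t => /(test_Cn 1)/(Cn_partial _ _ openT)[+ _] => H x; exact: H.
- by apply: (compact_support_Cc t (test_cont t)); exact: supp_notin.
- by apply: (compact_support_Cc t (test_partial_cont t)) => x; exact: supp_partial.
- by apply: (compact_support_Cc t (test_partial_cont t)) => x; exact: supp_partial.
Qed.

Lemma Cc1_slice1 w a b : Cc1 w a b -> exists B : R,
  [/\ 0 < B, (forall x : R * R, (B <= `|x.1|) -> w x = 0) & (forall x : R * R, (B <= `|x.1|) -> a x = 0)].
Proof.
move=> [_ /Cc_box[B B0 wB] /Cc_box[C C0 aC] _].
exists (B + C); split; [lra|move=> x ?; apply: wB; left; lra|move=> x ?; apply: aC; left; lra].
Qed.

Lemma Cc1_slice2 w a b : Cc1 w a b -> exists B : R,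
  [/\ 0 < B, (forall x : R * R, (B <= `|x.2|) -> w x = 0) & (forall x : R * R, (B <= `|x.2|) -> b x = 0)].
Proof.
move=> [_ /Cc_box[B B0 wB] _ /Cc_box[C C0 aC]].
exists (B + C); split; [lra|move=> x ?; apply: wB; right; lra|move=> x ?; apply: aC; right; lra].
Qed.

Lemma slice1_cont h (y : R) : continuous h -> continuous (fun t : R => h (t, y)).
Proof.
move=> hc t; apply: (@continuous_comp _ _ _ (fun t : R => (t, y)) h); last exact: hc.
by have := cvg_pair (@cvg_id _ (nbhs t)) (@cvg_cst _ y _ (nbhs t) _); apply.
Qed.

Lemma slice2_cont h (y : R) : continuous h -> continuous (fun t : R => h (y, t)).
Proof.
move=> hc t; apply: (@continuous_comp _ _ _ (fun t : R => (y, t)) h); last exact: hc.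
by have := cvg_pair (@cvg_cst _ y _ (nbhs t) _) (@cvg_id _ (nbhs t)); apply.
Qed.

Local Open Scope ereal_scope.

Lemma integral_partial1 w a b : Cc1 w a b -> \int[area R]_x (a x)%:E = 0.
Proof.
move=> C1; have [B [B0 wB aB]] := Cc1_slice1 C1.
have ia := Cc_integrable (Cc1_fst C1).
rewrite -(integral21_prod_meas1 ia) /fubini_G /=; apply: integral0_eq => y _.
apply: (@integral_deriv_eq0 R (fun t => w (t, y)) _ B).
- by move=> t; exact: (rdiff_slice1 (Cc1_rdiff C1 (t, y))).
- by apply: slice1_cont; case: (Cc1_fst C1).
- by move=> t tB; rewrite wB.
- by move=> t tB; rewrite aB.
Qed.

Lemma integral_partial2 w a b : Cc1 w a b -> \int[area R]_x (b x)%:E = 0.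
Proof.
move=> C1; have [B [B0 wB aB]] := Cc1_slice2 C1.
have ia := Cc_integrable (Cc1_snd C1).
rewrite -(integral12_prod_meas1 ia) /fubini_F /=; apply: integral0_eq => y _.
apply: (@integral_deriv_eq0 R (fun t => w (y, t)) _ B).
- by move=> t; exact: (rdiff_slice2 (Cc1_rdiff C1 (y, t))).
- by apply: slice2_cont; case: (Cc1_snd C1).
- by move=> t tB; rewrite wB.
- by move=> t tB; rewrite aB.
Qed.

(* On horizontal and vertical lines [w] is bounded by the integral of its
   derivative; the product of both bounds is integrated by Tonelli. *)
Lemma gagliardo w a b : Cc1 w a b ->
  \int[area R]_x (w x ^+ 2)%:E <= (\int[area R]_x `|a x|%:E) * (\int[area R]_x `|b x|%:E).
Proof.
move=> C1; have [[[wc _] [ac _]] [bc _]] := (Cc1_fun C1, Cc1_fst C1, Cc1_snd C1).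
have meas h : continuous h -> measurable_fun (setT : set plane) (fun x => (`|h x|)%:E).
  move=> hc; apply/measurable_EFinP; apply: measurableT_comp => //.
  exact: cont2_measurableT.
have [ma mb] := (meas _ ac, meas _ bc).
pose F (y : measurableTypeR R) := \int[lambda]_t `|a (t, y)|%:E.
pose G (x : measurableTypeR R) := \int[lambda]_t `|b (x, t)|%:E.
have F0 y : 0 <= F y by apply: integral_ge0 => t _; rewrite lee_fin.
have G0 y : 0 <= G y by apply: integral_ge0 => t _; rewrite lee_fin.
have a0 x : setT x -> 0 <= `|a x|%:E by rewrite lee_fin.
have b0 x : setT x -> 0 <= `|b x|%:E by rewrite lee_fin.
have mF : measurable_fun setT F.
  apply: (@measurable_fun_fubini_tonelli_G _ _ _ _ R lambda (fun x : plane => `|a x|%:E)) => // x; exact: a0.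
have mG : measurable_fun setT G.
  apply: (@measurable_fun_fubini_tonelli_F _ _ _ _ R lambda (fun x : plane => `|b x|%:E)) => // x; exact: b0.
have mFG : measurable_fun (setT : set plane) (fun x : plane => F x.2 * G x.1).
  apply: emeasurable_funM.
    by apply: (measurableT_comp mF); exact: measurable_snd.
  by apply: (measurableT_comp mG); exact: measurable_fst.
have B x : (w x ^+ 2)%:E <= F x.2 * G x.1.
  have -> : (w x ^+ 2)%R = (`|w x| * `|w x|)%R by rewrite -normrM -expr2 ger0_norm// sqr_ge0.
  rewrite EFinM; apply: lee_pmul; rewrite ?lee_fin//.
    have [B [B0 wB aB]] := Cc1_slice1 C1.
    rewrite [in X in X <= _](surjective_pairing x).
    apply: (@abs_le_integral_deriv R (fun t => w (t, x.2)) _ B).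
    - by move=> t; exact: (rdiff_slice1 (Cc1_rdiff C1 (t, x.2))).
    - exact: slice1_cont.
    - by move=> t tB; rewrite wB.
  have [B [B0 wB aB]] := Cc1_slice2 C1.
  rewrite [in X in X <= _](surjective_pairing x).
  apply: (@abs_le_integral_deriv R (fun t => w (x.1, t)) _ B).
  - by move=> t; exact: (rdiff_slice2 (Cc1_rdiff C1 (x.1, t))).
  - exact: slice2_cont.
  - by move=> t tB; rewrite wB.
apply: (@le_trans _ _ (\int[area R]_x (F x.2 * G x.1))).
  apply: ge0_le_integral => //.
  - by move=> x _; rewrite lee_fin sqr_ge0.
  - apply/measurable_EFinP; apply: measurable_funX; exact: cont2_measurableT.
rewrite /area fubini_tonelli1//; last by move=> x; rewrite mule_ge0.
rewrite /fubini_F/= (fubini_tonelli2 (fun x : plane => `|a x|%:E))//.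
rewrite (fubini_tonelli1 (fun x : plane => `|b x|%:E))// /fubini_F /fubini_G.
rewrite -/F -/G.
rewrite (eq_integral (fun x : measurableTypeR R => (\int[lambda]_y F y) * G x)); last first.
  by move=> x _; rewrite ge0_integralZr.
by rewrite ge0_integralZl//; apply: integral_ge0.
Qed.

(** A bound for the integral of [phi^(2 q)] at energy at most [1]. It starts from the area of the
    box; the recursion is [gagliardo] for [phi^q], with both factors estimated by
    [sobolev_derivative_le]. *)
Fixpoint sobolev_const (B : R) (q : nat) : R :=
  if q is q'.+1 then ((q%:R / 2) * (sobolev_const B q' + 1)) ^+ 2 else (2 * B) ^+ 2.

Lemma sobolev_const_ge0 (B : R) q : (0 <= sobolev_const B q)%R.
Proof. by case: q => [|q]; exact: sqr_ge0. Qed.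

Section SobolevPowers.
Variables (B : R) (phi : R * R -> R) (a b : R * R -> R).
Hypothesis B_gt0 : (0 < B)%R.
Hypothesis phi_Cc1 : Cc1 phi a b.
Hypothesis phi_box : forall x, ~ box B x -> phi x = 0%R.
Hypothesis a_box : forall x, ~ box B x -> a x = 0%R.
Hypothesis b_box : forall x, ~ box B x -> b x = 0%R.
Hypothesis energy_le1 : \int[area R]_x (a x ^+ 2 + b x ^+ 2)%:E <= 1.

(** This is [2 |phi^q d| <= phi^(2 q) + d^2], where the last term integrates to at most the energy.
    It is used for both partial derivatives [d]. *)
Lemma sobolev_derivative_le (q : nat) (S : R) (d : R * R -> R) : Cc d -> (forall x, ~ box B x -> d x = 0%R) ->
  (forall x, d x ^+ 2 <= a x ^+ 2 + b x ^+ 2)%R ->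
  \int[area R]_(x in (box B : set plane)) (phi x ^+ (2 * q))%:E <= S%:E ->
  \int[area R]_x `|q.+1%:R * phi x ^+ q * d x|%:E <= ((q.+1%:R / 2) * (S + 1))%:E.
Proof.
move=> [dc _] d_box d_le phiq.
have [[pc _] [ac _] [bc _]] := And3 (Cc1_fun phi_Cc1) (Cc1_fst phi_Cc1) (Cc1_snd phi_Cc1).
have mX (h : R * R -> R) n : continuous h -> measurable_fun (setT : set plane) (fun x => h x ^+ n)%R.
  by move=> hc; apply: measurable_funX; exact: cont2_measurableT.
rewrite -(@integral_supp _ (box B)) => [|x xB]; last by rewrite d_box// mulr0 normr0.
apply: (@le_trans _ _ (\int[area R]_(x in (box B : set plane))
   ((q.+1%:R / 2)%:E * ((phi x ^+ (2 * q))%:E + (a x ^+ 2 + b x ^+ 2)%:E)))).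
  apply: ge0_le_integral => //.
  - exact: box_measurable.
  - apply/measurable_EFinP; apply: measurableT_comp => //; apply: measurable_funM; last first.
      by apply: measurable_funTS; exact: cont2_measurableT.
    by apply: measurable_funM => //; apply: measurable_funTS; exact: mX.
  - apply: measurable_funTS; apply: emeasurable_funM => //; apply: emeasurable_funD; apply/measurable_EFinP; first exact: mX.
    by apply: measurable_funD; exact: mX.
  move=> x _; rewrite -EFinD -EFinM lee_fin.
  rewrite mulnC exprM normrM normrM ger0_norm// -mulrA -mulrA ler_wpM2l//.
  have := d_le x; rewrite -(real_normK (num_real (d x))) -(real_normK (num_real (phi x ^+ q))).
  by move: (`|_|)%R (`|_|)%R => u v; have := sqr_ge0 (u - v)%R; nra.
have ge0D x : (0 <= a x ^+ 2 + b x ^+ 2)%R by rewrite addr_ge0 ?sqr_ge0.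
have ge0X x : (0 <= phi x ^+ (2 * q))%R by rewrite exprM exprn_ge0 ?sqr_ge0.
have mD : measurable_fun (setT : set plane) (fun x => (a x ^+ 2 + b x ^+ 2)%:E).
  by apply/measurable_EFinP; apply: measurable_funD; exact: mX.
have mP : measurable_fun (setT : set plane) (fun x => (phi x ^+ (2 * q))%:E).
  by apply/measurable_EFinP; exact: mX.
have mB := box_measurable B.
rewrite ge0_integralZl//; last 2 first.
- by apply: measurable_funTS; exact: emeasurable_funD.
- by move=> x _; rewrite -EFinD lee_fin addr_ge0.
rewrite [X in _ <= X]EFinM lee_wpmul2l ?lee_fin//.
rewrite ge0_integralD//=; last 4 first.
- by move=> x _; rewrite lee_fin.
- exact: measurable_funTS.
- by move=> x _; rewrite lee_fin.
- exact: measurable_funTS.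
rewrite EFinD leeD//; apply: le_trans energy_le1.
by apply: ge0_subset_integral => // x _; rewrite lee_fin.
Qed.

Lemma sobolev_even (q : nat) :
  \int[area R]_(x in (box B : set plane)) (phi x ^+ (2 * q))%:E <= (sobolev_const B q)%:E.
Proof.
elim: q => [|q IH].
  rewrite (eq_integral (cst 1)) => [|x _]; last by rewrite muln0 expr0.
  by rewrite integral_cst ?mul1e ?area_box//; [exact: ltW|exact: box_measurable].
have S0 : (0 <= q.+1%:R / 2 * (sobolev_const B q + 1))%R.
  by rewrite mulr_ge0// addr_ge0 ?sobolev_const_ge0.
rewrite integral_supp; last by move=> x /phi_box ->; rewrite mulnC exprM expr0n/= expr0n.
under eq_integral do rewrite mulnC exprM.
apply: le_trans (gagliardo (Cc1X q phi_Cc1)) _.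
rewrite [sobolev_const _ _]expr2 EFinM; apply: lee_pmul.
- by apply: integral_ge0 => x _; rewrite lee_fin.
- by apply: integral_ge0 => x _; rewrite lee_fin.
- by apply: (sobolev_derivative_le (Cc1_fst phi_Cc1) a_box _ IH) => x; rewrite lerDl sqr_ge0.
- by apply: (sobolev_derivative_le (Cc1_snd phi_Cc1) b_box _ IH) => x; rewrite lerDr sqr_ge0.
Qed.

End SobolevPowers.

Definition plane_energy phi : \bar R := \int[area R]_x (energy_density phi x)%:E.

Definition plane_mass (p : R) phi : \bar R := \int[area R]_x (`|phi x| `^ p)%:E.

(** On the box [|phi|^p <= 1 + phi^(2 (q + 1))] as [p <= q + 1], which reduces a real exponent to
    the even ones. The constant depends on the domain only through [B]. *)
Lemma sobolev (B p : R) : (0 < B)%R -> (0 < p)%R -> exists2 K : R, (0 < K)%R &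
  forall D phi, (forall x, D x -> `|x.1| < B /\ `|x.2| < B)%R -> test_function D phi ->
    plane_energy phi <= 1 -> plane_mass p phi <= K%:E.
Proof.
move=> B0 p0; pose q := Num.truncn p; have pq : (p <= q.+1%:R)%R by rewrite ltW// truncnS_gt.
exists ((2 * B) ^+ 2 + sobolev_const B q.+1)%R.
  by rewrite ltr_wpDr ?sobolev_const_ge0// exprn_gt0// mulr_gt0.
move=> D phi DB tphi E1; have [_ _ KD] := tphi.
have out x : ~ box B x -> ~ supp phi x.
  by move=> xB /KD/DB[u1 u2]; apply: xB; apply/boxP; split; exact: ltW.
have mphi : measurable_fun (setT : set plane) phi by apply: cont2_measurableT; exact: test_cont tphi.
rewrite /plane_mass -(@integral_supp _ (box B)); last first.
  by move=> x /out/supp_notin ->; rewrite normr0 powR0// gt_eqF.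
apply: (@le_trans _ _ (\int[area R]_(x in (box B : set plane)) (cst 1 x + (phi x ^+ (2 * q.+1))%:E))).
  apply: ge0_le_integral.
  - exact: box_measurable.
  - by move=> x _; rewrite lee_fin powR_ge0.
  - apply/measurable_EFinP; apply: (measurableT_comp (measurable_powR p)).
    by apply: measurableT_comp => //; exact: measurable_funTS.
  - apply: emeasurable_funD; first exact: measurable_cst.
    by apply/measurable_EFinP; apply: measurable_funX; exact: measurable_funTS.
  move=> x _; rewrite /= -EFinD lee_fin.
  have X0 : (0 <= phi x ^+ (2 * q.+1))%R by rewrite exprM exprn_ge0 ?sqr_ge0.
  have [h|h] := leP `|phi x|%R 1%R.
    apply: (@le_trans _ _ 1%R); last by rewrite lerDl.
    by have := @ge0_ler_powR R p (ltW p0) `|phi x|%R 1%R; rewrite powR1; apply; rewrite ?nnegrE.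
  apply: (@le_trans _ _ (`|phi x| `^ (2 * q.+1)%:R)%R).
    by rewrite ler_powR//; [exact: ltW|rewrite natrM; lra].
  by rewrite powR_mulrn// exprM real_normK ?num_real// -exprM lerDr.
have mP : measurable_fun (box B : set plane) (fun x => (phi x ^+ (2 * q.+1))%:E).
  by apply/measurable_EFinP; apply: measurable_funX; exact: measurable_funTS.
rewrite ge0_integralD//; last 2 first.
- exact: box_measurable.
- by move=> x _; rewrite lee_fin exprM exprn_ge0 ?sqr_ge0.
rewrite integral_cst; last exact: box_measurable.
rewrite mul1e area_box ?(ltW B0)// EFinD leeD2l//.
apply: (sobolev_even B0 (test_Cc1 tphi)) => //.
- by move=> x /out; exact: supp_notin.
- by move=> x /out; exact: supp_partial.
- by move=> x /out; exact: supp_partial.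
Qed.

End CompactC1.

(** * Real powers and flat functions *)

Section OneVariableSmooth.
Variable R : realType.
Implicit Types (x : R * R) (f : R -> R).

Lemma is_derive_rdiff f x (l : R) : is_derive x.1 1 f l -> rdiff (fun y => f y.1) x l 0.
Proof.
move=> /is_derive_eps H e e0; have [d d0 D] := H e e0; exists d => // h k hd kd.
by rewrite mul0r addr0 (le_trans (D h hd))// ler_wpM2l ?(ltW e0)// lerDl.
Qed.

Lemma Cn_powR n (a : R) : Cn n [set x : R * R | 0 < x.1] (fun x => x.1 `^ a).
Proof.
elim: n a => [|n IH] a.
  by move=> x x0; apply: rdiff_cont (is_derive_rdiff (is_derive1_powR a x0)).
exists (fun x => a * x.1 `^ (a - 1)), (fun=> 0); split; last exact: Cn_cst.
- by move=> x x0; exact: (is_derive_rdiff (is_derive1_powR a x0)).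
- by apply: CnM; [exact: Cn_cst|exact: IH].
Qed.

(** The classical flat function [exp (-1/t)]; the powers of [1/t] are included so that the family is
    closed under differentiation. *)
Definition flat k (t : R) : R := if 0 < t then t^-1 ^+ k * expR (- t^-1) else 0.

Lemma flat_npos k (t : R) : t <= 0 -> flat k t = 0.
Proof. by rewrite /flat leNgt => /negbTE ->. Qed.

(** From [exp u >= u^(k + 2) / (k + 2)!] at [u = 1/t]. The second-order bound makes the derivative
    at [0] vanish. *)
Lemma flat_le k (t : R) : `|flat k t| <= k.+2`!%:R * `|t| ^+ 2.
Proof.
rewrite /flat; case: ifPn => [t0|_]; last by rewrite normr0 mulr_ge0// exprn_ge0.
have u0 : 0 < t^-1 by rewrite invr_gt0.
rewrite ger0_norm; last by rewrite mulr_ge0 ?expR_ge0// exprn_ge0 ?ltW.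
rewrite (gtr0_norm t0) expRN ler_pdivrMr ?expR_gt0//.
have F0 : 0 < k.+2`!%:R :> R by rewrite ltr0n fact_gt0.
have := expR_ge1Dxn k.+1 (ltW u0); set E := expR _ => HE.
have {}HE : t^-1 ^+ k.+2 / k.+2`!%:R <= E by lra.
move: HE; rewrite ler_pdivrMr// => HE.
have -> : t^-1 ^+ k = t ^+ 2 * t^-1 ^+ k.+2.
  by rewrite -[k.+2]addn2 exprD [t^-1 ^+ 2]exprVn mulrC mulfVK// expf_neq0// gt_eqF.
by rewrite [leRHS]mulrAC [leRHS]mulrC (mulrC _ E) ler_wpM2l ?sqr_ge0.
Qed.

Lemma flat_derive k (t : R) : is_derive t 1 (flat k) (- k%:R * flat k.+1 t + flat k.+2 t).
Proof.
apply: eps_is_derive => e e0.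
have [t0|t0|t0] := ltgtP t 0.
- exists (- t) => [|s]; first by lra.
  rewrite ltr_norml => /andP[s1 s2].
  rewrite !(flat_npos _ (ltW t0)) flat_npos; last by lra.
  by rewrite !mulr0 addr0 mulr0 !subr0 normr0 mulr_ge0// ltW.
- have tn : t != 0 by rewrite gt_eqF.
  have D1 : is_derive t 1 (fun s : R => s^-1) (- t ^- 2).
    by have := @is_deriveV R id t 1 1 tn _; rewrite /GRing.scale/= mulr1; apply.
  have D2 : is_derive t 1 (fun s : R => s^-1 ^+ k * expR (- s^-1)) (- k%:R * flat k.+1 t + flat k.+2 t).
    have D3 : is_derive t 1 (fun s : R => expR (- s^-1)) (expR (- t^-1) * t ^- 2).
      by have := @is_derive1_comp R expR (fun s => - s^-1) t _ _ (is_derive_expR _) (is_deriveN D1); rewrite opprK.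
    have := is_deriveM (is_deriveX k D1) D3.
    have -> : [eta GRing.inv] ^+ k * (fun s : R => expR (- s^-1)) = fun s => s^-1 ^+ k * expR (- s^-1).
      by apply/funext => s; rewrite mulrfctE exprfctE.
    congr (is_derive _ _ _ _); rewrite exprfctE /flat t0 /GRing.scale/=.
    have -> : t ^- 2 = t^-1 ^+ 2 by rewrite exprVn.
    case: k => [|k]; first by rewrite !mul0r ?mulr0 expr0 ?oppr0; ring.
    by rewrite !exprS; ring.
  have [d d0 D] := is_derive_eps D2 e0.
  exists (Num.min d t) => [|s]; first by rewrite lt_min d0.
  rewrite lt_min => /andP[sd st].
  have ts : 0 < t + s by move: st; rewrite ltr_norml => /andP[? _]; lra.
  have fE (u : R) : 0 < u -> flat k u = u^-1 ^+ k * expR (- u^-1) by rewrite /flat => ->.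
  by have := D s sd; rewrite (fE t)// (fE (t + s))// (mulrC s).
- set C : R := k.+2`!%:R.
  have C0 : 0 < C by rewrite ltr0n fact_gt0.
  exists (e / C) => [|s]; first by rewrite divr_gt0.
  rewrite ltr_pdivlMr// => sC.
  rewrite t0 add0r {2 3 4}/flat ltxx !mulr0 addr0 mulr0 !subr0.
  apply: le_trans (flat_le k s) _; rewrite -/C expr2 mulrA ler_wpM2r//.
  by rewrite mulrC ltW.
Qed.

Lemma Cn_flat n k : Cn n setT (fun x : R * R => flat k x.1).
Proof.
elim: n k => [|n IH] k.
  by move=> x _; apply: rdiff_cont (is_derive_rdiff (flat_derive k x.1)).
exists (fun x => - k%:R * flat k.+1 x.1 + flat k.+2 x.1), (fun=> 0); split; last exact: Cn_cst.
- by move=> x _; apply: is_derive_rdiff; exact: flat_derive.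
- by apply: CnD; [apply: CnM; [exact: Cn_cst|exact: IH]|exact: IH].
Qed.

Lemma flat0_gt0 (t : R) : (0 < flat 0 t) = (0 < t).
Proof. by rewrite /flat; case: ifPn => // t0; rewrite ?ltxx// expr0 mul1r expR_gt0. Qed.

Lemma flat0_ge0 (t : R) : 0 <= flat 0 t.
Proof. by rewrite /flat; case: ifPn => // t0; rewrite expr0 mul1r expR_ge0. Qed.

End OneVariableSmooth.

(** * Bump functions and smoothed absolute values *)

Section TestFunctions.
Variable R : realType.
Implicit Types (D : set (R * R)) (x : R * R) (phi : R * R -> R).

Lemma sqr_le_norm (a b : R) : 0 <= b -> a ^+ 2 <= b ^+ 2 -> `|a| <= b.
Proof. by move=> b0 ab; rewrite -(@ler_pXn2r _ 2) ?nnegrE// real_normK ?num_real. Qed.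

(** [flat 0] of [(d / 2)^2 - |x - x0|^2], which is positive exactly on a small disc. *)
Lemma bump_exists D x0 : open D -> D x0 ->
  exists2 phi, test_function D phi & (forall x, 0 <= phi x) /\ 0 < phi x0.
Proof.
move=> oD Dx0; have [d d0 H] := (open2P _).1 oD x0 Dx0.
pose q x := (d / 2) ^+ 2 + (-1) * ((x.1 + - x0.1) ^+ 2 + (x.2 + - x0.2) ^+ 2).
have qC n : Cn n setT q.
  apply: CnD; [exact: Cn_cst|apply: CnM; [exact: Cn_cst|]].
  by apply: CnD; apply: CnX; apply: CnD; [exact: Cn_fst|exact: Cn_cst|exact: Cn_snd|exact: Cn_cst].
pose phi x := flat 0 (q x).
have phiC n : Cn n setT phi.
  by apply: (@Cn_comp _ n setT setT (fun x => flat 0 x.1) q (fun=> 0)) => //; [exact: Cn_flat|exact: Cn_cst].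
have qc : continuous q by move=> x; exact: (qC 0).
pose K := [set x | 0 <= q x].
have cK : closed K.
  by apply: (@closed_comp _ _ q [set t | 0 <= t]) => [x _|]; [exact: qc|exact: closed_ge].
have KE x : K x -> `|x.1 - x0.1| < d /\ `|x.2 - x0.2| < d.
  rewrite /K /q /= => h.
  have h1 : (x.1 - x0.1) ^+ 2 <= (d / 2) ^+ 2 by have := sqr_ge0 (x.2 - x0.2); lra.
  have h2 : (x.2 - x0.2) ^+ 2 <= (d / 2) ^+ 2 by have := sqr_ge0 (x.1 - x0.1); lra.
  have d2 : 0 <= d / 2 by lra.
  by have := sqr_le_norm d2 h1; have := sqr_le_norm d2 h2; split; lra.
have KD : K `<=` D.
  by move=> x /KE[h1 h2]; have := H _ _ h1 h2; rewrite !(addrC _ (_ - _)) !subrK -surjective_pairing.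
have sK : supp phi `<=` K.
  apply: subset_trans cK; apply: closure_subset => x /=.
  by rewrite neq_lt ltNge flat0_ge0/= flat0_gt0; exact: ltW.
exists phi; last first.
  split => [x|]; first exact: flat0_ge0.
  rewrite flat0_gt0 /q !subrr expr0n addr0 mulr0 addr0 exprn_gt0//; lra.
split; first by apply/smoothP.
- apply: (@subclosed_compact _ _ (box (`|x0.1| + `|x0.2| + d))); [exact: closed_closure|exact: box_compact|].
  apply: subset_trans sK _ => x /KE[h1 h2]; apply/boxP.
  have := ler_normD (x.1 - x0.1) x0.1; have := ler_normD (x.2 - x0.2) x0.2.
  by rewrite !subrK; have := normr_ge0 x0.1; have := normr_ge0 x0.2; split; lra.
- exact: subset_trans sK KD.
Qed.

(* Makes a test function nonnegative without increasing its Dirichlet integral. *)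
Definition smooth_abs (e t : R) : R := (t ^+ 2 + e ^+ 2) `^ (2^-1) - e.

Section SmoothAbs.
Variable e : R.
Hypothesis e_gt0 : 0 < e.

Let root_gt0 (t : R) : 0 < t ^+ 2 + e ^+ 2.
Proof. by rewrite ltr_wpDl ?sqr_ge0// exprn_gt0. Qed.

Lemma smooth_abs0 : smooth_abs e 0 = 0.
Proof. by rewrite /smooth_abs expr0n add0r powR12_sqrt ?sqr_ge0// sqrtr_sqr gtr0_norm// subrr. Qed.

Lemma smooth_abs_bounds (t : R) : `|t| - e <= smooth_abs e t <= `|t| /\ 0 <= smooth_abs e t.
Proof.
rewrite /smooth_abs powR12_sqrt ?(ltW (root_gt0 _))//.
have te : `|t| <= Num.sqrt (t ^+ 2 + e ^+ 2) by rewrite -sqrtr_sqr ler_wsqrtr// lerDl sqr_ge0.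
have et : e <= Num.sqrt (t ^+ 2 + e ^+ 2).
  by rewrite -[leLHS](gtr0_norm e_gt0) -sqrtr_sqr ler_wsqrtr// lerDr sqr_ge0.
have t1 : Num.sqrt (t ^+ 2 + e ^+ 2) <= `|t| + e.
  have s0 : 0 <= `|t| + e by rewrite addr_ge0// ltW.
  rewrite -[leRHS](ger0_norm s0) -[leRHS]sqrtr_sqr ler_wsqrtr// sqrrD real_normK ?num_real//.
  have : 0 <= `|t| * e by rewrite mulr_ge0// ltW.
  by lra.
by split; [apply/andP; split|]; lra.
Qed.

Variables (D : set (R * R)) (phi : R * R -> R).
Hypothesis tphi : test_function D phi.

Let base x := phi x ^+ 2 + e ^+ 2.

Lemma smooth_abs_supp : supp (smooth_abs e \o phi) `<=` supp phi.
Proof.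
apply: closure_subset => x /=; apply: contra_neq => ->; exact: smooth_abs0.
Qed.

Lemma smooth_abs_test : test_function D (smooth_abs e \o phi).
Proof.
have [_ cK KD] := tphi; split.
- apply/smoothP => n; apply: CnD; last exact: Cn_cst.
  apply: (@Cn_comp _ n setT [set x | 0 < x.1] (fun x => x.1 `^ 2^-1) base (fun=> 0)) => //.
  + exact: Cn_powR.
  + by apply: CnD; [apply: CnX; exact: test_Cn tphi|exact: Cn_cst].
  + exact: Cn_cst.
  + by move=> x _; exact: root_gt0.
- exact: (subclosed_compact (@closed_closure _ _) cK smooth_abs_supp).
- exact: subset_trans smooth_abs_supp KD.
Qed.

(** The derivative [t / sqrt (t^2 + e^2)] of [smooth_abs e] has modulus at most [1]. *)
Lemma smooth_abs_energy x : energy_density (smooth_abs e \o phi) x <= energy_density phi x.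
Proof.
have D0 := Cc1_rdiff (test_Cc1 tphi) x.
have D1 := rdiffD (rdiffM D0 D0) (rdiff_cst (e ^+ 2) x).
have y0 : 0 < base x by exact: root_gt0.
have D2 := rdiff_comp (f := base) (g := fun=> 0) (is_derive_rdiff (x := (base x, 0)) (is_derive1_powR 2^-1 y0)) D1 (rdiff_cst 0 x).
have D3 := rdiffD D2 (rdiff_cst (- e) x).
rewrite /energy_density (rdiff_partial false D3) (rdiff_partial true D3) /=.
set a := partial false phi x; set b := partial true phi x.
set c := (base x) `^ (2^-1 - 1).
have cE : c ^+ 2 * base x = 1.
  rewrite -powR_mulrn ?powR_ge0// -powRrM (_ : (2^-1 - 1) * 2%:R = - 1); last by field.
  by rewrite powRN powRr1 ?(ltW y0)// mulVf// gt_eqF.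
have -> : (2^-1 * c * (phi x * a + phi x * a + 0) + 0 * 0 + 0) ^+ 2 +
   (2^-1 * c * (phi x * b + phi x * b + 0) + 0 * 0 + 0) ^+ 2 = (c ^+ 2 * phi x ^+ 2) * (a ^+ 2 + b ^+ 2) by field.
rewrite ler_piMl ?addr_ge0 ?sqr_ge0// -cE ler_wpM2l ?sqr_ge0//.
by rewrite /base lerDl sqr_ge0.
Qed.

End SmoothAbs.

End TestFunctions.

(** * The variational problem in terms of test functions *)

Section MeasureLemmas.
Context d (T : measurableType d) (R : realType) (mu : {measure set T -> \bar R}).
Variable D : set T.
Hypothesis mD : measurable D.
Local Open Scope ereal_scope.

Lemma ae_impl (P Q : T -> Prop) : (forall x, P x -> Q x) -> {ae mu, forall x, P x} -> {ae mu, forall x, Q x}.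
Proof. by move=> PQ; apply: filterS. Qed.

Lemma fatou_le (f : (T -> \bar R)^nat) (h : T -> \bar R) (C : \bar R) :
  (forall n, measurable_fun D (f n)) -> (forall n x, D x -> 0 <= f n x) ->
  measurable_fun D h -> (forall x, D x -> 0 <= h x) ->
  {ae mu, forall x, D x -> f ^~ x @ \oo --> h x} ->
  (forall n, \int[mu]_(x in D) f n x <= C) -> \int[mu]_(x in D) h x <= C.
Proof.
move=> mf f0 mh h0 fh fC.
rewrite (@ge0_ae_eq_integral _ _ _ mu D h (fun x => limn_einf (f ^~ x)))//; last 3 first.
- rewrite /limn_einf; apply: measurableT_comp => //.
  by apply: measurable_fun_limn_esup => n; exact: measurableT_comp.
- move=> x Dx; rewrite limn_einf_lim; apply: lime_ge; first exact: is_cvg_einfs.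
  by apply: nearW => n; apply: le_ereal_inf_tmp => _ [m _ <-]; exact: f0.
- apply: filterS fh => x H Dx; have := H Dx.
  by move=> /cvg_limn_einf_sup[-> _].
apply: le_trans (fatou _ mD mf f0) _.
rewrite limn_einf_lim; apply: lime_le; first exact: is_cvg_einfs.
apply: nearW => n; apply: le_trans (fC n); apply: ge_ereal_inf.
by exists (\int[mu]_(x in D) f n x) => //; exists n => //=.
Qed.

(** The sum of the [f n] has integral at most [2], hence is finite almost everywhere, and its terms
    tend to [0]. The geometric rate takes the place of extracting a subsequence. *)
Lemma ae_cvg0 (f : nat -> T -> R) : (forall n, measurable_fun D (f n)) ->
  (forall n x, D x -> 0 <= f n x)%R ->
  (forall n, \int[mu]_(x in D) (f n x)%:E <= (2^-1 ^+ n)%R%:E) ->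
  {ae mu, forall x, D x -> f ^~ x @ \oo --> (0:R)%R}.
Proof.
move=> mf f0 fI; pose F x : \bar R := \sum_(n <oo) (f n x)%:E.
have mf' n : measurable_fun D (EFin \o f n) by apply/measurable_EFinP.
have f0' n x : D x -> 0 <= (EFin \o f n) x by move=> /f0; rewrite lee_fin.
have geo n : (\sum_(0 <= i < n) 2^-1 ^+ i = 2 - 2 * 2^-1 ^+ n :> R)%R.
  elim: n => [|n IH]; first by rewrite big_geq// expr0 mulr1 subrr.
  by rewrite big_nat_recr//= IH exprS; field.
have F2 : \int[mu]_(x in D) F x <= 2%:E.
  rewrite (@integral_nneseries _ _ _ mu D mD (fun n => EFin \o f n))//.
  apply: lime_le; first by apply: is_cvg_nneseries => n _ _; apply: integral_ge0 => x; exact: f0'.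
  apply: nearW => n; apply: (@le_trans _ _ (\sum_(0 <= i < n) (2^-1 ^+ i)%R%:E)).
    by apply: lee_sum => i _; exact: fI.
  by rewrite sumEFin geo lee_fin gerBl// mulr_ge0// exprn_ge0.
have iF : mu.-integrable D F.
  apply/integrableP; split.
    apply: (@emeasurable_fun_cvg _ _ _ D (fun n x => \sum_(0 <= i < n) (f i x)%:E)).
      by move=> n; apply: emeasurable_sum => i; exact: mf'.
    by move=> x Dx; apply: is_cvg_nneseries => n _ _; exact: f0'.
  rewrite (eq_integral F) => [|x /[!inE] Dx].
    by apply: le_lt_trans F2 _; rewrite ltry.
  by rewrite gee0_abs// nneseries_ge0// => n _ _; exact: f0'.
apply: filterS (integrable_ae mD iF) => x Ffin Dx; have {Ffin} := Ffin Dx.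
have F0 : 0 <= F x by rewrite nneseries_ge0// => n _ _; exact: f0'.
rewrite ge0_fin_numE// => Foo.
apply: cvg_series_cvg_0; apply: nondecreasing_is_cvgn.
  by apply: nondecreasing_series => n _ _; exact: f0.
exists (fine (F x)) => _ [n _ <-]; rewrite /series/=.
rewrite -lee_fin fineK ?ge0_fin_numE// -sumEFin.
by apply: nneseries_lim_ge => k _ _; exact: f0'.
Qed.

End MeasureLemmas.

Section SquareIntegrable.
Variable R : realType.
Local Notation plane := (measurableTypeR R * measurableTypeR R)%type.
Implicit Types (D : set (R * R)) (h : R * R -> R).
Local Open Scope ereal_scope.

Lemma Lfun2P h : h \in Lfun (area R) 2%:E <->
  measurable_fun (setT : set plane) h /\ \int[area R]_x (h x ^+ 2)%:E < +oo.
Proof.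
have E : \int[area R]_x (`|h x| `^ 2)%:E = \int[area R]_x (h x ^+ 2)%:E.
  by apply: eq_integral => x _; rewrite -[2%R]/(2%:R)%R powR_mulrn// real_normK ?num_real.
split=> [lh|[mh hoo]].
  split; first by move: lh; rewrite inE => /andP[]; rewrite inE.
  have /integrableP[_] := Lfun2_integrable_sqr lh.
  by under eq_integral do rewrite /= ger0_norm ?sqr_ge0//.
rewrite inE; apply/andP; split; rewrite inE//= /finite_norm unlock.
by apply: poweR_lty; rewrite /= E.
Qed.

Lemma restrict_sqr D h x : ((fun x => (h x ^+ 2)%:E) \_ D) x = ((h \_ D) x ^+ 2)%:E.
Proof. by rewrite !patchE; case: ifPn => // _; rewrite expr0n. Qed.

Lemma L2P D h : measurable (D : set plane) -> L2 D h <->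
  measurable_fun (D : set plane) h /\ \int[area R]_(x in D) (h x ^+ 2)%:E < +oo.
Proof.
move=> mD; rewrite /L2.
rewrite integral_mkcond; under [X in _ /\ X < _]eq_integral do rewrite restrict_sqr.
have [A B] := Lfun2P (h \_ D); split.
  by move=> /A[mh ?]; split => //; exact: (measurable_restrictT h mD).2.
by move=> [mh ?]; apply: B; split => //; exact: (measurable_restrictT h mD).1.
Qed.

End SquareIntegrable.

Section TestAdmissible.
Variable R : realType.
Local Notation plane := (measurableTypeR R * measurableTypeR R)%type.
Variables (D : set (R * R)) (phi : R * R -> R) (p : R).
Hypothesis openD : open D.
Hypothesis p_gt0 : 0 < p.
Hypothesis tphi : test_function D phi.
Local Open Scope ereal_scope.

Let mD : measurable (D : set plane). Proof. exact: open2_measurable. Qed.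

Definition grad (psi : R * R -> R) (x : R * R) := (partial false psi x, partial true psi x).

Lemma test_out x : ~ D x -> ~ supp phi x.
Proof. by case: tphi => _ _ KD nD /KD. Qed.

Lemma test_energyE : plane_energy phi = \int[area R]_(x in D) (energy_density phi x)%:E.
Proof. by rewrite integral_supp// => x /test_out/supp_energy ->. Qed.

Lemma test_massE : plane_mass p phi = \int[area R]_(x in D) (`|phi x| `^ p)%:E.
Proof.
by rewrite integral_supp// => x /test_out/supp_notin ->; rewrite normr0 powR0// gt_eqF.
Qed.

Lemma Cc_L2 h : Cc h -> L2 D h.
Proof.
move=> Ch; have [hc _] := Ch; apply/(L2P _ mD); split.
  by apply: measurable_funTS; exact: cont2_measurableT.
have Ch2 : Cc (fun x => h x * h x)%R by apply: CcM.
have /integrableP[_] := Cc_integrable Ch2; apply: le_lt_trans.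
have mh : measurable_fun (setT : set plane) (fun x => (h x ^+ 2)%:E).
  by apply/measurable_EFinP; apply: measurable_funX; exact: cont2_measurableT.
apply: (@le_trans _ _ (\int[area R]_x (h x ^+ 2)%:E)).
  by apply: ge0_subset_integral => // x _; rewrite lee_fin sqr_ge0.
rewrite le_eqVlt; apply/orP; left; apply/eqP; apply: eq_integral => x _.
by rewrite /= -expr2 ger0_norm ?sqr_ge0.
Qed.

(** Integration by parts: the partial derivatives of the compactly supported product [phi * psi]
    have integral [0]. *)
Lemma test_weak_gradient : weak_gradient D phi (grad phi).
Proof.
move=> psi tpsi; have [C1 C1'] := (test_Cc1 tphi, test_Cc1 tpsi).
have C2 := Cc1M C1 C1'.
have cont (h : R * R -> R) : Cc h -> continuous h by case.
have main (a b : R * R -> R) : Cc a -> Cc b -> \int[area R]_x (psi x * a x + phi x * b x)%:E = 0 ->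
    (forall x, ~ D x -> a x = 0%R) ->
    (\int[area R]_(x in D) (phi x * b x) = - \int[area R]_(x in D) (a x * psi x))%R.
  move=> Ca Cb H aD.
  have I1 := Cc_integrable (CcM (cont _ (Cc1_fun C1')) Ca).
  have I2 := Cc_integrable (CcM (cont _ (Cc1_fun C1)) Cb).
  have E : (\int[area R]_x (psi x * a x + phi x * b x) = 0)%R by rewrite /Rintegral H.
  rewrite RintegralD// in E.
  have -> : (\int[area R]_(x in D) (phi x * b x) = \int[area R]_x (phi x * b x))%R.
    by rewrite /Rintegral integral_supp// => x /test_out/supp_notin ->; rewrite mul0r.
  have -> : (\int[area R]_(x in D) (a x * psi x) = \int[area R]_x (psi x * a x))%R.
    rewrite /Rintegral integral_supp; last by move=> x /aD ->; rewrite mul0r.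
    by under eq_integral do rewrite mulrC.
  by apply/eqP; rewrite -subr_eq0 opprK addrC; apply/eqP.
split; apply: main.
- exact: Cc1_fst C1.
- exact: Cc1_fst C1'.
- exact: integral_partial1 C2.
- by move=> x /test_out; exact: supp_partial.
- exact: Cc1_snd C1.
- exact: Cc1_snd C1'.
- exact: integral_partial2 C2.
- by move=> x /test_out; exact: supp_partial.
Qed.

Lemma test_W12_0 : W12_0 D phi (grad phi).
Proof.
have [_ C0 C1 C2] := test_Cc1 tphi.
split; first by split; [exact: Cc_L2|exact: Cc_L2|exact: Cc_L2|exact: test_weak_gradient].
move=> e e0; exists phi => //; rewrite /W12_dist2 integral0_eq ?lte_fin ?exprn_gt0// => x _.
by rewrite /= !subrr !expr0n !addr0.
Qed.

Lemma test_admissible : (forall x, 0 <= phi x)%R -> 0 < plane_mass p phi -> admissible D phi (grad phi).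
Proof.
move=> phi0 mass0; split; [exact: test_W12_0|by apply: aeW => x _|].
move=> ae0; move: mass0; rewrite test_massE.
rewrite (@ge0_ae_eq_integral _ _ _ (area R) D _ (cst 0))//.
- by rewrite integral0 ltxx.
- apply/measurable_EFinP; apply: (measurableT_comp (measurable_powR p)).
  by apply: measurableT_comp => //; apply: measurable_funTS; apply: cont2_measurableT; exact: test_cont tphi.
- by apply: ae_impl ae0 => x H Dx; rewrite H// normr0 powR0// gt_eqF.
Qed.

Lemma test_rayleigh : (forall x, 0 <= phi x)%R ->
  rayleigh p D phi (grad phi) = plane_energy phi / plane_mass p phi `^ (2 / p).
Proof.
move=> phi0; rewrite test_energyE test_massE.
have E : \int[area R]_(x in D) (phi x `^ p)%:E = \int[area R]_(x in D) (`|phi x| `^ p)%:E.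
  by apply: eq_integral => x _; rewrite ger0_norm.
by rewrite -E.
Qed.

End TestAdmissible.

Section Homogeneity.
Variable R : realType.
Local Notation plane := (measurableTypeR R * measurableTypeR R)%type.
Variables (D : set (R * R)) (phi : R * R -> R).
Hypothesis tphi : test_function D phi.

Lemma energy_density_cont : continuous (energy_density phi).
Proof.
have P i : Cn 0 setT (partial i phi) by move=> x _; exact: (test_partial_cont (i := i) tphi).
have H : Cn 0 setT (energy_density phi) := CnD (CnX 2 (P false)) (CnX 2 (P true)).
by move=> x; exact: H.
Qed.

Lemma energy_density_Cc : Cc (energy_density phi).
Proof. exact: (compact_support_Cc tphi energy_density_cont (@supp_energy _ _)). Qed.

Lemma test_scale (k : R) : test_function D (fun x => k * phi x).
Proof.
have [_ cK KD] := tphi.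
have sK : supp (fun x => k * phi x) `<=` supp phi.
  by apply: closure_subset => x /=; apply: contra_neq => ->; rewrite mulr0.
split.
- by apply/smoothP => n; apply: CnM; [exact: Cn_cst|exact: test_Cn tphi].
- by apply: (@subclosed_compact _ _ (supp phi)) => //; exact: closed_closure.
- exact: subset_trans sK KD.
Qed.

Lemma energy_density_scale (k : R) x :
  energy_density (fun x => k * phi x) x = k ^+ 2 * energy_density phi x.
Proof.
have D1 := rdiffM (rdiff_cst k x) (Cc1_rdiff (test_Cc1 tphi) x).
rewrite /energy_density (rdiff_partial false D1) (rdiff_partial true D1); ring.
Qed.

Local Open Scope ereal_scope.

Lemma energy_scale (k : R) : plane_energy (fun x => k * phi x)%R = (k ^+ 2)%:E * plane_energy phi.
Proof.
rewrite /plane_energy -ge0_integralZl//.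
- by apply: eq_integral => x _; rewrite energy_density_scale.
- by apply/measurable_EFinP; apply: cont2_measurableT; exact: energy_density_cont.
- by move=> x _; rewrite lee_fin energy_density_ge0.
- by rewrite lee_fin sqr_ge0.
Qed.

Lemma abs_powR_measurable (p : R) (h : R * R -> R) (E : set plane) : measurable_fun E h ->
  measurable_fun E (fun x => (`|h x| `^ p)%:E).
Proof.
by move=> mh; apply/measurable_EFinP; apply: (measurableT_comp (measurable_powR p)); exact: measurableT_comp.
Qed.

Lemma mass_scale (p k : R) : (0 <= k)%R -> plane_mass p (fun x => k * phi x)%R = (k `^ p)%:E * plane_mass p phi.
Proof.
move=> k0; rewrite /plane_mass -ge0_integralZl//.
- by apply: eq_integral => x _; rewrite normrM ger0_norm// powRM.
- by apply: abs_powR_measurable; apply: cont2_measurableT; exact: test_cont tphi.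
- by rewrite lee_fin powR_ge0.
Qed.

End Homogeneity.

Lemma sqr_cvg0 (R : realType) (a : nat -> R) : (a n ^+ 2 @[n --> \oo] --> (0 : R)) -> a n @[n --> \oo] --> (0 : R).
Proof.
move=> /cvgrPdist_lt H; apply/cvgrPdist_lt => e e0.
have := H (e ^+ 2) (exprn_gt0 2 e0); apply: filterS => n; rewrite !sub0r !normrN normrX.
by rewrite ltr_pXn2r// ?nnegrE ?ltW.
Qed.

Lemma abs_powR_cvg (R : realType) (p : R) (a : nat -> R) (l : R) : 0 < p -> a n @[n --> \oo] --> l ->
  ((`|a n| `^ p)%:E @[n --> \oo] --> (`|l| `^ p)%:E)%E.
Proof.
move=> p0 H; apply: cvg_EFin; first exact: nearW.
apply: (@cvg_comp _ _ _ a (fun t : R => `|t| `^ p) _ _ _ H); exact: abs_powR_cont.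
Qed.

(** With [t] small, the energy of an approximant exceeds that of its limit by as little as desired
    once the distance is small enough compared with [t]. *)
Lemma young_sqr (R : realFieldType) (t a g : R) : 0 < t -> a ^+ 2 <= (1 + t) * g ^+ 2 + (1 + t^-1) * (a - g) ^+ 2.
Proof.
move=> t0; rewrite -subr_ge0.
have -> : (1 + t) * g ^+ 2 + (1 + t^-1) * (a - g) ^+ 2 - a ^+ 2 = t^-1 * (t * g - (a - g)) ^+ 2.
  by field; rewrite gt_eqF.
by rewrite mulr_ge0 ?sqr_ge0// invr_ge0 ltW.
Qed.

(** * The infimum of the Rayleigh quotients *)

Section RayleighBound.
Variable R : realType.
Local Notation plane := (measurableTypeR R * measurableTypeR R)%type.
Variables (D : set (R * R)) (p A : R).
Hypothesis openD : open D.
Hypothesis p_gt0 : 0 < p.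
Hypothesis A_gt0 : 0 < A.
Local Open Scope ereal_scope.
Hypothesis mass_le_A : forall phi, test_function D phi -> plane_energy phi <= 1 -> plane_mass p phi <= A%:E.

Let mD : measurable (D : set plane). Proof. exact: open2_measurable. Qed.

(** Scaling by [c^(-1/2)] normalizes the energy to at most [1], and the mass is homogeneous of
    degree [p]. *)
Lemma mass_le phi (c : R) : (0 < c)%R -> test_function D phi -> plane_energy phi <= c%:E ->
  plane_mass p phi <= (A * c `^ (p / 2))%:E.
Proof.
move=> c0 tphi Ec; pose k := (c `^ (- 2^-1))%R.
have k0 : (0 < k)%R by rewrite powR_gt0.
have k2 : (k ^+ 2 = c^-1)%R.
  by rewrite -powR_mulrn ?(ltW k0)// -powRrM mulNr mulVf ?pnatr_eq0// powRN powRr1// ltW.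
have kp : (k `^ p = (c `^ (p / 2))^-1)%R by rewrite -powRrM mulNr powRN mulrC.
have := mass_le_A (test_scale tphi k); rewrite (energy_scale tphi) k2 => /(_ _)/wrap[|].
  by apply: le_trans (lee_wpmul2l _ Ec) _; rewrite -?EFinM ?lee_fin ?invr_ge0 ?(ltW c0)// mulVf// gt_eqF.
rewrite (mass_scale tphi) ?(ltW k0)// kp => H.
have C0 : (0 < c `^ (p / 2))%R by rewrite powR_gt0.
by move: H; rewrite lee_pdivrMl// -EFinM mulrC.
Qed.

Section Admissible.
Variables (u : R * R -> R) (g : R * R -> R * R).
Hypothesis W : W12_0 D u g.
Hypothesis u_ge0 : {ae area R, forall x, D x -> 0 <= u x}%R.

Let m2 (h : R * R -> R) : measurable_fun (D : set plane) h ->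
  measurable_fun (D : set plane) (fun x => (h x ^+ 2)%:E).
Proof. by move=> mh; apply/measurable_EFinP; exact: measurable_funX. Qed.

Lemma W12_energy_fin : \int[area R]_(x in D) ((g x).1 ^+ 2 + (g x).2 ^+ 2)%:E < +oo.
Proof.
have [[_ /(L2P _ mD)[m1 i1] /(L2P _ mD)[m3 i2] _] _] := W.
under eq_integral do rewrite EFinD.
rewrite ge0_integralD//; first exact: lte_add_pinfty.
- by move=> x _; rewrite lee_fin sqr_ge0.
- exact: (m2 m1).
- by move=> x _; rewrite lee_fin sqr_ge0.
- exact: (m2 m3).
Qed.

(** Test functions approximating [u] have energy at most [c], because the limit energy is strictly
    below [c], so [mass_le] applies to them; almost everywhere convergence and Fatou's lemma carry
    the bound to [u]. *)
Lemma W12_mass_le (c : R) : (0 < c)%R -> \int[area R]_(x in D) ((g x).1 ^+ 2 + (g x).2 ^+ 2)%:E < c%:E ->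
  \int[area R]_(x in D) (u x `^ p)%:E <= (A * c `^ (p / 2))%:E.
Proof.
move=> c0 Ec; have [[/(L2P _ mD)[mu _] /(L2P _ mD)[mg1 _] /(L2P _ mD)[mg2 _] _] apx] := W.
have := W12_energy_fin; set E := \int[area R]_(x in D) _ in Ec *.
have E0 : 0 <= E by apply: integral_ge0 => x _; rewrite lee_fin addr_ge0 ?sqr_ge0.
move=> Efin; have [e EE] : exists e : R, E = e%:E.
  by exists (fine E); rewrite fineK// ge0_fin_numE.
rewrite EE lee_fin in E0; rewrite EE lte_fin in Ec.
(* The gap [c - e] is shared equally between the factor [1 + t] in front of the energy and the
   contribution of the distance [d]. *)
have [t [d [t0 d0 td]]] : exists t d : R, [/\ 0 < t, 0 < d & (1 + t) * e + (1 + t^-1) * d ^+ 2 <= c]%R.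
  exists ((c - e) / (2 * (e + 1)))%R.
  have t0 : (0 < (c - e) / (2 * (e + 1)))%R by rewrite divr_gt0 ?subr_gt0// mulr_gt0// ltr_wpDl.
  set t := (_ / _)%R in t0 *.
  have et : (t * e <= (c - e) / 2)%R.
    rewrite /t mulrAC ler_pdivrMr; last by rewrite mulr_gt0// ltr_wpDl.
    by nra.
  have s0 : (0 < 1 + t^-1)%R by rewrite addr_gt0// invr_gt0.
  exists (Num.min 1 ((c - e) / (2 * (1 + t^-1))))%R; split => //.
    by rewrite lt_min ltr01 divr_gt0 ?subr_gt0// mulr_gt0.
  set d := Num.min _ _.
  have d0 : (0 <= d)%R by rewrite le_min ler01 divr_ge0 ?subr_ge0 ?(ltW Ec)// mulr_ge0// ltW.
  have d1 : (d <= 1)%R by rewrite ge_min lexx.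
  have : (d * (2 * (1 + t^-1)) <= c - e)%R.
    by rewrite -ler_pdivlMr ?mulr_gt0// ge_min lexx orbT.
  have : (d ^+ 2 * (1 + t^-1) <= d * (1 + t^-1))%R.
    by rewrite ler_wpM2r ?(ltW s0)// expr2 ler_piMl.
  by move: (t^-1)%R => s; lra.
(* The bound [d] controls the energy of every approximant, and [2^-n] provides the summable rate for
   convergence almost everywhere. *)
pose dn n : R := Num.min d (2^-1 ^+ n)%R.
have dn0 n : (0 < dn n)%R by rewrite lt_min d0 exprn_gt0.
have /choice[phi Hphi] n : exists phi, test_function D phi /\ W12_dist2 D u g phi < (dn n ^+ 2)%:E.
  by have [phi ? ?] := apx _ (dn0 n); exists phi.
have tphi n := (Hphi n).1.
have mphi n : measurable_fun (D : set plane) (phi n).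
  by apply: measurable_funTS; apply: cont2_measurableT; exact: test_cont (tphi n).
have mpart n i : measurable_fun (D : set plane) (partial i (phi n)).
  by apply: measurable_funTS; apply: cont2_measurableT; exact: test_partial_cont (tphi n).
have md n : measurable_fun (D : set plane) (fun x => (phi n x - u x) ^+ 2)%R.
  by apply: measurable_funX; exact: measurable_funB.
have md1 n : measurable_fun (D : set plane) (fun x => (partial false (phi n) x - (g x).1) ^+ 2)%R.
  by apply: measurable_funX; exact: measurable_funB.
have md2 n : measurable_fun (D : set plane) (fun x => (partial true (phi n) x - (g x).2) ^+ 2)%R.
  by apply: measurable_funX; exact: measurable_funB.
have en n : plane_energy (phi n) <= c%:E.
  rewrite (test_energyE (tphi n)).
  pose q x := ((partial false (phi n) x - (g x).1) ^+ 2 + (partial true (phi n) x - (g x).2) ^+ 2)%R.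
  have mq : measurable_fun (D : set plane) (fun x => (q x)%:E).
    by apply/measurable_EFinP; exact: measurable_funD.
  have q0 x : (0 <= q x)%R by rewrite addr_ge0 ?sqr_ge0.
  pose G x := ((g x).1 ^+ 2 + (g x).2 ^+ 2)%R.
  have mG : measurable_fun (D : set plane) (fun x => (G x)%:E).
    by apply/measurable_EFinP; apply: measurable_funD; exact: measurable_funX.
  have G0 x : (0 <= G x)%R by rewrite addr_ge0 ?sqr_ge0.
  have t1 : 0 <= (1 + t)%:E by rewrite lee_fin addr_ge0// ltW.
  have t2 : 0 <= (1 + t^-1)%:E by rewrite lee_fin addr_ge0// invr_ge0 ltW.
  apply: (@le_trans _ _ (\int[area R]_(x in D) ((1 + t)%:E * (G x)%:E + (1 + t^-1)%:E * (q x)%:E))).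
    apply: ge0_le_integral => //.
    - by move=> x _; rewrite lee_fin energy_density_ge0.
    - apply/measurable_EFinP; apply: measurable_funTS; apply: cont2_measurableT; exact: energy_density_cont (tphi n).
    - by apply: emeasurable_funD; exact: emeasurable_funM.
    move=> x _; rewrite -!EFinM -EFinD lee_fin /energy_density /G /q.
    have := young_sqr (partial false (phi n) x) (g x).1 t0.
    have := young_sqr (partial true (phi n) x) (g x).2 t0.
    move=> h1 h2; apply: le_trans (lerD h2 h1) _.
    by rewrite !mulrDr addrACA.
  rewrite ge0_integralD//; last 4 first.
  - by move=> x _; rewrite mule_ge0 ?lee_fin.
  - exact: emeasurable_funM.
  - by move=> x _; rewrite mule_ge0 ?lee_fin.
  - exact: emeasurable_funM.
  rewrite !ge0_integralZl//; last 2 first.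
  - by move=> x _; rewrite lee_fin.
  - by move=> x _; rewrite lee_fin.
  have -> : \int[area R]_(x in D) (G x)%:E = e%:E by rewrite -EE.
  apply: (@le_trans _ _ ((1 + t)%:E * e%:E + (1 + t^-1)%:E * (d ^+ 2)%:E)); last by rewrite -!EFinM -EFinD lee_fin.
  rewrite leeD2l// lee_wpmul2l//.
  apply: (@le_trans _ _ (W12_dist2 D u g (phi n))); last first.
    apply: le_trans (ltW (Hphi n).2) _; rewrite lee_fin ler_pXn2r// ?nnegrE ?(ltW d0) ?(ltW (dn0 n))//.
    by rewrite /dn ge_min lexx.
  apply: ge0_le_integral => //.
  - by move=> x _; rewrite lee_fin.
  - by apply/measurable_EFinP; apply: measurable_funD => //; exact: measurable_funD.
  - by move=> x _; rewrite lee_fin /q -addrA lerDr sqr_ge0.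
have close n : \int[area R]_(x in D) ((phi n x - u x) ^+ 2)%:E <= (2^-1 ^+ n)%:E.
  apply: (@le_trans _ _ (W12_dist2 D u g (phi n))).
    apply: ge0_le_integral => //.
    - by move=> x _; rewrite lee_fin sqr_ge0.
    - exact/measurable_EFinP.
    - by apply/measurable_EFinP; apply: measurable_funD => //; exact: measurable_funD.
    - by move=> x _; rewrite lee_fin -addrA lerDl addr_ge0 ?sqr_ge0.
  apply: le_trans (ltW (Hphi n).2) _; rewrite lee_fin expr2.
  have dnle : (dn n <= 2^-1 ^+ n)%R by rewrite /dn ge_min lexx orbT.
  have h1 : (2^-1 ^+ n <= 1 :> R)%R by rewrite exprn_ile1//; lra.
  by have := dn0 n; nra.
have cv := ae_cvg0 mD md (fun n x _ => sqr_ge0 _) close.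
(* [u] is nonnegative only almost everywhere, and the limit of the masses of the approximants
   involves [|u|]. *)
have -> : \int[area R]_(x in D) (u x `^ p)%:E = \int[area R]_(x in D) (`|u x| `^ p)%:E.
  apply: ge0_ae_eq_integral => //.
  - by apply/measurable_EFinP; exact: (measurableT_comp (measurable_powR p)).
  - exact: abs_powR_measurable.
  - by move=> x _; rewrite lee_fin powR_ge0.
  - by apply: ae_impl u_ge0 => x H Dx; rewrite ger0_norm// H.
apply: (@fatou_le _ _ _ (area R) D mD (fun n x => (`|phi n x| `^ p)%:E)).
- by move=> n; exact: abs_powR_measurable.
- by move=> n x _; rewrite lee_fin powR_ge0.
- exact: abs_powR_measurable.
- by move=> x _; rewrite lee_fin powR_ge0.
- apply: ae_impl cv => x H Dx; have {}H := H Dx.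
  have : (phi n x - u x)%R @[n --> \oo] --> (0:R)%R.
    exact: sqr_cvg0.
  move=> /(cvgD (@cvg_cst _ (u x) _ \oo _)); rewrite addr0 => {}H.
  have {}H : phi n x @[n --> \oo] --> u x.
    by apply: cvg_trans H; apply: near_eq_cvg; apply: nearW => n /=; rewrite addrC subrK.
  exact: abs_powR_cvg.
- move=> n; rewrite -(test_massE p_gt0 (tphi n)); exact: mass_le.
Qed.


Hypothesis u_neq0 : ~ {ae area R, forall x, D x -> u x = 0%R}.

Lemma rayleigh_ge : ((A `^ (2 / p))^-1)%:E <= rayleigh p D u g.
Proof.
have [[/(L2P _ mD)[mu _] _ _ _] _] := W.
have mup : measurable_fun (D : set plane) (fun x => (u x `^ p)%:E).
  by apply/measurable_EFinP; exact: (measurableT_comp (measurable_powR p)).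
have := W12_energy_fin; have := W12_mass_le; rewrite /rayleigh.
set E := \int[area R]_(x in D) _; set N := \int[area R]_(x in D) _ => mass Eoo.
have E0 : 0 <= E by apply: integral_ge0 => x _; rewrite lee_fin addr_ge0 ?sqr_ge0.
have N0 : 0 <= N by apply: integral_ge0 => x _; rewrite lee_fin powR_ge0.
have [e EE] : exists e : R, E = e%:E by exists (fine E); rewrite fineK// ge0_fin_numE.
rewrite EE lee_fin in E0; rewrite EE in mass *.
have [n NE] : exists n : R, N = n%:E.
  exists (fine N); rewrite fineK// ge0_fin_numE//.
  by apply: le_lt_trans (mass (e + 1)%R _ _) _; rewrite ?lte_fin ?ltry//; lra.
rewrite NE lee_fin in N0; rewrite NE in mass *.
(* A vanishing mass would make [u] zero almost everywhere, which [u_neq0] excludes. *)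
have n0 : (0 < n)%R.
  rewrite lt_neqAle N0 andbT eq_sym; apply/eqP => n0; apply: u_neq0.
  have : \int[area R]_(x in D) `|(u x `^ p)%:E| = 0.
    have -> : 0%R = N by rewrite NE n0.
    apply: eq_integral => x _; by rewrite gee0_abs// lee_fin powR_ge0.
  move/(ae_eq_integral_abs (area R) mD mup); apply: ae_impl => x H /H [] /eqP.
  by rewrite powR_eq0 => /andP[/eqP].
rewrite poweR_EFin inver gt_eqF ?powR_gt0// -EFinM lee_fin.
rewrite ler_pdivlMr ?powR_gt0// ler_pdivrMl ?powR_gt0//.
(* [W12_mass_le] wants a bound strictly above the energy; the slack [d] is chosen so that it
   reappears unchanged after multiplication by [A^(2/p)]. *)
apply/ler_addgt0Pr => d d0.
have A2 : (0 < A `^ (2 / p))%R by rewrite powR_gt0.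
have c0 : (e < e + d / A `^ (2 / p))%R by rewrite ltrDl divr_gt0.
have := mass _ (le_lt_trans E0 c0); rewrite lte_fin => /(_ c0); rewrite lee_fin.
set c := (e + _)%R in c0 *.
have p2 : (0 <= 2 / p)%R by rewrite divr_ge0// ltW.
move=> /(ge0_ler_powR p2 (ltW n0 : n \in Num.nneg)) => /(_ _)/wrap[|].
  by rewrite nnegrE mulr_ge0 ?powR_ge0// ltW.
move/le_trans; apply; rewrite powRM ?powR_ge0 ?(ltW A_gt0)// -powRrM.
rewrite (_ : p / 2 * (2 / p) = 1)%R; last by field; rewrite gt_eqF.
rewrite powRr1; last by rewrite (ltW (le_lt_trans E0 c0)).
by rewrite /c mulrDr (mulrCA _ d) mulfV ?gt_eqF// mulr1.
Qed.

End Admissible.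

Hypothesis mass_approx : forall m, (m < A)%R -> exists phi,
  [/\ test_function D phi, plane_energy phi <= 1 & m%:E < plane_mass p phi].

(** By Fatou's lemma along [e = 1 / (n + 1)]: a uniform bound [m] for the smoothed masses would
    bound the mass of [phi] as well. *)
Lemma mass_smooth_abs phi (m : R) : test_function D phi -> m%:E < plane_mass p phi ->
  exists2 e : R, (0 < e)%R & m%:E < plane_mass p (smooth_abs e \o phi).
Proof.
move=> tphi; apply: contraPP => H.
have e0 n : (0 < n.+1%:R^-1 :> R)%R by rewrite invr_gt0.
have le n : plane_mass p (smooth_abs n.+1%:R^-1 \o phi) <= m%:E.
  by rewrite leNgt; apply/negP => ?; apply: H; exists n.+1%:R^-1%R.
apply/negP; rewrite -leNgt.
apply: (@fatou_le _ _ _ (area R) setT measurableT (fun n x => (`|(smooth_abs n.+1%:R^-1%R \o phi) x| `^ p)%:E)).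
- move=> n; apply: abs_powR_measurable; apply: cont2_measurableT.
  exact: test_cont (smooth_abs_test (e0 n) tphi).
- by move=> n x _; rewrite lee_fin powR_ge0.
- by apply: abs_powR_measurable; apply: cont2_measurableT; exact: test_cont tphi.
- by move=> x _; rewrite lee_fin powR_ge0.
- apply: aeW => x _.
  have : (smooth_abs n.+1%:R^-1 (phi x))%R @[n --> \oo] --> `|phi x|%R.
    have i0 : (n.+1%:R^-1 : R)%R @[n --> \oo] --> (0 : R)%R by exact: cvg_harmonic.
    apply: (@squeeze_cvgr _ _ _ _ (fun n => `|phi x| - n.+1%:R^-1)%R (cst `|phi x|%R)).
    - by apply: nearW => n; have [] := smooth_abs_bounds (e0 n) (phi x).
    - by rewrite -[X in _ --> X]subr0; apply: cvgB => //; exact: cvg_cst.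
    - exact: cvg_cst.
  by move=> /(abs_powR_cvg p_gt0); rewrite normr_id.
- exact: le.
Qed.

(** The lower bound is [rayleigh_ge]. For the upper bound, a test function of mass above [m] is made
    nonnegative without raising its energy, and is then an admissible competitor. *)
Lemma Cp_inf : ereal_inf [set q | exists u g, admissible D u g /\ q = rayleigh p D u g] =
  ((A `^ (2 / p))^-1)%:E.
Proof.
set S := [set q | _].
have p2 : (0 < 2 / p)%R by rewrite divr_gt0.
have lb : ((A `^ (2 / p))^-1)%:E <= ereal_inf S.
  apply: le_ereal_inf_tmp => _ [u [g [[W u0 un0] ->]]]; exact: rayleigh_ge.
have ub (m : R) : (0 < m)%R -> (m < A)%R -> ereal_inf S <= ((m `^ (2 / p))^-1)%:E.
  move=> m0 mA; have [phi [tphi Ephi mphi]] := mass_approx mA.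
  have [e e0 me] := mass_smooth_abs tphi mphi.
  set psi := smooth_abs e \o phi in me.
  have tpsi : test_function D psi by exact: smooth_abs_test.
  have psi0 x : (0 <= psi x)%R by have [] := smooth_abs_bounds e0 (phi x).
  have Epsi : plane_energy psi <= 1.
    apply: le_trans Ephi; apply: ge0_le_integral => //.
    - by move=> x _; rewrite lee_fin energy_density_ge0.
    - by apply/measurable_EFinP; apply: cont2_measurableT; exact: energy_density_cont tpsi.
    - by apply/measurable_EFinP; apply: cont2_measurableT; exact: energy_density_cont tphi.
    - by move=> x _; rewrite lee_fin; exact: (smooth_abs_energy e0 tphi).
  have mass0 : 0 < plane_mass p psi by apply: lt_trans me; rewrite lte_fin.
  have adm := test_admissible openD p_gt0 tpsi psi0 mass0.
  apply: (@le_trans _ _ (rayleigh p D psi (grad psi))); first by apply: ereal_inf_lbound; exists psi, (grad psi).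
  rewrite (test_rayleigh p_gt0 tpsi psi0).
  have := mass_le_A tpsi Epsi.
  case: (plane_mass p psi) me => [M| |] //; rewrite ?lte_fin => mM _.
  rewrite poweR_EFin inver gt_eqF ?powR_gt0 ?(lt_trans m0 mM)//.
  apply: (@le_trans _ _ (1 * ((M `^ (2 / p))^-1)%:E)).
    by rewrite lee_wpmul2r// lee_fin invr_ge0 powR_ge0.
  rewrite mul1e lee_fin lef_pV2 ?posrE ?powR_gt0 ?(lt_trans m0 mM)//.
  by rewrite ge0_ler_powR ?(ltW p2) ?nnegrE ?(ltW m0) ?(ltW mM) ?(ltW (lt_trans m0 mM)).
(* If the infimum [i] exceeded [A^(- 2/p)], then [k = i^(- p/2)] would be less than [A], and the
   upper bound at the midpoint of [k] and [A] would be below [i]. The value [+oo] is excluded by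
   [m = A / 2]. *)
case: (ereal_inf S) lb ub => [i| |] lb ub; last by rewrite leeNy_eq in lb.
  congr EFin; apply/eqP; rewrite eq_le -!lee_fin lb andbT lee_fin leNgt; apply/negP => Ai.
  rewrite lee_fin in lb.
  have A2 : (0 < A `^ (2 / p))%R by rewrite powR_gt0.
  have i0 : (0 < i)%R by apply: lt_trans Ai; rewrite invr_gt0.
  pose k := (i^-1 `^ (p / 2))%R.
  have kA : (k < A)%R.
    have -> : A = ((A `^ (2 / p)) `^ (p / 2))%R.
      by rewrite -powRrM (_ : 2 / p * (p / 2) = 1)%R ?powRr1 ?(ltW A_gt0)//; field; rewrite gt_eqF.
    by rewrite gt0_ltr_powR ?divr_gt0 ?nnegrE ?(ltW A2) ?invr_ge0 ?(ltW i0)// invf_plt.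
  have k0 : (0 < k)%R by rewrite powR_gt0// invr_gt0.
  have := ub ((k + A) / 2)%R; rewrite lee_fin => /(_ _ _)/wrap[||]; first by lra.
    by lra.
  apply/negP; rewrite -ltNge invf_plt ?posrE//; last by rewrite powR_gt0//; lra.
  have -> : (i^-1 = k `^ (2 / p))%R.
    by rewrite -powRrM (_ : p / 2 * (2 / p) = 1)%R ?powRr1 ?invr_ge0 ?(ltW i0)//; field; rewrite gt_eqF.
  by rewrite gt0_ltr_powR ?nnegrE ?(ltW k0)//; lra.
have : +oo <= (((A / 2) `^ (2 / p))^-1)%R%:E by have A0 := A_gt0; apply: ub; lra.
by rewrite leye_eq.
Qed.

End RayleighBound.

(** * Weighted masses on the disc *)

Section WeightedMass.
Variable R : realType.
Local Notation plane := (measurableTypeR R * measurableTypeR R)%type.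
Local Notation tc := (@to_complex R).
Implicit Types (U V : set R[i]) (phi psi w : R * R -> R) (p : R).
Local Open Scope ereal_scope.

Lemma integral_gt0 (D : set (R * R)) (h : R * R -> R) x0 : open D -> D x0 ->
  (forall x, D x -> {for x, continuous h}) -> (forall x, D x -> 0 <= h x)%R -> (0 < h x0)%R ->
  0 < \int[area R]_(x in D) (h x)%:E.
Proof.
move=> oD Dx0 hc h0 hx0.
have [d1 d10 H1] := (open2P _).1 oD x0 Dx0.
have e0 : (0 < h x0 / 2)%R by rewrite divr_gt0.
have [d2 d20 H2] := (cont2P _ _).1 (hc x0 Dx0) _ e0.
pose t := (Num.min d1 d2 / 2)%R.
have t0 : (0 < t)%R by rewrite divr_gt0// lt_min d10.
have [td1 td2] : (t < d1)%R /\ (t < d2)%R.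
  have : (Num.min d1 d2 <= d1)%R by rewrite ge_min lexx.
  have : (Num.min d1 d2 <= d2)%R by rewrite ge_min lexx orbT.
  by rewrite /t; split; lra.
have sq u : square x0.1 x0.2 t u -> D u /\ (h x0 / 2 <= h u)%R.
  move=> /squareP[/andP[u1 u2] /andP[v1 v2]].
  have E : u = (x0.1 + (u.1 - x0.1), x0.2 + (u.2 - x0.2))%R.
    by rewrite ![(_ + (_ - _))%R]addrC !subrK -surjective_pairing.
  have n1 : (`|u.1 - x0.1| <= t)%R by rewrite ger0_norm; lra.
  have n2 : (`|u.2 - x0.2| <= t)%R by rewrite ger0_norm; lra.
  split; first by rewrite E; apply: H1; [exact: le_lt_trans td1|exact: le_lt_trans td1].
  have := H2 _ _ (le_lt_trans n1 td2) (le_lt_trans n2 td2); rewrite -E ltr_norml => /andP[+ _].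
  lra.
have mh : measurable_fun (D : set plane) (fun x => (h x)%:E).
  by apply/measurable_EFinP; exact: cont2_measurable.
have mS := square_measurable x0.1 x0.2 t.
apply: (@lt_le_trans _ _ (\int[area R]_(x in (square x0.1 x0.2 t : set plane)) (cst (h x0 / 2)%:E x))).
  by rewrite integral_cst// area_square ?(ltW t0)// mule_gt0// lte_fin// exprn_gt0.
apply: (@le_trans _ _ (\int[area R]_(x in (square x0.1 x0.2 t : set plane)) (h x)%:E)).
  apply: ge0_le_integral => //.
  - by move=> x _; rewrite lee_fin ltW.
  - by apply: measurable_funS mh; [exact: open2_measurable|move=> x /sq[]].
  - by move=> x /sq[_]; rewrite lee_fin.
apply: ge0_subset_integral => //.
- exact: open2_measurable.
- by move=> x /sq[].
Qed.

Definition wmass U p w phi : \bar R := \int[area R]_(x in tc @^-1` U) (`|phi x| `^ p * w x)%:E.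

Definition weight U w : Prop := (forall x, U (tc x) -> {for x, continuous w}) /\ forall x, U (tc x) -> (0 <= w x)%R.

Definition bounded_dom U : Prop := exists B : R, forall x, U (tc x) -> (`|x.1| < B /\ `|x.2| < B)%R.

Definition energy_test U phi : Prop := test_function (tc @^-1` U) phi /\ plane_energy phi <= 1.

Lemma wmass_cont U p w phi : (0 < p)%R -> weight U w -> test_function (tc @^-1` U) phi ->
  weight U (fun x => `|phi x| `^ p * w x)%R.
Proof.
move=> p0 [wc w0] tphi; split=> x Ux; last by rewrite mulr_ge0 ?powR_ge0 ?w0.
apply: continuousM; last exact: wc.
apply: (@continuous_comp _ _ _ phi (fun t : R => `|t| `^ p)%R); first exact: test_cont tphi x.
exact: abs_powR_cont.
Qed.

Lemma wmass_measurable U p w phi : copen U -> (0 < p)%R -> weight U w -> test_function (tc @^-1` U) phi ->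
  measurable_fun (tc @^-1` U : set plane) (fun x => (`|phi x| `^ p * w x)%:E).
Proof.
move=> oU p0 W tphi; apply/measurable_EFinP; apply: cont2_measurable; first exact: copen_open.
exact: (wmass_cont p0 W tphi).1.
Qed.

Lemma wmass_pullback U V f f' g g' p w psi : conf_pair U V f f' g g' ->
  bounded_dom U -> bounded_dom V -> (0 < p)%R -> weight V w -> test_function (tc @^-1` V) psi ->
  wmass V p w psi = wmass U p (fun x => w (rmap f x) * cabs (f' (tc x)) ^+ 2)%R (pullback f U psi).
Proof.
move=> cp [B1 HB1] [B2 HB2] p0 W tpsi; have [hc h0] := wmass_cont p0 W tpsi.
have [_ cK KV] := tpsi.
have bd U' (B B' : R) : (forall x, U' (tc x) -> (`|x.1| < B /\ `|x.2| < B)%R) -> (B <= B')%R ->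
    (forall x, U' (tc x) -> (`|x.1| < B' /\ `|x.2| < B')%R).
  by move=> H BB x /H[? ?]; split; exact: lt_le_trans BB.
rewrite /wmass (@change_of_variables _ U V f f' g g' _ (supp psi) (Num.max B1 B2) cp) //.
- apply: eq_integral => x; rewrite inE => Ux; congr EFin.
  by rewrite (pullbackE f psi Ux) mulrA.
- by apply: (bd _ _ _ HB1); rewrite le_max lexx.
- by apply: (bd _ _ _ HB2); rewrite le_max lexx orbT.
- by move=> x _ /supp_notin ->; rewrite normr0 powR0 ?mul0r// gt_eqF.
Qed.

(** Conformal invariance of the Dirichlet integral: the factor [|f'|^2] of [pullback_energy] is
    exactly the Jacobian. *)
Lemma energy_pullback U V f f' g g' psi : conf_pair U V f f' g g' ->
  bounded_dom U -> bounded_dom V -> test_function (tc @^-1` V) psi ->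
  plane_energy (pullback f U psi) = plane_energy psi.
Proof.
move=> cp [B1 HB1] [B2 HB2] tpsi.
have tphi := pullback_test cp tpsi.
rewrite (test_energyE tpsi) (test_energyE tphi).
have [_ cK KV] := tpsi.
rewrite (@change_of_variables _ U V f f' g g' _ (supp psi) (Num.max B1 B2) cp) //.
- by apply: eq_integral => x; rewrite inE => Ux; rewrite (pullback_energy cp tpsi Ux).
- by move=> x /HB1[? ?]; split; rewrite lt_max; apply/orP; left.
- by move=> x /HB2[? ?]; split; rewrite lt_max; apply/orP; right.
- by move=> x _; exact: energy_density_cont tpsi x.
- by move=> x _; exact: energy_density_ge0.
- by move=> x _; exact: supp_energy.
Qed.

Lemma pullbackK U V f f' g g' phi : conf_pair U V f f' g g' ->
  forall x, U (tc x) -> pullback f U (pullback g V phi) x = phi x.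
Proof.
move=> cp x Ux; rewrite pullbackE// pullbackE; last exact: (rmap_in cp).
by rewrite (rmapK cp).
Qed.

(** The supremum of the weighted masses as a relation with a real number, which includes its
    finiteness. *)
Definition wsup U p w (m : R) : Prop :=
  (forall phi, energy_test U phi -> wmass U p w phi <= m%:E) /\
  forall m', (m' < m)%R -> exists2 phi, energy_test U phi & m'%:E < wmass U p w phi.

Lemma wmass1 U p phi : (0 < p)%R -> test_function (tc @^-1` U) phi -> wmass U p (fun=> 1%R) phi = plane_mass p phi.
Proof.
move=> p0 tphi; rewrite (test_massE p0 tphi); apply: eq_integral => x _.
by rewrite mulr1.
Qed.

Lemma weight1 U : weight U (fun=> 1%R).
Proof. by split=> x _ //; exact: cvg_cst. Qed.

(** Pullback matches the test functions on [V] with those on [U], keeps the energy and puts the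
    weight [|f'|^2] on the mass. Hence [m] is the supremum of unweighted masses on [V], to which
    [Cp_inf] applies. *)
Theorem Cp_transfer U V f f' g g' p (m : R) : conf_pair U V f f' g g' ->
  bounded_dom U -> bounded_dom V -> (0 < p)%R -> (0 < m)%R ->
  wsup U p (fun x => cabs (f' (tc x)) ^+ 2)%R m ->
  Cp p V = ((m `^ (2 / p))^-1)%R.
Proof.
move=> cp bU bV p0 m0 [ub apx]; have cp' := conf_pair_sym cp.
have pb psi : test_function (tc @^-1` V) psi ->
    plane_mass p psi = wmass U p (fun x => cabs (f' (tc x)) ^+ 2)%R (pullback f U psi).
  move=> tpsi; rewrite -(wmass1 p0 tpsi) (wmass_pullback cp)//; last exact: weight1.
  by apply: eq_integral => x _; rewrite mul1r.
rewrite /Cp (@Cp_inf _ _ p m)//.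
- by apply: copen_open; exact: (cp_openV cp).
- move=> psi tpsi E1; rewrite pb//; apply: ub; split; first exact: (pullback_test cp).
  by rewrite (energy_pullback cp).
- move=> m' /apx[phi [tphi E1] mm]; exists (pullback g V phi).
  have tpsi := pullback_test cp' tphi.
  split; [exact: tpsi|by rewrite (energy_pullback cp' bV bU tphi)|rewrite (pb _ tpsi)].
  apply: lt_le_trans mm _; rewrite le_eqVlt; apply/orP; left; apply/eqP.
  by apply: eq_integral => x; rewrite inE => Ux; rewrite (pullbackK _ cp).
Qed.

Lemma wmass_le U p w w' phi : copen U -> (0 < p)%R -> weight U w -> weight U w' ->
  test_function (tc @^-1` U) phi -> (forall x, U (tc x) -> w x <= w' x)%R ->
  wmass U p w phi <= wmass U p w' phi.
Proof.
move=> oU p0 W W' tphi ww; have mU := open2_measurable (copen_open oU).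
apply: ge0_le_integral => //.
- by move=> x Ux; rewrite lee_fin; exact: (wmass_cont p0 W tphi).2.
- exact: wmass_measurable.
- exact: wmass_measurable.
- by move=> x Ux; rewrite lee_fin ler_wpM2l ?powR_ge0// ww.
Qed.

Lemma weight_cst U (c : R) : (0 <= c)%R -> weight U (fun=> c).
Proof. by move=> c0; split=> x _ //; exact: cvg_cst. Qed.

Lemma weightD U w w' : weight U w -> weight U w' -> weight U (fun x => w x + w' x)%R.
Proof.
move=> [wc w0] [wc' w0']; split=> x Ux; last by rewrite addr_ge0 ?w0 ?w0'.
by apply: continuousD; [exact: wc|exact: wc'].
Qed.

Lemma weightZ U (c : R) w : (0 <= c)%R -> weight U w -> weight U (fun x => c * w x)%R.
Proof.
move=> c0 [wc w0]; split=> x Ux; last by rewrite mulr_ge0 ?w0.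
by apply: continuousM; [exact: cvg_cst|exact: wc].
Qed.

Lemma wmassD U p w w' phi : copen U -> (0 < p)%R -> weight U w -> weight U w' ->
  test_function (tc @^-1` U) phi ->
  wmass U p (fun x => w x + w' x)%R phi = wmass U p w phi + wmass U p w' phi.
Proof.
move=> oU p0 W W' tphi; have mU := open2_measurable (copen_open oU).
rewrite /wmass -ge0_integralD//.
- by apply: eq_integral => x _; rewrite -EFinD mulrDr.
- by move=> x Ux; rewrite lee_fin; exact: (wmass_cont p0 W tphi).2.
- exact: wmass_measurable.
- by move=> x Ux; rewrite lee_fin; exact: (wmass_cont p0 W' tphi).2.
- exact: wmass_measurable.
Qed.

Lemma wmassZ U p (c : R) w phi : copen U -> (0 < p)%R -> (0 <= c)%R -> weight U w ->
  test_function (tc @^-1` U) phi ->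
  wmass U p (fun x => c * w x)%R phi = c%:E * wmass U p w phi.
Proof.
move=> oU p0 c0 W tphi; have mU := open2_measurable (copen_open oU).
rewrite /wmass -ge0_integralZl//.
- by apply: eq_integral => x _; rewrite -EFinM mulrCA.
- exact: wmass_measurable.
- by move=> x Ux; rewrite lee_fin; exact: (wmass_cont p0 W tphi).2.
Qed.

Lemma wmass_ge0 U p w phi : weight U w -> 0 <= wmass U p w phi.
Proof.
by move=> [_ w0]; apply: integral_ge0 => x Ux; rewrite lee_fin mulr_ge0 ?powR_ge0 ?w0.
Qed.

Lemma energy_test_exists U z0 : copen U -> U z0 -> exists phi,
  [/\ energy_test U phi, forall x, (0 <= phi x)%R & (0 < phi (of_complex z0))%R].
Proof.
move=> oU Uz; have Uz' : (tc @^-1` U) (of_complex z0) by rewrite /preimage /= of_complexK.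
have [phi tphi [phi0 phi1]] := bump_exists (copen_open oU) Uz'.
have E0 : 0 <= plane_energy phi by apply: integral_ge0 => x _; rewrite lee_fin energy_density_ge0.
have Eoo : plane_energy phi < +oo.
  have /integrableP[_] := Cc_integrable (energy_density_Cc tphi).
  rewrite /plane_energy; under eq_integral do rewrite /= ger0_norm ?energy_density_ge0//.
  by [].
have [e eE] : exists e : R, plane_energy phi = e%:E by exists (fine (plane_energy phi)); rewrite fineK// ge0_fin_numE.
rewrite eE lee_fin in E0.
have k0 : (0 < (1 + e)^-1)%R by rewrite invr_gt0 ltr_wpDr.
exists (fun x => (1 + e)^-1 * phi x)%R; split; last by rewrite mulr_gt0.
  split; first exact: test_scale.
  rewrite (energy_scale tphi) eE -EFinM lee_fin exprVn.
  have e1 : (0 < (1 + e) ^+ 2)%R by rewrite exprn_gt0// ltr_wpDr.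
  by rewrite mulrC ler_pdivrMr// mul1r; nra.
by move=> x; rewrite mulr_ge0// ltW.
Qed.

(** The masses are bounded by the Sobolev inequality and the bound on the weight; positivity comes
    from a bump function at a point where the weight is positive. *)
Lemma wsup_exists U p w (B : R) z0 : copen U -> bounded_dom U -> (0 < p)%R -> U z0 -> weight U w ->
  (forall x, U (tc x) -> w x <= B)%R -> (0 < w (of_complex z0))%R ->
  exists2 m : R, (0 < m)%R & wsup U p w m.
Proof.
move=> oU [C UC] p0 Uz W wB w0.
have Uz' : U (tc (of_complex z0)) by rewrite of_complexK.
have B0 : (0 < B)%R by exact: lt_le_trans (wB _ Uz').
have C0 : (0 < C)%R by have [+ _] := UC _ Uz'; apply: le_lt_trans.
have [K K0 HK] := sobolev C0 p0.
pose S := [set wmass U p w phi | phi in energy_test U].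
have [phi0 [T0 phi0_ge0 phi0_gt0]] := energy_test_exists oU Uz.
have S_gt0 : 0 < ereal_sup S.
  apply: (@lt_le_trans _ _ (wmass U p w phi0)); last by apply: ereal_sup_ubound; exists phi0.
  have [hc h0] := wmass_cont p0 W T0.1.
  apply: (@integral_gt0 _ _ (of_complex z0)) => //; first exact: copen_open.
  by rewrite mulr_gt0// powR_gt0// gtr0_norm.
have S_le : ereal_sup S <= (B * K)%:E.
  apply: ge_ereal_sup => _ [phi [tphi E1] <-].
  have WB := weight_cst U (ltW B0).
  apply: le_trans (wmass_le oU p0 W WB tphi wB) _.
  have -> : wmass U p (fun=> B) phi = wmass U p (fun=> B * 1)%R phi by rewrite mulr1.
  rewrite (wmassZ oU p0 (ltW B0) (weight1 U) tphi) (wmass1 p0 tphi) EFinM lee_wpmul2l ?lee_fin ?(ltW B0)//.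
  exact: HK UC tphi E1.
have fS : ereal_sup S \is a fin_num by rewrite ge0_fin_numE ?(ltW S_gt0)// (le_lt_trans S_le)// ltry.
exists (fine (ereal_sup S)); first by rewrite -lte_fin fineK.
split=> [phi Tphi|m']; first by rewrite fineK//; apply: ereal_sup_ubound; exists phi.
rewrite -lte_fin fineK// => /ereal_sup_gt[_ [phi Tphi <-] ?].
by exists phi.
Qed.

Lemma wsup_uniq U p w m m' : wsup U p w m -> wsup U p w m' -> m = m'.
Proof.
move=> [u1 a1] [u2 a2]; apply/eqP; rewrite eq_le; apply/andP; split; rewrite leNgt; apply/negP.
- by move=> /a1[phi /u2 h1 h2]; have := lt_le_trans h2 h1; rewrite ltxx.
- by move=> /a2[phi /u1 h1 h2]; have := lt_le_trans h2 h1; rewrite ltxx.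
Qed.

End WeightedMass.

(** * Convexity in log r *)

Section ThirdOrder.
Variable R : realType.
Implicit Types (c z w h a : R[i]) (F f : R[i] -> R[i]).

(** Cauchy estimates together with the third Taylor remainder; the factor [2] again bounds
    [rho / (rho - |h|)]. *)
Lemma taylor3 F c (r rho M : R) :
  (forall z, cabs (z - c) < r -> exists a, cderiv F z a) -> 0 < rho -> rho < r ->
  (forall z, cabs (z - c) = rho -> cabs (F z) <= M) ->
  forall a, cderiv F c a -> exists a2, [/\ cabs (F c) <= M, cabs a <= M / rho, cabs a2 <= M / rho ^+ 2 &
    forall h, cabs h <= rho / 2 -> exists2 q, cabs q <= 2 * M / rho ^+ 3 &
      F (c + h) = F c + a * h + a2 * h ^+ 2 + q * h ^+ 3].
Proof.
move=> Fd rho0 rhor FM a Fa.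
have [G [G0 GS GB GD]] := taylor Fd rho0 rhor FM.
have cc : cabs (c - c) < rho by rewrite subrr cabs0.
have aE : a = G 1%N c.
  have [G1 hG1] := GD 1%N.
  apply: (@cderiv_uniq _ F c) => //.
  apply: (@cderiv_eq _ (fun z => F c + (z - c) * G 1%N z)).
    exists rho => // w wr; rewrite -(G0 w wr) (GS 0%N w wr) G0//.
  have := cderivD (cderiv_cst (F c) c) (cderivM (cderivB c (cderiv_id c)) (hG1 c cc)).
  by rewrite add0r mul1r subrr mul0r addr0.
have bnd n : cabs (G n c) <= M / rho ^+ n.
  apply: le_trans (GB n c cc) _; rewrite subrr cabs0 subr0.
  by rewrite (mulrAC M) mulfK// gt_eqF.
exists (G 2%N c); split.
- by have := bnd 0%N; rewrite G0// expr0 divr1.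
- by rewrite aE; have := bnd 1%N; rewrite expr1.
- exact: bnd.
move=> h hr; have h0 := cabs_ge0 h.
have E : c + h - c = h by rewrite addrC addKr.
have hr' : cabs (c + h - c) < rho by rewrite E; lra.
exists (G 3%N (c + h)).
  apply: le_trans (GB 3%N _ hr') _; rewrite E.
  have M0 : 0 <= M.
    apply: le_trans (cabs_ge0 (F (c + rho%:C))) (FM _ _).
    by rewrite addrC addKr cabs_real gtr0_norm.
  rewrite ler_pdivrMr; last lra.
  have -> : M * rho / rho ^+ 3 = M / rho ^+ 3 * rho by ring.
  have -> : 2 * M / rho ^+ 3 * (rho - cabs h) = M / rho ^+ 3 * (2 * (rho - cabs h)) by ring.
  by rewrite ler_wpM2l ?divr_ge0 ?exprn_ge0 ?(ltW rho0)//; lra.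
rewrite -(G0 _ hr') (GS 0%N _ hr') (GS 1%N _ hr') (GS 2%N _ hr') E aE G0//; ring.
Qed.

(* All mixed terms cancel over the four points: this is why the third-order
   remainder below is not spoilt by a term of order [rho ^+ 2]. *)
Lemma four_point_sqr (a0 a1 a2 : R[i]) (rho : R) :
  let P h := a0 + a1 * h + a2 * h ^+ 2 in
  cabs (P rho%:C) ^+ 2 + cabs (P (- rho)%:C) ^+ 2 + cabs (P (0 +i* rho)) ^+ 2 + cabs (P (0 +i* (- rho))) ^+ 2 =
  4 * cabs a0 ^+ 2 + 4 * rho ^+ 2 * cabs a1 ^+ 2 + 4 * rho ^+ 4 * cabs a2 ^+ 2.
Proof.
by case: a0 a1 a2 => [x0 y0] [x1 y1] [x2 y2] /=; rewrite !sqr_cabs !expr2 /=; ring.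
Qed.

Lemma sqr_cabs_perturb (P E : R[i]) (B e : R) : cabs P <= B -> cabs E <= e ->
  cabs P ^+ 2 - 2 * B * e <= cabs (P + E) ^+ 2.
Proof.
move=> PB Ee; have [P0 E0] := (cabs_ge0 P, cabs_ge0 E).
have h := cabs_leB P (- E); rewrite opprK cabsN in h.
have B0 : 0 <= B * e by rewrite mulr_ge0//; [exact: le_trans PB|exact: le_trans Ee].
have PE : cabs P * cabs E <= B * e by rewrite ler_pM.
have [hl|hl] := leP (cabs E) (cabs P).
  have : (cabs P - cabs E) ^+ 2 <= cabs (P + E) ^+ 2.
    by rewrite ler_pXn2r ?nnegrE ?subr_ge0 ?cabs_ge0.
  by have := sqr_ge0 (cabs E); rewrite sqrrB; lra.
have : cabs P ^+ 2 <= cabs P * cabs E by rewrite expr2 ler_wpM2l// ltW.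
by have := sqr_ge0 (cabs (P + E)); lra.
Qed.

Lemma sqr_cabs_diff (P E : R[i]) (B e : R) : cabs P <= B -> cabs E <= e -> e <= B ->
  `|cabs (P + E) ^+ 2 - cabs P ^+ 2| <= 3 * B * e.
Proof.
move=> PB Ee eB; have [P0 E0] := (cabs_ge0 P, cabs_ge0 E).
have PE : cabs P * cabs E <= B * e by rewrite ler_pM.
have EE : cabs E * cabs E <= B * e by rewrite ler_pM// (le_trans Ee).
have B0 : 0 <= B * e by apply: le_trans PE; rewrite mulr_ge0.
rewrite ler_norml; apply/andP; split.
  by have := sqr_cabs_perturb PB Ee; lra.
have : cabs (P + E) ^+ 2 <= (cabs P + cabs E) ^+ 2.
  by rewrite ler_pXn2r ?nnegrE ?addr_ge0 ?cabs_ge0// cabsD.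
by rewrite sqrrD [cabs E ^+ 2]expr2; lra.
Qed.

Section LogExpansion.
Variables (f f' : R[i] -> R[i]).
Hypothesis hf : holo (cball 0 1) f f'.

(** Third-order expansion of [h |-> f (e^(s + h) z)]. The coefficients [a0] and [a1] are explicit
    because their squared moduli become weights, whereas [a2] only has to be bounded. *)
Definition logexp_spec (s : R) (z a0 a1 : R[i]) (C rho : R) : Prop :=
  exists a2, [/\ cabs a0 <= C, cabs a1 <= C, cabs a2 <= C &
    forall h, cabs h <= rho -> exists2 q, cabs q <= C &
      f (cexp (s%:C + h) * z) = a0 + a1 * h + a2 * h ^+ 2 + q * h ^+ 3].

Lemma log_expansion (s : R) : s < 0 -> exists C rho : R, [/\ 0 < C, 0 < rho, rho <= 1, rho < - s &
  forall z, cball 0 1 z ->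
    logexp_spec s z (f (cexp s%:C * z)) (cexp s%:C * z * f' (cexp s%:C * z)) C rho].
Proof.
(* For [|w - s| = - s / 2] the point [cexp w * z] stays in the disc of radius [t < 1] for every [z]
   of the unit disc. This makes the Cauchy estimates, whose sum is [C], uniform in [z]. *)
move=> s0; set t := expR (s / 2).
have t1 : t < 1 by rewrite expR_lt1; lra.
have [||B B0 HB] := @cball_bounded R f 0 t; first exact: expR_ge0.
  move=> z zt; apply: cderiv_cont (hf _); rewrite /cball/=; exact: le_lt_trans t1.
have r0 : 0 < - s / 2 by lra.
set r := - s / 2 in r0 *.
pose C := B + B / r + B / r ^+ 2 + 2 * B / r ^+ 3.
have r20 : 0 <= B / r ^+ 2 by rewrite divr_ge0 ?sqr_ge0// ltW.
have r10 : 0 <= B / r by rewrite divr_ge0// ltW.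
have r30 : 0 <= 2 * B / r ^+ 3 by apply: divr_ge0; [apply: mulr_ge0 => //; exact: ltW|apply: exprn_ge0; exact: ltW].
exists C, (Num.min 1 (r / 2)); split.
- by rewrite /C; lra.
- by rewrite lt_min ltr01/=; lra.
- by rewrite ge_min lexx.
- apply: (@le_lt_trans _ _ (r / 2)); first by rewrite ge_min lexx orbT.
  by rewrite /r; lra.
move=> z z1.
have in_ball w : cabs (w - s%:C) < - s -> cball 0 1 (cexp w * z).
  rewrite /cball/= !subr0 => ws; rewrite cabsM cabs_cexp.
  have := le_lt_trans (Re_le_cabs _) ws; rewrite !ReImE/= ltr_norml => /andP[_ h].
  have e1 : expR (Re w) < 1 by rewrite expR_lt1; lra.
  have := cabs_ge0 z; move: z1; rewrite /cball/= subr0; have := expR_ge0 (Re w).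
  by move: (expR _) (cabs z) e1 => x y *; nra.
have Fderiv w : cabs (w - s%:C) < - s ->
    cderiv (fun w => f (cexp w * z)) w (cexp w * z * f' (cexp w * z)).
  move=> ws; have D1 : cderiv (fun w => cexp w * z) w (cexp w * z).
    by have := cderivM (cderiv_cexp w) (cderiv_cst z w); rewrite mulr0 addr0.
  by have := cderiv_comp D1 (hf (in_ball _ ws)); rewrite mulrC.
have s_in : cabs (s%:C - s%:C) < - s by rewrite subrr cabs0; lra.
have [||||a2 [h0 h1 h2 H]] := @taylor3 (fun w => f (cexp w * z)) s%:C (- s) r B _ _ _ _ _ (Fderiv _ s_in).
- by move=> w /Fderiv; exists (cexp w * z * f' (cexp w * z)).
- exact: r0.
- by rewrite /r; lra.
- move=> w wr; apply: HB; rewrite subr0 cabsM cabs_cexp.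
  have := Re_le_cabs (w - s%:C); rewrite wr !ReImE/= ler_norml => /andP[_ h].
  have e1 : expR (Re w) <= t by rewrite ler_expR /r in h *; lra.
  have := cabs_ge0 z; move: z1; rewrite /cball/= subr0; have := expR_ge0 (Re w).
  by move: (expR _) (cabs z) e1 => x y *; nra.
exists a2; split; rewrite /C; [lra|lra|lra|].
move=> h hr; have hr2 : cabs h <= r / 2 by apply: le_trans hr _; rewrite ge_min lexx orbT.
by have [q q1 q2] := H h hr2; exists q => //; lra.
Qed.

End LogExpansion.

Lemma sum4_le (p1 p2 p3 p4 q1 q2 q3 q4 c u v y : R) : p1 + p2 + p3 + p4 = u + v + y -> 0 <= y ->
  p1 - 6 * c <= q1 -> p2 - 6 * c <= q2 -> p3 - 6 * c <= q3 -> p4 - 6 * c <= q4 ->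
  u + v <= q1 + q2 + q3 + q4 + 24 * c.
Proof. lra. Qed.

(** Each point has a quadratic part bounded by [3 C] and a remainder bounded by [C rho^3], which
    costs [2 * 3 C * C rho^3] in the square; four points give the constant [24]. *)
Lemma log_four_point f (s : R) (z a0 a1 : R[i]) (C rho0 rho : R) : logexp_spec f s z a0 a1 C rho0 ->
  0 < C -> 0 < rho -> rho <= rho0 -> rho0 <= 1 ->
  4 * cabs a0 ^+ 2 + 4 * rho ^+ 2 * cabs a1 ^+ 2 <=
  cabs (f (cexp (s + rho)%:C * z)) ^+ 2 + cabs (f (cexp (s - rho)%:C * z)) ^+ 2 +
  cabs (f (cexp (s +i* rho) * z)) ^+ 2 + cabs (f (cexp (s +i* (- rho)) * z)) ^+ 2 +
  24 * (C ^+ 2 * rho ^+ 3).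
Proof.
move=> [a2 [h0 h1 h2 H]] C0 rho_gt0 rhoh rho1.
have rle1 : rho <= 1 by exact: le_trans rho1.
have key h : cabs h = rho ->
    cabs (a0 + a1 * h + a2 * h ^+ 2) ^+ 2 - 6 * (C ^+ 2 * rho ^+ 3) <= cabs (f (cexp (s%:C + h) * z)) ^+ 2.
  move=> hE; have [|q qC ->] := H h; first by rewrite hE.
  have PB : cabs (a0 + a1 * h + a2 * h ^+ 2) <= 3 * C.
    apply: le_trans (cabsD _ _) _.
    have : cabs (a2 * h ^+ 2) <= C.
      by rewrite cabsM cabsX hE -[leRHS]mulr1 ler_pM ?cabs_ge0 ?exprn_ge0 ?exprn_ile1// ltW.
    have : cabs (a1 * h) <= C by rewrite cabsM hE -[leRHS]mulr1 ler_pM ?cabs_ge0// ltW.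
    have := cabsD a0 (a1 * h); lra.
  have EB : cabs (q * h ^+ 3) <= C * rho ^+ 3.
    by rewrite cabsM cabsX hE ler_wpM2r// exprn_ge0// ltW.
  by have := sqr_cabs_perturb PB EB; rewrite (_ : 2 * (3 * C) * (C * rho ^+ 3) = 6 * (C ^+ 2 * rho ^+ 3))//; ring.
have E1 : (s + rho)%:C = s%:C + rho%:C by apply: complex_eqP; rewrite !ReImE/= ?addr0.
have E2 : (s - rho)%:C = s%:C + (- rho)%:C by apply: complex_eqP; rewrite !ReImE/= ?addr0.
have E3 : s +i* rho = s%:C + (0 +i* rho) by apply: complex_eqP; rewrite !ReImE/= ?addr0 ?add0r.
have E4 : s +i* (- rho) = s%:C + (0 +i* (- rho)) by apply: complex_eqP; rewrite !ReImE/= ?addr0 ?add0r.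
rewrite E1 E2 E3 E4.
have n1 : cabs rho%:C = rho by rewrite cabs_real gtr0_norm.
have n2 : cabs (- rho)%:C = rho by rewrite cabs_real normrN gtr0_norm.
have n3 : cabs (0 +i* rho) = rho by rewrite /cabs/= expr0n add0r sqrtr_sqr gtr0_norm.
have n4 : cabs (0 +i* (- rho)) = rho by rewrite /cabs/= expr0n add0r sqrrN sqrtr_sqr gtr0_norm.
have := four_point_sqr a0 a1 a2 rho => /= E.
have y0 : 0 <= 4 * rho ^+ 4 * cabs a2 ^+ 2.
  by rewrite mulr_ge0 ?sqr_ge0// mulr_ge0// exprn_ge0// ltW.
exact: (sum4_le E y0 (key _ n1) (key _ n2) (key _ n3) (key _ n4)).
Qed.

(** The increment is at most [3 C |t|] and the value at most [3 C]; [sqr_cabs_diff] contributes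
    another factor [3], hence [27]. *)
Lemma log_close f (s t : R) (z a0 a1 : R[i]) (C rho : R) : logexp_spec f s z a0 a1 C rho ->
  0 < C -> rho <= 1 -> `|t| <= rho ->
  `|cabs (f (cexp (s + t)%:C * z)) ^+ 2 - cabs a0 ^+ 2| <= 27 * C ^+ 2 * `|t|.
Proof.
move=> [a2 [h0 h1 h2 H]] C0 rho1 tr; have t1 : `|t| <= 1 by exact: le_trans rho1.
have [|q qC] := H t%:C; first by rewrite cabs_real.
have -> : (s + t)%:C = s%:C + t%:C by apply: complex_eqP; rewrite !ReImE/= ?addr0.
move=> ->; rewrite -!addrA.
have EB : cabs (a1 * t%:C + (a2 * t%:C ^+ 2 + q * t%:C ^+ 3)) <= 3 * C * `|t|.
  have t0 := normr_ge0 t; have t2 : `|t| ^+ 2 <= `|t| by rewrite expr2 ler_piMl.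
  have t3 : `|t| ^+ 3 <= `|t| by apply: le_trans t2; rewrite exprS ler_piMl ?sqr_ge0.
  apply: le_trans (cabsD _ _) _.
  have := cabsD (a2 * t%:C ^+ 2) (q * t%:C ^+ 3).
  have : cabs (a1 * t%:C) <= C * `|t| by rewrite cabsM cabs_real ler_wpM2r.
  have : cabs (a2 * t%:C ^+ 2) <= C * `|t| by rewrite cabsM cabsX cabs_real ler_pM ?cabs_ge0 ?exprn_ge0.
  have : cabs (q * t%:C ^+ 3) <= C * `|t| by rewrite cabsM cabsX cabs_real ler_pM ?cabs_ge0 ?exprn_ge0.
  lra.
have PB : cabs a0 <= 3 * C by lra.
have eB : 3 * C * `|t| <= 3 * C by rewrite ler_piMr//; lra.
have := sqr_cabs_diff PB EB eB.
by rewrite (_ : 3 * (3 * C) * (3 * C * `|t|) = 27 * C ^+ 2 * `|t|)//; ring.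
Qed.

End ThirdOrder.

(** * Convexity from an approximate midpoint inequality *)

Section LocalConvexity.
Variable R : realType.
Variable M : R -> R.

(** [C] and [rho0] may vary with [s]: in the application they come from an expansion on a disc that
    approaches the unit circle as [s] tends to [0]. *)
Hypothesis midpoint : forall s, s < 0 -> exists C rho0 : R, [/\ 0 < rho0, rho0 < - s &
  forall rho, 0 < rho -> rho <= rho0 -> 2 * M s <= M (s + rho) + M (s - rho) + C * rho ^+ 3].
Hypothesis lipschitz_at : forall s, s < 0 -> exists K rho0 : R, 0 < rho0 /\
  forall t, `|t| <= rho0 -> `|M (s + t) - M s| <= K * `|t|.

Lemma locally_lipschitz_continuous (s : R) : s < 0 -> {for s, continuous M}.
Proof.
move=> /lipschitz_at[K [rho0 [r0 H]]]; apply/cvgrPdist_lt => e e0.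
have K0 : 0 < `|K| + 1 by rewrite ltr_wpDl.
apply/nbhs_ballP; exists (Num.min rho0 (e / (`|K| + 1))); first by rewrite /= lt_min r0 divr_gt0.
move=> t; rewrite /ball/= lt_min => /andP[t1 t2].
have := H (t - s); rewrite [s + _]addrC subrK distrC => /(_ (ltW t1)) h; rewrite distrC.
apply: le_lt_trans h _; rewrite ltr_pdivlMr// in t2.
have h0 : K * `|s - t| <= `|K| * `|s - t| by rewrite ler_wpM2r// ler_norm.
have := normr_ge0 (s - t); lra.
Qed.

Let second_difference_absurd (dp dm d y e x k : R) : dp <= d -> dm <= d ->
  dp + dm - 2 * d = y + 2 * e -> - x <= y -> x <= k -> k <= e -> 0 < e -> False.
Proof. lra. Qed.

(* At an interior maximum of [M] minus its chord plus the small strictly convex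
   term [e (t - s1) (t - s2)], the second difference would be both nonpositive
   and at least [2 e rho^2 - C rho^3]. *)
Lemma local_midpoint_convex (s1 s s2 : R) : s1 < s -> s < s2 -> s2 < 0 ->
  (s2 - s1) * M s <= (s2 - s) * M s1 + (s - s1) * M s2.
Proof.
move=> s1s ss2 s20; have s12 : s1 < s2 by lra.
have l0 : 0 < s2 - s1 by lra.
apply/ler_addgt0Pr => e0 e0_gt0.
(* The factor [e] is chosen so that the strictly convex term of [D] equals [- e0] at [s]. *)
pose P := (s - s1) * (s2 - s).
have P0 : 0 < P by rewrite mulr_gt0//; lra.
pose e := e0 / P.
have e_gt0 : 0 < e by rewrite divr_gt0.
pose D t := (s2 - s1) * M t - ((s2 - t) * M s1 + (t - s1) * M s2) + e * ((t - s1) * (t - s2)).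
have Dc : {within `[s1, s2], continuous D}.
  apply: continuous_in_subspaceT => t /[!inE]/=; rewrite in_itv/= => /andP[_ ts2].
  have Mc : {for t, continuous M} by apply: locally_lipschitz_continuous; lra.
  have ic (a b : R) : {for t, continuous (fun t => a * t + b)}.
    apply: (@continuousD _ _ _ (fun t => a * t) (fun=> b)); last exact: cst_continuous.
    by apply: (@continuousM _ _ (fun=> a) id); [exact: cst_continuous|exact: cvg_id].
  have -> : D = (fun t => ((s2 - s1) * M t + ((M s1 - M s2) * t + (s1 * M s2 - s2 * M s1))) +
      (e * t + (- e * s1)) * (1 * t + (- s2))) by apply/funext => u; rewrite /D; ring.
  have c1 : {for t, continuous (fun t => (s2 - s1) * M t)}.
    by apply: (@continuousM _ _ (fun=> (s2 - s1)) M); [exact: cst_continuous|exact: Mc].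
  exact: (continuousD (continuousD c1 (ic _ _)) (continuousM (ic _ _) (ic _ _))).
have [c] := EVT_max (ltW s12) Dc; rewrite in_itv/= => /andP[c1 c2] cmax.
have D1 : D s1 = 0 by rewrite /D; ring.
have D2 : D s2 = 0 by rewrite /D; ring.
suff : D c = 0.
  move=> Dc0; have := cmax s; rewrite in_itv/= Dc0 (ltW s1s) (ltW ss2) => /(_ isT).
  have -> : D s = (s2 - s1) * M s - ((s2 - s) * M s1 + (s - s1) * M s2) - e * P by rewrite /D /P; ring.
  by rewrite /e divfK ?gt_eqF//; lra.
move: c1; rewrite le_eqVlt => /predU1P[<-//|c1].
move: c2; rewrite le_eqVlt => /predU1P[->//|c2].
have [|C [rho0 [r0 _ H]]] := midpoint (s := c); first by lra.
exfalso; pose k := (s2 - s1) * (`|C| + 1).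
have C0 : 0 < `|C| + 1 by rewrite ltr_wpDl.
have k0 : 0 < k by rewrite mulr_gt0.
(* The points [c + rho] and [c - rho] stay in the interval, and the cubic error is at most
   [e rho^2], half of the second difference [2 e rho^2] of the convex term. *)
pose rho := Num.min (Num.min rho0 (e / k)) (Num.min (c - s1) (s2 - c)).
have rho_gt0 : 0 < rho by rewrite !lt_min r0 divr_gt0//=; lra.
have h1 : rho <= rho0 by rewrite !ge_min lexx.
have h2 : rho <= e / k by rewrite !ge_min lexx !orbT.
have h3 : rho <= c - s1 by rewrite !ge_min lexx !orbT.
have h4 : rho <= s2 - c by rewrite !ge_min lexx !orbT.
have := cmax (c + rho); rewrite in_itv/= => /(_ _)/wrap[|m1]; first by apply/andP; split; lra.
have := cmax (c - rho); rewrite in_itv/= => /(_ _)/wrap[|m2]; first by apply/andP; split; lra.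
have := H rho rho_gt0 h1 => m3.
have E : D (c + rho) + D (c - rho) - 2 * D c = (s2 - s1) * (M (c + rho) + M (c - rho) - 2 * M c) + 2 * (e * rho ^+ 2).
  by rewrite /D; ring.
have m4 : - ((s2 - s1) * (C * rho ^+ 3)) <= (s2 - s1) * (M (c + rho) + M (c - rho) - 2 * M c).
  by rewrite -mulrN ler_pM2l//; lra.
have r3 : 0 < rho ^+ 3 by rewrite exprn_gt0.
have m5 : (s2 - s1) * (C * rho ^+ 3) <= k * rho ^+ 3.
  rewrite /k -mulrA ler_pM2l// ler_pM2r//; have := ler_norm C; lra.
have m6 : k * rho ^+ 3 <= e * rho ^+ 2.
  rewrite exprS mulrA ler_wpM2r ?sqr_ge0// mulrC -ler_pdivlMr//.
have m7 : 0 < e * rho ^+ 2 by rewrite mulr_gt0// exprn_gt0.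
exact: (second_difference_absurd m1 m2 E m4 m5 m6 m7).
Qed.

Hypothesis bounded_below : exists B s0 : R, s0 < 0 /\ forall s, s <= s0 -> M s <= B.

(** A strict decrease somewhere would, by convexity, force [M] to grow at least linearly towards
    [-oo], against its boundedness there. *)
Lemma local_midpoint_nondecreasing (s s' : R) : s < s' -> s' < 0 -> M s <= M s'.
Proof.
move=> ss' s'0; rewrite leNgt; apply/negP => lt; have [B [s0 [s00 H]]] := bounded_below.
(* The distance to the left of [s] beyond which the line through the points at [s] and [s'] exceeds
   the bound [B]. *)
pose X := `|(s' - s) * (B - M s)| / (M s - M s') + 1.
have d0 : 0 < M s - M s' by lra.
have X0 : 0 < X by rewrite ltr_wpDl// divr_ge0// ltW.
pose t := Num.min s0 (s - X).
have t1 : t <= s0 by rewrite ge_min lexx.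
have t2 : t <= s - X by rewrite ge_min lexx orbT.
have ts : t < s by lra.
have := local_midpoint_convex ts ss' s'0; have := H t t1 => MB C.
have XE : `|(s' - s) * (B - M s)| + (M s - M s') = X * (M s - M s').
  by rewrite /X [RHS]mulrDl mul1r divfK// gt_eqF.
have := ler_norm ((s' - s) * (B - M s)).
have : X * (M s - M s') <= (s - t) * (M s - M s') by rewrite ler_pM2r//; lra.
have : (s' - s) * M t <= (s' - s) * B by rewrite ler_pM2l//; lra.
rewrite -XE => h1 h2 h3.
have h4 : (s - t) * (M s - M s') <= (s' - s) * (B - M s).
  rewrite -subr_ge0 (_ : _ - _ = ((s' - s) * B - (s' - s) * M t) +
    ((s' - s) * M t + (s - t) * M s' - (s' - t) * M s)); last by ring.
  by rewrite addr_ge0 ?subr_ge0.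
lra.
Qed.

(** To the left of [s1], convexity with equal values at [s1] and [s2] gives [M t >= M s2], and
    monotonicity gives the reverse. *)
Lemma local_midpoint_flat (s1 s2 t : R) : s1 < s2 -> s2 < 0 -> M s1 = M s2 -> t <= s2 -> M t = M s2.
Proof.
move=> s12 s20 E; rewrite le_eqVlt => /predU1P[->//|ts2].
apply/eqP; rewrite eq_le (local_midpoint_nondecreasing ts2 s20)/=.
have [ts1|s1t|->] := ltgtP t s1; last by rewrite E.
  have := local_midpoint_convex ts1 s12 s20; rewrite E => h.
  have : (s2 - s1) * M s2 <= (s2 - s1) * M t by lra.
  by rewrite ler_pM2l//; lra.
by rewrite -E local_midpoint_nondecreasing//; lra.
Qed.

Lemma local_midpoint_jensen (t x y : R) : 0 <= t -> t <= 1 -> x < 0 -> y < 0 ->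
  M (t * x + (1 - t) * y) <= t * M x + (1 - t) * M y.
Proof.
wlog xy : t x y / x <= y => [H t0 t1 x0 y0|].
  have [xy|/ltW yx] := leP x y; first exact: H.
  rewrite addrC [leRHS]addrC; have := H (1 - t) y x yx; rewrite subKr; apply => //; lra.
move=> t0 t1 x0 y0; move: xy; rewrite le_eqVlt => /predU1P[->|xy].
  by rewrite -!mulrDl [t + _]addrC subrK !mul1r.
move: t0; rewrite le_eqVlt => /predU1P[<-|t0]; first by rewrite !mul0r !add0r subr0 !mul1r.
move: t1; rewrite le_eqVlt => /predU1P[->|t1]; first by rewrite subrr !mul0r !addr0 !mul1r.
have d0 : 0 < y - x by lra.
have t1' : 0 < 1 - t by lra.
set s := t * x + (1 - t) * y.
have E1 : s - x = (y - x) * (1 - t) by rewrite /s; ring.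
have E2 : y - s = (y - x) * t by rewrite /s; ring.
have xs : x < s by rewrite -subr_gt0 E1 mulr_gt0.
have sy : s < y by rewrite -subr_gt0 E2 mulr_gt0.
have := local_midpoint_convex xs sy y0.
by rewrite E1 E2 -!mulrA -mulrDr ler_pM2l.
Qed.

End LocalConvexity.

(** * The supremum of the weighted masses as a function of log r *)

Section DiscMass.
Variable R : realType.
Local Notation plane := (measurableTypeR R * measurableTypeR R)%type.
Local Notation tc := (@to_complex R).
Local Notation U := (cball 0 1 : set R[i]).

Lemma holo_weight V (F F' : R[i] -> R[i]) : copen V -> holo V F F' ->
  weight V (fun x => cabs (F (tc x)) ^+ 2).
Proof.
move=> oV hF; split=> x Vx; last exact: sqr_ge0.
have [A C] := holo_Cn 0 oV hF; have D := CnD (CnX 2 A) (CnX 2 C).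
rewrite (_ : (fun u => _) = (fun u => Re (F (tc u)) ^+ 2 + Im (F (tc u)) ^+ 2)); first exact: D.
by apply/funext => u; rewrite sqr_cabs.
Qed.

Lemma holo_dilate (F F' : R[i] -> R[i]) (c : R[i]) : cabs c <= 1 -> holo U F F' ->
  holo U (fun z => F (c * z)) (fun z => c * F' (c * z)).
Proof.
move=> c1 hF z Uz; have D1 : cderiv (fun z => c * z) z c.
  by have := cderivZ c (cderiv_id z); rewrite mulr1.
have Ucz : U (c * z).
  move: Uz; rewrite /cball/= !subr0 cabsM => z1.
  by apply: le_lt_trans z1; rewrite ler_piMl ?cabs_ge0.
by have := cderiv_comp D1 (hF _ Ucz); rewrite mulrC.
Qed.

Lemma bounded_cball (r : R) : bounded_dom (cball 0 r : set R[i]).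
Proof.
exists r => x; rewrite /cball/= subr0 => xr.
by split; [exact: le_lt_trans (Re_le_cabs _) xr|exact: le_lt_trans (Im_le_cabs _) xr].
Qed.

Lemma scale_conf_pair (u : R[i]) (r : R) : u != 0 ->
  conf_pair (cball 0 r) (cball 0 (cabs u * r)) (fun z => u * z) (fun=> u) (fun z => u^-1 * z) (fun=> u^-1).
Proof.
move=> u0; have cu : 0 < cabs u by rewrite cabs_gt0.
split.
- exact: cball_open.
- exact: cball_open.
- by move=> z _; have := cderivZ u (cderiv_id z); rewrite mulr1.
- by move=> z _; have := cderivZ u^-1 (cderiv_id z); rewrite mulr1.
- move=> z; rewrite /cball/= !subr0 => zr; rewrite cabsM ltr_pM2l//; split => //.
  by rewrite mulrA mulVf ?mul1r.
- move=> z; rewrite /cball/= !subr0 => zr; rewrite cabsM cabsV ltr_pdivrMl//; split => //.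
  by rewrite mulrA mulfV ?mul1r.
Qed.

Lemma wsup_le_cst V p w (m c : R) : wsup V p w m ->
  (forall phi, energy_test V phi -> (wmass V p w phi <= c%:E)%E) -> m <= c.
Proof.
move=> [_ apx] H; rewrite leNgt; apply/negP => /apx[phi /H h1 h2].
by have := lt_le_trans h2 h1; rewrite ltxx.
Qed.

Section Rotation.
Local Open Scope ereal_scope.

(** Rotating the weight has the same effect on the mass as rotating the test function the opposite
    way, and the latter keeps the energy. *)
Lemma wsup_rotate p (w : R * R -> R) (m : R) (u : R[i]) phi : (0 < p)%R -> weight U w -> wsup U p w m ->
  cabs u = 1%R -> energy_test U phi ->
  wmass U p (fun x => w (of_complex (u * tc x)%R)) phi <= m%:E.
Proof.
move=> p0 W [ub _] u1 [tphi E1].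
have u0 : (u != 0)%R by rewrite -cabs_gt0 u1.
have cp := scale_conf_pair 1 u0; rewrite u1 mulr1 in cp.
have cp' := conf_pair_sym cp; have bU := @bounded_cball 1.
have T : energy_test U (pullback (fun z => u^-1 * z)%R U phi).
  by split; [exact: (pullback_test cp')|rewrite (energy_pullback cp')].
apply: le_trans (ub _ T); rewrite (wmass_pullback cp bU bU p0 W T.1).
rewrite le_eqVlt; apply/orP; left; apply/eqP; apply: eq_integral => x; rewrite inE => Ux.
by rewrite (pullbackK _ cp)// u1 expr1n mulr1.
Qed.

End Rotation.

Variables (f f' f'' : R[i] -> R[i]) (p : R).
Hypothesis p_gt0 : 0 < p.
Hypothesis hf : holo U f f'.
Hypothesis hf' : holo U f' f''.
Hypothesis f_neq0 : forall z, U z -> f z != 0.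

(** In this section [f] stands for the derivative of the conformal map. [ddweight] is the squared
    modulus of the derivative of [w |-> f (cexp w * z)] at [w = s]. *)
Definition dweight (s : R) (x : R * R) : R := cabs (f (cexp s%:C * tc x)) ^+ 2.
Definition ddweight (s : R) (x : R * R) : R :=
  cabs (cexp s%:C * tc x * f' (cexp s%:C * tc x)) ^+ 2.

Lemma cabs_cexp_real (s : R) : cabs (cexp s%:C) = expR s.
Proof. by rewrite cabs_cexp. Qed.

Lemma cabs_cexp_lt1 (z : R[i]) : Re z < 0 -> cabs (cexp z) <= 1.
Proof. by move=> s0; rewrite cabs_cexp ltW// expR_lt1. Qed.

Lemma cexp_weight (z : R[i]) : Re z < 0 -> weight U (fun x => cabs (f (cexp z * tc x)) ^+ 2).
Proof.
move=> s0; have := holo_dilate (cabs_cexp_lt1 s0) hf.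
by apply: holo_weight; exact: cball_open.
Qed.

Lemma ddweight_weight (s : R) : s < 0 -> weight U (ddweight s).
Proof.
move=> s0; have h1 := holo_dilate (cabs_cexp_lt1 (z := s%:C) s0) hf'.
have h2 : holo U (fun z => cexp s%:C * z) (fun=> cexp s%:C).
  by move=> z _; have := cderivZ (cexp s%:C) (cderiv_id z); rewrite mulr1.
apply: (@holo_weight U (fun z => cexp s%:C * z * f' (cexp s%:C * z))
  (fun z => cexp s%:C * f' (cexp s%:C * z) + cexp s%:C * z * (cexp s%:C * f'' (cexp s%:C * z)))).
  exact: cball_open.
by move=> z Uz; have := cderivM (h2 z Uz) (h1 z Uz).
Qed.

Lemma dweight_le (s0 : R) : s0 < 0 -> exists2 B : R, 0 < B &
  forall s x, s <= s0 -> U (tc x) -> dweight s x <= B.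
Proof.
move=> s00; have [||B B0 HB] := @cball_bounded R f 0 (expR s0); first exact: expR_ge0.
  move=> z zt; apply: cderiv_cont (hf _); rewrite /cball/=; apply: le_lt_trans zt _.
  by rewrite expR_lt1.
exists (B ^+ 2); first by rewrite exprn_gt0.
move=> s x ss Ux; rewrite /dweight ler_pXn2r ?nnegrE ?cabs_ge0 ?(ltW B0)//; apply: HB.
rewrite subr0 cabsM cabs_cexp_real; apply: (@le_trans _ _ (expR s)).
  by rewrite ler_piMr ?expR_ge0// ltW//; move: Ux; rewrite /cball/= subr0.
by rewrite ler_expR.
Qed.

Lemma disc_sup_exists (s : R) : s < 0 -> exists2 m : R, 0 < m & wsup U p (dweight s) m.
Proof.
move=> s0; have [B B0 HB] := dweight_le s0.
have U0 : U 0 by rewrite /cball/= subrr cabs0.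
apply: (@wsup_exists _ U p (dweight s) B 0) => //.
- exact: cball_open.
- exact: bounded_cball.
- exact: (cexp_weight (z := s%:C)).
- by move=> x; apply: HB.
- by rewrite /dweight of_complexK mulr0 exprn_gt0// cabs_gt0 f_neq0.
Qed.

Lemma sobolev_disc (q : R) : 0 < q -> exists2 K : R, 0 < K &
  forall phi, energy_test U phi -> (plane_mass q phi <= K%:E)%E.
Proof.
move=> q0; have [C UC] := bounded_cball 1.
have C0 : 0 < C.
  have [|+ _] := UC (0, 0); last exact: le_lt_trans.
  by rewrite /cball/= subr0 /to_complex/= (_ : 0 +i* 0 = 0) ?cabs0//.
have [K K0 HK] := sobolev C0 q0; exists K => // phi [tphi E1]; exact: HK UC tphi E1.
Qed.

Variable M : R -> R.
Hypothesis M_sup : forall s, s < 0 -> 0 < M s /\ wsup U p (dweight s) (M s).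

Let oU : copen U. Proof. exact: cball_open. Qed.

Lemma wmass_cst_le (c K : R) phi : 0 <= c -> (plane_mass p phi <= K%:E)%E -> energy_test U phi ->
  (wmass U p (fun=> c) phi <= (c * K)%:E)%E.
Proof.
move=> c0 HK [tphi _].
have -> : wmass U p (fun=> c) phi = wmass U p (fun=> c * 1) phi by rewrite mulr1.
by rewrite (wmassZ oU p_gt0 c0 (weight1 U) tphi) (wmass1 p_gt0 tphi) EFinM lee_wpmul2l ?lee_fin.
Qed.

(** [log_four_point] integrated against [|phi|^p]. The two imaginary shifts rotate the weight and
    contribute at most [M s] each. The [ddweight] term is retained for the strictness. *)
Lemma disc_four_point (s : R) : s < 0 -> exists C rho0 : R, [/\ 0 < C, 0 < rho0, rho0 <= 1, rho0 < - s &
  forall rho phi, 0 < rho -> rho <= rho0 -> energy_test U phi ->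
  (4%:E * wmass U p (dweight s) phi + (4 * rho ^+ 2)%:E * wmass U p (ddweight s) phi <=
   (2 * M s + M (s + rho) + M (s - rho) + C * rho ^+ 3)%:E)%E].
Proof.
move=> s0; have [C [rho0 [C0 r0 r1 rs H]]] := log_expansion hf s0.
have [K K0 HK] := sobolev_disc p_gt0.
exists (24 * C ^+ 2 * K), rho0; split => //; first by rewrite !mulr_gt0// exprn_gt0.
move=> rho phi rho_gt0 rhoh Tphi; have [tphi _] := Tphi.
have sp : s + rho < 0 by lra.
have sm : s - rho < 0 by lra.
have W0 : weight U (dweight s) by exact: (cexp_weight (z := s%:C)).
have W1 : weight U (dweight (s + rho)) by exact: (cexp_weight (z := (s + rho)%:C)).
have W2 : weight U (dweight (s - rho)) by exact: (cexp_weight (z := (s - rho)%:C)).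
have W3 : weight U (fun x => cabs (f (cexp (s +i* rho) * tc x)) ^+ 2) by exact: cexp_weight.
have W4 : weight U (fun x => cabs (f (cexp (s +i* (- rho)) * tc x)) ^+ 2) by exact: cexp_weight.
have WJ := ddweight_weight s0.
have c0 : 0 <= 24 * (C ^+ 2 * rho ^+ 3) by rewrite !mulr_ge0 ?exprn_ge0// ltW.
have W5 := weight_cst U c0.
have r4 : 0 <= 4 * rho ^+ 2 by rewrite mulr_ge0 ?sqr_ge0.
have p4 : 0 <= 4 :> R by [].
rewrite -(wmassZ oU p_gt0 p4 W0 tphi) -(wmassZ oU p_gt0 r4 WJ tphi).
rewrite -(wmassD oU p_gt0 (weightZ p4 W0) (weightZ r4 WJ) tphi).
have W12 := weightD W1 W2; have W123 := weightD W12 W3; have W1234 := weightD W123 W4.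
apply: le_trans (wmass_le oU p_gt0 _ (weightD W1234 W5) tphi _) _.
- by apply: weightD; exact: weightZ.
- by move=> x Ux; exact: (log_four_point (H _ Ux)).
rewrite (wmassD oU p_gt0 W1234 W5 tphi) (wmassD oU p_gt0 W123 W4 tphi).
rewrite (wmassD oU p_gt0 W12 W3 tphi) (wmassD oU p_gt0 W1 W2 tphi).
have [_ S0] := M_sup s0; have [_ [S1 _]] := M_sup sp; have [_ [S2 _]] := M_sup sm.
have rot (t : R) : (wmass U p (fun x => (cabs (f (cexp (s +i* t) * tc x)) ^+ 2)%R) phi <= (M s)%:E)%E.
  have u1 : cabs (cexp (0 +i* t)) = 1 by rewrite cabs_cexp/= expR0.
  apply: le_trans (wsup_rotate p_gt0 W0 S0 u1 Tphi).
  rewrite le_eqVlt; apply/orP; left; apply/eqP; apply: eq_integral => x _.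
  rewrite /dweight of_complexK mulrA -cexpD.
  by rewrite (_ : s%:C + (0 +i* t) = s +i* t)//; apply: complex_eqP; rewrite !ReImE/= ?addr0 ?add0r.
apply: (@le_trans _ _ ((M (s + rho))%:E + (M (s - rho))%:E + (M s)%:E + (M s)%:E + (24 * (C ^+ 2 * rho ^+ 3) * K)%:E)%E).
  exact: (leeD (leeD (leeD (leeD (S1 _ Tphi) (S2 _ Tphi)) (rot rho)) (rot (- rho))) (wmass_cst_le c0 (HK _ Tphi) Tphi)).
by rewrite -!EFinD lee_fin le_eqVlt; apply/orP; left; apply/eqP; ring.
Qed.

(** The nonnegative [ddweight] term is dropped and [phi] approaches the supremum; [4 M s] against
    [2 M s] leaves [2 M s]. *)
Lemma disc_midpoint (s : R) : s < 0 -> exists C rho0 : R, [/\ 0 < rho0, rho0 < - s &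
  forall rho, 0 < rho -> rho <= rho0 -> 2 * M s <= M (s + rho) + M (s - rho) + C * rho ^+ 3].
Proof.
move=> s0; have [C [rho0 [C0 r0 r1 rs H]]] := disc_four_point s0.
exists C, rho0; split => // rho rho_gt0 rhoh.
suff : 4 * M s <= 2 * M s + M (s + rho) + M (s - rho) + C * rho ^+ 3 by lra.
apply/ler_addgt0Pr => e e0; have [_ [_ apx]] := M_sup s0.
have [|phi Tphi lt] := apx (M s - e / 4); first by lra.
have := H rho phi rho_gt0 rhoh Tphi.
have W0 : weight U (dweight s) by exact: (cexp_weight (z := s%:C)).
have J0 := wmass_ge0 p phi (ddweight_weight s0).
move=> h; have : ((4 * (M s - e / 4))%:E <= (2 * M s + M (s + rho) + M (s - rho) + C * rho ^+ 3)%:E)%E.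
  apply: le_trans h; rewrite EFinM; apply: (@le_trans _ _ (4%:E * wmass U p (dweight s) phi)%E).
    by rewrite lee_wpmul2l ?lee_fin// ltW.
  by rewrite leeDl// mule_ge0// lee_fin mulr_ge0 ?sqr_ge0.
by rewrite lee_fin; lra.
Qed.

(** The weights at [s] and [s + t] differ by [O(|t|)] uniformly on the disc, and the unweighted
    masses are bounded, so the suprema differ by [O(|t|)]. *)
Lemma disc_lipschitz (s : R) : s < 0 -> exists K rho0 : R, 0 < rho0 /\
  forall t, `|t| <= rho0 -> `|M (s + t) - M s| <= K * `|t|.
Proof.
move=> s0; have [C [rho0 [C0 r0 r1 rs H]]] := log_expansion hf s0.
have [K K0 HK] := sobolev_disc p_gt0.
exists (27 * C ^+ 2 * K), rho0; split => // t tr.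
have st : s + t < 0 by move: tr; rewrite ler_norml => /andP[_ ?]; lra.
have W0 : weight U (dweight s) by exact: (cexp_weight (z := s%:C)).
have W1 : weight U (dweight (s + t)) by exact: (cexp_weight (z := (s + t)%:C)).
have c0 : 0 <= 27 * C ^+ 2 * `|t| by rewrite mulr_ge0// mulr_ge0// sqr_ge0.
have Wc := weight_cst U c0.
have D x : U (tc x) -> `|dweight (s + t) x - dweight s x| <= 27 * C ^+ 2 * `|t|.
  by move=> Ux; exact: (log_close (H _ Ux)).
have [_ S0] := M_sup s0; have [_ S1] := M_sup st.
have main a b (wa wb : R * R -> R) : weight U wa -> weight U wb -> wsup U p wa a -> wsup U p wb b ->
    (forall x, U (tc x) -> wa x <= wb x + 27 * C ^+ 2 * `|t|) -> a <= b + 27 * C ^+ 2 * K * `|t|.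
  move=> Wa Wb Sa [Sb _] ab; apply: (wsup_le_cst Sa) => phi Tphi; have [tphi _] := Tphi.
  apply: le_trans (wmass_le oU p_gt0 Wa (weightD Wb Wc) tphi ab) _.
  rewrite (wmassD oU p_gt0 Wb Wc tphi) EFinD; apply: leeD; first exact: Sb.
  have -> : 27 * C ^+ 2 * K * `|t| = 27 * C ^+ 2 * `|t| * K by ring.
  exact: wmass_cst_le c0 (HK _ Tphi) Tphi.
rewrite ler_norml; apply/andP; split.
  have := main _ _ _ _ W0 W1 S0 S1 => /(_ _)/wrap[|]; last by lra.
  by move=> x /D; rewrite ler_norml => /andP[? _]; lra.
have := main _ _ _ _ W1 W0 S1 S0 => /(_ _)/wrap[|]; last by lra.
by move=> x /D; rewrite ler_norml => /andP[_ ?]; lra.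
Qed.

Lemma disc_bounded : exists B s0 : R, s0 < 0 /\ forall s, s <= s0 -> M s <= B.
Proof.
have n1 : -1 < 0 :> R by lra.
have [B B0 HB] := dweight_le n1; have [K K0 HK] := sobolev_disc p_gt0.
exists (B * K), (-1); split => // s s1; have s0 : s < 0 by lra.
have [_ S0] := M_sup s0; apply: (wsup_le_cst S0) => phi Tphi; have [tphi _] := Tphi.
have W0 : weight U (dweight s) by exact: (cexp_weight (z := s%:C)).
apply: le_trans (wmass_le oU p_gt0 W0 (weight_cst U (ltW B0)) tphi _) _.
  by move=> x; exact: HB.
exact: wmass_cst_le (ltW B0) (HK _ Tphi) Tphi.
Qed.


Lemma power_weight N : weight U (fun x => (cabs (tc x) ^+ N) ^+ 2).
Proof.
split=> x _; last exact: sqr_ge0.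
have H : Cn 0 setT (fun x : R * R => (x.1 ^+ 2 + x.2 ^+ 2) ^+ N).
  by apply: CnX; apply: CnD; apply: CnX; [exact: Cn_fst|exact: Cn_snd].
rewrite (_ : (fun u => _) = (fun x : R * R => (x.1 ^+ 2 + x.2 ^+ 2) ^+ N)); first exact: H.
by apply/funext => u; rewrite -exprM mulnC exprM sqr_cabs.
Qed.

Section NearZero.
Local Open Scope ereal_scope.

(* With [A = |phi|^p], use [A <= e A^2 + e^-1] near the origin and
   [d^N <= |z|^N] away from it. *)
Lemma mass_near_zero (e d : R) (N : nat) phi : (0 < e)%R -> (0 < d)%R -> energy_test U phi ->
  wmass U p (fun=> 1%R) phi <= e%:E * plane_mass (p * 2) phi + (e^-1 * (2 * d) ^+ 2)%:E +
    (((d ^+ N) ^+ 2)^-1)%:E * wmass U p (fun x => (cabs (tc x) ^+ N) ^+ 2)%R phi.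
Proof.
move=> e0 d0 [tphi _]; have mU := open2_measurable (copen_open oU).
have p2 : (0 < p * 2)%R by rewrite mulr_gt0.
have Wq := power_weight N.
have dN : (0 < (d ^+ N) ^+ 2)%R by rewrite !exprn_gt0.
have mphi : measurable_fun (setT : set plane) phi by apply: cont2_measurableT; exact: test_cont tphi.
have mA q : measurable_fun (tc @^-1` U : set plane) (fun x => (`|phi x| `^ q)%:E).
  by apply: measurable_funTS; exact: abs_powR_measurable.
have mI : measurable_fun (tc @^-1` U : set plane) (fun x => (\1_(box d : set plane) x)%:E : \bar R).
  by apply/measurable_EFinP; apply: measurable_funTS; apply: measurable_indic; exact: box_measurable.
have mQ := wmass_measurable oU p_gt0 Wq tphi.
have i0 : (0 <= ((d ^+ N) ^+ 2)^-1)%R by rewrite invr_ge0 ltW.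
have ei0 : (0 <= e^-1)%R by rewrite invr_ge0 ltW.
apply: (@le_trans _ _ (\int[area R]_(x in tc @^-1` U) (e%:E * (`|phi x| `^ (p * 2))%:E +
    (e^-1)%:E * (\1_(box d : set plane) x)%:E +
    (((d ^+ N) ^+ 2)^-1)%:E * (`|phi x| `^ p * (cabs (tc x) ^+ N) ^+ 2)%:E))).
  apply: ge0_le_integral => //.
  - by under eq_fun do rewrite mulr1; exact: mA.
  - apply: emeasurable_funD; last exact: emeasurable_funM.
    by apply: emeasurable_funD; exact: emeasurable_funM.
  move=> x Ux; rewrite mulr1 -!EFinM -!EFinD lee_fin powRrM.
  set A := (`|phi x| `^ p)%R; have A0 : (0 <= A)%R by exact: powR_ge0.
  rewrite -[2%R]/(2%:R)%R powR_mulrn//.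
  have q0 : (0 <= (cabs (tc x) ^+ N) ^+ 2)%R by exact: sqr_ge0.
  have [xd|xd] := pselect (box d x).
    rewrite indicE mem_set// mulr1.
    have h1 : (A <= e * A ^+ 2 + e^-1)%R.
      rewrite -subr_ge0 (_ : _ - _ = e * (A - (2 * e)^-1) ^+ 2 + 3 / 4 * e^-1)%R; last by field; rewrite gt_eqF.
      by rewrite addr_ge0// mulr_ge0 ?sqr_ge0 ?(ltW e0)//.
    by apply: le_trans h1 _; rewrite lerDl; apply: mulr_ge0 => //; exact: mulr_ge0.
  have dx : (d <= cabs (tc x))%R.
    rewrite leNgt; apply/negP => xd'; apply: xd; apply/boxP.
    by split; apply: ltW; [exact: le_lt_trans (Re_le_cabs (tc x)) xd'|exact: le_lt_trans (Im_le_cabs (tc x)) xd'].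
  have h2 : ((d ^+ N) ^+ 2 <= (cabs (tc x) ^+ N) ^+ 2)%R.
    by rewrite ler_pXn2r ?nnegrE ?exprn_ge0 ?cabs_ge0 ?(ltW d0)// lerXn2r ?nnegrE ?cabs_ge0 ?(ltW d0).
  have h3 : (A <= ((d ^+ N) ^+ 2)^-1 * (A * (cabs (tc x) ^+ N) ^+ 2))%R.
    by rewrite mulrCA ler_peMr// ler_pdivlMl// mulr1.
  apply: le_trans h3 _; rewrite lerDr addr_ge0// mulr_ge0// ?sqr_ge0 ?(ltW e0)//.
rewrite ge0_integralD//; last 4 first.
- by move=> x _; rewrite -!EFinM -EFinD lee_fin addr_ge0// mulr_ge0 ?powR_ge0 ?(ltW e0).
- by apply: emeasurable_funD; exact: emeasurable_funM.
- by move=> x _; rewrite -EFinM lee_fin; apply: mulr_ge0 => //; apply: mulr_ge0; [exact: powR_ge0|exact: sqr_ge0].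
- exact: emeasurable_funM.
rewrite ge0_integralD//; last 4 first.
- by move=> x _; rewrite -EFinM lee_fin mulr_ge0 ?powR_ge0 ?(ltW e0).
- exact: emeasurable_funM.
- by move=> x _; rewrite -EFinM lee_fin mulr_ge0.
- exact: emeasurable_funM.
rewrite !ge0_integralZl//; last 2 first.
- by move=> x _; rewrite lee_fin; apply: mulr_ge0; [exact: powR_ge0|exact: sqr_ge0].
- by rewrite lee_fin ltW.
apply: leeD => //; apply: leeD; first by rewrite (test_massE p2 tphi).
rewrite EFinM lee_wpmul2l ?lee_fin// -(area_box (ltW d0)).
have mB := box_measurable d.
rewrite integral_indic//; apply: le_measure; rewrite ?inE//.
exact: measurableI.
Qed.

Lemma wmass_fin w phi (r : R) : weight U w -> wmass U p w phi <= r%:E ->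
  exists v : R, [/\ (0 <= v)%R, (v <= r)%R & wmass U p w phi = v%:E].
Proof.
move=> W H; have W0 := wmass_ge0 p phi W.
have fv : wmass U p w phi \is a fin_num by rewrite ge0_fin_numE// (le_lt_trans H)// ltry.
by exists (fine (wmass U p w phi)); split; rewrite -?lee_fin fineK.
Qed.

End NearZero.


(** The parameters are chosen in the order [e], [d], [rho]; each of the three summands is then at
    most [m / 8], and so is [rho^3]. The expression [(C + 4) * rho / 4 / c] is the bound for the
    mass with weight [|z|^(2 N)] found in [disc_strict]. *)
Lemma small_parameters (m B K2 C c : R) (N : nat) (rho0 : R) : 0 < m -> 0 < B -> 0 < K2 -> 0 < C -> 0 < c -> 0 < rho0 ->
  exists e d rho : R, [/\ 0 < e, 0 < d, 0 < rho, rho <= rho0 &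
   B * (e * K2 + e^-1 * (2 * d) ^+ 2 + ((d ^+ N) ^+ 2)^-1 * ((C + 4) * rho / 4 / c)) < m - rho ^+ 3].
Proof.
move=> m0 B0 K0 C0 c0 r0; pose e := m / (8 * B * K2).
have e0 : 0 < e by rewrite divr_gt0 ?mulr_gt0.
pose d := Num.min 1 (m * e / (32 * B)).
have d0 : 0 < d by rewrite lt_min ltr01/=; apply: divr_gt0; exact: mulr_gt0.
have d1 : d <= 1 by rewrite ge_min lexx.
have d2 : d <= m * e / (32 * B) by rewrite ge_min lexx orbT.
pose D := ((d ^+ N) ^+ 2)^-1; have D0 : 0 < D by rewrite invr_gt0 !exprn_gt0.
pose rho := Num.min (Num.min 1 rho0) (Num.min (m / 8) (m * c / (2 * B * D * (C + 4)))).
have C4 : 0 < C + 4 by lra.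
have rho_gt0 : 0 < rho by rewrite !lt_min ltr01 r0 !divr_gt0 ?mulr_gt0.
have h1 : rho <= 1 by rewrite !ge_min lexx.
have h2 : rho <= rho0 by rewrite !ge_min lexx !orbT.
have h3 : rho <= m / 8 by rewrite !ge_min lexx !orbT.
have h4 : rho <= m * c / (2 * B * D * (C + 4)) by rewrite !ge_min lexx !orbT.
exists e, d, rho; split => //; rewrite -/D !mulrDr.
have t1 : B * (e * K2) = m / 8 by rewrite /e; field; rewrite !gt_eqF.
have t2 : B * (e^-1 * (2 * d) ^+ 2) <= m / 8.
  have -> : B * (e^-1 * (2 * d) ^+ 2) = (4 * B / e) * (d * d) by field; rewrite gt_eqF.
  have -> : m / 8 = (4 * B / e) * (m * e / (32 * B) * 1) by field; rewrite !gt_eqF.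
  by rewrite ler_pM2l ?divr_gt0 ?mulr_gt0// ler_pM// ltW.
have t3 : B * (D * ((C + 4) * rho / 4 / c)) <= m / 8.
  have -> : B * (D * ((C + 4) * rho / 4 / c)) = (B * D * (C + 4) / (4 * c)) * rho by field; rewrite gt_eqF.
  have -> : m / 8 = (B * D * (C + 4) / (4 * c)) * (m * c / (2 * B * D * (C + 4))) by field; rewrite !gt_eqF.
  by rewrite ler_pM2l// divr_gt0 ?mulr_gt0.
have t4 : rho ^+ 3 <= rho.
  by rewrite exprS ler_piMr ?(ltW rho_gt0)// exprn_ile1// ltW.
lra.
Qed.

Lemma disc_strict (s1 s2 : R) : s1 < s2 -> s2 < 0 -> M s1 = M s2 -> forall z, U z -> f' z = 0.
Proof.
move=> s12 s20 E.
(* Unless [f'] vanishes identically, [f' z = z^n G z] near [0] with [G 0 != 0]. *)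
have [|//|[n [G [Gc G0 [d0 d0_gt0 HG]]]]] := @taylor_dichotomy R f' 0 1 ltr01.
  by move=> z Uz; exists (f'' z); exact: hf'.
exfalso; have flat t : t <= s2 -> M t = M s2.
  exact: (local_midpoint_flat disc_midpoint disc_lipschitz disc_bounded s12 s20 E).
have g0 : 0 < cabs (G 0) / 2 by rewrite divr_gt0// cabs_gt0.
set g := cabs (G 0) / 2 in g0.
have [d1 d10 H1] := Gc _ g0.
pose dd := Num.min d0 d1; have dd0 : 0 < dd by rewrite lt_min d0_gt0.
(* As [rho <= 1], the point [s + rho] stays in the range where [M] is constant; and [e^s <= dd]
   keeps all points [e^s z] where the factorization of [f'] holds. *)
pose s := Num.min (s2 - 1) (ln dd).
have ss2 : s <= s2 - 1 by rewrite ge_min lexx.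
have sdd : expR s <= dd by rewrite -[leRHS]lnK// ler_expR ge_min lexx orbT.
have s0 : s < 0 by lra.
(* [ddweight] has a factor [z] besides [f'], hence the exponent [n + 1]; [g] bounds [|G|] from
   below. *)
pose c := (expR s ^+ n.+1 * g) ^+ 2.
have c0 : 0 < c by rewrite exprn_gt0// mulr_gt0// exprn_gt0// expR_gt0.
have Jlow x : U (tc x) -> c * (cabs (tc x) ^+ n.+1) ^+ 2 <= ddweight s x.
  move=> Ux; rewrite /ddweight /c -exprMn.
  set v := cexp s%:C * tc x.
  have vE : cabs v = expR s * cabs (tc x) by rewrite cabsM cabs_cexp_real.
  have vdd : cabs (v - 0) < dd.
    rewrite subr0 vE; move: Ux; rewrite /cball/= subr0 => x1.
    have := expR_gt0 s; have := cabs_ge0 (tc x).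
    by move: (expR s) (cabs _) x1 sdd => a b; nra.
  have Gv : g <= cabs (G v).
    have vd1 : cabs (v - 0) < d1 by apply: lt_le_trans vdd _; rewrite ge_min lexx orbT.
    have := H1 v vd1; have := cabs_leB (G 0) (G v); rewrite cabsB /g; lra.
  rewrite HG; last by apply: lt_le_trans vdd _; rewrite ge_min lexx.
  rewrite subr0 mulrA -exprS cabsM cabsX vE [(_ * cabs _) ^+ n.+1]exprMn.
  rewrite ler_pXn2r ?nnegrE ?mulr_ge0 ?exprn_ge0 ?expR_ge0 ?cabs_ge0 ?(ltW g0)//.
  by rewrite mulrAC ler_wpM2l// mulr_ge0// exprn_ge0 ?expR_ge0 ?cabs_ge0.
have [m0 _] := M_sup s20; set m := M s2 in flat m0.
have [B B0 HB] := dweight_le s0.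
have [K K0 HK] := sobolev_disc p_gt0.
have p2 : 0 < p * 2 by rewrite mulr_gt0.
have [K2 K20 HK2] := sobolev_disc p2.
have [C [rho0 [C0 r0 r1 rs H]]] := disc_four_point s0.
have [e [d [rho [e0 dgt0 rho_gt0 rhole small]]]] := small_parameters n.+1 m0 B0 K20 C0 c0 r0.
have [_ [Mub apx]] := M_sup s0; rewrite flat in Mub apx; last by lra.
(* The defect of [phi] is given the same order [rho^3] as the error in the four-point inequality. *)
have [|phi Tphi lt] := apx (m - rho ^+ 3); first by rewrite ltrBlDr ltrDl exprn_gt0.
have four := H rho phi rho_gt0 rhole Tphi; rewrite !flat in four; [|lra..].
have [tphi _] := Tphi.
have WW : weight U (dweight s) by exact: (cexp_weight (z := s%:C)).
have WJ := ddweight_weight s0.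
have Wq := power_weight n.+1.
have [iw [iw0 iwm iwE]] := wmass_fin WW (Mub _ Tphi).
have W1 := @weight1 R U.
have [a [a00 aK aE]] : exists v : R, [/\ 0 <= v, v <= K & wmass U p (fun=> 1) phi = v%:E].
  by apply: wmass_fin => //; rewrite (wmass1 p_gt0 tphi); exact: HK.
have iwa : iw <= B * a.
  rewrite -lee_fin EFinM -iwE -aE -(wmassZ oU p_gt0 (ltW B0) W1 tphi).
  apply: wmass_le => //; first exact: weightZ (ltW B0) W1.
  by move=> x Ux; rewrite mulr1; exact: HB.
have r24 : 0 < 4 * rho ^+ 2 by rewrite mulr_gt0// exprn_gt0.
(* The four values of [M] all equal [m] and cancel against [4 m]; what is left is
   [4 rho^2 j <= (C + 4) rho^3]. *)
have [j [j0 jle jE]] : exists v : R, [/\ 0 <= v, v <= (C + 4) * rho / 4 & wmass U p (ddweight s) phi = v%:E].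
  apply: wmass_fin => //; rewrite iwE in four lt; rewrite lte_fin in lt.
  have J0 := wmass_ge0 p phi WJ.
  case: (wmass U p (ddweight s) phi) J0 four => [j| |] //; last by rewrite gt0_muley ?lte_fin// addey.
  rewrite -!EFinM -EFinD !lee_fin => j0 four.
  have : 4 * rho ^+ 2 * j <= (C + 4) * rho ^+ 3 by lra.
  rewrite (_ : (C + 4) * rho ^+ 3 = 4 * rho ^+ 2 * ((C + 4) * rho / 4)); last by field.
  by rewrite ler_pM2l.
have [q [q0 qle qE]] : exists v : R, [/\ 0 <= v, v <= (C + 4) * rho / 4 / c & wmass U p (fun x => (cabs (tc x) ^+ n.+1) ^+ 2) phi = v%:E].
  apply: wmass_fin => //.
  have : (wmass U p (fun x => c * (cabs (tc x) ^+ n.+1) ^+ 2)%R phi <= j%:E)%E.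
    by rewrite -jE; apply: wmass_le => //; apply: weightZ => //; exact: ltW.
  rewrite (wmassZ oU p_gt0 (ltW c0) Wq tphi) -lee_pdivlMl// => h; apply: le_trans h _.
  by rewrite -EFinM lee_fin mulrC ler_wpM2r// invr_ge0 ltW.
have := mass_near_zero n.+1 e0 dgt0 Tphi; rewrite aE qE => near.
have : (a%:E <= (e * K2 + e^-1 * (2 * d) ^+ 2 + ((d ^+ n.+1) ^+ 2)^-1 * q)%:E)%E.
  apply: le_trans near _; rewrite EFinD (EFinM _ q) leeD2r// EFinD leeD2r// EFinM.
  by rewrite lee_wpmul2l ?lee_fin ?(ltW e0)//; exact: HK2.
rewrite lee_fin => ha.
have Bq : B * (((d ^+ n.+1) ^+ 2)^-1 * q) <= B * (((d ^+ n.+1) ^+ 2)^-1 * ((C + 4) * rho / 4 / c)).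
  by rewrite ler_pM2l// ler_wpM2l// invr_ge0 sqr_ge0.
have Ba : B * a <= B * (e * K2 + e^-1 * (2 * d) ^+ 2 + ((d ^+ n.+1) ^+ 2)^-1 * q) by rewrite ler_pM2l.
rewrite iwE lte_fin in lt.
(* The mass [iw] is at most [B a], which [small] puts below [m - rho^3], against the choice of
   [phi]. *)
move: small Bq Ba lt iwa; rewrite !mulrDr; clear.
move=> h1 h2 h3 h4 h5; have h6 := lt_le_trans h4 (le_trans h5 (le_trans h3 (lerD (lexx _) h2))).
by have := lt_trans h1 h6; rewrite ltxx.
Qed.

End DiscMass.

(** * Images of discs *)

Section CapacityOfImages.
Variable R : realType.
Local Notation tc := (@to_complex R).
Local Notation U := (cball 0 1 : set R[i]).
Implicit Types (f g : R[i] -> R[i]) (z : R[i]) (V : set R[i]).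

Lemma disc_cball (r : R) : disc r = cball 0 r.
Proof. by apply/seteqP; split=> z; rewrite /disc /cball/= subr0 cabsE ltcR. Qed.

Lemma derivable_cderiv f z : derivable (f : R[i]^o -> R[i]^o) z 1 -> exists a, cderiv f z a.
Proof.
rewrite /derivable => /cvg_ex[l /= fl]; exists l => e e0.
move: fl => /cvgrPdist_lt /(_ e%:C); rewrite ltcR => /(_ e0).
rewrite /dnbhs => /nbhs_ballP[d /= d0 H].
(* The radius [d] is an element of [R[i]]; being positive in the order of [R[i]], it is real. *)
have [dR dE] : exists dR : R, d = dR%:C.
  by exists (Re d); move: d0; rewrite ltcE/= => /andP[/eqP d1 _]; apply: complex_eqP.
rewrite dE ltcR in d0; exists dR => // h hd.
have [->|h0] := eqVneq h 0.
  by rewrite addr0 subrr sub0r mulr0 cabsN !cabs0 mulr0.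
have := H h; rewrite /ball/= sub0r normrN cabsE dE ltcR => /(_ hd h0).
rewrite cabsE ltcR /GRing.scale/= mulr1 => D.
have -> : f (z + h) - f z - l * h = - h * (l - h^-1 * (f (h + z) - f z)).
  by rewrite [z + h]addrC; field.
by rewrite cabsM cabsN mulrC ler_wpM2r ?cabs_ge0// ltW.
Qed.

Lemma conformal_holo f : conformal_on (disc 1) f -> exists f', holo U f f' /\ set_inj U f.
Proof.
move=> [fd finj]; rewrite disc_cball in fd finj.
have /choice[f' Hf'] z : exists a, U z -> cderiv f z a.
  have [/fd/derivable_cderiv[a]|nU] := pselect (U z); first by exists a.
  by exists 0.
by exists f'.
Qed.

Lemma conf_pair_comp U1 V1 W1 f f' g g' h h' k k' : conf_pair U1 V1 f f' g g' -> conf_pair V1 W1 h h' k k' ->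
  conf_pair U1 W1 (fun z => h (f z)) (fun z => h' (f z) * f' z) (fun w => g (k w)) (fun w => g' (k w) * k' w).
Proof.
move=> [oU oV hf hg Hf Hg] [_ oW hh hk Hh Hk]; split => //.
- by move=> z Uz; apply: cderiv_comp; [exact: hf|apply: hh; exact: (Hf _ Uz).1].
- by move=> w Ww; apply: cderiv_comp; [exact: hk|apply: hg; exact: (Hk _ Ww).1].
- move=> z Uz; have [Vf gf] := Hf _ Uz; have [Wh kh] := Hh _ Vf.
  by rewrite kh.
- move=> w Ww; have [Vk hk'] := Hk _ Ww; have [Ug fg] := Hg _ Vk.
  by rewrite fg.
Qed.

Lemma image_conf_pair f f' V : copen V -> holo V f f' -> set_inj V f ->
  exists g g', conf_pair V (f @` V) f f' g g'.
Proof.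
move=> oV hf finj.
have /choice[g Hg] w : exists z, (f @` V) w -> V z /\ f z = w.
  have [[z Vz fz]|nV] := pselect ((f @` V) w); first by exists z.
  by exists 0.
have gK z : V z -> g (f z) = z.
  move=> Vz; have [|Vg fg] := Hg (f z); first by exists z.
  by apply: finj; rewrite ?inE.
exists g, (fun w => (f' (g w))^-1); split => //.
- exact: image_copen hf finj.
- exact: (inverse_holo oV hf finj gK).
- by move=> z Vz; split; [exists z|exact: gK].
Qed.

Lemma wsupZ V p w (m c : R) : copen V -> 0 < p -> weight V w -> 0 < c -> wsup V p w m ->
  wsup V p (fun x => c * w x) (c * m).
Proof.
move=> oV p0 W c0 [ub apx]; split=> [phi Tphi|m' mm].
  rewrite (wmassZ oV p0 (ltW c0) W Tphi.1) EFinM lee_wpmul2l ?lee_fin ?(ltW c0)//.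
  exact: ub.
have [|phi Tphi lt] := apx (c^-1 * m'); first by rewrite ltr_pdivrMl.
exists phi => //; rewrite (wmassZ oV p0 (ltW c0) W Tphi.1).
by rewrite -lte_pdivrMl// -EFinM.
Qed.

Lemma wsup_ext V p w w' (m : R) : (forall x, V (tc x) -> w x = w' x) -> wsup V p w m -> wsup V p w' m.
Proof.
move=> E; have Ew phi : wmass V p w phi = wmass V p w' phi.
  by apply: eq_integral => x; rewrite inE => Vx; rewrite E.
by move=> [ub apx]; split=> [phi /ub|m' /apx[phi ? ?]]; [rewrite Ew|exists phi; rewrite // -Ew].
Qed.

Lemma image_bounded f f' (r : R) : r < 1 -> 0 <= r -> holo U f f' -> bounded_dom (f @` cball 0 r).
Proof.
move=> r1 r0 hf; have [|B B0 HB] := @cball_bounded R f 0 r r0.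
  by move=> z zr; apply: cderiv_cont (hf _ _); rewrite /cball/=; exact: le_lt_trans r1.
exists (B + 1) => x [z zr zE].
have : cabs (tc x) <= B by rewrite -zE; apply: HB; apply: ltW.
by have := Re_le_cabs (tc x); have := Im_le_cabs (tc x); rewrite /=; split; lra.
Qed.

Lemma constant_of_deriv0 F F' : holo U F F' -> (forall z, U z -> F' z = 0) -> forall z, U z -> F z = F 0.
Proof.
move=> hF F0 z Uz; have := @segment_le R F 0 z 0; rewrite !add0r mul0r => /(_ _)/wrap[|h].
  move=> t /andP[t0 t1]; have Utz : U (t%:C * z).
    move: Uz; rewrite /cball/= !subr0 cabsM cabs_real ger0_norm// => z1.
    by apply: le_lt_trans z1; rewrite ler_piMl ?cabs_ge0.
  rewrite add0r; exists (F' (t%:C * z)); first exact: hF.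
  by rewrite F0// cabs0.
by apply/eqP; rewrite -subr_eq0 -cabs0_eq0 eq_le h cabs_ge0.
Qed.

Section Disc.
Variables (p K : R).
Hypothesis p_gt0 : 0 < p.
Hypothesis K_gt0 : 0 < K.
Hypothesis K_sup : wsup U p (fun=> 1) K.

Let oU : copen U. Proof. exact: cball_open. Qed.

Lemma Cp_disc (r : R) : 0 < r -> Cp p (disc r) = ((r ^+ 2 * K) `^ (2 / p))^-1.
Proof.
move=> r0; rewrite disc_cball.
have u0 : r%:C != 0 by rewrite -cabs_gt0 cabs_real gtr0_norm.
have cp := scale_conf_pair 1 u0; rewrite cabs_real gtr0_norm// mulr1 in cp.
apply: (Cp_transfer cp (bounded_cball 1) (bounded_cball r) p_gt0).
  by rewrite mulr_gt0// exprn_gt0.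
have r2 : 0 < r ^+ 2 by rewrite exprn_gt0.
apply: wsup_ext (wsupZ oU p_gt0 (weight1 U) r2 K_sup) => x _.
by rewrite mulr1 cabs_real gtr0_norm.
Qed.

Variables (f f' : R[i] -> R[i]).
Hypothesis hf : holo U f f'.
Hypothesis f_inj : set_inj U f.

Lemma cexp_real (s : R) : cexp s%:C = (expR s)%:C.
Proof. by rewrite /cexp/= cos0 sin0 mulr1 mulr0. Qed.

(** Transfer along [z |-> f (e^s z)], whose derivative has squared modulus [e^(2 s)] times
    [dweight f' s]. *)
Lemma Cp_image (s m : R) : s < 0 -> 0 < m -> weight U (dweight f' s) -> wsup U p (dweight f' s) m ->
  Cp p (f @` disc (expR s)) = ((expR s ^+ 2 * m) `^ (2 / p))^-1.
Proof.
move=> s0 m0 W S; rewrite disc_cball; have r0 := expR_gt0 s; have r1 : expR s < 1 by rewrite expR_lt1.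
have u0 : (expR s)%:C != 0 by rewrite -cabs_gt0 cabs_real gtr0_norm.
have cp := scale_conf_pair 1 u0; rewrite cabs_real gtr0_norm// mulr1 in cp.
have sub : cball 0 (expR s) `<=` U by move=> z; rewrite /cball/= => /lt_trans; apply.
have [g [g' cp']] : exists g g', conf_pair (cball 0 (expR s)) (f @` cball 0 (expR s)) f f' g g'.
  apply: image_conf_pair; first exact: cball_open.
    by move=> z /sub; exact: hf.
  by move=> z w; rewrite !inE => /sub Uz /sub Uw; apply: f_inj; rewrite inE.
apply: (Cp_transfer (conf_pair_comp cp cp') (bounded_cball 1) _ p_gt0).
- exact: image_bounded (ltW r0) hf.
- by rewrite mulr_gt0// exprn_gt0.
have r2 : 0 < expR s ^+ 2 by rewrite exprn_gt0.
apply: wsup_ext (wsupZ oU p_gt0 W r2 S) => x _.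
by rewrite /dweight cexp_real cabsM exprMn cabs_real gtr0_norm// mulrC.
Qed.

End Disc.

End CapacityOfImages.

Theorem theorem1 (R : realType) (f : R[i] -> R[i]) (p : R)
    (hf : conformal_on (disc 1) f) (hp : 1 <= p) :
  [/\ forall r : R, 0 < r -> r < 1 ->
        Cp_ratio p f r = r `^ (4 / p) / Cp p (disc 1) * Cp p (f @` disc r),
      ~ linear_on (disc 1) f ->
        forall r s : R, 0 < r -> r < s -> s < 1 ->
          Cp_ratio p f s < Cp_ratio p f r,
      linear_on (disc 1) f ->
        exists c : R, forall r : R, 0 < r -> r < 1 -> Cp_ratio p f r = c &
      p <= 2 ->
        convex_function (`]-oo, 0[%classic : set R^o)
          (fun s : R^o => (Cp_ratio p f (expR s))^-1 : R^o)].
Proof.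
have p0 : 0 < p by exact: lt_le_trans hp.
pose U : set R[i] := cball 0 1.
have oU : copen U by exact: cball_open.
have U0 : U 0 by rewrite /U /cball/= subrr cabs0.
have [f' [holof finj]] := conformal_holo hf.
have [f'' holof'] := holo_deriv oU holof; have [f3 holof''] := holo_deriv oU holof'.
have f'0 z : U z -> f' z != 0 by exact: injective_deriv_neq0 oU holof finj.
have [K K0 HK] : exists2 K : R, 0 < K & wsup U p (fun=> 1) K.
  by apply: (@wsup_exists R U p _ 1 0) => //; [exact: bounded_cball|exact: weight1].
(* Outside [s < 0] the values of [M] are arbitrary. The weight is that of [f'], so the lemmas on the
   disc are used with [f'] in the place of [f]. *)
have /choice[M HM] s : exists m, s < 0 -> 0 < m /\ wsup U p (dweight f' s) m.
  have [s0|s0] := ltP s 0; last by exists 0.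
  by have [m m0 Sm] := disc_sup_exists p0 holof' f'0 s0; exists m.
pose a := 2 / p; have a0 : 0 < a by rewrite divr_gt0.
have W s : s < 0 -> weight U (dweight f' s) by move=> s0; exact: (cexp_weight holof' (z := s%:C)).
have CpD r : 0 < r -> Cp p (disc r) = ((r ^+ 2 * K) `^ a)^-1 by exact: Cp_disc.
have CpI s : s < 0 -> Cp p (f @` disc (expR s)) = ((expR s ^+ 2 * M s) `^ a)^-1.
  by move=> s0; have [m0 Sm] := HM s s0; exact: (Cp_image p0 holof finj s0 m0 (W s s0) Sm).
(* The factor [r^(4/p)] is common to both capacities, so the ratio is [(K / M s)^(2/p)]. *)
have r2a (r m : R) : 0 < r -> 0 < m -> (r ^+ 2 * m) `^ a = r `^ (4 / p) * m `^ a.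
  move=> r0 m0; rewrite powRM ?sqr_ge0 ?(ltW m0)//; congr (_ * _).
  by rewrite -powR_mulrn ?(ltW r0)// -powRrM; congr (_ `^ _); rewrite /a; field; rewrite gt_eqF.
have ratioE s : s < 0 -> Cp_ratio p f (expR s) = K `^ a / M s `^ a.
  move=> s0; have [m0 _] := HM s s0; have r0 := expR_gt0 s.
  rewrite /Cp_ratio CpI// CpD// !r2a//.
  by field; rewrite !gt_eqF ?powR_gt0.
have lnE (r : R) : 0 < r -> r < 1 -> exists2 s, s < 0 & r = expR s.
  by move=> r0 r1; exists (ln r); [rewrite ln_lt0// r0|rewrite lnK].
have mid := disc_midpoint p0 holof' holof'' HM.
have lip := disc_lipschitz p0 holof' HM.
have bnd := disc_bounded p0 holof' HM.
have mono := local_midpoint_nondecreasing mid lip bnd.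
split.
- move=> r r0 r1; have [s s0 rE] := lnE r r0 r1; have [m0 _] := HM s s0.
  rewrite /Cp_ratio rE CpI// !CpD ?expR_gt0// expr1n mul1r !r2a ?expR_gt0//.
  by field; rewrite !gt_eqF ?powR_gt0 ?expR_gt0.
- move=> nlin r r' r0 rr' r'1.
  have [s s0 rE] := lnE r r0 (lt_trans rr' r'1).
  have [s' s'0 r'E] := lnE r' (lt_trans r0 rr') r'1.
  have ss' : s < s' by rewrite -ltr_expR -rE -r'E.
  have [m0 _] := HM s s0; have [m'0 _] := HM s' s'0.
  rewrite rE r'E !ratioE// ltr_pM2l ?powR_gt0// ltf_pV2 ?posrE ?powR_gt0//.
  rewrite gt0_ltr_powR ?nnegrE ?(ltW m0) ?(ltW m'0)// lt_neqAle mono// andbT.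
  (* Monotonicity leaves only equality to exclude: it gives [f'' = 0], so [f'] is the constant
     [f' 0], nonzero by injectivity, and [f z - f' 0 * z] is constant. *)
  apply/eqP => E; apply: nlin.
  have f''0 := disc_strict p0 holof' holof'' HM ss' s'0 E.
  have f'c := constant_of_deriv0 holof' f''0.
  exists (f' 0), (f 0); split; first exact: f'0.
  move=> z; rewrite disc_cball => Uz.
  have H : holo U (fun z => f z + - f' 0 * z) (fun z => f' z + - f' 0).
    move=> w Uw; apply: cderivD; first exact: holof.
    by have := cderivZ (- f' 0) (cderiv_id w); rewrite mulr1.
  have := constant_of_deriv0 H => /(_ _ z Uz)/wrap[|].
    by move=> w /f'c ->; rewrite subrr.
  by rewrite mulr0 addr0 => <-; rewrite mulNr [_ + (_ - _)]addrC subrK.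
- move=> [b [c [b0 fE]]]; rewrite disc_cball in fE.
  have f'E z : U z -> f' z = b.
    move=> Uz; apply: (cderiv_uniq (holof z Uz)).
    apply: (@cderiv_eq _ (fun z => b * z + c)).
      by have [d d0 H] := oU z Uz; exists d => // w /H/fE ->.
    have := cderivD (cderivZ b (cderiv_id z)) (cderiv_cst c z).
    by rewrite mulr1 addr0.
  have b2 : 0 < cabs b ^+ 2 by rewrite exprn_gt0// cabs_gt0.
  (* The weight is the constant [|b|^2], and uniqueness of the supremum identifies [M s]. *)
  have ME s : s < 0 -> M s = cabs b ^+ 2 * K.
    move=> s0; have [_ Sm] := HM s s0; apply: (wsup_uniq Sm).
    apply: wsup_ext (wsupZ oU p0 (weight1 U) b2 HK) => x Ux.
    rewrite mulr1 /dweight f'E//; move: Ux; rewrite /U /cball/= !subr0 cabsM => x1.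
    by apply: le_lt_trans x1; rewrite ler_piMl ?cabs_ge0 ?cabs_cexp_lt1.
  exists (K `^ a / (cabs b ^+ 2 * K) `^ a) => r r0 r1.
  by have [s s0 ->] := lnE r r0 r1; rewrite ratioE// ME.
- move=> p2 t x y; rewrite !inE/= !in_itv/= => x0 y0.
  (* Here [p <= 2] enters: for [a = 2 / p >= 1] the power [x^a] is nondecreasing and convex on the
     nonnegative reals, so it preserves the convexity of [M]. *)
  have a1 : 1 <= a by rewrite ler_pdivlMr// mul1r.
  have t01 : 0 <= t%:num <= 1 by apply/andP; split.
  set t1 := t%:num in t01; move: t01 => /andP[t0 tle1].
  have s0 : t1 * x + (1 - t1) * y < 0.
    move: t0; rewrite le_eqVlt => /predU1P[<-|t0]; first by rewrite mul0r add0r subr0 mul1r.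
    have h1 : t1 * x < 0 by rewrite pmulr_rlt0.
    have h2 : (1 - t1) * y <= 0 by rewrite mulr_ge0_le0 ?subr_ge0// ltW.
    lra.
  have J := local_midpoint_jensen mid lip t0 tle1 x0 y0.
  have [mx _] := HM x x0; have [my _] := HM y y0; have [ms _] := HM _ s0.
  have := @convex_powR R a a1 t (M x) (M y); rewrite !inE/= !in_itv/= !andbT.
  move=> /(_ (ltW mx) (ltW my)); rewrite !convRE => P.
  have -> : Cp_ratio p f (expR (conv t x y)) = K `^ a / M (t1 * x + (1 - t1) * y) `^ a.
    exact: ratioE.
  rewrite !ratioE// !invf_div.
  have Ka : 0 < K `^ a by rewrite powR_gt0.
  apply: (@le_trans _ _ ((t%:num * M x `^ a + unstable.onem t%:num * M y `^ a) / K `^ a)); last first.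
    by rewrite mulrDl -!mulrA.
  rewrite ler_pM2r ?invr_gt0//; apply: le_trans P; apply: ge0_ler_powR => //; first exact: ltW.
  - by rewrite nnegrE ltW.
  - by rewrite nnegrE addr_ge0// mulr_ge0// ?subr_ge0// ltW.
Qed.
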